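(* Let $\epsilon\in\{-1,1\}$, and let $a\neq0$, $b>0$, $c$ be real constants with $a+b\neq 0$ and $2a+b\neq 0$. Let $\varphi:\Sigma\to M^2(\epsilon)\times\mathbb{R}$ be an isometric immersion, and assume that $\Sigma$ is a W-surface ($aK_i+bK_e=c$) having positive extrinsic curvature. Consider $\Sigma$ as a Riemann surface with the conformal structure induced by its second fundamental form. Then the quadratic form $Q\,dz^2$, where $z$ is a local conformal parameter for the second fundamental form and $$Q=E+f(1-\nu^2)\,h_z^2,$$ either vanishes identically or its zeros are isolated with negative index.
   Context: $M^2(1)=\mathbb{S}^2$ (unit sphere), $M^2(-1)=\mathbb{H}^2$ (hyperbolic plane of curvature $-1$); $M^2(\epsilon)\times\mathbb{R}$ has the product metric. $K_i$, $K_e$ are the intrinsic (Gaussian) and extrinsic (product of principal curvatures) curvatures. A connected surface $\Sigma$ isometrically immersed in $M^2(\epsilon)\times\mathbb{R}$ is a W-surface if $aK_i+bK_e=c$ for real constants $a\neq0$, $b>0$ and $c$. Since $K_e>0$, $\Sigma$ is orientable; $N$ is the global unit normal for which the second fundamental form $II$ is positive definite, $\nu=\langle N,\partial_t\rangle$ is the angle function ($\partial_t$ is the unit vector field tangent to the factor $\mathbb{R}$), and $h:\Sigma\to\mathbb{R}$ is the height function (restriction to $\Sigma$ of the projection onto $\mathbb{R}$). For a local conformal parameter $z$ for $II$, the fundamental forms are $I=E\,dz^2+2F|dz|^2+\overline{E}\,d\overline{z}^2$ and $II=2\rho|dz|^2$ with $\rho>0$. $f:[0,1]\to\mathbb{R}$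 is the real analytic function given by $$f(t)=\frac{-\epsilon(2a+b)(c-\epsilon a)t-(c-\epsilon a)^2+(c-\epsilon a(1-t))^{\frac{2a+b}{a}}(c-\epsilon a)^{-\frac{b}{a}}}{\epsilon(a+b)(c-\epsilon a)\,t^2}$$ (near $t=0$ it is given by its Taylor series). The index of an isolated zero of $Q\,dz^2$ is, as usual, the index of the line field $\{\operatorname{Im}(Q\,dz^2)=0\}$ at that point. *)

(* Defs.v *)
From HB Require Import structures.
From mathcomp Require Import all_boot all_order all_algebra.
From mathcomp Require Import all_classical all_reals all_analysis.
From mathcomp.real_closed Require Export complex.

Set Implicit Arguments.
Unset Strict Implicit.
Unset Printing Implicit Defensive.

Import Order.TTheory GRing.Theory Num.Theory.
Import numFieldNormedType.Exports.

Local Open Scope classical_set_scope.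
Local Open Scope ring_scope.
Local Open Scope complex_scope.

(** * Smooth surfaces *)

Definition partial (R : realType) (W : normedModType R) (i : 'I_2)
  (F : 'rV[R]_2 -> W) (u : 'rV[R]_2) : W := 'D_(delta_mx 0 i) F u.

(* Class C^k on an open set [D]; values of [F] outside [D] are irrelevant. *)
Fixpoint Ck (R : realType) (W : normedModType R) (k : nat) (D : set 'rV[R]_2)
  (F : 'rV[R]_2 -> W) : Prop :=
  (forall u, D u -> {for u, continuous F}) /\
  match k with
  | 0%N => True
  | k'.+1 => forall i : 'I_2,
      (forall u, D u -> derivable F u (delta_mx 0 i)) /\ Ck k' D (partial i F)
  end.

Definition smooth (R : realType) (W : normedModType R) (D : set 'rV[R]_2)
  (F : 'rV[R]_2 -> W) : Prop := forall k, Ck k D F.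

(* A homeomorphism between an open set [dom] of [S] and an open set [cod] of
   the plane; [coord] and [param] are meaningful on these sets only. *)
Record chart (R : realType) (S : topologicalType) := Chart {
  dom : set S;
  cod : set 'rV[R]_2;
  coord : S -> 'rV[R]_2;
  param : 'rV[R]_2 -> S;
  dom_open : open dom;
  cod_open : open cod;
  coord_cod : forall p, dom p -> cod (coord p);
  param_dom : forall u, cod u -> dom (param u);
  coordK : forall p, dom p -> param (coord p) = p;
  paramK : forall u, cod u -> coord (param u) = u;
  coord_continuous : forall p, dom p -> {for p, continuous coord};
  param_continuous : forall u, cod u -> {for u, continuous param}
}.

Definition smooth_transition (R : realType) (S : topologicalType)
  (z w : chart R S) : Prop :=
  smooth (cod z `&` (param z @^-1` dom w)) (coord w \o param z).

Definition compatible (R : realType) (S : topologicalType)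
  (z w : chart R S) : Prop := smooth_transition z w /\ smooth_transition w z.

Record smoothSurface (R : realType) := SmoothSurface {
  points :> topologicalType;
  atlas : set (chart R points);
  surface_hausdorff : hausdorff_space points;
  surface_second_countable : @second_countable points;
  atlas_cover : forall p : points, exists2 z, atlas z & dom z p;
  atlas_compatible : forall z w, atlas z -> atlas w -> compatible z w
}.

(** * The ambient space *)

(* [M^2(eps) x R] sits in [R^3 x R]; [M^2(eps)] is the unit sphere of Euclidean
   space for [eps = 1], and for [eps = -1] the upper sheet of the hyperboloid
   [x0^2 + x1^2 - x2^2 = -1] in Minkowski space. *)
Definition lform (R : realType) (eps : R) (x y : 'rV[R]_3) : R :=
  x 0 0 * y 0 0 + x 0 1 * y 0 1 + eps * (x 0 2%:R * y 0 2%:R).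

Definition M2 (R : realType) (eps : R) : set 'rV[R]_3 :=
  [set x | lform eps x x = eps /\ (eps = -1 -> 0 < x 0 2%:R)].

Definition inner (R : realType) (eps : R) (X Y : 'rV[R]_3 * R) : R :=
  lform eps X.1 Y.1 + X.2 * Y.2.

Definition tangent (R : realType) (eps : R) (x X : 'rV[R]_3 * R) : Prop :=
  lform eps x.1 X.1 = 0.

Definition dt (R : realType) : 'rV[R]_3 * R := (0, 1).

(** * Local theory: [Phi] is a parametrized surface, [n] a normal along it *)

Definition first_form (R : realType) (eps : R) (Phi : 'rV[R]_2 -> 'rV[R]_3 * R)
  (u : 'rV[R]_2) : 'M[R]_2 :=
  \matrix_(i, j) inner eps (partial i Phi u) (partial j Phi u).

(* The Levi-Civita connection of [M^2(eps) x R] is the tangential part of the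
   flat connection of [R^3 x R]; as [n] is tangent to [M^2(eps) x R], pairing
   with [n] does not see the projection. *)
Definition second_form (R : realType) (eps : R) (Phi n : 'rV[R]_2 -> 'rV[R]_3 * R)
  (u : 'rV[R]_2) : 'M[R]_2 :=
  \matrix_(i, j) inner eps (partial i (partial j Phi) u) (n u).

Definition posdef (R : realType) (A : 'M[R]_2) : Prop :=
  forall v : 'rV[R]_2, v != 0 -> 0 < (v *m A *m v^T) 0 0.

Definition shape_operator (R : realType) (eps : R)
  (Phi n : 'rV[R]_2 -> 'rV[R]_3 * R) (u : 'rV[R]_2) : 'M[R]_2 :=
  invmx (first_form eps Phi u) *m second_form eps Phi n u.

(* The principal curvatures are the eigenvalues of the shape operator; their
   product is its determinant ([Ke_principal]). *)
Definition Ke (R : realType) (eps : R) (Phi n : 'rV[R]_2 -> 'rV[R]_3 * R)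
  (u : 'rV[R]_2) : R := \det (shape_operator eps Phi n u).

Lemma Ke_principal (R : realType) (eps : R) (Phi n : 'rV[R]_2 -> 'rV[R]_3 * R)
  (u : 'rV[R]_2) (k1 k2 : R) :
  char_poly (shape_operator eps Phi n u) = ('X - k1%:P) * ('X - k2%:P) ->
  Ke eps Phi n u = k1 * k2.
Proof.
move=> h; have := char_poly_det (shape_operator eps Phi n u).
rewrite h -horner_coef0 !hornerE mulrNN expr2 mulN1r opprK mul1r => ->.
by [].
Qed.

Definition christoffel (R : realType) (g : 'rV[R]_2 -> 'M[R]_2) (k i j : 'I_2)
  (u : 'rV[R]_2) : R :=
  2^-1 * \sum_l invmx (g u) k l *
    (partial i (fun v => g v j l : R) u + partial j (fun v => g v i l : R) u
     - partial l (fun v => g v i j : R) u).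

(* Component [k] of [R(d_0, d_1) d_1], for
   [R(X, Y) Z = nabla_X nabla_Y Z - nabla_Y nabla_X Z - nabla_[X, Y] Z]. *)
Definition riemann (R : realType) (g : 'rV[R]_2 -> 'M[R]_2) (k : 'I_2)
  (u : 'rV[R]_2) : R :=
  partial 0 (christoffel g k 1 1) u - partial 1 (christoffel g k 0 1) u
  + \sum_m (christoffel g m 1 1 u * christoffel g k 0 m u
            - christoffel g m 0 1 u * christoffel g k 1 m u).

Definition gauss_curvature (R : realType) (g : 'rV[R]_2 -> 'M[R]_2)
  (u : 'rV[R]_2) : R := (\sum_k riemann g k u * g u k 0) / \det (g u).

Definition Ki (R : realType) (eps : R) (Phi : 'rV[R]_2 -> 'rV[R]_3 * R)
  (u : 'rV[R]_2) : R := gauss_curvature (first_form eps Phi) u.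

(** * Surfaces immersed in [M^2(eps) x R] *)

Definition immersion (R : realType) (eps : R) (S : smoothSurface R)
  (phi : S -> 'rV[R]_3 * R) : Prop :=
  (forall p, M2 eps (phi p).1) /\
  (forall z, atlas z ->
     smooth (cod z) (phi \o param z) /\
     forall u, cod z u -> injective (fun v => 'D_v (phi \o param z) u)).

Definition unit_normal (R : realType) (eps : R) (S : smoothSurface R)
  (phi N : S -> 'rV[R]_3 * R) : Prop :=
  forall z, atlas z -> forall u, cod z u ->
    [/\ tangent eps (phi (param z u)) (N (param z u)),
        inner eps (N (param z u)) (N (param z u)) = 1
      & forall v, inner eps ('D_v (phi \o param z) u) (N (param z u)) = 0].

Definition second_form_posdef (R : realType) (eps : R) (S : smoothSurface R)
  (phi N : S -> 'rV[R]_3 * R) : Prop :=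
  forall z, atlas z -> forall u, cod z u ->
    posdef (second_form eps (phi \o param z) (N \o param z) u).

Definition positive_Ke (R : realType) (eps : R) (S : smoothSurface R)
  (phi N : S -> 'rV[R]_3 * R) : Prop :=
  forall z, atlas z -> forall u, cod z u ->
    0 < Ke eps (phi \o param z) (N \o param z) u.

Definition W_surface (R : realType) (eps a b c : R) (S : smoothSurface R)
  (phi N : S -> 'rV[R]_3 * R) : Prop :=
  forall z, atlas z -> forall u, cod z u ->
    a * Ki eps (phi \o param z) u
    + b * Ke eps (phi \o param z) (N \o param z) u = c.

Definition angle (R : realType) (eps : R) (S : smoothSurface R)
  (N : S -> 'rV[R]_3 * R) (p : S) : R := inner eps (N p) (dt R).

Definition height (R : realType) (S : smoothSurface R)
  (phi : S -> 'rV[R]_3 * R) (p : S) : R := (phi p).2.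

(* The point [(x, y)] of the plane stands for [x + i y], so that
   [|dz|^2 = dx^2 + dy^2] has the identity matrix.  Charts of both orientations
   are allowed: replacing [z] by its conjugate replaces [Q dz^2] by its
   conjugate, which has the same zeros and the same line field. *)
Definition conformal_parameter (R : realType) (eps : R) (S : smoothSurface R)
  (phi N : S -> 'rV[R]_3 * R) (z : chart R S) : Prop :=
  (forall w, atlas w -> compatible z w) /\
  (forall u, cod z u -> exists2 rho : R, 0 < rho &
     second_form eps (phi \o param z) (N \o param z) u = (2 * rho)%:M).

(** * The quadratic differential *)

(* [I = E dz^2 + 2 F |dz|^2 + conj(E) dzbar^2] gives [E = I(d_z, d_z)] with
   [d_z = (d_x - i d_y) / 2]. *)
Definition Ecoef (R : realType) (g : 'M[R]_2) : R[i] :=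
  (4^-1 * (g 0 0 - g 1 1)) -i* (2^-1 * g 0 1).

Definition dz (R : realType) (h : 'rV[R]_2 -> R) (u : 'rV[R]_2) : R[i] :=
  (2^-1 * partial 0 h u) -i* (2^-1 * partial 1 h u).

Definition Qcoef (R : realType) (eps : R) (f : R -> R) (S : smoothSurface R)
  (phi N : S -> 'rV[R]_3 * R) (z : chart R S) (u : 'rV[R]_2) : R[i] :=
  Ecoef (first_form eps (phi \o param z) u)
  + (f (1 - angle eps N (param z u) ^+ 2))%:C
    * dz (height phi \o param z) u ^+ 2.

Definition analytic_on (R : realType) (D : set R) (f : R -> R) : Prop :=
  forall x, D x -> exists (s : R^nat) (r : R), 0 < r /\
    forall y, D y -> `|y - x| < r -> pseries s (y - x) @ \oo --> f y.

(* The two powers have real exponents with sum 2, so they make sense together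
   when the two bases have the same sign, the signs cancelling if both are
   negative; this is always the case near [t = 0].  Analyticity then determines
   [f] on the whole of [0, 1], including at 0. *)
Definition is_f (R : realType) (eps a b c : R) (f : R -> R) : Prop :=
  [/\ c - eps * a != 0,
      analytic_on [set t | 0 <= t <= 1] f
    & forall t, 0 < t <= 1 -> 0 < (c - eps * a * (1 - t)) * (c - eps * a) ->
      f t = (- eps * (2 * a + b) * (c - eps * a) * t - (c - eps * a) ^+ 2
             + `|c - eps * a * (1 - t)| `^ ((2 * a + b) / a)
               * `|c - eps * a| `^ (- (b / a)))
            / (eps * (a + b) * (c - eps * a) * t ^+ 2)].

Definition isolated_zero (R : realType) (Q : 'rV[R]_2 -> R[i]) (u0 : 'rV[R]_2)
  : Prop := Q u0 = 0 /\ \forall u \near u0^', Q u != 0.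

Definition polar (R : realType) (u0 : 'rV[R]_2) (r s : R) : 'rV[R]_2 :=
  u0 + \row_(i < 2) (r * (if i == 0 then cos s else sin s)).

(* [j] is the rotation number of the line field [Im (Q dz^2) = 0] along a circle
   around [u0], small enough for its disc to lie in [D] and to contain no zero
   but [u0]: [theta] is a continuous determination of the angle of a direction
   of the field, i.e. [dz = e^(i theta)].  The equation has two orthogonal
   solutions at each point; both rotate alike. *)
Definition line_field_index (R : realType) (D : set 'rV[R]_2)
  (Q : 'rV[R]_2 -> R[i]) (u0 : 'rV[R]_2) (j : R) : Prop :=
  exists r : R, [/\ 0 < r,
    (forall t s, 0 < t <= r -> D (polar u0 t s) /\ Q (polar u0 t s) != 0)
  & exists theta : R -> R,
    [/\ {within `[0, 2 * pi], continuous theta},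
        (forall s, 0 <= s <= 2 * pi ->
           complex.Im (Q (polar u0 r s)
               * (cos (theta s) +i* sin (theta s)) ^+ 2) = 0)
      & theta (2 * pi) - theta 0 = 2 * pi * j]].

(* Main.v *)
(** Let [tau] be the Beltrami coefficient of [II] in a chart, so that
    [Z = d_0 - tau d_1] is null for [II], and let
    [T = I + f (1 - nu^2) dh^2]; in a conformal chart [tau = i] and [T(Z, Z)] is
    [4 Q].  The Gauss equation turns [a K_i + b K_e = c] into
    [(a + b) det II = (c - eps a nu^2) det I].  Together with the Codazzi equation
    and the differential equation
    [(c - eps a (1 - t)) (t f' + 2 f) = eps (2 a + b) (1 + t f)]
    this gives [Zbar q = A q + B qbar] for [q = T(Z, Z)], with [A] and [B] smooth.

    A frequency function, in polar coordinates adapted to [tau], shows that a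
    solution of such a system vanishes near each point where it vanishes to
    infinite order.  The set of points near which [T] is proportional to [II] is
    therefore open and closed, and either it is the whole surface, or, in a
    conformal chart, [Q] is [c z^k + O(|z|^(k+1))] with [c <> 0] and [k >= 1] at each
    of its zeros, which is then isolated of index [- k / 2]. *)
Require Import Defs.
From HB Require Import structures.
From mathcomp Require Import all_boot all_order all_algebra.
From mathcomp Require Import all_classical all_reals all_analysis.
From mathcomp Require Import ring lra.

Set Implicit Arguments.
Unset Strict Implicit.
Unset Printing Implicit Defensive.

Import Order.TTheory GRing.Theory Num.Theory.
Import numFieldNormedType.Exports.

Local Open Scope classical_set_scope.
Local Open Scope ring_scope.
Local Open Scope complex_scope.

(** Isothermal parameters for [II] occur only as charts that are given, and nothing says that they
    cover the surface. Continuation from point to point therefore runs in atlas charts, where [II]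
    is an arbitrary positive form; this is why a Beltrami coefficient [tau] is carried along and why
    [q = 0] is read as proportionality of [T] and [II], which does not depend on the chart.
    Conformal charts return only for the local shape of a zero. The frequency is a quotient [J / H]
    of two integrals over circles, about the degree of [q] seen at radius [r]. It is almost
    monotone, so it stays bounded as [r] shrinks, and a nonzero [H] cannot decay faster than a power
    of [r]. Smooth coefficients are enough for this, and no integral representation of solutions is
    involved. Two further obstacles: the normal [N] is given as a mere function, so its smoothness
    has to be derived; and the formula for [f] may lose its meaning away from [t = 0], so the
    differential equation is proved near 0 and carried over [[0, 1]] by analyticity. *)

Section Line.
Variables (R : realType) (V : normedModType R).
Implicit Types (F : V -> R) (w v : V).

Lemma is_derive_line F w v (s : R) : derivable F (w + s *: v) v ->
  is_derive s 1 (fun s : R => F (w + s *: v)) ('D_v F (w + s *: v)).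
Proof.
move=> dF.
have E : (fun h : R => h^-1 *: ((F (w + (h *: 1 + s) *: v)) - F (w + s *: v)))
       = (fun h : R => h^-1 *: (F (h *: v + (w + s *: v)) - F (w + s *: v))).
  apply/funext => h; congr (_ *: (F _ - _)).
  by rewrite [h *: 1]mulr1 scalerDl addrCA.
apply: DeriveDef; first by rewrite /derivable /= E.
by rewrite /derive /= E.
Qed.

Lemma line_MVT F w v (t : R) :
  (forall s : R, `|s| <= `|t| -> derivable F (w + s *: v) v) ->
  exists2 s : R, `|s| <= `|t| & F (w + t *: v) - F w = t * 'D_v F (w + s *: v).
Proof.
move=> dF; pose g (s : R) := F (w + s *: v).
have dg (s : R) : `|s| <= `|t| -> is_derive s 1 g ('D_v F (w + s *: v)).
  by move=> st; apply: is_derive_line; exact: dF.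
have cg (a b : R) : (forall x, x \in `[a, b]%R -> `|x| <= `|t|) ->
    {within `[a, b], continuous g}.
  by move=> ab; apply: derivable_within_continuous => x /ab /dg[].
have g0 : g 0 = F w by rewrite /g scale0r addr0.
have [t0|t0] := leP 0 t.
  have sub x : x \in `[0, t]%R -> `|x| <= `|t|.
    by rewrite in_itv/= => /andP[x0 xt]; rewrite !ger0_norm.
  have [|c ct] := @MVT_segment _ g (fun s => 'D_v F (w + s *: v)) 0 t t0 _ (cg _ _ sub).
    by move=> x /subset_itv_oo_cc /sub; exact: dg.
  by rewrite g0 subr0 mulrC => E; exists c => //; exact: sub.
have sub x : x \in `[t, 0]%R -> `|x| <= `|t|.
  rewrite in_itv/= => /andP[x0 xt]; rewrite !ler0_norm ?lerN2//.
  exact: ltW.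
have [|c ct] := @MVT_segment _ g (fun s => 'D_v F (w + s *: v)) t 0 (ltW t0) _ (cg _ _ sub).
  by move=> x /subset_itv_oo_cc /sub; exact: dg.
rewrite g0 => E; exists c; first exact: sub.
by rewrite -[LHS]opprB E sub0r mulrN opprK mulrC.
Qed.
End Line.

(** * Calculus of functions of class C^k on the plane *)

Section Plane.
Variable R : realType.
Local Notation plane := 'rV[R]_2.
Local Notation e i := (delta_mx 0 i : plane).
Implicit Types (u v : plane) (D : set plane).

Lemma planeE u : u = u 0 0 *: e 0 + u 0 1 *: e 1.
Proof.
apply/rowP => i; rewrite !mxE !eqxx /=.
case: (unliftP 0 i) => [j ->|->] /=; last by rewrite /= mulr1 mulr0 addr0.
by rewrite (ord1 j) /= mulr0 mulr1 add0r; congr (u _ _); apply/val_inj.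
Qed.

Lemma plane_normE u : `|u| = Num.max `|u 0 0| `|u 0 1|.
Proof.
rewrite [LHS]/Num.Def.normr/= mx_normrE; apply/le_anti/andP; split.
  apply/bigmax_leP; split=> [|[i j] _ /=]; first by rewrite le_max normr_ge0.
  rewrite (ord1 i); case: (unliftP 0 j) => [k ->|->]; rewrite le_max ?lexx//.
  apply/orP; right; rewrite (ord1 k).
  by rewrite (_ : lift 0 0 = 1) //; apply/val_inj.
by rewrite ge_max; apply/andP; split;
  [exact: (le_bigmax _ _ (ord0, 0)) | exact: (le_bigmax _ _ (ord0, 1))].
Qed.

Lemma forall2 (P : 'I_2 -> Prop) : P 0 -> P 1 -> forall i, P i.
Proof.
move=> P0 P1 i; case: (unliftP 0 i) => [j ->|->] //.
by rewrite (ord1 j) (_ : lift 0 0 = 1) //; apply/val_inj.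
Qed.

End Plane.

(** The candidate differential of a function with partial derivatives [a] and [b]; the linear
    structure registered below allows ['d F u] to be identified with it. *)
Definition lin2 (R : realType) (a b : R) (h : 'rV[R]_2) : R := h 0 0 * a + h 0 1 * b.

Fact lin2_is_linear (R : realType) (a b : R) : linear (lin2 a b).
Proof. by move=> k x y; rewrite /lin2 !mxE /GRing.scale/=; ring. Qed.

HB.instance Definition _ (R : realType) (a b : R) :=
  GRing.isLinear.Build R 'rV[R]_2 R _ (lin2 a b) (lin2_is_linear a b).

Section Continuity.
Variables (R : realType) (T : topologicalType).
Implicit Types (F G : T -> R) (x : T).

Lemma contD F G x : {for x, continuous F} -> {for x, continuous G} ->
  {for x, continuous (fun y => F y + G y)}.
Proof. by move=> cF cG; exact: (continuousD cF cG). Qed.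

Lemma contM F G x : {for x, continuous F} -> {for x, continuous G} ->
  {for x, continuous (fun y => F y * G y)}.
Proof. by move=> cF cG; exact: (continuousM cF cG). Qed.

Lemma contN F x : {for x, continuous F} -> {for x, continuous (fun y => - F y)}.
Proof. by move=> cF; exact: (continuousN cF). Qed.

Lemma contV F x : F x != 0 -> {for x, continuous F} ->
  {for x, continuous (fun y => (F y)^-1)}.
Proof. by move=> F0 cF; exact: cvgV. Qed.

Lemma cont_cst (a : R) x : {for x, continuous (fun _ : T => a)}.
Proof. exact: cst_continuous. Qed.

End Continuity.

Section Differentiable.
Variable R : realType.
Local Notation plane := 'rV[R]_2.
Local Notation e i := (delta_mx 0 i : plane).
Implicit Types (u v : plane) (D : set plane).

Lemma lin2_continuous (a b : R) : continuous (lin2 a b).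
Proof.
move=> u; have c i : {for u, continuous (fun h : plane => h 0 i)}.
  exact: coord_continuous.
suff : {for u, continuous (fun h : plane => h 0 0 * a + h 0 1 * b)} by [].
by apply: contD; apply: contM => //; exact: cont_cst.
Qed.

Lemma e00 : (e 0) 0 0 = 1. Proof. by rewrite mxE. Qed.
Lemma e01 : (e 0) 0 1 = 0. Proof. by rewrite mxE. Qed.
Lemma e10 : (e 1) 0 0 = 0. Proof. by rewrite mxE. Qed.
Lemma e11 : (e 1) 0 1 = 1. Proof. by rewrite mxE. Qed.
Definition eE := (e00, e01, e10, e11).

Lemma norm_le2 (i : 'I_2) u : `|u 0 i| <= `|u|.
Proof.
rewrite plane_normE; elim/forall2: i; by rewrite le_max lexx ?orbT.
Qed.

Lemma norm_e2 (i : 'I_2) (s : R) : `|s *: e i| = `|s|.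
Proof.
rewrite plane_normE !mxE /=; elim/forall2: i => /=; rewrite mulr1 mulr0 normr0.
  by rewrite max_l.
by rewrite max_r.
Qed.

Lemma is_diff_lin2 (F : plane -> R) u (a b : R) :
  (forall eps : R, 0 < eps -> \forall h \near (0 : plane),
     `|F (h + u) - F u - lin2 a b h| <= eps * `|h|) ->
  is_diff u F (lin2 a b).
Proof.
move=> H; have E : F \o shift u = cst (F u) + lin2 a b +o_ (0 : plane) id.
  apply/eqaddoP => eps /H; apply: filterS => h.
  have -> // : (F \o shift u - (cst (F u) + lin2 a b)) h = F (h + u) - F u - lin2 a b h.
  by rewrite -[RHS]addrA -opprD.
have V : 'd F u = lin2 a b :> (plane -> R).
  by apply: diff_unique => //; exact: lin2_continuous.
apply: DiffDef => //; apply/diff_locallyP; rewrite V; split=> //.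
exact: lin2_continuous.
Qed.

Lemma near_normP (V : normedModType R) (x : V) (P : V -> Prop) :
  (\forall y \near x, P y) <-> exists2 d : R, 0 < d & forall y, `|y - x| < d -> P y.
Proof.
split.
  move=> /nbhs_normP[d /= d0 dP]; exists d => // y yx.
  by apply: dP; rewrite /ball_ /= distrC.
move=> [d d0 dP]; apply/nbhs_normP; exists d => //= y; rewrite /ball_ /= distrC.
exact: dP.
Qed.

Lemma continuousP (V W : normedModType R) (F : V -> W) (x : V) :
  {for x, continuous F} <-> forall eps : R, 0 < eps ->
    exists2 d : R, 0 < d & forall y, `|y - x| < d -> `|F y - F x| < eps.
Proof.
split=> [cF eps eps0|H].
  move/cvgrPdist_lt : cF => /(_ _ eps0) /near_normP[d d0 dF]; exists d => // y.
  by move=> /dF; rewrite distrC.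
apply/cvgrPdist_lt => eps eps0; apply/near_normP.
have [d d0 dF] := H _ eps0; exists d => // y /dF; by rewrite distrC.
Qed.

Lemma openP (V : normedModType R) (D : set V) : open D <->
  forall x, D x -> exists2 d : R, 0 < d & forall y, `|y - x| < d -> D y.
Proof.
rewrite openE; split=> oD x /oD; first by move/near_normP.
by move=> H; apply/near_normP.
Qed.

(** The increment splits along a path that follows [e 1] and then [e 0]; the mean value theorem on
    each leg and continuity of the partial derivatives at [u] bound the remainder. *)
Lemma C1_is_diff D (F : plane -> R) u : open D -> D u ->
  (forall v, D v -> forall i, derivable F v (e i)) ->
  (forall i, {for u, continuous (partial i F)}) ->
  is_diff u F (lin2 (partial 0 F u) (partial 1 F u)).
Proof.
move=> /openP oD /oD[d d0 dD] dF cF; apply: is_diff_lin2 => eps eps0.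
have eps2 : 0 < eps / 2 by rewrite divr_gt0.
have [d1 d10 c1] := (continuousP _ _).1 (cF 0) _ eps2.
have [d2 d20 c2] := (continuousP _ _).1 (cF 1) _ eps2.
apply/near_normP; exists (Num.min d (Num.min d1 d2)).
  by rewrite !lt_min d0 d10.
move=> h; rewrite subr0 !lt_min => /and3P[hd hd1 hd2].
have H0 (s : R) : `|s| <= `|h 0 0| -> `|u + h 0 1 *: e 1 + s *: e 0 - u| <= `|h|.
  move=> sh; rewrite -[u + _ + _]addrA addrAC subrr add0r [leLHS]plane_normE !mxE /=.
  rewrite !(mulr0, mulr1, add0r, addr0) plane_normE ge_max !le_max sh lexx.
  by rewrite orbT.
have H1 (s : R) : `|s| <= `|h 0 1| -> `|u + s *: e 1 - u| <= `|h|.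
  move=> sh; rewrite addrAC subrr add0r norm_e2.
  by apply: (le_trans sh); exact: norm_le2.
have [s0 sh0 E0] := @line_MVT _ _ F (u + h 0 1 *: e 1) (e 0) (h 0 0)
  (fun s hs => dF _ (dD _ (le_lt_trans (H0 s hs) hd)) 0).
have [s1 sh1 E1] := @line_MVT _ _ F u (e 1) (h 0 1)
  (fun s hs => dF _ (dD _ (le_lt_trans (H1 s hs) hd)) 1).
have -> : F (h + u) - F u - lin2 (partial 0 F u) (partial 1 F u) h =
  h 0 0 * (partial 0 F (u + h 0 1 *: e 1 + s0 *: e 0) - partial 0 F u) +
  h 0 1 * (partial 1 F (u + s1 *: e 1) - partial 1 F u).
  rewrite /lin2 !mulrBr -[X in _ = X - _ + _]E0 -[X in _ = _ + (X - _)]E1.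
  have -> : u + h 0 1 *: e 1 + h 0 0 *: e 0 = h + u.
    by rewrite [in RHS](planeE h) -addrA addrC (addrC (_ *: e 1)).
  by ring.
apply: (le_trans (ler_normD _ _)); rewrite !normrM (splitr eps) mulrDl.
apply: lerD; rewrite mulrC; apply: ler_pM => //; try exact: norm_le2.
  by apply/ltW/c1; exact: (le_lt_trans (H0 _ sh0)).
by apply/ltW/c2; exact: (le_lt_trans (H1 _ sh1)).
Qed.
End Differentiable.

Section CkGeneral.
Variables (R : realType) (W : normedModType R).
Local Notation plane := 'rV[R]_2.
Local Notation e i := (delta_mx 0 i : plane).
Implicit Types (u v : plane) (D : set plane) (F G : plane -> W) (k : nat) (i : 'I_2).

Lemma near_open_eq D F G u : open D -> D u -> (forall v, D v -> F v = G v) ->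
  \near u, F u = G u.
Proof.
move=> oD Du FG; have : nbhs u D by apply: open_nbhs_nbhs.
by apply: filterS => v /FG.
Qed.

Lemma partial_ext D F G i u : open D -> D u -> (forall v, D v -> F v = G v) ->
  partial i F u = partial i G u.
Proof. by move=> oD Du FG; apply/near_eq_derive/(near_open_eq oD). Qed.

Lemma derivable_ext D F G u v : open D -> D u -> (forall v, D v -> F v = G v) ->
  derivable F u v -> derivable G u v.
Proof. by move=> oD Du FG; apply/near_eq_derivable/(near_open_eq oD). Qed.

Lemma cont_ext D F G u : open D -> D u -> (forall v, D v -> F v = G v) ->
  {for u, continuous F} -> {for u, continuous G}.
Proof.
move=> /openP oD Du FG /continuousP cF; apply/continuousP => eps /cF[d d0 dF].
have [d' d'0 dD] := oD _ Du; exists (Num.min d d'); first by rewrite lt_min d0.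
by move=> v; rewrite lt_min => /andP[vd vd']; rewrite -!FG //; [exact: dF|exact: dD].
Qed.

Lemma Ck_ext k D F G : open D -> (forall v, D v -> F v = G v) ->
  Ck k D F -> Ck k D G.
Proof.
move=> oD; elim: k F G => [|k IH] F G FG [cF dF].
  by split=> // u Du; exact: (cont_ext oD Du FG (cF _ Du)).
split=> [u Du|i]; first exact: (cont_ext oD Du FG (cF _ Du)).
have [deF CF] := dF i; split=> [u Du|].
  exact: (derivable_ext oD Du FG (deF _ Du)).
by apply: (IH _ _ _ CF) => u Du; exact: (partial_ext i oD Du FG).
Qed.

Lemma Ck_sub k D D' F : D' `<=` D -> Ck k D F -> Ck k D' F.
Proof.
move=> sD; elim: k F => [|k IH] F [cF dF].
  by split=> // u /sD; exact: cF.
split=> [u /sD|i]; first exact: cF.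
by have [deF CF] := dF i; split=> [u /sD|]; [exact: deF|exact: IH].
Qed.

Lemma CkW k D F : Ck k.+1 D F -> Ck k D F.
Proof.
elim: k F => [|k IH] F [cF dF] //.
split=> // i; have [deF CF] := dF i; split=> //; exact: IH.
Qed.

Lemma smooth_ext D F G : open D -> (forall v, D v -> F v = G v) ->
  smooth D F -> smooth D G.
Proof. by move=> oD FG sF k; exact: (Ck_ext oD FG (sF k)). Qed.

Lemma smooth_sub D D' F : D' `<=` D -> smooth D F -> smooth D' F.
Proof. by move=> sD sF k; exact: (Ck_sub sD (sF k)). Qed.

Lemma smooth_partial D F i : smooth D F -> smooth D (partial i F).
Proof. by move=> sF k; have [_ /(_ i)[]] := sF k.+1. Qed.

Lemma smooth_cont D F u : smooth D F -> D u -> {for u, continuous F}.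
Proof. by move=> sF Du; have [+ _] := sF 0%N; exact. Qed.

Lemma smooth_derivable D F i u : smooth D F -> D u -> derivable F u (e i).
Proof. by move=> sF Du; have [_ /(_ i)[+ _]] := sF 1%N; exact. Qed.

End CkGeneral.

Section CkReal.
Variable R : realType.
Local Notation plane := 'rV[R]_2.
Local Notation e i := (delta_mx 0 i : plane).
Implicit Types (u v : plane) (D : set plane) (F G : plane -> R) (k : nat) (i : 'I_2).

Lemma partialD F G i u : derivable F u (e i) -> derivable G u (e i) ->
  partial i (fun v => F v + G v) u = partial i F u + partial i G u.
Proof. exact: deriveD. Qed.

Lemma partialN F i u : derivable F u (e i) ->
  partial i (fun v => - F v) u = - partial i F u.
Proof. exact: deriveN. Qed.

Lemma partialM F G i u : derivable F u (e i) -> derivable G u (e i) ->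
  partial i (fun v => F v * G v) u = F u * partial i G u + G u * partial i F u.
Proof. exact: deriveM. Qed.

Lemma partial_cst (a : R) i u : partial i (fun _ => a) u = 0.
Proof. exact: derive_cst. Qed.

Lemma partialV F i u : F u != 0 -> derivable F u (e i) ->
  partial i (fun v => (F v)^-1) u = - partial i F u * (F u)^-1 * (F u)^-1.
Proof.
move=> F0 dF; have := deriveV F0 dF.
by rewrite /partial => ->; rewrite /GRing.scale/= -exprVn expr2; ring.
Qed.

Lemma derivD F G u v : derivable F u v -> derivable G u v ->
  derivable (fun w => F w + G w) u v.
Proof. exact: derivableD. Qed.

Lemma derivN F u v : derivable F u v -> derivable (fun w => - F w) u v.
Proof. exact: derivableN. Qed.

Lemma derivM F G u v : derivable F u v -> derivable G u v ->
  derivable (fun w => F w * G w) u v.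
Proof. exact: derivableM. Qed.

Lemma derivV F u v : F u != 0 -> derivable F u v ->
  derivable (fun w => (F w)^-1) u v.
Proof. exact: derivableV. Qed.

Lemma Ck_cst k D (a : R) : Ck k D (fun _ => a).
Proof.
elim: k a => [|k IH] a; first by split=> // u _; exact: cst_continuous.
split=> [u _|i]; first exact: cst_continuous.
split=> [u _|]; first exact: derivable_cst.
rewrite (_ : partial i _ = fun => 0) //; apply/funext => u.
exact: partial_cst.
Qed.

Lemma CkD k D F G : open D -> Ck k D F -> Ck k D G ->
  Ck k D (fun v => F v + G v).
Proof.
move=> oD; elim: k F G => [|k IH] F G [cF dF] [cG dG].
  by split=> [u Du|]; [apply: contD; [exact: cF|exact: cG]|].
split=> [u Du|i]; first by apply: contD; [exact: cF|exact: cG].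
have [deF CF] := dF i; have [deG CG] := dG i; split=> [u Du|].
  by apply: derivD; [exact: deF|exact: deG].
apply: (Ck_ext oD _ (IH _ _ CF CG)) => u Du.
by rewrite partialD; [|exact: deF|exact: deG].
Qed.

Lemma CkN k D F : open D -> Ck k D F -> Ck k D (fun v => - F v).
Proof.
move=> oD; elim: k F => [|k IH] F [cF dF].
  by split=> [u Du|]; [apply: contN; exact: cF|].
split=> [u Du|i]; first by apply: contN; exact: cF.
have [deF CF] := dF i; split=> [u Du|].
  by apply: derivN; exact: deF.
apply: (Ck_ext oD _ (IH _ CF)) => u Du.
by rewrite partialN //; exact: deF.
Qed.

Lemma CkM k D F G : open D -> Ck k D F -> Ck k D G ->
  Ck k D (fun v => F v * G v).
Proof.
move=> oD; elim: k F G => [|k IH] F G CF0 CG0; have [cF dF] := CF0; have [cG dG] := CG0.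
  by split=> [u Du|]; [apply: contM; [exact: cF|exact: cG]|].
split=> [u Du|i]; first by apply: contM; [exact: cF|exact: cG].
have [deF CF] := dF i; have [deG CG] := dG i; split=> [u Du|].
  by apply: derivM; [exact: deF|exact: deG].
apply: (Ck_ext oD _ (CkD oD (IH _ _ (CkW CF0) CG) (IH _ _ (CkW CG0) CF))) => u Du.
by rewrite partialM; [|exact: deF|exact: deG].
Qed.

(** The derivative contains [F^-1] again, but only to order [k], so the induction can keep [F]
    fixed. [Ck_sqrt] follows the same pattern. *)
Lemma CkV k D F : open D -> (forall v, D v -> F v != 0) -> Ck k D F ->
  Ck k D (fun v => (F v)^-1).
Proof.
move=> oD F0; elim: k => [|k IH] CF0; have [cF dF] := CF0.
  by split=> [u Du|]; [apply: contV; [exact: F0|exact: cF]|].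
split=> [u Du|i]; first by apply: contV; [exact: F0|exact: cF].
have [deF CF] := dF i; split=> [u Du|].
  by apply: derivV; [exact: F0|exact: deF].
have CV := IH (CkW CF0).
apply: (Ck_ext oD _ (CkM oD (CkM oD (CkN oD CF) CV) CV)) => u Du.
by rewrite partialV; [|exact: F0|exact: deF].
Qed.

(** Reduces a directional derivative to a derivative at the origin of the real line, where the
    one-variable chain rule applies. *)
Lemma is_derive_line0 (V W : normedModType R) (G : V -> W) (u v : V) (d : W) :
  is_derive u v G d <-> is_derive (0 : R) 1 (fun s : R => G (u + s *: v)) d.
Proof.
have E : (fun h : R => h^-1 *: (G (u + (h *: (1 : R) + 0 : R) *: v) - G (u + (0 : R) *: v)))
       = (fun h : R => h^-1 *: (G (h *: v + u) - G u)).
  apply/funext => h; congr (_ *: (G _ - G _)); last by rewrite scale0r addr0.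
  by rewrite [h *: 1]mulr1 addr0 addrC.
by split=> -[dG Gd]; apply: DeriveDef;
  move: dG Gd; rewrite /derivable /derive /= E.
Qed.

Lemma is_derive_comp F (phi : R -> R) u v (a d : R) :
  is_derive u v F a -> is_derive (F u) 1 phi d -> is_derive u v (phi \o F) (a * d).
Proof.
move=> /is_derive_line0 dF dp; apply/is_derive_line0.
have dl : derivable (fun s : R => F (u + s *: v)) (0 : R) 1 by case: dF.
have l0 : F (u + 0 *: v) = F u by rewrite scale0r addr0.
have dp' : derivable phi (F (u + 0 *: v)) 1 by case: dp; rewrite l0.
apply: DeriveDef.
  apply/derivable1_diffP.
  apply: (@differentiable_comp _ _ _ _ (fun s : R => F (u + s *: v)) phi);
    exact/derivable1_diffP.
rewrite -derive1E (derive1_comp dl dp') l0 !derive1E mulrC.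
by case: dF => _ ->; case: dp => _ ->.
Qed.

Lemma is_derive_sqrt (x : R) : 0 < x ->
  is_derive x 1 (@Num.sqrt R) (2^-1 * (Num.sqrt x)^-1).
Proof.
move=> x0; have := is_derive1_sqrt x0; by rewrite invfM.
Qed.

Lemma Ck_sqrt k D F : open D -> (forall v, D v -> 0 < F v) -> Ck k D F ->
  Ck k D (fun v => Num.sqrt (F v)).
Proof.
move=> oD F0; have s0 u : D u -> Num.sqrt (F u) != 0.
  by move=> /F0 Fu; rewrite gt_eqF // sqrtr_gt0.
elim: k => [|k IH] CF0; have [cF dF] := CF0.
  by split=> // u Du; exact: (continuous_comp (cF _ Du) (@sqrt_continuous _ _)).
split=> [u Du|i].
  exact: (continuous_comp (cF _ Du) (@sqrt_continuous _ _)).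
have [deF CF] := dF i.
have H u : D u -> is_derive u (e i) (fun v => Num.sqrt (F v))
    (partial i F u * (2^-1 * (Num.sqrt (F u))^-1)).
  move=> Du; apply: is_derive_comp; first exact/derivableP/deF.
  exact/is_derive_sqrt/F0.
split=> [u Du|]; first by case: (H _ Du).
apply: (Ck_ext oD (F := fun u => partial i F u * (2^-1 * (Num.sqrt (F u))^-1))).
  by move=> u Du; case: (H _ Du) => _ <-.
by apply: CkM => //; apply: CkM => //; [exact: Ck_cst|apply: CkV => //; exact: IH (CkW CF0)].
Qed.

End CkReal.

Section Chain.
Variable R : realType.
Local Notation plane := 'rV[R]_2.
Local Notation e i := (delta_mx 0 i : plane).

Lemma chain2 (V : normedModType R) (F : plane -> R) (X : V -> plane) (t v : V)
    (a b d0 d1 : R) :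
  is_diff (X t) F (lin2 a b) ->
  is_derive t v (fun s => X s 0 0) d0 -> is_derive t v (fun s => X s 0 1) d1 ->
  is_derive t v (fun s => F (X s)) (d0 * a + d1 * b).
Proof.
move=> dF /is_derive_line0 d0X /is_derive_line0 d1X; apply/is_derive_line0.
pose Y (s : R) := X (t + s *: v).
have Y0 : Y 0 = X t by rewrite /Y scale0r addr0.
have dY : derivable Y (0 : R) 1.
  apply/derivable_mxP => i; elim/forall2 => //; rewrite (ord1 i).
    by case: d0X.
  by case: d1X.
have dY' : differentiable Y (0 : R) by exact/derivable1_diffP.
have dF' : is_diff (Y 0) F (lin2 a b) by rewrite Y0.
have dF2 : differentiable F (Y 0) by case: dF'.
suff : is_derive (0 : R) 1 (F \o Y) (d0 * a + d1 * b) by [].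
apply: DeriveDef.
  apply/derivable1_diffP; exact: differentiable_comp.
rewrite deriveE; last exact: differentiable_comp.
rewrite diff_comp //=.
rewrite diff_val -deriveE // derive_mx // /lin2 !mxE.
by case: d0X => _ ->; case: d1X => _ ->.
Qed.

Lemma smooth_is_diff (D : set plane) (F : plane -> R) u :
  open D -> smooth D F -> D u -> is_diff u F (lin2 (partial 0 F u) (partial 1 F u)).
Proof.
move=> oD sF Du; apply: (C1_is_diff oD Du) => [v Dv i|i].
  exact: smooth_derivable Dv.
by apply: smooth_cont Du; exact: smooth_partial.
Qed.

Lemma Ck2_is_diff (D : set plane) (F : plane -> R) u k :
  open D -> Ck k.+1 D F -> D u -> is_diff u F (lin2 (partial 0 F u) (partial 1 F u)).
Proof.
move=> oD [_ dF] Du; apply: (C1_is_diff oD Du) => [v Dv i|i].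
  by have [+ _] := dF i; apply.
by have [_ ] := dF i; case: (k) => [|k'] [+ _]; apply.
Qed.

(** One second difference [A] over a small square is the area times either mixed derivative, taken
    somewhere in the square; continuity of both at [u] then forces equality. *)
Lemma Schwarz (D : set plane) (F : plane -> R) u :
  open D -> Ck 2 D F -> D u -> partial 0 (partial 1 F) u = partial 1 (partial 0 F) u.
Proof.
move=> /openP oD [_ CF] Du; have [d d0 dD] := oD _ Du.
have [dF0 [_ CF0]] := CF 0; have [dF1 [_ CF1]] := CF 1.
have [dF10 [c10 _]] := CF0 1; have [dF01 [c01 _]] := CF1 0.
have /continuousP c10' := c10 _ Du; have /continuousP c01' := c01 _ Du.
apply/eqP; rewrite -subr_eq0 -normr_le0; apply/ler_addgt0Pr => eps eps0.
rewrite add0r; have eps2 : 0 < eps / 2 by rewrite divr_gt0.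
have [d1 d10 H1] := c10' _ eps2; have [d2 d20 H2] := c01' _ eps2.
pose m := Num.min d (Num.min d1 d2).
have m0 : 0 < m by rewrite !lt_min d0 d10.
pose h := m / 2; have h0 : 0 < h by rewrite divr_gt0.
have near_u (s t : R) : `|s| <= `|h| -> `|t| <= `|h| ->
    `|u + s *: e 0 + t *: e 1 - u| < m.
  move=> sh th; rewrite -[u + _ + _]addrA addrAC subrr add0r plane_normE !mxE /=.
  rewrite !(mulr0, mulr1, add0r, addr0) gt_max.
  have hm : `|h| < m by rewrite gtr0_norm // /h ltr_pdivrMr // ltr_pMr // ltr1n.
  by rewrite (le_lt_trans sh hm) (le_lt_trans th hm).
have near_D (s t : R) : `|s| <= `|h| -> `|t| <= `|h| -> D (u + s *: e 0 + t *: e 1).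
  move=> sh th; apply: dD; apply: lt_le_trans (near_u _ _ sh th) _.
  by rewrite ge_min lexx.
have hh : `|h| <= `|h| by []. 
have h00 : `|0 : R| <= `|h| by rewrite normr0.
have add00 (w : plane) i : w + 0 *: e i = w by rewrite scale0r addr0.
have near_D1 (s : R) : `|s| <= `|h| -> D (u + s *: e 0).
  by move=> sh; rewrite -(add00 (u + s *: e 0) 1); exact: near_D.
have near_D2 (t : R) : `|t| <= `|h| -> D (u + t *: e 1).
  by move=> th; rewrite -{1}(add00 u 0); exact: near_D.
have shE (w b v : plane) :
    (fun h : R => h^-1 *: (F (h *: v + w + b) - F (w + b))) =
    (fun h : R => h^-1 *: (F (h *: v + (w + b)) - F (w + b))).
  by apply/funext => k; rewrite addrA.
have shiftD (w b v : plane) : derivable F (w + b) v -> derivable (fun w => F (w + b)) w v.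
  by rewrite /derivable /= shE.
have shiftE (w b v : plane) : 'D_v (fun w => F (w + b)) w = 'D_v F (w + b).
  by rewrite /derive /= shE.
pose A := F (u + h *: e 0 + h *: e 1) - F (u + h *: e 0) - F (u + h *: e 1) + F u.
have [s [t [sh th EA]]] : exists s t : R, [/\ `|s| <= `|h|, `|t| <= `|h| &
    A = h * (h * partial 1 (partial 0 F) (u + s *: e 0 + t *: e 1))].
  pose G w := F (w + h *: e 1) - F w.
  have dG s : `|s| <= `|h| -> is_derive (u + s *: e 0) (e 0) G
      (partial 0 F (u + s *: e 0 + h *: e 1) - partial 0 F (u + s *: e 0)).
    move=> sh; rewrite -[X in X - _]shiftE.
    apply: is_deriveB; apply/derivableP; last exact/dF0/near_D1.
    exact/shiftD/dF0/near_D.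
  have [s sh Es] := @line_MVT _ _ G u (e 0) h (fun s hs => let: DeriveDef d _ := dG s hs in d).
  have [t th Et] := @line_MVT _ _ (partial 0 F) (u + s *: e 0) (e 1) h
    (fun t ht => dF10 _ (near_D _ _ sh ht)).
  exists s, t; split=> //; rewrite -Et.
  by have [_ <-] := dG _ sh; rewrite -Es /G /A; ring.
have [s' [t' [sh' th' EA']]] : exists s t : R, [/\ `|s| <= `|h|, `|t| <= `|h| &
    A = h * (h * partial 0 (partial 1 F) (u + s *: e 0 + t *: e 1))].
  pose G w := F (w + h *: e 0) - F w.
  have dG r : `|r| <= `|h| -> is_derive (u + r *: e 1) (e 1) G
      (partial 1 F (u + r *: e 1 + h *: e 0) - partial 1 F (u + r *: e 1)).
    move=> rh; rewrite -[X in X - _]shiftE.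
    apply: is_deriveB; apply/derivableP; last exact/dF1/near_D2.
    by apply/shiftD/dF1; rewrite addrAC; exact/near_D.
  have [t' th' Et] := @line_MVT _ _ G u (e 1) h (fun s hs => let: DeriveDef d _ := dG s hs in d).
  have [s' sh' Es] := @line_MVT _ _ (partial 1 F) (u + t' *: e 1) (e 0) h
    (fun s hs => dF01 _ (eq_ind _ D (near_D _ _ hs th') _ (addrAC _ _ _))).
  have ac (x y : R) : u + x *: e 0 + y *: e 1 = u + y *: e 1 + x *: e 0 by rewrite addrAC.
  exists s', t'; split; [exact: sh'|exact: th'|].
  rewrite ac -Es; have [_ <-] := dG _ th'.
  by rewrite -Et /G /A ac; ring.
have E : partial 1 (partial 0 F) (u + s *: e 0 + t *: e 1) =
         partial 0 (partial 1 F) (u + s' *: e 0 + t' *: e 1).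
  have hn : h != 0 by rewrite gt_eqF.
  by move: EA'; rewrite EA => /(mulfI hn) /(mulfI hn).
have := H1 _ (lt_le_trans (near_u _ _ sh th) _); rewrite !ge_min lexx orbT /= => /(_ isT) L1.
have := H2 _ (lt_le_trans (near_u _ _ sh' th') _); rewrite !ge_min lexx !orbT /= => /(_ isT) L2.
move: L1 L2; rewrite E => L1 L2.
rewrite (splitr eps).
have := ler_distD (partial 0 (partial 1 F) (u + s' *: e 0 + t' *: e 1))
  (partial 0 (partial 1 F) u) (partial 1 (partial 0 F) u).
move=> H; rewrite distrC in L2; exact: (le_trans H (lerD (ltW L2) (ltW L1))).
Qed.

End Chain.

Section Smooth.
Variable R : realType.
Local Notation plane := 'rV[R]_2.
Local Notation e i := (delta_mx 0 i : plane).
Variable D : set plane.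
Hypothesis oD : open D.
Implicit Types (u v : plane) (F G : plane -> R) (k : nat) (i : 'I_2).

Lemma smooth_cst (a : R) : smooth D (fun _ => a).
Proof. by move=> k; exact: Ck_cst. Qed.

Lemma smoothD F G : smooth D F -> smooth D G -> smooth D (fun v => F v + G v).
Proof. by move=> sF sG k; exact: CkD. Qed.

Lemma smoothN F : smooth D F -> smooth D (fun v => - F v).
Proof. by move=> sF k; exact: CkN. Qed.

Lemma smoothB F G : smooth D F -> smooth D G -> smooth D (fun v => F v - G v).
Proof. by move=> sF sG; apply: smoothD => //; exact: smoothN. Qed.

Lemma smoothM F G : smooth D F -> smooth D G -> smooth D (fun v => F v * G v).
Proof. by move=> sF sG k; exact: CkM. Qed.

Lemma smoothV F : (forall v, D v -> F v != 0) -> smooth D F ->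
  smooth D (fun v => (F v)^-1).
Proof. by move=> F0 sF k; exact: CkV. Qed.

Lemma smooth_sqrt F : (forall v, D v -> 0 < F v) -> smooth D F ->
  smooth D (fun v => Num.sqrt (F v)).
Proof. by move=> F0 sF k; exact: Ck_sqrt. Qed.

Lemma Ck_comp k (D' : set plane) (F : plane -> R) (psi : plane -> plane) :
  open D' -> (forall u, D u -> D' (psi u)) ->
  Ck k D' F -> (forall i, Ck k D (fun u => psi u 0 i)) ->
  Ck k D (fun u => F (psi u)).
Proof.
move=> oD' DD'; have cpsi l u : D u -> (forall i, Ck l D (fun u => psi u 0 i)) -> {for u, continuous psi}.
  move=> Du cp; apply/continuousP => eps eps0.
  have c i : {for u, continuous (fun u => psi u 0 i)}.
    by have := cp i; case: (l) => [|l'] [+ _]; apply.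
  have [d0 d00 H0] := (continuousP _ _).1 (c 0) _ eps0.
  have [d1 d10 H1] := (continuousP _ _).1 (c 1) _ eps0.
  exists (Num.min d0 d1); first by rewrite lt_min d00.
  move=> v; rewrite lt_min => /andP[v0 v1].
  by rewrite plane_normE !mxE gt_max H0 // H1.
elim: k F => [|k IH] F CF cp.
  split=> [u Du|//]; apply: (continuous_comp (cpsi _ _ Du cp)).
  by have [+ _] := CF; apply; exact: DD'.
split=> [u Du|i].
  apply: (continuous_comp (cpsi _ _ Du cp)).
  by have [+ _] := CF; apply; exact: DD'.
have H u : D u -> is_derive u (e i) (fun u => F (psi u))
   (partial i (fun u => psi u 0 0) u * partial 0 F (psi u) +
    partial i (fun u => psi u 0 1) u * partial 1 F (psi u)).
  move=> Du; apply: chain2; first exact: Ck2_is_diff oD' CF (DD' _ Du).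
    by apply/derivableP; have [_ /(_ i)[+ _]] := cp 0; apply.
  by apply/derivableP; have [_ /(_ i)[+ _]] := cp 1; apply.
split=> [u Du|]; first by case: (H _ Du).
have cp' j : Ck k D (fun u => psi u 0 j) by exact/CkW.
have cpi j : Ck k D (partial i (fun u => psi u 0 j)) by have [_ /(_ i)[]] := cp j.
have CFj j : Ck k D (fun u => partial j F (psi u)).
  by apply: IH => //; have [_ /(_ j)[]] := CF.
apply: (Ck_ext oD _ (CkD oD (CkM oD (cpi 0) (CFj 0)) (CkM oD (cpi 1) (CFj 1)))).
by move=> u Du; case: (H _ Du) => _ <-.
Qed.

End Smooth.

Section DeriveRules.
Variables (R : realType) (V : normedModType R).
Implicit Types (F G : V -> R) (x v : V) (a b : R).

Lemma derD F G x v a b : is_derive x v F a -> is_derive x v G b ->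
  is_derive x v (fun y => F y + G y) (a + b).
Proof. exact: is_deriveD. Qed.

Lemma derN F x v a : is_derive x v F a -> is_derive x v (fun y => - F y) (- a).
Proof. exact: is_deriveN. Qed.

Lemma derB F G x v a b : is_derive x v F a -> is_derive x v G b ->
  is_derive x v (fun y => F y - G y) (a - b).
Proof. by move=> dF dG; apply: derD => //; exact: derN. Qed.

Lemma derM F G x v a b : is_derive x v F a -> is_derive x v G b ->
  is_derive x v (fun y => F y * G y) (F x * b + G x * a).
Proof. exact: is_deriveM. Qed.

Lemma derC a x v : is_derive x v (fun _ => a) 0.
Proof. exact: is_derive_cst. Qed.

Lemma derV F x v a : F x != 0 -> is_derive x v F a ->
  is_derive x v (fun y => (F y)^-1) (- a / F x ^+ 2).
Proof.
move=> F0 [dF Fa]; apply: DeriveDef; first exact: derivableV.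
by rewrite (deriveV F0 dF) Fa /GRing.scale/= !mulNr mulrC.
Qed.

Lemma der_eq F x v a b : is_derive x v F a -> a = b -> is_derive x v F b.
Proof. by move=> + <-. Qed.

End DeriveRules.

Lemma derX (R : realType) (V : normedModType R) (F : V -> R) x v a n : is_derive x v F a ->
  is_derive x v (fun y => F y ^+ n.+1) (n.+1%:R * F x ^+ n * a).
Proof.
move=> dF; elim: n => [|n IH].
  by apply: (der_eq (b := _) dF); rewrite expr0 !mul1r.
rewrite (_ : (fun y => _) = fun y => F y * F y ^+ n.+1); last first.
  by apply/funext => y; rewrite exprS.
by apply: (der_eq (derM dF IH)); rewrite !exprS [in RHS]mulrS; ring.
Qed.

(** * Frequency functions: the argument in the radius *)

Section FrequencyODE.
Variable R : realType.
Implicit Types (r s : R).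

Lemma increasing_cc (F : R -> R) (a b : R) : a <= b ->
  (forall x, a <= x <= b -> exists2 d, is_derive x 1 F d & 0 <= d) -> F a <= F b.
Proof.
move=> ab dF.
have der x : a <= x <= b -> derivable F x 1 by move=> /dF[d []].
apply: (@ger0_derive1_le_cc R F a b); rewrite ?in_itv/= ?lexx ?ab//.
- by move=> x; rewrite in_itv/= => /andP[/ltW ax /ltW xb]; apply: der; rewrite ax.
- move=> x; rewrite in_itv/= => /andP[/ltW ax /ltW xb].
  by rewrite derive1E; have [|d [_ ->]] := dF x; rewrite ?ax.
- by apply: derivable_within_continuous => x; rewrite in_itv/= => /der.
Qed.

(** [H] stands for the integral of [|w|^2] over the circle of radius [r], and [2 * J] for [r] times
    its derivative, up to an error. For [w = z^k] the quotient [J / H] is [k]. *)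
Variables (H J dH dJ : R -> R) (delta C : R).
Hypothesis C0 : 0 <= C.
Hypothesis dHr : forall r, 0 < r < delta -> is_derive r 1 H (dH r).
Hypothesis dJr : forall r, 0 < r < delta -> is_derive r 1 J (dJ r).
Hypothesis H0 : forall r, 0 < r < delta -> 0 <= H r.
Hypothesis eqH : forall r, 0 < r < delta -> `|r * dH r - 2 * J r| <= C * r * H r.
Hypothesis eqJ : forall r, 0 < r < delta -> 0 < H r ->
  2 * J r ^+ 2 - C * r * (`|J r| + H r) * H r <= r * dJ r * H r.

Let N r := J r / H r.
(** [g x] is [exp (arsinh x)]: positive, at least [x], with logarithmic derivative
    [1 / sqrt (x^2 + 1)]. As [|x| + 1 <= 2 sqrt (x^2 + 1)], it turns the lower bound on the
    derivative of [N], linear in [|N|], into monotonicity of [y], whatever the sign of [N]. *)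
Let g (x : R) := x + Num.sqrt (x ^+ 2 + 1).

Let g_gt0 x : 0 < g x.
Proof.
rewrite /g -ltrBlDl sub0r; have [x0|x0] := ltP 0 x.
  by rewrite (@lt_le_trans _ _ 0) ?oppr_lt0 ?sqrtr_ge0.
rewrite -(ler0_norm x0) -sqrtr_sqr ltr_sqrt ?ltrDl//.
by rewrite ltr_pwDr // sqr_ge0.
Qed.

Let is_derive_g (x : R) : is_derive x 1 g (g x / Num.sqrt (x ^+ 2 + 1)).
Proof.
have s0 : 0 < x ^+ 2 + 1 by rewrite ltr_pwDr // sqr_ge0.
have sn : Num.sqrt (x ^+ 2 + 1) != 0 by rewrite gt_eqF // sqrtr_gt0.
have d1 : is_derive x 1 (fun x : R => x ^+ 2 + 1) (2 * x).
  apply: (der_eq (derD (derX 1 (is_derive_id x 1)) (derC 1 x 1))).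
  by rewrite expr1 mulr1 addr0.
have d2 : is_derive x 1 (Num.sqrt \o (fun x : R => x ^+ 2 + 1)) ((2 * x) * (2^-1 * (Num.sqrt (x ^+ 2 + 1))^-1)).
  apply: (der_eq (@is_derive1_comp R _ (fun x : R => x ^+ 2 + 1) x _ _ (is_derive_sqrt s0) d1)).
  by rewrite mulrC.
apply: (der_eq (derD (is_derive_id x 1) d2)).
by rewrite /g; field.
Qed.

Let y r := g (N r) * expR (4 * C * r).

Let dN r : 0 < r < delta -> 0 < H r ->
  is_derive r 1 N ((dJ r * H r - J r * dH r) / H r ^+ 2).
Proof.
move=> rd Hr; have Hn : H r != 0 by rewrite gt_eqF.
apply: (der_eq (derM (dJr rd) (derV Hn (dHr rd)))).
by field; rewrite gt_eqF.
Qed.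

(** In the quotient rule the terms [2 * J ^+ 2] coming from [eqJ] and from [eqH] cancel, and only
    errors remain. *)
Let dN_ge r : 0 < r < delta -> 0 < H r ->
  - (2 * C) * (`|N r| + 1) <= (dJ r * H r - J r * dH r) / H r ^+ 2.
Proof.
move=> rd Hr; have r0 : 0 < r by case/andP: rd.
rewrite -(ler_pM2l r0) [leRHS]mulrA ler_pdivlMr ?exprn_gt0 //.
have E1 := eqH rd; have E2 := eqJ rd Hr.
have NJ : `|N r| * H r = `|J r| by rewrite /N normrM normfV (gtr0_norm Hr) divfK // gt_eqF.
have -> : r * (- (2 * C) * (`|N r| + 1)) * H r ^+ 2 = - (2 * C * r * (`|J r| + H r) * H r).
  by rewrite -NJ; ring.
have : J r * (r * dH r - 2 * J r) <= C * r * (`|J r| + H r) * H r.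
  apply: le_trans (ler_norm _) _; rewrite normrM.
  apply: le_trans (ler_wpM2l (normr_ge0 _) E1) _.
  have -> : `|J r| * (C * r * H r) = C * r * `|J r| * H r by ring.
  rewrite ler_pM2r // ler_wpM2l ?lerDl ?(ltW Hr) // mulr_ge0 // ltW //.
have -> : r * (dJ r * H r - J r * dH r) = r * dJ r * H r - J r * (r * dH r) by ring.
lra.
Qed.

Let dy r : 0 < r < delta -> 0 < H r -> exists2 a, is_derive r 1 y a & 0 <= a.
Proof.
move=> rd Hr.
have d1 : is_derive r 1 (g \o N) (g (N r) / Num.sqrt (N r ^+ 2 + 1) * ((dJ r * H r - J r * dH r) / H r ^+ 2)).
  by apply: is_derive1_comp; [exact: is_derive_g|exact: dN].
have d2 : is_derive r 1 (fun r => expR (4 * C * r)) (expR (4 * C * r) * (4 * C)).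
  apply: (der_eq (@is_derive1_comp R expR (fun r => 4 * C * r) r _ _ (is_derive_expR _) (derM (derC (4 * C) r 1) (is_derive_id r 1)))).
  by rewrite mulr0 addr0 mulr1.
eexists; first exact: (derM d1 d2).
rewrite /=; set s := Num.sqrt _; have s0 : 0 < s.
  by rewrite sqrtr_gt0 ltr_pwDr // sqr_ge0.
have -> : g (N r) * (expR (4 * C * r) * (4 * C)) + expR (4 * C * r) *
  (g (N r) / s * ((dJ r * H r - J r * dH r) / H r ^+ 2)) =
  expR (4 * C * r) * g (N r) / s *
   (4 * C * s + (dJ r * H r - J r * dH r) / H r ^+ 2) by field; rewrite !gt_eqF.
apply: mulr_ge0; first by rewrite divr_ge0 ?mulr_ge0 ?expR_ge0 ?ltW.
have := dN_ge rd Hr; have Ns : `|N r| + 1 <= 2 * s.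
  rewrite mulr_natl mulr2n lerD //.
    by rewrite -sqrtr_sqr ler_sqrt ?lerDl // ltW // ltr_pwDr // sqr_ge0.
  by rewrite -[leLHS]sqrtr1 ler_sqrt ?lerDr ?sqr_ge0 // ltW // ltr_pwDr // sqr_ge0.
move: Ns; set X := _ / H r ^+ 2; set m := `|N r| + 1 => Ns.
have : 2 * C * m <= 2 * C * (2 * s) by apply: ler_wpM2l => //; rewrite mulr_ge0.
lra.
Qed.

(** Monotonicity of [y] bounds [N] from above to the left of [r0]. Hence [x * dH x] is at most a
    constant times [H x], and the quotient of [H] by a power of the radius decreases. *)
Let lower (r0 : R) : 0 < r0 < delta -> 0 < H r0 ->
  exists2 c : R, 0 < c & exists m : nat, forall r, 0 < r -> r <= r0 ->
    (forall x, r <= x <= r0 -> 0 < H x) -> c * r ^+ m <= H r.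
Proof.
move=> /andP[r00 r0d] Hr0.
(* [m.+1] exceeds the bound on [x * dH x / H x]: twice the bound [y r0] on [N], plus the error of
   [eqH]. *)
pose m := Num.trunc (2 * y r0 + C * delta).
have mP : 2 * y r0 + C * delta <= m.+1%:R by exact/ltW/truncnS_gt.
exists (H r0 / r0 ^+ m.+1); first by rewrite divr_gt0 // exprn_gt0.
exists m.+1 => r rp rr0 Hp.
have dom x : r <= x <= r0 -> 0 < x < delta.
  by move=> /andP[rx xr]; rewrite (lt_le_trans rp rx) (le_lt_trans xr r0d).
have yle x : r <= x <= r0 -> y x <= y r0.
  move=> /andP[rx xr0]; apply: increasing_cc => // z /andP[xz zr0].
  have rz : r <= z <= r0 by rewrite (le_trans rx xz).
  by have [a da a0] := dy (dom _ rz) (Hp _ rz); exists a.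
have Nle x : r <= x <= r0 -> N x <= y r0.
  move=> xr; apply: le_trans (yle _ xr); rewrite /y.
  apply: (@le_trans _ _ (g (N x))); first by rewrite /g lerDl sqrtr_ge0.
  have [x0 _] := andP (dom _ xr).
  by rewrite ler_peMr ?(ltW (g_gt0 _))// -expR0 ler_expR !mulr_ge0 // ltW.
rewrite -ler_pdivlMr ?exprn_gt0 //.
suff : - (H r * (r ^+ m.+1)^-1) <= - (H r0 * (r0 ^+ m.+1)^-1) by rewrite lerN2.
apply: (@increasing_cc (fun x => - (H x * (x ^+ m.+1)^-1))) => // x xr.
have xd := dom _ xr; have x0 : 0 < x by case/andP: xd.
have xn : x != 0 by rewrite gt_eqF.
have Hx := Hp _ xr.
eexists.
  apply: derN; apply: derM; first exact: dHr.
  apply: derV; first by rewrite expf_neq0.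
  exact: (derX m (is_derive_id x 1)).
have -> : - (H x * (- (m.+1%:R * x ^+ m * 1) / (x ^+ m.+1) ^+ 2) +
   (x ^+ m.+1)^-1 * dH x) = (m.+1%:R * H x - x * dH x) / (x ^+ m.+2).
  by rewrite !exprS; field; rewrite xn expf_neq0.
apply: divr_ge0; last by rewrite exprn_ge0 // ltW.
rewrite subr_ge0.
have E1 := le_trans (ler_norm _) (eqH xd).
have JN : J x = N x * H x by rewrite /N divfK // gt_eqF.
have NH : N x * H x <= y r0 * H x by rewrite ler_pM2r // Nle.
have MH : (2 * y r0 + C * delta) * H x <= m.+1%:R * H x by rewrite ler_pM2r.
have CH : C * x * H x <= C * delta * H x.
  rewrite ler_pM2r // ler_wpM2l // ltW //; by case/andP: xd.
move: E1; rewrite JN; lra.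
Qed.

Lemma frequency_ode : 
  (forall k, exists2 B : R, 0 <= B & forall r, 0 < r < delta -> H r <= B * r ^+ k) ->
  forall r, 0 < r < delta -> H r = 0.
Proof.
move=> flat r0 r0d; apply/eqP; apply: contraT => Hn.
have Hr0 : 0 < H r0 by rewrite lt_neqAle eq_sym Hn H0.
have [c c0 [m low]] := lower r0d Hr0.
have r00 : 0 < r0 by case/andP: r0d.
have dom x : 0 < x -> x <= r0 -> 0 < x < delta.
  by move=> x0 xr; rewrite x0 (le_lt_trans xr) //; case/andP: r0d.
(* At the last zero [s] before [r0], [H] is continuous, yet [low] keeps it above [c * s ^+ m] just
   to the right of [s]. *)
have Hpos r : 0 < r -> r <= r0 -> 0 < H r.
  move=> rp rr0; apply/negP => /negP; rewrite -leNgt => Hr.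
  pose Z := [set x | 0 < x <= r0 /\ H x = 0].
  have Zr : Z r.
    split; first by rewrite rp.
    by apply/le_anti; rewrite Hr H0 // dom.
  have Zsup : has_sup Z by split; [exists r|exists r0 => x [/andP[]]].
  set s := sup Z.
  have rs : r <= s by exact: ub_le_sup Zsup.2 _ Zr.
  have sp : 0 < s by exact: lt_le_trans rs.
  have sr0 : s <= r0 by apply: ge_sup; [exists r|move=> x [/andP[]]].
  have ds : {for s, continuous H}.
    apply/differentiable_continuous/derivable1_diffP.
    by case: (dHr (dom _ sp sr0)).
  have Hs : H s = 0.
    apply/eqP; apply: contraT => Hsn.
    have Hsp : 0 < H s by rewrite lt_neqAle eq_sym Hsn H0 // dom.
    have [d d0 dH'] := (continuousP _ _).1 ds _ Hsp.
    have [x Zx sx] := sup_adherent d0 Zsup.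
    have xs : x <= s by exact: ub_le_sup Zsup.2 _ Zx.
    have := dH' x; rewrite Zx.2 sub0r normrN (gtr0_norm Hsp) ltxx => H1.
    suff // : false by []. apply: H1.
    rewrite ler0_norm ?subr_le0 // opprB; rewrite -/s in sx; lra.
  have ss : s < r0.
    by rewrite lt_neqAle sr0 andbT; apply/eqP => sE; move: Hr0; rewrite -sE Hs ltxx.
  have low' x : s < x -> x <= r0 -> c * s ^+ m <= H x.
    move=> sx xr0; apply: le_trans (low _ (lt_trans sp sx) xr0 _).
      by rewrite ler_pM2l // lerXn2r ?nnegrE ?(ltW sp) ?(ltW sx) // ltW // (lt_trans sp).
    move=> z /andP[xz zr0]; rewrite lt_neqAle H0 ?andbT; last first.
      by rewrite dom // (lt_le_trans _ xz) // (lt_trans sp).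
    apply/eqP => Hz; have := ub_le_sup Zsup.2 (x := z).
    rewrite leNgt (lt_le_trans sx xz) => H1.
    suff // : false by []. apply: H1; split=> //.
    by rewrite zr0 (lt_le_trans _ xz) // (lt_trans sp).
  have cs : 0 < c * s ^+ m by rewrite mulr_gt0 // exprn_gt0.
  have [d d0 dH'] := (continuousP _ _).1 ds _ cs.
  pose x := Num.min r0 (s + d / 2).
  have sx : s < x by rewrite lt_min ss ltrDl divr_gt0.
  have xr0 : x <= r0 by rewrite ge_min lexx.
  have xd : `|x - s| < d.
    rewrite gtr0_norm ?subr_gt0 //.
    have : x <= s + d / 2 by rewrite ge_min lexx orbT.
    lra.
  have := dH' _ xd; rewrite Hs subr0 ltNge => /negP; apply.
  exact: le_trans (low' _ sx xr0) (ler_norm _).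
(* One order more than in the lower bound makes the two bounds incompatible for small radii. *)
have [B B0 flatB] := flat m.+1.
have key r : 0 < r -> r <= r0 -> c <= B * r.
  move=> rp rr0; have := flatB _ (dom _ rp rr0).
  have low1 := low _ rp rr0 (fun x h => Hpos _ (lt_le_trans rp (andP h).1) (andP h).2).
  move=> /(le_trans low1); rewrite exprS mulrA ler_pM2r // exprn_gt0 //.
pose r := Num.min r0 (c / (2 * (B + 1))).
have B1 : 0 < 2 * (B + 1) by rewrite mulr_gt0 // ltr_pwDr.
have rp : 0 < r by rewrite lt_min r00 divr_gt0.
have rr0 : r <= r0 by rewrite ge_min lexx.
have := key _ rp rr0; rewrite leNgt => /negP[].
have rc : r * (2 * (B + 1)) <= c by rewrite -ler_pdivlMr // ge_min lexx orbT.
have : 0 <= B * r by rewrite mulr_ge0 // ltW.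
nra.
Qed.
End FrequencyODE.

(** * Integration over the circle *)

Section CircleIntegral.
Variable R : realType.
Implicit Types (k l : R -> R).

Let mu := @lebesgue_measure R.
Definition circle_int k : R := \int[@lebesgue_measure R]_(t in `[0, 2 * pi]) k t.
Local Notation I := circle_int.
(** Continuity on the whole line spares one-sided conditions at the ends of [[0, 2 * pi]]. *)
Definition cont k := forall t : R, {for t, continuous k}.

Lemma cont_add k l : cont k -> cont l -> cont (fun t => k t + l t).
Proof. by move=> ck cl t; exact: (contD (ck t) (cl t)). Qed.

Lemma cont_opp k : cont k -> cont (fun t => - k t).
Proof. by move=> ck t; exact: (contN (ck t)). Qed.

Lemma cont_mul k l : cont k -> cont l -> cont (fun t => k t * l t).
Proof. by move=> ck cl t; exact: (contM (ck t) (cl t)). Qed.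

Lemma cont_const (a : R) : cont (fun _ => a).
Proof. by move=> t; exact: cont_cst. Qed.

Let pi2_gt0 : 0 < 2 * pi :> R. Proof. by rewrite mulr_gt0 // pi_gt0. Qed.

Let cint k : cont k -> mu.-integrable `[0, 2 * pi] (EFin \o k).
Proof.
move=> ck; apply: continuous_compact_integrable; first exact: segment_compact.
by apply: continuous_subspaceT => x; exact: ck.
Qed.

Lemma circle_intD k l : cont k -> cont l -> I (fun t => k t + l t) = I k + I l.
Proof. by move=> ck cl; rewrite /I RintegralD //; exact: cint. Qed.

Lemma circle_intZ (a : R) k : cont k -> I (fun t => a * k t) = a * I k.
Proof. by move=> ck; rewrite /I RintegralZl //; exact: cint. Qed.

Lemma circle_int_le k l : cont k -> cont l -> (forall t, k t <= l t) -> I k <= I l.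
Proof. by move=> ck cl kl; rewrite /I le_Rintegral //; exact: cint. Qed.

Lemma circle_int_ge0 k : (forall t, 0 <= k t) -> 0 <= I k.
Proof. by move=> k0; apply: Rintegral_ge0. Qed.

Lemma circle_int_cst (a : R) : I (fun _ => a) = a * (2 * pi).
Proof.
rewrite /I Rintegral_cst //= lebesgue_measure_itv /= lte_fin pi2_gt0.
by rewrite sube0.
Qed.

(** The form in which integration by parts on the circle is used below: the boundary terms cancel by
    periodicity. *)
Lemma circle_int_derive k l : cont l -> (forall t : R, is_derive t 1 k (l t)) ->
  k (2 * pi) = k 0 -> I l = 0.
Proof.
move=> cl dk per; rewrite /I /Rintegral (@continuous_FTC2 _ l k) //.
- by rewrite per /= subrr.
- by apply: continuous_subspaceT => x; exact: cl.
- have ck (t : R) : {for t, continuous k}.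
    by apply/differentiable_continuous/derivable1_diffP; case: (dk t).
  split; first by move=> x _; case: (dk x).
    exact: cvg_at_right_filter (ck 0).
  exact: cvg_at_left_filter (ck _).
- by move=> x _; rewrite derive1E; case: (dk x).
Qed.

(** A positive value persists, up to a factor 2, on an interval around the point cut to
    [[0, 2 * pi]], and this interval alone makes the integral positive. *)
Lemma circle_int_eq0 k : cont k -> (forall t, 0 <= k t) -> I k = 0 ->
  forall t, 0 <= t <= 2 * pi -> k t = 0.
Proof.
move=> ck k0 Ik t0 t0I; apply/eqP; apply: contraT => kn.
have kp : 0 < k t0 by rewrite lt_neqAle eq_sym kn k0.
have kp2 : 0 < k t0 / 2 by rewrite divr_gt0.
have [d d0 kd] := (continuousP _ _).1 (ck t0) _ kp2.
pose a := Num.max 0 (t0 - d / 2); pose b := Num.min (2 * pi) (t0 + d / 2).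
have d2 : 0 < d / 2 by rewrite divr_gt0.
have [t00 t02] := andP t0I.
have ab : a < b.
  rewrite gt_max !lt_min pi2_gt0 /=; apply/andP; split.
    by rewrite (le_lt_trans t00) // ltrDl.
  by rewrite (lt_le_trans _ t02) /= ?ltrBlDr -?addrA ?ltrDl ?addr_gt0.
have sub : (`[a, b]%classic : set R) `<=` `[0, 2 * pi]%classic.
  move=> x /=; rewrite !in_itv/= ge_max le_min => /andP[/andP[-> _] /andP[-> _]] //.
have kge x : x \in `[a, b] -> k t0 / 2 <= k x.
  rewrite in_itv/= ge_max le_min => /andP[/andP[_ x1] /andP[_ x2]].
  have xd : `|x - t0| < d by rewrite ltr_norml; apply/andP; split; lra.
  by have := kd _ xd; rewrite ltr_norml => /andP[+ _]; lra.
have intab : mu.-integrable `[a, b] (EFin \o k) by apply: integrableS (cint ck).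
have intc : mu.-integrable `[a, b] (EFin \o (fun _ : R => k t0 / 2)).
  apply: continuous_compact_integrable; first exact: segment_compact.
  by apply: continuous_subspaceT => x; exact: cst_continuous.
have : (k t0 / 2) * (b - a) <= I k.
  apply: (@le_trans _ _ (\int[mu]_(t in `[a, b]) k t)).
    have -> : k t0 / 2 * (b - a) = \int[mu]_(t in `[a, b]) (k t0 / 2).
      by rewrite Rintegral_cst //= lebesgue_measure_itv /= lte_fin ab.
    by apply: (le_Rintegral _ intc intab) => // x; exact: kge.
  have fin1 := integrable_fin_num _ intab; have fin2 := integrable_fin_num _ (cint ck).
  rewrite /I /Rintegral fine_le ?fin1 ?fin2 //.
  apply: ge0_subset_integral => //.
    by apply: (measurable_int mu); exact: cint.
  by move=> x _; rewrite lee_fin.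
rewrite Ik leNgt => /negP[].
by rewrite mulr_gt0 // subr_gt0.
Qed.

Lemma circle_int_is_derive (K dK : R -> R -> R) (u v M : R) :
  (forall r, u < r < v -> cont (K r)) ->
  (forall r t, u < r < v -> is_derive r 1 (K ^~ t) (dK r t)) ->
  (forall r t, u < r < v -> `|dK r t| <= M) ->
  forall r, u < r < v -> is_derive r 1 (fun r => I (K r)) (I (dK r)).
Proof.
move=> cK dKr dKM r ruv.
have E x t : u < x < v -> partial1of2 K x t = dK x t.
  by move=> xuv; rewrite partial1of2E; case: (dKr x t xuv).
have rI : `]u, v[%classic r by rewrite /= in_itv.
have intK x : `]u, v[%classic x -> mu.-integrable `[0, 2 * pi] (EFin \o K x).
  by rewrite /= in_itv/= => /cK; exact: cint.
have derK x t : `]u, v[%classic x -> `[0, 2 * pi]%classic t -> derivable (K ^~ t) x 1.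
  by rewrite /= in_itv/= => xuv _; case: (dKr x t xuv).
have M0 : 0 <= M by apply: le_trans (dKM r 0 ruv).
have intM : mu.-integrable `[0, 2 * pi] (EFin \o (fun _ : R => M)).
  by apply: cint => t; exact: cst_continuous.
have ub x t : `]u, v[%classic x -> `[0, 2 * pi]%classic t -> `|partial1of2 K x t| <= M.
  by rewrite /= in_itv/= => xuv _; rewrite E // dKM.
apply: DeriveDef.
  have := @derivable_under_integral R _ _ mu K `[0, 2 * pi] (measurable_itv _) r u v rI intK derK _ (fun _ => M0) intM ub.
  exact.
have := @differentiation_under_integral R _ _ mu K `[0, 2 * pi] (measurable_itv _) r u v rI intK derK _ (fun _ => M0) intM ub.
rewrite derive1E => ->.
by apply: eq_Rintegral => t _; rewrite E.
Qed.

End CircleIntegral.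

(** * Frequency inequalities on a circle *)

Section FrequencyPointwise.
Variable R : realFieldType.
Variables (C r N k1 k1r k1t k2 w1 w2 wr1 wr2 wt1 wt2 : R).
Hypotheses (C1 : 1 <= C) (r0 : 0 < r) (r1 : r <= 1).
Hypotheses (k1_ge : 1 <= 2 * k1) (k1_le : k1 <= C) (k2_le : `|k2| <= C).
Hypotheses (k1r_le : `|k1r| <= C) (k1t_le : `|k1t| <= C * r).
(** With [w = w1 + i w2] the system reads [r w_r = (k2 - i k1) w_t + e]; for holomorphic [w] it
    holds with [k1 = 1], [k2 = 0] and [e = 0]. *)
Let e1 : R := r * wr1 - (k2 * wt1 + k1 * wt2).
Let e2 : R := r * wr2 - (k2 * wt2 - k1 * wt1).
Hypotheses (e1_le : `|e1| <= C * r * (`|w1| + `|w2|)).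
Hypotheses (e2_le : `|e2| <= C * r * (`|w1| + `|w2|)).

Let W : R := `|w1| + `|w2|.
Let T : R := `|wt1| + `|wt2|.
(** [U1 + i U2] is [- i k1 w_t - N w]; in the holomorphic case it vanishes when [w] is homogeneous
    of degree [N]. *)
Let U1 : R := k1 * wt2 - N * w1.
Let U2 : R := - (k1 * wt1) - N * w2.

Let cross_le (x1 x2 y1 y2 : R) :
  `|x2 * y1 - x1 * y2| <= (`|x1| + `|x2|) * (`|y1| + `|y2|).
Proof.
apply: le_trans (ler_normB _ _) _; rewrite !normrM mulrDl !mulrDr.
have := mulr_ge0 (normr_ge0 x1) (normr_ge0 y1).
have := mulr_ge0 (normr_ge0 x2) (normr_ge0 y2).
lra.
Qed.

Let W0 : 0 <= W. Proof. by rewrite addr_ge0. Qed.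
Let T0 : 0 <= T. Proof. by rewrite addr_ge0. Qed.

Let sqr_sum_le (x y : R) : (`|x| + `|y|) ^+ 2 <= 2 * (x ^+ 2 + y ^+ 2).
Proof.
rewrite -(real_normK (num_real x)) -(real_normK (num_real y)).
by have := sqr_ge0 (`|x| - `|y|); lra.
Qed.

(** Here [N] is a free parameter; once it is set to [J / H], the main term integrates to
    [2 * J ^+ 2 / H]. Completing the square with [N] takes the place of the Cauchy-Schwarz
    inequality and keeps the defect [U1 ^+ 2 + U2 ^+ 2], which absorbs the errors that contain
    tangential derivatives. *)
Lemma frequency_pointwise :
  2 * (2 * N * (k1 * (wt2 * w1 - wt1 * w2)) - N ^+ 2 * (w1 ^+ 2 + w2 ^+ 2))
    - 48 * C ^+ 4 * r * (`|N| + 1) * (w1 ^+ 2 + w2 ^+ 2) <=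
  r * (k1r * (wt2 * w1 - wt1 * w2) - k1t * (wr2 * w1 - wr1 * w2)
       + 2 * (k1 * (wt2 * wr1 - wt1 * wr2))).
Proof.
have k10 : 0 <= k1 by rewrite -(pmulr_rge0 _ (ltr0n _ 2)) (le_trans ler01).
have C0 : 0 <= C by rewrite (le_trans ler01).
have CC : C <= C * C by rewrite ler_peMl.
have errA : `|r * (k1r * (wt2 * w1 - wt1 * w2))| <= r * (C * (T * W)).
  rewrite normrM (gtr0_norm r0) ler_pM2l // normrM ler_pM // cross_le.
have Rw1 : `|r * wr1| <= C * (T + W).
  have -> : r * wr1 = k2 * wt1 + k1 * wt2 + e1 by rewrite /e1; ring.
  apply: le_trans (ler_normD _ _) _; rewrite mulrDr; apply: lerD.
    apply: le_trans (ler_normD _ _) _; rewrite !normrM mulrDr.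
    by apply: lerD; rewrite ler_wpM2r // (ger0_norm k10).
  by apply: le_trans e1_le _; rewrite ler_wpM2r // ler_piMr.
have Rw2 : `|r * wr2| <= C * (T + W).
  have -> : r * wr2 = k2 * wt2 - k1 * wt1 + e2 by rewrite /e2; ring.
  apply: le_trans (ler_normD _ _) _; rewrite mulrDr; apply: lerD.
    apply: le_trans (ler_normB _ _) _; rewrite !normrM mulrDr addrC.
    by apply: lerD; rewrite ler_wpM2r // (ger0_norm k10).
  by apply: le_trans e2_le _; rewrite ler_wpM2r // ler_piMr.
have errB : `|k1t * ((r * wr2) * w1 - (r * wr1) * w2)| <= C * r * (C * (T + W) * W).
  rewrite normrM ler_pM //; apply: le_trans (ler_normB _ _) _.
  by rewrite !(normrM _ w1) !(normrM _ w2) mulrDr; apply: lerD; rewrite ler_wpM2r.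
have errC : `|2 * (k1 * (wt2 * e1 - wt1 * e2))| <= 2 * (C * (T * (C * r * W))).
  rewrite normrM (ger0_norm (_ : 0 <= 2)) // ler_pM2l // normrM ler_pM ?(ger0_norm k10) //.
  apply: le_trans (ler_normB _ _) _; rewrite !normrM mulrDl addrC.
  by apply: lerD; rewrite ler_wpM2l.
(* Tangential derivatives are controlled by the defect and by [N w], because [1 <= 2 * k1]. *)
have TV : T <= 2 * (`|U1| + `|U2| + `|N| * W).
  have V2 : `|k1 * wt2| <= `|U1| + `|N| * `|w1|.
    by rewrite -normrM (le_trans _ (ler_normD _ _)) // /U1 subrK.
  have V1 : `|k1 * wt1| <= `|U2| + `|N| * `|w2|.
    by rewrite -normrM -normrN (le_trans _ (ler_normD _ _)) // /U2 subrK.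
  rewrite !normrM !(ger0_norm k10) in V1 V2.
  have t1 : `|wt1| <= 2 * (k1 * `|wt1|) by rewrite mulrA ler_peMl.
  have t2 : `|wt2| <= 2 * (k1 * `|wt2|) by rewrite mulrA ler_peMl.
  rewrite /T /W mulrDr !mulrDr; lra.
have UU := sqr_sum_le U1 U2; have WW := sqr_sum_le w1 w2.
rewrite -/W in WW.
set US := `|U1| + `|U2| in UU TV.
have US0 : 0 <= US by rewrite addr_ge0.
have err : r * (C * (T * W)) + C * r * (C * (T + W) * W) + 2 * (C * (T * (C * r * W)))
    <= 4 * C ^+ 2 * r * (T * W + W ^+ 2).
  have TW0 : 0 <= T * W by rewrite mulr_ge0.
  have h1 : C * (r * (T * W)) <= C * C * (r * (T * W)).
    by rewrite ler_wpM2r // mulr_ge0 // ltW.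
  have h2 : 0 <= C * C * (r * (W * W)) by rewrite !mulr_ge0 // ltW.
  rewrite !expr2; lra.
have TW : T * W <= 2 * (US * W) + 2 * `|N| * W ^+ 2.
  have := ler_wpM2r W0 TV; rewrite expr2; lra.
(* The weight is chosen so that the defect pays for the first term: [US ^+ 2] is at most
   [2 * (U1 ^+ 2 + U2 ^+ 2)]. *)
have amgm : 8 * C ^+ 2 * r * (US * W) <= US ^+ 2 + 16 * C ^+ 4 * r * W ^+ 2.
  have s0 := sqr_ge0 (US - 4 * C ^+ 2 * r * W).
  have rr : 16 * C ^+ 4 * W ^+ 2 * (r * r) <= 16 * C ^+ 4 * W ^+ 2 * r.
    by rewrite ler_wpM2l ?mulr_ge0 ?exprn_ge0 // ler_piMl // ltW.
  have E : (US - 4 * C ^+ 2 * r * W) ^+ 2 = US ^+ 2 - 8 * C ^+ 2 * r * (US * W) + 16 * C ^+ 4 * W ^+ 2 * (r * r) by ring.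
  rewrite E in s0; lra.
have total : 4 * C ^+ 2 * r * (T * W + W ^+ 2) <=
   2 * (U1 ^+ 2 + U2 ^+ 2) + 48 * C ^+ 4 * r * (`|N| + 1) * (w1 ^+ 2 + w2 ^+ 2).
  have Cr0 : 0 <= 4 * C ^+ 2 * r by rewrite !mulr_ge0 ?exprn_ge0 // ltW.
  have h1 := ler_wpM2l Cr0 TW.
  have h2 : 16 * C ^+ 4 * r * W ^+ 2 + 4 * C ^+ 2 * r * ((2 * `|N| + 1) * W ^+ 2) <=
     24 * C ^+ 4 * r * (`|N| + 1) * W ^+ 2.
    have c24 : C ^+ 2 <= C ^+ 4 by rewrite ler_weXn2l.
    have x0 : 0 <= r * ((2 * `|N| + 1) * W ^+ 2).
      by rewrite !mulr_ge0 ?exprn_ge0 ?addr_ge0 ?mulr_ge0 // ltW.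
    have h := ler_wpM2r x0 c24.
    have y0 : 0 <= C ^+ 4 * (r * (`|N| * W ^+ 2)).
      by rewrite !mulr_ge0 ?exprn_ge0 // ltW.
    have z0 : 0 <= C ^+ 4 * (r * W ^+ 2) by rewrite !mulr_ge0 ?exprn_ge0 // ltW.
    lra.
  have h3 : 24 * C ^+ 4 * r * (`|N| + 1) * W ^+ 2 <= 24 * C ^+ 4 * r * (`|N| + 1) * (2 * (w1 ^+ 2 + w2 ^+ 2)).
    by rewrite ler_wpM2l // !mulr_ge0 ?exprn_ge0 ?addr_ge0 // ltW.
  lra.
have main : 2 * (k1 * k1 * (wt1 ^+ 2 + wt2 ^+ 2)) =
  2 * (2 * N * (k1 * (wt2 * w1 - wt1 * w2)) - N ^+ 2 * (w1 ^+ 2 + w2 ^+ 2)) + 2 * (U1 ^+ 2 + U2 ^+ 2).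
  by rewrite /U1 /U2; ring.
(* Inserting the system for [r w_r] into the last term produces the main term; the contributions of
   [k2] cancel. *)
have split_eq : r * (k1r * (wt2 * w1 - wt1 * w2) - k1t * (wr2 * w1 - wr1 * w2)
       + 2 * (k1 * (wt2 * wr1 - wt1 * wr2))) =
  r * (k1r * (wt2 * w1 - wt1 * w2)) - k1t * ((r * wr2) * w1 - (r * wr1) * w2)
  + 2 * (k1 * (wt2 * e1 - wt1 * e2)) + 2 * (k1 * k1 * (wt1 ^+ 2 + wt2 ^+ 2)).
  by rewrite /e1 /e2; ring.
rewrite split_eq main.
move: errA errB errC; rewrite !ler_norml => /andP[a1 _] /andP[_ a2] /andP[a3 _].
lra.
Qed.

End FrequencyPointwise.

Section CircleVanish.
Variable R : realType.
Variables (delta C : R).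
Variables (w1 w2 wr1 wr2 wt1 wt2 wrt1 wrt2 k1 k1r k1t k2 k2t : R -> R -> R).
Let dom (r : R) := 0 < r < delta.
Local Notation I := (@circle_int R).
Implicit Types r t : R.

Hypotheses (d1 : delta <= 1) (C1 : 1 <= C).
Hypothesis w1_r : forall r t, dom r -> is_derive r 1 (w1 ^~ t) (wr1 r t).
Hypothesis w2_r : forall r t, dom r -> is_derive r 1 (w2 ^~ t) (wr2 r t).
Hypothesis w1_t : forall r t, dom r -> is_derive t 1 (w1 r) (wt1 r t).
Hypothesis w2_t : forall r t, dom r -> is_derive t 1 (w2 r) (wt2 r t).
Hypothesis wr1_t : forall r t, dom r -> is_derive t 1 (wr1 r) (wrt1 r t).
Hypothesis wr2_t : forall r t, dom r -> is_derive t 1 (wr2 r) (wrt2 r t).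
Hypothesis wt1_r : forall r t, dom r -> is_derive r 1 (wt1 ^~ t) (wrt1 r t).
Hypothesis wt2_r : forall r t, dom r -> is_derive r 1 (wt2 ^~ t) (wrt2 r t).
Hypothesis k1_r : forall r t, dom r -> is_derive r 1 (k1 ^~ t) (k1r r t).
Hypothesis k1_t : forall r t, dom r -> is_derive t 1 (k1 r) (k1t r t).
Hypothesis k2_t : forall r t, dom r -> is_derive t 1 (k2 r) (k2t r t).
Hypothesis wt1_c : forall r, dom r -> cont (wt1 r).
Hypothesis wt2_c : forall r, dom r -> cont (wt2 r).
Hypothesis wrt1_c : forall r, dom r -> cont (wrt1 r).
Hypothesis wrt2_c : forall r, dom r -> cont (wrt2 r).
Hypothesis k1r_c : forall r, dom r -> cont (k1r r).
Hypothesis k1t_c : forall r, dom r -> cont (k1t r).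
Hypothesis k2t_c : forall r, dom r -> cont (k2t r).
Hypothesis w1_p : forall r, dom r -> w1 r (2 * pi) = w1 r 0.
Hypothesis w2_p : forall r, dom r -> w2 r (2 * pi) = w2 r 0.
Hypothesis wr1_p : forall r, dom r -> wr1 r (2 * pi) = wr1 r 0.
Hypothesis wr2_p : forall r, dom r -> wr2 r (2 * pi) = wr2 r 0.
Hypothesis k1_p : forall r, dom r -> k1 r (2 * pi) = k1 r 0.
Hypothesis k2_p : forall r, dom r -> k2 r (2 * pi) = k2 r 0.
Hypothesis w1_b : forall r t, dom r -> `|w1 r t| <= C.
Hypothesis w2_b : forall r t, dom r -> `|w2 r t| <= C.
Hypothesis wr1_b : forall r t, dom r -> `|wr1 r t| <= C.
Hypothesis wr2_b : forall r t, dom r -> `|wr2 r t| <= C.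
Hypothesis wt1_b : forall r t, dom r -> `|wt1 r t| <= C.
Hypothesis wt2_b : forall r t, dom r -> `|wt2 r t| <= C.
Hypothesis wrt1_b : forall r t, dom r -> `|wrt1 r t| <= C.
Hypothesis wrt2_b : forall r t, dom r -> `|wrt2 r t| <= C.
Hypothesis k1_ge : forall r t, dom r -> 1 <= 2 * k1 r t.
Hypothesis k1_le : forall r t, dom r -> k1 r t <= C.
Hypothesis k1r_le : forall r t, dom r -> `|k1r r t| <= C.
Hypothesis k1t_le : forall r t, dom r -> `|k1t r t| <= C * r.
Hypothesis k2_le : forall r t, dom r -> `|k2 r t| <= C.
Hypothesis k2t_le : forall r t, dom r -> `|k2t r t| <= C * r.
Let e1 r t := r * wr1 r t - (k2 r t * wt1 r t + k1 r t * wt2 r t).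
Let e2 r t := r * wr2 r t - (k2 r t * wt2 r t - k1 r t * wt1 r t).
Hypothesis e1_le : forall r t, dom r -> `|e1 r t| <= C * r * (`|w1 r t| + `|w2 r t|).
Hypothesis e2_le : forall r t, dom r -> `|e2 r t| <= C * r * (`|w1 r t| + `|w2 r t|).
Hypothesis flat : forall k, exists2 B : R, 0 <= B &
  forall r t, dom r -> `|w1 r t| <= B * r ^+ k /\ `|w2 r t| <= B * r ^+ k.

Let h r t := w1 r t * w1 r t + w2 r t * w2 r t.
Let hr r t := 2 * (w1 r t * wr1 r t + w2 r t * wr2 r t).
Let j r t := k1 r t * (wt2 r t * w1 r t - wt1 r t * w2 r t).
Let jr r t := k1r r t * (wt2 r t * w1 r t - wt1 r t * w2 r t) +
  k1 r t * (wrt2 r t * w1 r t + wt2 r t * wr1 r t - (wrt1 r t * w2 r t + wt1 r t * wr2 r t)).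
Let jr' r t := k1r r t * (wt2 r t * w1 r t - wt1 r t * w2 r t)
  - k1t r t * (wr2 r t * w1 r t - wr1 r t * w2 r t)
  + 2 * (k1 r t * (wt2 r t * wr1 r t - wt1 r t * wr2 r t)).

Let der_cont (F dF : R -> R) : (forall t, is_derive t 1 F (dF t)) -> cont F.
Proof.
by move=> dFt t; apply/differentiable_continuous/derivable1_diffP; case: (dFt t).
Qed.

Let w1_c r : dom r -> cont (w1 r). Proof. by move=> rd; apply: der_cont => t; exact: w1_t. Qed.
Let w2_c r : dom r -> cont (w2 r). Proof. by move=> rd; apply: der_cont => t; exact: w2_t. Qed.
Let wr1_c r : dom r -> cont (wr1 r). Proof. by move=> rd; apply: der_cont => t; exact: wr1_t. Qed.
Let wr2_c r : dom r -> cont (wr2 r). Proof. by move=> rd; apply: der_cont => t; exact: wr2_t. Qed.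
Let k1_c r : dom r -> cont (k1 r). Proof. by move=> rd; apply: der_cont => t; exact: k1_t. Qed.
Let k2_c r : dom r -> cont (k2 r). Proof. by move=> rd; apply: der_cont => t; exact: k2_t. Qed.

Ltac ct rd := repeat lazymatch goal with
  | |- cont (fun t => _ + _) => apply: cont_add
  | |- cont (fun t => _ * _) => apply: cont_mul
  | |- cont (fun t => - _) => apply: cont_opp
  | |- cont (w1 _) => exact (w1_c rd)
  | |- cont (fun t => w1 _ t) => exact (w1_c rd)
  | |- cont (w2 _) => exact (w2_c rd)
  | |- cont (fun t => w2 _ t) => exact (w2_c rd)
  | |- cont (wr1 _) => exact (wr1_c rd)
  | |- cont (fun t => wr1 _ t) => exact (wr1_c rd)
  | |- cont (wr2 _) => exact (wr2_c rd)
  | |- cont (fun t => wr2 _ t) => exact (wr2_c rd)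
  | |- cont (wt1 _) => exact (wt1_c rd)
  | |- cont (fun t => wt1 _ t) => exact (wt1_c rd)
  | |- cont (wt2 _) => exact (wt2_c rd)
  | |- cont (fun t => wt2 _ t) => exact (wt2_c rd)
  | |- cont (wrt1 _) => exact (wrt1_c rd)
  | |- cont (fun t => wrt1 _ t) => exact (wrt1_c rd)
  | |- cont (wrt2 _) => exact (wrt2_c rd)
  | |- cont (fun t => wrt2 _ t) => exact (wrt2_c rd)
  | |- cont (k1 _) => exact (k1_c rd)
  | |- cont (fun t => k1 _ t) => exact (k1_c rd)
  | |- cont (k1r _) => exact (k1r_c rd)
  | |- cont (fun t => k1r _ t) => exact (k1r_c rd)
  | |- cont (k1t _) => exact (k1t_c rd)
  | |- cont (fun t => k1t _ t) => exact (k1t_c rd)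
  | |- cont (k2 _) => exact (k2_c rd)
  | |- cont (fun t => k2 _ t) => exact (k2_c rd)
  | |- cont (k2t _) => exact (k2t_c rd)
  | |- cont (fun t => k2t _ t) => exact (k2t_c rd)
  | |- cont (fun t => _) => exact: cont_const
  end.

Let h_c r : dom r -> cont (h r). Proof. by move=> rd; rewrite /h; ct rd. Qed.
Let hr_c r : dom r -> cont (hr r). Proof. by move=> rd; rewrite /hr; ct rd. Qed.
Let j_c r : dom r -> cont (j r). Proof. by move=> rd; rewrite /j; ct rd. Qed.
Let jr_c r : dom r -> cont (jr r). Proof. by move=> rd; rewrite /jr; ct rd. Qed.
Let jr'_c r : dom r -> cont (jr' r). Proof. by move=> rd; rewrite /jr'; ct rd. Qed.

Let bM (x y a b : R) : `|x| <= a -> `|y| <= b -> `|x * y| <= a * b.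
Proof. by move=> xa yb; rewrite normrM ler_pM. Qed.
Let bD (x y a b : R) : `|x| <= a -> `|y| <= b -> `|x + y| <= a + b.
Proof. by move=> xa yb; apply: le_trans (ler_normD _ _) _; rewrite lerD. Qed.
Let bB (x y a b : R) : `|x| <= a -> `|y| <= b -> `|x - y| <= a + b.
Proof. by move=> xa yb; apply: le_trans (ler_normB _ _) _; rewrite lerD. Qed.

Let C0 : 0 <= C. Proof. exact: le_trans C1. Qed.
Let k10 r t : dom r -> 0 <= k1 r t.
Proof.
by move=> rd; rewrite -(pmulr_rge0 _ (ltr0n _ 2)) (le_trans ler01) // k1_ge.
Qed.
Let k1_b r t : dom r -> `|k1 r t| <= C.
Proof. by move=> rd; rewrite ger0_norm ?k10 // k1_le. Qed.

Let dH r : dom r -> is_derive r 1 (fun r => I (h r)) (I (hr r)).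
Proof.
apply: (circle_int_is_derive (M := 2 * (C * C + C * C))) => [x xd|x t xd|x t xd].
- exact: h_c.
- apply: (der_eq (derD (derM (w1_r t xd) (w1_r t xd)) (derM (w2_r t xd) (w2_r t xd)))).
  by rewrite /hr; ring.
- rewrite /hr; apply: bM; first by rewrite ger0_norm.
  by apply: bD; apply: bM; rewrite ?w1_b ?w2_b ?wr1_b ?wr2_b.
Qed.

(** The mixed derivatives are bounded by a constant only, not in terms of [w]. Subtracting the total
    [t]-derivative of [k1 * (wr2 * w1 - wr1 * w2)] trades them for first derivatives. *)
Let jr_eq r : dom r -> I (jr r) = I (jr' r).
Proof.
move=> rd; pose l t := k1t r t * (wr2 r t * w1 r t - wr1 r t * w2 r t)
  + k1 r t * ((wrt2 r t * w1 r t + wr2 r t * wt1 r t) - (wrt1 r t * w2 r t + wr1 r t * wt2 r t)).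
have lc : cont l by rewrite /l; ct rd.
have l0 : I l = 0.
  apply: (@circle_int_derive _ (fun t => k1 r t * (wr2 r t * w1 r t - wr1 r t * w2 r t))) => // [t|].
    apply: (der_eq (derM (k1_t t rd) (derB (derM (wr2_t t rd) (w1_t t rd)) (derM (wr1_t t rd) (w2_t t rd))))).
    by rewrite /l; ring.
  by rewrite k1_p // wr2_p // wr1_p // w1_p // w2_p.
have -> : jr r = fun t => jr' r t + l t.
  by apply/funext => t; rewrite /jr /jr' /l; ring.
by rewrite circle_intD ?l0 ?addr0 //; exact: jr'_c.
Qed.

Let dJ r : dom r -> is_derive r 1 (fun r => I (j r)) (I (jr' r)).
Proof.
move=> rd; rewrite -jr_eq //; move: r rd.
apply: (circle_int_is_derive (M := C * (C * C + C * C) + C * (C * C + C * C + (C * C + C * C)))) => [x xd|x t xd|x t xd].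
- exact: j_c.
- apply: (der_eq (derM (k1_r t xd) (derB (derM (wt2_r t xd) (w1_r t xd)) (derM (wt1_r t xd) (w2_r t xd))))).
  by rewrite /jr; ring.
- rewrite /jr; apply: bD; apply: bM; rewrite ?k1_b ?k1r_le //.
    by apply: bB; apply: bM; rewrite ?w1_b ?w2_b ?wt1_b ?wt2_b.
  by apply: bB; apply: bD; apply: bM; rewrite ?w1_b ?w2_b ?wt1_b ?wt2_b ?wr1_b ?wr2_b ?wrt1_b ?wrt2_b.
Qed.

Let h0 r t : 0 <= h r t.
Proof. by rewrite /h -!expr2 addr_ge0 ?sqr_ge0. Qed.

(** After insertion of the system, [r * hr] is [2 * j] plus the total derivative of [k2 * h] plus
    errors. Of the factor 5, the terms [e1] and [e2] account for 4 and [k2t] for 1. *)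
Let eqH r : dom r -> `|r * I (hr r) - 2 * I (j r)| <= 5 * C * r * I (h r).
Proof.
move=> rd; have r0 : 0 < r by case/andP: rd.
pose l t := k2t r t * h r t + k2 r t * (2 * (w1 r t * wt1 r t + w2 r t * wt2 r t)).
have lc : cont l by rewrite /l /h; ct rd.
have l0 : I l = 0.
  apply: (@circle_int_derive _ (fun t => k2 r t * h r t)) => // [t|].
    apply: (der_eq (derM (k2_t t rd) (derD (derM (w1_t t rd) (w1_t t rd)) (derM (w2_t t rd) (w2_t t rd))))).
    by rewrite /l /h; ring.
  by rewrite /h k2_p // w1_p // w2_p.
pose m t := 2 * (w1 r t * e1 r t + w2 r t * e2 r t) + -1 * (k2t r t * h r t).
have ec1 : cont (e1 r) by rewrite /e1; ct rd.
have ec2 : cont (e2 r) by rewrite /e2; ct rd.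
have mc : cont m.
  by rewrite /m /h /e1 /e2; ct rd.
have E : (fun t => r * hr r t) = fun t => 2 * j r t + (l t + m t).
  by apply/funext => t; rewrite /hr /l /m /e1 /e2 /j /h; ring.
have E2 : r * I (hr r) - 2 * I (j r) = I m.
  have c2j : cont (fun t => 2 * j r t) by rewrite /j; ct rd.
  have clm : cont (fun t => l t + m t).
    by apply: cont_add.
  rewrite -circle_intZ; last exact: hr_c.
  rewrite E circle_intD // circle_intD // l0 add0r circle_intZ; last exact: j_c.
  by rewrite addrAC subrr add0r.
have mb t : `|m t| <= 5 * C * r * h r t.
  have hW : (`|w1 r t| + `|w2 r t|) ^+ 2 <= 2 * h r t.
    rewrite /h -!expr2 -(real_normK (num_real (w1 r t))) -(real_normK (num_real (w2 r t))).
    by have := sqr_ge0 (`|w1 r t| - `|w2 r t|); lra.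
  have b1 : `|w1 r t * e1 r t + w2 r t * e2 r t| <= C * r * (`|w1 r t| + `|w2 r t|) ^+ 2.
    apply: le_trans (bD (bM (lexx _) (e1_le t rd)) (bM (lexx _) (e2_le t rd))) _.
    by rewrite -mulrDl mulrCA -expr2.
  have b2 : `|k2t r t * h r t| <= C * r * h r t.
    by apply: bM; [exact: k2t_le|rewrite ger0_norm].
  have Cr : 0 <= C * r by rewrite mulr_ge0 // ltW.
  have := ler_wpM2l Cr hW; move: b1 b2; rewrite /m !ler_norml.
  move=> /andP[b1 b2] /andP[b3 b4] b5; apply/andP; split; lra.
have mulc : cont (fun t => 5 * C * r * h r t) by rewrite /h; ct rd.
rewrite E2 -circle_intZ; last exact: h_c.
rewrite ler_norml -mulN1r -circle_intZ //; apply/andP; split.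
  apply: circle_int_le => // [t|t].
    by apply: (contM _ (mulc t)); exact: cont_cst.
  by have := mb t; rewrite ler_norml mulN1r => /andP[].
by apply: circle_int_le => // t; have := mb t; rewrite ler_norml => /andP[].
Qed.

(** The pointwise inequality is integrated with [N] equal to the quotient of the two integrals, then
    multiplied by [I (h r)]. *)
Let eqJ r : dom r -> 0 < I (h r) ->
  2 * I (j r) ^+ 2 - 48 * C ^+ 4 * r * (`|I (j r)| + I (h r)) * I (h r) <= r * I (jr' r) * I (h r).
Proof.
move=> rd Hr; set N := I (j r) / I (h r).
have r0 : 0 < r by case/andP: rd.
have r1 : r <= 1 by case/andP: rd => _ /ltW /le_trans; apply.
have NH : N * I (h r) = I (j r) by rewrite /N divfK // gt_eqF.
have NHa : `|N| * I (h r) = `|I (j r)| by rewrite -NH [RHS]normrM (gtr0_norm Hr).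
have c1 : cont (fun t => 4 * N * j r t) by rewrite /j; ct rd.
have c2 : cont (fun t => - (2 * N ^+ 2 + 48 * C ^+ 4 * r * (`|N| + 1)) * h r t) by rewrite /h; ct rd.
have c3 : cont (fun t => r * jr' r t) by rewrite /jr'; ct rd.
have : 4 * N * I (j r) + - (2 * N ^+ 2 + 48 * C ^+ 4 * r * (`|N| + 1)) * I (h r) <= r * I (jr' r).
  rewrite -(circle_intZ _ (j_c rd)) -(circle_intZ _ (h_c rd)) -(circle_intZ _ (jr'_c rd)).
  rewrite -circle_intD //; apply: circle_int_le => // [t|t].
    exact: (contD (c1 t) (c2 t)).
  have := frequency_pointwise N C1 r0 r1 (k1_ge t rd) (k1_le t rd) (k2_le t rd)
    (k1r_le t rd) (k1t_le t rd) (e1_le t rd) (e2_le t rd).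
  rewrite /jr' /h -!expr2 /j; lra.
rewrite -(ler_pM2r Hr); apply: le_trans.
have -> : (4 * N * I (j r) + - (2 * N ^+ 2 + 48 * C ^+ 4 * r * (`|N| + 1)) * I (h r)) * I (h r)
  = 4 * (N * I (h r)) * I (j r) - 2 * (N * I (h r)) ^+ 2 - 48 * C ^+ 4 * r * (`|N| * I (h r) + I (h r)) * I (h r).
  by ring.
rewrite NH NHa; lra.
Qed.

Lemma circle_vanish r t : dom r -> 0 <= t <= 2 * pi -> w1 r t = 0 /\ w2 r t = 0.
Proof.
move=> rd t02.
pose C' := 5 * C + 48 * C ^+ 4.
have C4 : 0 <= 48 * C ^+ 4 by rewrite mulr_ge0 // exprn_ge0.
have C'0 : 0 <= C' by rewrite addr_ge0 // mulr_ge0.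
have Hge x : 0 <= I (h x) by apply: circle_int_ge0.
have H0 : I (h r) = 0.
  apply: (@frequency_ode R (fun r => I (h r)) (fun r => I (j r)) (fun r => I (hr r))
    (fun r => I (jr' r)) delta C') => // [x xd|x xd Hx|k].
  - apply: (le_trans (eqH xd)); rewrite ler_wpM2r // ler_wpM2r //; last by rewrite lerDl.
    by case/andP: xd => /ltW.
  - apply: le_trans (eqJ xd Hx); rewrite lerD2l lerN2 ler_wpM2r // ler_wpM2r ?addr_ge0 //.
    rewrite ler_wpM2r //; last by rewrite lerDr mulr_ge0.
    by case/andP: xd => /ltW.
  have [B B0 Bf] := flat k; exists (2 * (B * B) * (2 * pi)).
    by rewrite !mulr_ge0 // pi_ge0.
  move=> x xd; have [x0 x1] := andP xd.
  (* [h] is quadratic in [w] and would decay twice as fast; order [k] suffices and keeps the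
     exponent of the hypothesis. *)
  have xk : x ^+ k * x ^+ k <= x ^+ k.
    rewrite ler_piMl ?exprn_ge0 ?(ltW x0) // exprn_ile1 ?(ltW x0) //.
    by apply: ltW; apply: (lt_le_trans x1).
  have hb s : h x s <= 2 * (B * B) * x ^+ k.
    have [b1 b2] := Bf x s xd.
    have sq (y : R) : `|y| <= B * x ^+ k -> y * y <= (B * B) * x ^+ k.
      move=> yb; apply: (le_trans (ler_norm _)).
      apply: (le_trans (bM yb yb)); rewrite mulrACA ler_wpM2l // mulr_ge0 //.
    rewrite /h -mulrA mulr_natl mulr2n lerD ?sq //.
  have cc : cont (fun _ : R => 2 * (B * B) * x ^+ k) by move=> s; exact: cont_cst.
  apply: (le_trans (circle_int_le (h_c xd) cc hb)).
  by rewrite circle_int_cst mulrAC.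
have /= ht := circle_int_eq0 (h_c rd) (h0 r) H0 t02.
move/eqP: ht; rewrite /h -!expr2 paddr_eq0 ?sqr_ge0 // !sqrf_eq0.
by move=> /andP[/eqP -> /eqP ->].
Qed.

End CircleVanish.

(** * Polar coordinates and bounds near their centre *)

Section Germs.
Variable R : realType.
Implicit Types (f g : R -> R -> R) (r t : R).

(** Germs at [r = 0], bounded uniformly in the angle, as the circle integrals require; [Or] is the
    corresponding [O(r)]. *)
Definition Bd f := exists C d : R, [/\ 0 <= C, 0 < d &
  forall r t, 0 < r < d -> `|f r t| <= C].
Definition Or f := exists C d : R, [/\ 0 <= C, 0 < d &
  forall r t, 0 < r < d -> `|f r t| <= C * r].

Let dmin (r d1 d2 : R) : 0 < r < Num.min d1 d2 -> 0 < r < d1 /\ 0 < r < d2.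
Proof. by rewrite lt_min => /and3P[-> -> ->]. Qed.

Lemma Bd_add f g : Bd f -> Bd g -> Bd (fun r t => f r t + g r t).
Proof.
move=> [C1 [d1 [C10 d10 H1]]] [C2 [d2 [C20 d20 H2]]].
exists (C1 + C2), (Num.min d1 d2); rewrite addr_ge0 // lt_min d10; split=> // r t.
move=> /dmin[r1 r2]; apply: le_trans (ler_normD _ _) _.
exact: lerD (H1 r t r1) (H2 r t r2).
Qed.

Lemma Bd_opp f : Bd f -> Bd (fun r t => - f r t).
Proof.
move=> [C1 [d1 [C10 d10 H1]]]; exists C1, d1; split=> // r t rd.
rewrite normrN; exact: H1.
Qed.

Lemma Bd_mul f g : Bd f -> Bd g -> Bd (fun r t => f r t * g r t).
Proof.
move=> [C1 [d1 [C10 d10 H1]]] [C2 [d2 [C20 d20 H2]]].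
exists (C1 * C2), (Num.min d1 d2); rewrite mulr_ge0 // lt_min d10; split=> // r t.
move=> /dmin[r1 r2]; rewrite normrM.
exact: ler_pM (normr_ge0 _) (normr_ge0 _) (H1 r t r1) (H2 r t r2).
Qed.

Lemma Bd_cst (a : R) : Bd (fun _ _ => a).
Proof. by exists `|a|, 1. Qed.

Lemma Bd_cos : Bd (fun _ t => cos t).
Proof. by exists 1, 1; split=> // r t _; rewrite ler_norml cos_le1 cos_geN1. Qed.

Lemma Bd_sin : Bd (fun _ t => sin t).
Proof. by exists 1, 1; split=> // r t _; rewrite ler_norml sin_le1 sin_geN1. Qed.

Lemma Or_id : Or (fun r _ => r).
Proof. by exists 1, 1; split=> // r t /andP[r0 _]; rewrite mul1r gtr0_norm. Qed.

Lemma Or_Bd f : Or f -> Bd f.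
Proof.
move=> [C [d [C0 d0 H]]]; exists C, (Num.min d 1); rewrite lt_min d0 ltr01; split=> // r t.
move=> /dmin[rd /andP[r0 r1]]; apply: le_trans (H r t rd) _.
by rewrite ler_piMr // ltW.
Qed.

Lemma Or_add f g : Or f -> Or g -> Or (fun r t => f r t + g r t).
Proof.
move=> [C1 [d1 [C10 d10 H1]]] [C2 [d2 [C20 d20 H2]]].
exists (C1 + C2), (Num.min d1 d2); rewrite addr_ge0 // lt_min d10; split=> // r t.
move=> /dmin[r1 r2]; apply: le_trans (ler_normD _ _) _; rewrite mulrDl.
exact: lerD (H1 r t r1) (H2 r t r2).
Qed.

Lemma Or_opp f : Or f -> Or (fun r t => - f r t).
Proof.
move=> [C1 [d1 [C10 d10 H1]]]; exists C1, d1; split=> // r t rd.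
rewrite normrN; exact: H1.
Qed.

Lemma Or_mull f g : Or f -> Bd g -> Or (fun r t => f r t * g r t).
Proof.
move=> [C1 [d1 [C10 d10 H1]]] [C2 [d2 [C20 d20 H2]]].
exists (C1 * C2), (Num.min d1 d2); rewrite mulr_ge0 // lt_min d10; split=> // r t.
move=> /dmin[r1 r2]; rewrite normrM mulrAC.
exact: ler_pM (normr_ge0 _) (normr_ge0 _) (H1 r t r1) (H2 r t r2).
Qed.

Lemma Or_mulr f g : Bd f -> Or g -> Or (fun r t => f r t * g r t).
Proof.
move=> Bf Og; have [C [d [C0 d0 H]]] := Or_mull Og Bf.
by exists C, d; split=> // r t rd; rewrite mulrC H.
Qed.

Lemma Or_ext f g (d : R) : 0 < d -> (forall r t, 0 < r < d -> f r t = g r t) -> Or f -> Or g.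
Proof.
move=> d0 fg [C1 [d1 [C10 d10 H1]]]; exists C1, (Num.min d1 d); rewrite lt_min d10.
by split=> // r t /dmin[r1 r2]; rewrite -fg // H1.
Qed.

Lemma Or_near f (a eps : R) : 0 < eps -> Or (fun r t => f r t - a) ->
  exists2 d : R, 0 < d & forall r t, 0 < r < d -> `|f r t - a| <= eps.
Proof.
move=> e0 [C [d [C0 d0 H]]].
have C1 : 0 < C + 1 by rewrite ltr_wpDl.
exists (Num.min d (eps / (C + 1))); first by rewrite lt_min d0 divr_gt0.
move=> r t /dmin[rd /andP[r0 re]]; apply: le_trans (H r t rd) _.
have := ltW re; rewrite ler_pdivlMr // mulrDr mulr1 mulrC.
by apply: le_trans; rewrite lerDl ltW.
Qed.

Lemma Bd_inv f (a : R) : 0 < a -> Or (fun r t => f r t - a) -> Bd (fun r t => (f r t)^-1).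
Proof.
move=> a0 Of; have a2 : 0 < a / 2 by rewrite divr_gt0.
have [d d0 H] := Or_near a2 Of; exists (a / 2)^-1, d; split=> //.
  by rewrite invr_ge0 ltW.
move=> r t /(H r t); rewrite ler_norml => /andP[h _].
have fa : a / 2 <= f r t by lra.
have f0 : 0 < f r t by exact: lt_le_trans fa.
by rewrite ger0_norm ?invr_ge0 ?(ltW f0) // lef_pV2.
Qed.

(* Finitely many germ bounds share their constants once each is stated as an
   eventual property for [C] large and [d] small. *)
Definition ex_bound (Q : R -> R -> Prop) := exists C0 d0 : R, 0 < d0 /\
  forall C d, C0 <= C -> 0 < d -> d <= d0 -> Q C d.

Lemma ex_bound_and P Q : ex_bound P -> ex_bound Q -> ex_bound (fun C d => P C d /\ Q C d).
Proof.
move=> [C1 [d1 [d10 H1]]] [C2 [d2 [d20 H2]]].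
exists (Num.max C1 C2), (Num.min d1 d2); rewrite lt_min d10; split=> // C d.
rewrite ge_max le_min => /andP[c1 c2] d0 /andP[l1 l2].
by split; [exact: H1|exact: H2].
Qed.

Lemma ex_bound_Bd f : Bd f -> ex_bound (fun C d => forall r t, 0 < r < d -> `|f r t| <= C).
Proof.
move=> [C1 [d1 [C10 d10 H1]]]; exists C1, d1; split=> // C d cC d0 dd r t /andP[r0 rd].
by apply: le_trans (H1 r t _) cC; rewrite r0 (lt_le_trans rd).
Qed.

Lemma ex_bound_Or f : Or f -> ex_bound (fun C d => forall r t, 0 < r < d -> `|f r t| <= C * r).
Proof.
move=> [C1 [d1 [C10 d10 H1]]]; exists C1, d1; split=> // C d cC d0 dd r t /andP[r0 rd].
apply: le_trans (H1 r t _) _; first by rewrite r0 (lt_le_trans rd).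
by rewrite ler_pM2r.
Qed.

End Germs.

Section Polar.
Variable R : realType.
Local Notation plane := 'rV[R]_2.
Variables (p : plane) (D : set plane) (delta : R).
Hypothesis oD : open D.
Hypothesis delta_gt0 : 0 < delta.
Hypothesis ballD : forall u, `|u - p| < delta -> D u.
Implicit Types (F : plane -> R) (r t : R).

Definition pull F r t : R := F (polar p r t).
Definition pull_r F r t : R :=
  cos t * pull (partial 0 F) r t + sin t * pull (partial 1 F) r t.
Definition pull_t F r t : R :=
  r * (cos t * pull (partial 1 F) r t - sin t * pull (partial 0 F) r t).
(** Serves as both mixed derivatives of [pull F]; they agree by [Schwarz]. *)
Definition pull_rt F r t : R :=
  cos t * pull (partial 1 F) r t - sin t * pull (partial 0 F) r t +
  r * (cos t * pull_r (partial 1 F) r t - sin t * pull_r (partial 0 F) r t).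

Lemma polarE0 r t : (polar p r t) 0 0 = p 0 0 + r * cos t.
Proof. by rewrite !mxE. Qed.

Lemma polarE1 r t : (polar p r t) 0 1 = p 0 1 + r * sin t.
Proof. by rewrite !mxE. Qed.

Lemma polar_dist r t : `|polar p r t - p| <= `|r|.
Proof.
have E0 : (polar p r t - p) 0 0 = r * cos t.
  by rewrite [LHS]mxE polarE0 [X in _ + X]mxE addrAC subrr add0r.
have E1 : (polar p r t - p) 0 1 = r * sin t.
  by rewrite [LHS]mxE polarE1 [X in _ + X]mxE addrAC subrr add0r.
rewrite plane_normE E0 E1.
rewrite ge_max !normrM; apply/andP; split; rewrite ler_piMr // ler_norml.
  by rewrite cos_le1 cos_geN1.
by rewrite sin_le1 sin_geN1.
Qed.

Lemma polar_D r t : 0 < r < delta -> D (polar p r t).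
Proof.
move=> /andP[r0 rd]; apply: ballD; apply: le_lt_trans (polar_dist r t) _.
by rewrite gtr0_norm.
Qed.

Lemma pull_is_derive_r F r t : smooth D F -> 0 < r < delta ->
  is_derive r 1 (pull F ^~ t) (pull_r F r t).
Proof.
move=> sF rd; have dF := smooth_is_diff oD sF (polar_D t rd).
apply: (der_eq (@chain2 R R F (fun r => polar p r t) r 1 _ _ (cos t) (sin t) dF _ _)) => //.
- under eq_fun do rewrite polarE0.
  apply: (der_eq (derD (derC _ _ _) (derM (is_derive_id r 1) (derC _ _ _)))).
  by rewrite add0r mulr0 add0r mulr1.
- under eq_fun do rewrite polarE1.
  apply: (der_eq (derD (derC _ _ _) (derM (is_derive_id r 1) (derC _ _ _)))).
  by rewrite add0r mulr0 add0r mulr1.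
Qed.

Lemma pull_is_derive_t F r t : smooth D F -> 0 < r < delta ->
  is_derive t 1 (pull F r) (pull_t F r t).
Proof.
move=> sF rd; have dF := smooth_is_diff oD sF (polar_D t rd).
apply: (der_eq (@chain2 R R F (polar p r) t 1 _ _ (r * - sin t) (r * cos t) dF _ _)).
- under eq_fun do rewrite polarE0.
  apply: (der_eq (derD (derC _ _ _) (derM (derC _ _ _) (is_derive_cos t)))).
  by rewrite mulr0 addr0 add0r.
- under eq_fun do rewrite polarE1.
  apply: (der_eq (derD (derC _ _ _) (derM (derC _ _ _) (is_derive_sin t)))).
  by rewrite mulr0 addr0 add0r.
- rewrite /pull_t /pull; move: (partial 1 F _) (partial 0 F _) (cos t) (sin t) => x0 x1 x2 x3; ring.
Qed.

Lemma pull_rt_r F r t : smooth D F -> 0 < r < delta ->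
  is_derive r 1 (pull_t F ^~ t) (pull_rt F r t).
Proof.
move=> sF rd.
have d0 := pull_is_derive_r t (smooth_partial 0 sF) rd.
have d1 := pull_is_derive_r t (smooth_partial 1 sF) rd.
apply: (der_eq (derM (is_derive_id r 1) (derB (derM (derC (cos t) r 1) d1) (derM (derC (sin t) r 1) d0)))).
rewrite /pull_rt.
move: (pull (partial 1 F) r t) (pull (partial 0 F) r t) (pull_r (partial 1 F) r t)
  (pull_r (partial 0 F) r t) (cos t) (sin t) => x0 x1 x2 x3 x4 x5; ring.
Qed.

Lemma pull_rt_t F r t : smooth D F -> 0 < r < delta ->
  is_derive t 1 (pull_r F r) (pull_rt F r t).
Proof.
move=> sF rd.
have d0 := pull_is_derive_t t (smooth_partial 0 sF) rd.
have d1 := pull_is_derive_t t (smooth_partial 1 sF) rd.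
apply: (der_eq (derD (derM (is_derive_cos t) d0) (derM (is_derive_sin t) d1))).
rewrite /pull_rt /pull_r /pull_t /pull.
rewrite -(Schwarz oD (sF 2%N) (polar_D t rd)).
move: (partial 1 F _) (partial 0 F _) (partial 1 (partial 1 F) _) (partial 0 (partial 0 F) _)
  (partial 0 (partial 1 F) _) (cos t) (sin t) => x0 x1 x2 x3 x4 x5 x6; ring.
Qed.

Lemma pull_cont F r : smooth D F -> 0 < r < delta -> cont (pull F r).
Proof.
move=> sF rd t; apply/differentiable_continuous/derivable1_diffP.
by case: (pull_is_derive_t t sF rd).
Qed.

Lemma pull_per F r : pull F r (2 * pi) = pull F r 0.
Proof.
congr F; apply/rowP => i; elim/forall2: i; rewrite ?polarE0 ?polarE1.
  by rewrite (mulr_natl pi 2) cos2pi cos0.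
by rewrite (mulr_natl pi 2) sin2pi sin0.
Qed.

Let Dp : D p. Proof. by apply: ballD; rewrite subrr normr0. Qed.

Let norm_le1 (x y : R) : `|x - y| <= 1 -> `|x| <= `|y| + 1.
Proof. by move=> xy; rewrite -lerBlDl (le_trans (lerB_dist _ _)). Qed.

Lemma Bd_pull F : smooth D F -> Bd (pull F).
Proof.
move=> sF; have [d d0 H] := (continuousP _ _).1 (smooth_cont sF Dp) 1 ltr01.
exists (`|F p| + 1), d; split=> [||r t /andP[r0 rd]]; [by rewrite addr_ge0|by []|].
have := H (polar p r t) (le_lt_trans (polar_dist r t) _).
rewrite gtr0_norm // => /(_ rd) /ltW Hd.
exact: norm_le1.
Qed.

(** The mean value theorem on the ray from [p] yields the factor [r], the partial derivatives being
    bounded near [p]. *)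
Lemma Or_pull F : smooth D F -> F p = 0 -> Or (pull F).
Proof.
move=> sF Fp.
have [C0 [d0 [C00 d00 H0]]] := Bd_pull (smooth_partial 0 sF).
have [C1 [d1 [C10 d10 H1]]] := Bd_pull (smooth_partial 1 sF).
have cC (i : 'I_2) := smooth_cont (smooth_partial i sF) Dp.
have [e0 e00 K0] := (continuousP _ _).1 (cC 0) 1 ltr01.
have [e1 e10 K1] := (continuousP _ _).1 (cC 1) 1 ltr01.
exists (`|partial 0 F p| + 1 + (`|partial 1 F p| + 1)), (Num.min delta (Num.min e0 e1)).
split; first by rewrite !addr_ge0.
  by rewrite !lt_min delta_gt0 e00.
move=> r t; rewrite !lt_min => /and4P[r0 rd re0 re1].
pose v : plane := \row_(i < 2) (if i == 0 then cos t else sin t).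
have pE (s : R) : polar p s t = p + s *: v.
  by congr (_ + _); apply/rowP => i; rewrite !mxE.
have near_p (s : R) : `|s| <= `|r| -> `|p + s *: v - p| <= r.
  by move=> sr; rewrite -pE (le_trans (polar_dist _ _)) // -(gtr0_norm r0).
have Ds (s : R) : `|s| <= `|r| -> D (p + s *: v).
  by move=> sr; apply: ballD; exact: le_lt_trans (near_p s sr) rd.
have der s : `|s| <= `|r| -> derivable F (p + s *: v) v.
  by move=> /Ds Dsv; apply: diff_derivable; case: (smooth_is_diff oD sF Dsv).
have [s sr] := line_MVT der.
rewrite Fp subr0 -pE => E; rewrite /pull E normrM (gtr0_norm r0) mulrC ler_pM2r //.
rewrite deriveE; last by case: (smooth_is_diff oD sF (Ds _ sr)).
have [_ ->] := smooth_is_diff oD sF (Ds _ sr).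
rewrite /lin2 !mxE /=; apply: le_trans (ler_normD _ _) _.
rewrite !normrM; apply: lerD.
  rewrite -[leRHS]mul1r ler_pM // ?ler_norml ?cos_le1 ?cos_geN1 //.
  have /ltW h := K0 _ (le_lt_trans (near_p s sr) re0).
  rewrite -ler_norml; exact: norm_le1 h.
rewrite -[leRHS]mul1r ler_pM // ?ler_norml ?sin_le1 ?sin_geN1 //.
have /ltW h := K1 _ (le_lt_trans (near_p s sr) re1).
rewrite -ler_norml; exact: norm_le1 h.
Qed.

End Polar.

(** The radius is Euclidean while the norm of the plane is the maximum norm, whence the factor 2.
    The angle is [acos (x / r)], or its reflection if [y] is negative. *)
Lemma polar_repr (R : realType) (p u : 'rV[R]_2) : exists r t : R,
  [/\ 0 <= r, r <= 2 * `|u - p|, 0 <= t <= 2 * pi & u = polar p r t].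
Proof.
pose x := u 0 0 - p 0 0; pose y := u 0 1 - p 0 1.
pose r := Num.sqrt (x ^+ 2 + y ^+ 2).
have s0 : 0 <= x ^+ 2 + y ^+ 2 by rewrite addr_ge0 ?sqr_ge0.
have r0 : 0 <= r by rewrite sqrtr_ge0.
have r2 : r ^+ 2 = x ^+ 2 + y ^+ 2 by rewrite sqr_sqrtr.
have pi0 : 0 <= pi :> R by exact: pi_ge0.
have xE : (u - p) 0 0 = x by rewrite [LHS]mxE [X in _ + X]mxE.
have yE : (u - p) 0 1 = y by rewrite [LHS]mxE [X in _ + X]mxE.
have rle : r <= 2 * `|u - p|.
  have m0 : 0 <= 2 * `|u - p| by rewrite mulr_ge0.
  rewrite -(@ler_pXn2r _ 2) ?nnegrE // r2.
  have hx : x ^+ 2 <= `|u - p| ^+ 2.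
    by rewrite -(real_normK (num_real x)) lerXn2r ?nnegrE // -xE norm_le2.
  have hy : y ^+ 2 <= `|u - p| ^+ 2.
    by rewrite -(real_normK (num_real y)) lerXn2r ?nnegrE // -yE norm_le2.
  have := sqr_ge0 `|u - p|; rewrite exprMn; lra.
suff [t t02 [xt yt]] : exists2 t : R, 0 <= t <= 2 * pi & x = r * cos t /\ y = r * sin t.
  exists r, t; split=> //; apply/rowP => i; elim/forall2: i.
    by rewrite polarE0 -xt /x addrC subrK.
  by rewrite polarE1 -yt /y addrC subrK.
have [r_eq0|rn] := eqVneq r 0.
  exists 0; first by rewrite lexx mulr_ge0.
  move: r2; rewrite r_eq0 expr0n /= => /esym/eqP; rewrite paddr_eq0 ?sqr_ge0 // !sqrf_eq0.
  by move=> /andP[/eqP -> /eqP ->]; rewrite !mul0r.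
have rp : 0 < r by rewrite lt_neqAle eq_sym rn.
have xr : -1 <= x / r <= 1.
  rewrite -ler_norml normrM normfV (gtr0_norm rp) ler_pdivrMr // mul1r.
  rewrite -(@ler_pXn2r _ 2) ?nnegrE // real_normK ?num_real // r2 lerDl sqr_ge0 //.
have ca := acosK (x := x / r); rewrite in_itv /= xr in ca.
have sa : sin (acos (x / r)) = `|y| / r.
  rewrite sin_acos // -[RHS]ger0_norm ?divr_ge0 // -sqrtr_sqr; congr Num.sqrt.
  by rewrite !exprMn exprVn real_normK ?num_real // -[1](@mulfV _ (r ^+ 2)) ?expf_neq0 // r2 -mulrBl addrC addKr.
have [y0|y0] := leP 0 y.
  exists (acos (x / r)); first by rewrite acos_ge0 //= (le_trans (acos_lepi _)) // mulr_natl mulr2n lerDl.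
  by rewrite ca // sa (ger0_norm y0) !(mulrC r) !divfK.
exists (2 * pi - acos (x / r)).
  rewrite subr_ge0 lerBlDr lerDl acos_ge0 // andbT (le_trans (acos_lepi _)) //.
  by rewrite mulr_natl mulr2n lerDl.
have c2 : cos (2 * pi - acos (x / r)) = x / r.
  by rewrite cosB mulr_natl cos2pi sin2pi mul1r mul0r addr0 ca.
have s2 : sin (2 * pi - acos (x / r)) = y / r.
  by rewrite sinB mulr_natl cos2pi sin2pi mul0r mul1r sub0r sa (ltr0_norm y0) mulNr opprK.
by rewrite c2 s2 !(mulrC r) !divfK.
Qed.

Ltac bd_leaf := match goal with
  | H : Bd ?f |- Bd ?g => constr_eq f g; exact H
  | H : Or ?f |- Bd ?g => constr_eq f g; exact (Or_Bd H)
  end.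

Ltac bd := repeat first [bd_leaf | lazymatch goal with
  | |- Bd (fun r t => _ + _) => apply: Bd_add
  | |- Bd (fun r t => _ * _) => apply: Bd_mul
  | |- Bd (fun r t => - _) => apply: Bd_opp
  | |- Bd (fun r t => cos _) => exact: Bd_cos
  | |- Bd (fun r t => sin _) => exact: Bd_sin
  | |- Bd (fun r t => r) => exact: Or_Bd (Or_id _)
  | |- Bd (pull_r _ _) => rewrite /pull_r
  | |- Bd (pull_t _ _) => rewrite /pull_t
  | |- Bd (pull_rt _ _) => rewrite /pull_rt
  | |- Bd (fun r t => pull_r _ _ _ _) => rewrite /pull_r
  | |- Bd (fun r t => _) => exact: Bd_cst
  end].

Ltac ctn := repeat first [
  match goal with H : cont ?f |- cont ?g => constr_eq f g; exact H end
  | lazymatch goal with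
    | |- cont (fun t => _ + _) => apply: cont_add
    | |- cont (fun t => _ * _) => apply: cont_mul
    | |- cont (fun t => - _) => apply: cont_opp
    | |- cont (fun t => _) => exact: cont_const
    end].

(** * Strong unique continuation for Beltrami systems *)

Section UniqueContinuation.
Variable R : realType.
Local Notation plane := 'rV[R]_2.
Variables (p : plane) (D : set plane) (q1 q2 t1 t2 : plane -> R) (K : R).
Hypotheses (oD : open D) (Dp : D p).
Implicit Types r t : R.
Hypotheses (sq1 : smooth D q1) (sq2 : smooth D q2).
Hypotheses (st1 : smooth D t1) (st2 : smooth D t2).
Hypotheses (t1p : t1 p = 0) (t2p : t2 p = 1).
Let G1 u := partial 0 q1 u - t1 u * partial 1 q1 u - t2 u * partial 1 q2 u.
Let G2 u := partial 0 q2 u - t1 u * partial 1 q2 u + t2 u * partial 1 q1 u.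
Hypothesis K0 : 0 <= K.
Hypothesis G1_le : forall u, D u -> `|G1 u| <= K * (`|q1 u| + `|q2 u|).
Hypothesis G2_le : forall u, D u -> `|G2 u| <= K * (`|q1 u| + `|q2 u|).
Hypothesis flat : forall k, exists B d : R, [/\ 0 <= B, 0 < d & forall u, `|u - p| < d ->
  `|q1 u| <= B * `|u - p| ^+ k /\ `|q2 u| <= B * `|u - p| ^+ k].

Let a := pull p t1.
Let b := pull p t2.
Let ar := pull_r p t1.
Let br := pull_r p t2.
Let at_ := pull_t p t1.
Let bt := pull_t p t2.
(** With [tau = t1 + i t2] and [q = q1 + i q2] the system is [(d_0 - conj tau d_1) q = G]. In polar
    coordinates [r q_r] is [(sin t + conj tau cos t) / (cos t - conj tau sin t)] times [q_t], up to
    [r G] over the same denominator. That quotient is [k2 - i k1], and [den] is the squared modulus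
    of its denominator. *)
Let den r t := (cos t - a r t * sin t) * (cos t - a r t * sin t)
  + (b r t * sin t) * (b r t * sin t).
Let denr r t := 2 * (cos t - a r t * sin t) * - (ar r t * sin t)
  + 2 * (b r t * sin t) * (br r t * sin t).
Let dent r t := 2 * (cos t - a r t * sin t) * (- sin t - (at_ r t * sin t + a r t * cos t))
  + 2 * (b r t * sin t) * (bt r t * sin t + b r t * cos t).
Let num r t := cos t * sin t * (1 - a r t * a r t - b r t * b r t)
  + a r t * (cos t * cos t - sin t * sin t).
Let numt r t := (cos t * cos t - sin t * sin t) * (1 - a r t * a r t - b r t * b r t)
  - cos t * sin t * (2 * a r t * at_ r t + 2 * b r t * bt r t)
  + at_ r t * (cos t * cos t - sin t * sin t) - 4 * a r t * (cos t * sin t).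
Let ivd r t := (den r t)^-1.
Let k1 r t := b r t * ivd r t.
Let k1r r t := br r t * ivd r t - b r t * (denr r t * (ivd r t * ivd r t)).
Let k1t r t := bt r t * ivd r t - b r t * (dent r t * (ivd r t * ivd r t)).
Let k2 r t := num r t * ivd r t.
Let k2t r t := numt r t * ivd r t - num r t * (dent r t * (ivd r t * ivd r t)).

Let ball_D : exists2 d : R, 0 < d & forall u, `|u - p| < d -> D u.
Proof. by have /openP := oD; apply. Qed.

Let cs1 t : cos t * cos t = 1 - sin t * sin t :> R.
Proof. by rewrite -!expr2 cos2sin2. Qed.

Section Bounds.
Variable d : R.
Hypotheses (d_gt0 : 0 < d) (dD : forall u, `|u - p| < d -> D u).

Let Bp F : smooth D F -> Bd (pull p F). Proof. exact: (Bd_pull d_gt0 dD). Qed.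

Let Ba : Bd a. Proof. exact: Bp. Qed.
Let Bb : Bd b. Proof. exact: Bp. Qed.
Let Ba0 : Bd (pull p (partial 0 t1)). Proof. exact/Bp/smooth_partial. Qed.
Let Ba1 : Bd (pull p (partial 1 t1)). Proof. exact/Bp/smooth_partial. Qed.
Let Bb0 : Bd (pull p (partial 0 t2)). Proof. exact/Bp/smooth_partial. Qed.
Let Bb1 : Bd (pull p (partial 1 t2)). Proof. exact/Bp/smooth_partial. Qed.
Let Bar : Bd ar. Proof. by rewrite /ar; bd. Qed.
Let Bbr : Bd br. Proof. by rewrite /br; bd. Qed.
Let Oat : Or at_.
Proof. by apply: Or_mull; [exact: Or_id|bd]. Qed.
Let Obt : Or bt.
Proof. by apply: Or_mull; [exact: Or_id|bd]. Qed.
Let Oa : Or a. Proof. exact: (Or_pull oD d_gt0 dD). Qed.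
Let Ob : Or (fun r t => b r t - 1).
Proof.
apply: (Or_ext (f := pull p (fun u => t2 u - 1)) d_gt0) => //.
apply: (Or_pull oD d_gt0 dD); last by rewrite t2p subrr.
by apply: smoothB => //; exact: smooth_cst.
Qed.

Let Ob' : Or (fun r t => b r t + - 1). Proof. exact: Ob. Qed.

(** For [a = 0] and [b = 1] the denominator is 1. The rewriting gives every term a factor [b - 1] or
    [a], which are [O(r)] by the normalisation at [p]; the next estimates are obtained alike. *)
Let Oden : Or (fun r t => den r t - 1).
Proof.
apply: (Or_ext (f := fun r t => (b r t - 1) * ((b r t + 1) * (sin t * sin t))
   + a r t * (a r t * (sin t * sin t) - 2 * (cos t * sin t))) d_gt0).
  by move=> r t _; rewrite /den; have := cs1 t; move: (cos t) (sin t) (a r t) (b r t) => x y u v h; ring: h.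
apply: Or_add; first by apply: (Or_mull Ob); bd.
by apply: (Or_mull Oa); bd.
Qed.

Let Bden : Bd den. Proof. by rewrite /den; bd. Qed.
Let Bivd : Bd ivd. Proof. exact: (Bd_inv ltr01). Qed.
Let Bdenr : Bd denr. Proof. by rewrite /denr; bd. Qed.

Let Odent : Or dent.
Proof.
apply: (Or_ext (f := fun r t => (b r t - 1) * ((b r t + 1) * (2 * (sin t * cos t)))
  + a r t * (2 * (sin t * (sin t + (at_ r t * sin t + a r t * cos t))) - 2 * (cos t * cos t))
  + at_ r t * (- (2 * (cos t * sin t)))
  + bt r t * (2 * (b r t * (sin t * sin t)))) d_gt0).
  by move=> r t _; rewrite /dent; move: (cos t) (sin t) (a r t) (b r t) (at_ r t) (bt r t) => x y u v h k; ring.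
apply: Or_add; last by apply: (Or_mull Obt); bd.
apply: Or_add; last by apply: (Or_mull Oat); bd.
apply: Or_add; first by apply: (Or_mull Ob'); bd.
apply: (Or_mull Oa); bd.
Qed.

Let Onab : Or (fun r t => 1 - a r t * a r t - b r t * b r t).
Proof.
apply: (Or_ext (f := fun r t => (b r t - 1) * (- (b r t + 1)) + a r t * (- a r t)) d_gt0).
  by move=> r t _; move: (a r t) (b r t) => x y; ring.
by apply: Or_add; [apply: (Or_mull Ob')|apply: (Or_mull Oa)]; bd.
Qed.

Let Onum : Or num.
Proof.
apply: Or_add; first by apply: (Or_mulr _ Onab); bd.
by apply: (Or_mull Oa); bd.
Qed.

Let Onumt : Or numt.
Proof.
apply: Or_add; last by apply: Or_opp; apply: Or_mull; [apply: (Or_mulr _ Oa)|]; bd.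
apply: Or_add; last by apply: (Or_mull Oat); bd.
apply: Or_add; first by apply: (Or_mulr _ Onab); bd.
apply: Or_opp; apply: Or_mulr; first by bd.
apply: Or_add; first by apply: (Or_mulr _ Oat); bd.
by apply: (Or_mulr _ Obt); bd.
Qed.

Lemma uc_Bk1 : Bd k1. Proof. by rewrite /k1; bd. Qed.
Lemma uc_Bk1r : Bd k1r. Proof. by rewrite /k1r; bd. Qed.
Lemma uc_Ok1t : Or k1t.
Proof.
apply: Or_add; first by apply: (Or_mull Obt); bd.
by apply: Or_opp; apply: Or_mulr; [bd|apply: (Or_mull Odent); bd].
Qed.
Lemma uc_Bk2 : Bd k2. Proof. by apply: Bd_mul => //; exact: Or_Bd. Qed.
Lemma uc_Ok2t : Or k2t.
Proof.
apply: Or_add; first by apply: (Or_mull Onumt); bd.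
by apply: Or_opp; apply: (Or_mull Onum); bd.
Qed.

Lemma uc_den_near : exists2 d' : R, 0 < d' & forall r t, 0 < r < d' -> 0 < den r t.
Proof.
have h2 : (0 : R) < 2^-1 by rewrite invr_gt0.
have [d' d'0 H] := Or_near h2 Oden.
exists d' => // r t /(H r t); rewrite ler_norml => /andP[h _]; lra.
Qed.

Lemma uc_k1_near : exists2 d' : R, 0 < d' & forall r t, 0 < r < d' -> 1 <= 2 * k1 r t.
Proof.
have [d1 d10 H1] := uc_den_near.
have O : Or (fun r t => k1 r t - 1).
  apply: (Or_ext (f := fun r t => ((b r t - 1) + - (den r t - 1)) * ivd r t) d10).
    move=> r t rd; rewrite /k1 /ivd; have := H1 r t rd; move: (den r t) (b r t) => x y x0.
    by field; rewrite gt_eqF.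
  by apply: (Or_mull _ Bivd); apply: Or_add => //; exact: Or_opp.
have h2 : (0 : R) < 2^-1 by rewrite invr_gt0.
have [d' d'0 H] := Or_near h2 O.
exists d' => // r t /(H r t); rewrite ler_norml => /andP[h _]; lra.
Qed.

Let Bq F : smooth D F ->
  [/\ Bd (pull p F), Bd (pull_r p F), Bd (pull_t p F) & Bd (pull_rt p F)].
Proof.
move=> sF; have B0 := Bp sF.
have B1 := Bp (smooth_partial 0 sF); have B2 := Bp (smooth_partial 1 sF).
have B3 := Bp (smooth_partial 0 (smooth_partial 0 sF)).
have B4 := Bp (smooth_partial 1 (smooth_partial 0 sF)).
have B5 := Bp (smooth_partial 0 (smooth_partial 1 sF)).
have B6 := Bp (smooth_partial 1 (smooth_partial 1 sF)).
by split; bd.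
Qed.

Let e1 r t := r * pull_r p q1 r t - (k2 r t * pull_t p q1 r t + k1 r t * pull_t p q2 r t).
Let e2 r t := r * pull_r p q2 r t - (k2 r t * pull_t p q2 r t - k1 r t * pull_t p q1 r t).

(** The factor of [r (G1 + i G2)] is [1 / (cos t - conj tau sin t)], which equals
    [sin t (k2 - i k1) + cos t]. *)
Let eE r t : 0 < den r t ->
  e1 r t = r * ((sin t * k2 r t + cos t) * G1 (polar p r t) + sin t * k1 r t * G2 (polar p r t)) /\
  e2 r t = r * ((sin t * k2 r t + cos t) * G2 (polar p r t) - sin t * k1 r t * G1 (polar p r t)).
Proof.
rewrite /e1 /e2 /k1 /k2 /ivd /num /pull_t /pull_r /G1 /G2 /a /b /pull => den0.
have dn : den r t != 0 by rewrite gt_eqF.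
move: dn; rewrite /den /a /b /pull; have := cs1 t.
move: (partial 0 q1 _) (partial 1 q1 _) (partial 0 q2 _) (partial 1 q2 _)
  (t1 _) (t2 _) (cos t) (sin t) => x0 x1 y0 y1 u v c s h dn.
(* Homogenising selected occurrences of [v] in [c] and [s] lets [field] conclude without the
   relation between [c] and [s]. *)
have E : v = v * (c * c + s * s) by rewrite h; ring.
split.
  rewrite [X in _ = _ * (_ + _ * (X * _) * _)]E [X in _ - (_ + X * _ * _)]E.
  by field.
rewrite [X in _ = _ * (_ - _ * (X * _) * _)]E [X in _ - (_ - X * _ * _)]E.
by field.
Qed.

Let ev_e (e X Y : R -> R -> R) (d' : R) : 0 < d' -> Bd X -> Bd Y ->
  (forall r t, 0 < r < d' -> `|e r t| <= r * (`|X r t| * (K * (`|pull p q1 r t| + `|pull p q2 r t|))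
     + `|Y r t| * (K * (`|pull p q1 r t| + `|pull p q2 r t|)))) ->
  ex_bound (fun C d => forall r t, 0 < r < d ->
    `|e r t| <= C * r * (`|pull p q1 r t| + `|pull p q2 r t|)).
Proof.
move=> d'0 [C1 [d1 [C10 d10 H1]]] [C2 [d2 [C20 d20 H2]]] He.
exists ((C1 + C2) * K), (Num.min d' (Num.min d1 d2)).
split; first by rewrite !lt_min d'0 d10.
move=> C d0 CC d00 dd r t /andP[r0 rd].
have : r < Num.min d' (Num.min d1 d2) by exact: lt_le_trans dd.
rewrite !lt_min => /and3P[rd' rd1 rd2].
apply: le_trans (He r t _) _; first by rewrite r0.
set W := `|pull p q1 r t| + _; have W0 : 0 <= W by rewrite addr_ge0.
rewrite (mulrC C) -!mulrA ler_pM2l // -mulrDl.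
apply: (@le_trans _ _ ((C1 + C2) * (K * W))); last by rewrite mulrA ler_wpM2r.
rewrite ler_wpM2r ?mulr_ge0 // lerD //; [apply: H1|apply: H2]; by rewrite r0.
Qed.

Let a_r r t : 0 < r < d -> is_derive r 1 (a ^~ t) (ar r t).
Proof. by move=> rd; exact: (pull_is_derive_r oD dD t st1 rd). Qed.
Let b_r r t : 0 < r < d -> is_derive r 1 (b ^~ t) (br r t).
Proof. by move=> rd; exact: (pull_is_derive_r oD dD t st2 rd). Qed.
Let a_t r t : 0 < r < d -> is_derive t 1 (a r) (at_ r t).
Proof. by move=> rd; exact: (pull_is_derive_t oD dD t st1 rd). Qed.
Let b_t r t : 0 < r < d -> is_derive t 1 (b r) (bt r t).
Proof. by move=> rd; exact: (pull_is_derive_t oD dD t st2 rd). Qed.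

Let den_r r t : 0 < r < d -> is_derive r 1 (den ^~ t) (denr r t).
Proof.
move=> rd.
have h1 := derB (derC (cos t) r (1 : R)) (derM (a_r t rd) (derC (sin t) r (1 : R))).
have h2 := derM (b_r t rd) (derC (sin t) r (1 : R)).
apply: (der_eq (derD (derM h1 h1) (derM h2 h2))).
rewrite /denr; move: (cos t) (sin t) (a r t) (b r t) (ar r t) (br r t) => x y u v h k; ring.
Qed.

Let den_t r t : 0 < r < d -> is_derive t 1 (den r) (dent r t).
Proof.
move=> rd.
have h1 := derB (is_derive_cos t) (derM (a_t t rd) (is_derive_sin t)).
have h2 := derM (b_t t rd) (is_derive_sin t).
apply: (der_eq (derD (derM h1 h1) (derM h2 h2))).
rewrite /dent; move: (cos t) (sin t) (a r t) (b r t) (at_ r t) (bt r t) => x y u v h k; ring.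
Qed.

Let num_t r t : 0 < r < d -> is_derive t 1 (num r) (numt r t).
Proof.
move=> rd; have c := is_derive_cos t; have s := is_derive_sin t.
have h1 := derB (derB (derC 1 t (1 : R)) (derM (a_t t rd) (a_t t rd))) (derM (b_t t rd) (b_t t rd)).
apply: (der_eq (derD (derM (derM c s) h1) (derM (a_t t rd) (derB (derM c c) (derM s s))))).
rewrite /numt; move: (cos t) (sin t) (a r t) (b r t) (at_ r t) (bt r t) => x y u v h k; ring.
Qed.

Let k1_r r t : 0 < r < d -> 0 < den r t -> is_derive r 1 (k1 ^~ t) (k1r r t).
Proof.
move=> rd den0; have dn : den r t != 0 by rewrite gt_eqF.
apply: (der_eq (derM (b_r t rd) (@derV R R (den ^~ t) r 1 _ dn (den_r t rd)))).
rewrite /k1r /ivd; move: (den r t) dn (denr r t) (b r t) (br r t) => x xn y z w.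
by field.
Qed.

Let k1_t r t : 0 < r < d -> 0 < den r t -> is_derive t 1 (k1 r) (k1t r t).
Proof.
move=> rd den0; have dn : den r t != 0 by rewrite gt_eqF.
apply: (der_eq (derM (b_t t rd) (@derV R R (den r) t 1 _ dn (den_t t rd)))).
rewrite /k1t /ivd; move: (den r t) dn (dent r t) (b r t) (bt r t) => x xn y z w.
by field.
Qed.

Let k2_t r t : 0 < r < d -> 0 < den r t -> is_derive t 1 (k2 r) (k2t r t).
Proof.
move=> rd den0; have dn : den r t != 0 by rewrite gt_eqF.
apply: (der_eq (derM (num_t t rd) (@derV R R (den r) t 1 _ dn (den_t t rd)))).
rewrite /k2t /ivd; move: (den r t) dn (dent r t) (num r t) (numt r t) => x xn y z w.
by field.
Qed.

Lemma uc_core : exists2 dl : R, 0 < dl & forall r t, 0 < r < dl -> 0 <= t <= 2 * pi ->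
  pull p q1 r t = 0 /\ pull p q2 r t = 0.
Proof.
have [Bw1 Bwr1 Bwt1 Bwrt1] := Bq sq1; have [Bw2 Bwr2 Bwt2 Bwrt2] := Bq sq2.
have [dd dd0 denP] := uc_den_near; have [dk dk0 k1P] := uc_k1_near.
have BX : Bd (fun r t => sin t * k2 r t + cos t).
  by have Bk2 := uc_Bk2; bd.
have BY : Bd (fun r t => sin t * k1 r t) by have Bk1 := uc_Bk1; bd.
pose m := Num.min dd d.
have m0 : 0 < m by rewrite lt_min dd0.
have mP r : 0 < r < m -> 0 < r < dd /\ 0 < r < d.
  by rewrite lt_min => /and3P[-> -> ->].
have e1P := @ev_e e1 _ _ m m0 BX BY _.
have {}e1P : ex_bound (fun C d => forall r t, 0 < r < d ->
    `|e1 r t| <= C * r * (`|pull p q1 r t| + `|pull p q2 r t|)).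
  apply: e1P => r t /mP[rdd rd].
  have [-> _] := eE (denP r t rdd); have r0 : 0 < r by case/andP: rd.
  have Dr := polar_D dD t rd.
  rewrite normrM (gtr0_norm r0) ler_pM2l // (le_trans (ler_normD _ _)) // lerD //.
    by rewrite normrM ler_wpM2l // G1_le.
  by rewrite normrM ler_wpM2l // G2_le.
have e2P := @ev_e e2 _ _ m m0 BX BY _.
have {}e2P : ex_bound (fun C d => forall r t, 0 < r < d ->
    `|e2 r t| <= C * r * (`|pull p q1 r t| + `|pull p q2 r t|)).
  apply: e2P => r t /mP[rdd rd].
  have [_ ->] := eE (denP r t rdd); have r0 : 0 < r by case/andP: rd.
  have Dr := polar_D dD t rd.
  rewrite normrM (gtr0_norm r0) ler_pM2l // (le_trans (ler_normB _ _)) // lerD //.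
    by rewrite normrM ler_wpM2l // G2_le.
  by rewrite normrM ler_wpM2l // G1_le.
have [C0 [d0 [d0p H]]] := ex_bound_and e1P (ex_bound_and e2P
  (ex_bound_and (ex_bound_Bd Bw1) (ex_bound_and (ex_bound_Bd Bwr1) (ex_bound_and (ex_bound_Bd Bwt1) (ex_bound_and (ex_bound_Bd Bwrt1)
  (ex_bound_and (ex_bound_Bd Bw2) (ex_bound_and (ex_bound_Bd Bwr2) (ex_bound_and (ex_bound_Bd Bwt2) (ex_bound_and (ex_bound_Bd Bwrt2)
  (ex_bound_and (ex_bound_Bd uc_Bk1) (ex_bound_and (ex_bound_Bd uc_Bk1r) (ex_bound_and (ex_bound_Or uc_Ok1t) (ex_bound_and (ex_bound_Bd uc_Bk2) (ex_bound_Or uc_Ok2t)))))))))))))).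
(* [circle_vanish] asks for [1 <= C] and [dl <= 1] on top of the shared bounds. *)
pose C := Num.max C0 1; pose dl := Num.min (Num.min d0 1) (Num.min m dk).
have dl0 : 0 < dl by rewrite !lt_min d0p ltr01 dd0 d_gt0 dk0.
have dl_d0 : dl <= d0 by rewrite !ge_min lexx.
have dl1 : dl <= 1 by rewrite !ge_min lexx orbT.
have C1 : 1 <= C by rewrite le_max lexx orbT.
have CC0 : C0 <= C by rewrite le_max lexx.
have dom r : 0 < r < dl -> [/\ 0 < r < dd, 0 < r < d & 0 < r < dk].
  by rewrite !lt_min => /and4P[-> _ /andP[-> ->] ->].
have [He1 [He2 [Hw1 [Hwr1 [Hwt1 [Hwrt1 [Hw2 [Hwr2 [Hwt2 [Hwrt2 [Hk1 [Hk1r [Hk1t [Hk2 Hk2t]]]]]]]]]]]]]] :=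
  H C dl CC0 dl0 dl_d0.
have sub (F : plane -> R) r : smooth D F -> 0 < r < dl -> cont (pull p F r).
  by move=> sF /dom[_ rd _]; exact: (pull_cont oD dD sF rd).
exists dl => // r t rd t02.
have cC : cont (@cos R) by move=> x; exact: continuous_cos.
have cS : cont (@sin R) by move=> x; exact: continuous_sin.
(* Beyond the radius [e] of the decay estimate the constant bound [C] serves instead, at the price
   of [C / e ^+ k]. *)
have flat' k : exists2 B : R, 0 <= B & forall r t, 0 < r < dl ->
    `|pull p q1 r t| <= B * r ^+ k /\ `|pull p q2 r t| <= B * r ^+ k.
  have [B [e [B0 e0 HB]]] := flat k.
  have C00 : 0 <= C by exact: le_trans C1.
  have ek : 0 < e ^+ k by rewrite exprn_gt0.
  have Bk : 0 <= C / e ^+ k by rewrite divr_ge0 // ltW.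
  exists (B + C / e ^+ k); first by rewrite addr_ge0.
  move=> r' t' r'd; have r'0 : 0 < r' by case/andP: r'd.
  have rk : 0 <= r' ^+ k by rewrite exprn_ge0 // ltW.
  have [re|er] := ltP r' e.
    have pd : `|polar p r' t' - p| <= r' by rewrite -[leRHS](gtr0_norm r'0) polar_dist.
    have [h1 h2] := HB (polar p r' t') (le_lt_trans pd re).
    have le1 : B * `|polar p r' t' - p| ^+ k <= (B + C / e ^+ k) * r' ^+ k.
      apply: ler_pM; [exact: B0|by rewrite exprn_ge0|by rewrite lerDl|].
      by apply: lerXn2r => //; rewrite nnegrE // ltW.
    by split; [apply: le_trans h1 le1|apply: le_trans h2 le1].
  have le2 : C <= (B + C / e ^+ k) * r' ^+ k.
    apply: (@le_trans _ _ (C / e ^+ k * r' ^+ k)); last by rewrite ler_wpM2r // lerDr.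
    rewrite -mulrA ler_peMr // mulrC ler_pdivlMr // mul1r.
    by apply: lerXn2r => //; rewrite nnegrE ltW.
  by split; [apply: le_trans (Hw1 r' t' r'd) le2|apply: le_trans (Hw2 r' t' r'd) le2].
have ci r' : 0 < r' < dl -> cont (ivd r').
  move=> rd' s; have [rdd rd1 _] := dom _ rd'.
  apply: contV; first by rewrite gt_eqF // denP.
  apply/differentiable_continuous/derivable1_diffP; by case: (den_t s rd1).
have smp i (F : plane -> R) : smooth D F -> smooth D (partial i F) by exact: smooth_partial.
have cpt (F : plane -> R) r' : smooth D F -> 0 < r' < dl -> cont (pull_t p F r').
  move=> sF rd'; rewrite /pull_t; apply: cont_mul; first exact: cont_const.
  apply: cont_add; last apply: cont_opp.
    by apply: cont_mul => //; exact: (sub _ _ (smp 1 _ sF) rd').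
  by apply: cont_mul => //; exact: (sub _ _ (smp 0 _ sF) rd').
have cpr (F : plane -> R) r' : smooth D F -> 0 < r' < dl -> cont (pull_r p F r').
  move=> sF rd'; rewrite /pull_r; apply: cont_add.
    by apply: cont_mul => //; exact: (sub _ _ (smp 0 _ sF) rd').
  by apply: cont_mul => //; exact: (sub _ _ (smp 1 _ sF) rd').
have cprt (F : plane -> R) r' : smooth D F -> 0 < r' < dl -> cont (pull_rt p F r').
  move=> sF rd'; rewrite /pull_rt; apply: cont_add.
    apply: cont_add; last apply: cont_opp.
      by apply: cont_mul => //; exact: (sub _ _ (smp 1 _ sF) rd').
    by apply: cont_mul => //; exact: (sub _ _ (smp 0 _ sF) rd').
  apply: cont_mul; first exact: cont_const.
  apply: cont_add; last apply: cont_opp.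
    by apply: cont_mul => //; exact: (cpr _ _ (smp 1 _ sF) rd').
  by apply: cont_mul => //; exact: (cpr _ _ (smp 0 _ sF) rd').
have per (F : plane -> R) r' : smooth D F -> pull_r p F r' (2 * pi) = pull_r p F r' 0.
  by move=> sF; rewrite /pull_r !pull_per (mulr_natl pi 2) cos2pi sin2pi cos0 sin0.
have kper r' : [/\ k1 r' (2 * pi) = k1 r' 0 & k2 r' (2 * pi) = k2 r' 0].
  rewrite /k1 /k2 /ivd /num /den /a /b !pull_per (mulr_natl pi 2) cos2pi sin2pi cos0 sin0.
  by split.
apply: (@circle_vanish R dl C (pull p q1) (pull p q2) (pull_r p q1) (pull_r p q2)
  (pull_t p q1) (pull_t p q2) (pull_rt p q1) (pull_rt p q2) k1 k1r k1t k2 k2t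
  dl1 C1
  (fun r' t' rd' => let: And3 _ h _ := dom r' rd' in pull_is_derive_r oD dD t' sq1 h)
  (fun r' t' rd' => let: And3 _ h _ := dom r' rd' in pull_is_derive_r oD dD t' sq2 h)
  (fun r' t' rd' => let: And3 _ h _ := dom r' rd' in pull_is_derive_t oD dD t' sq1 h)
  (fun r' t' rd' => let: And3 _ h _ := dom r' rd' in pull_is_derive_t oD dD t' sq2 h)
  (fun r' t' rd' => let: And3 _ h _ := dom r' rd' in pull_rt_t oD dD t' sq1 h)
  (fun r' t' rd' => let: And3 _ h _ := dom r' rd' in pull_rt_t oD dD t' sq2 h)
  (fun r' t' rd' => let: And3 _ h _ := dom r' rd' in pull_rt_r oD dD t' sq1 h)
  (fun r' t' rd' => let: And3 _ h _ := dom r' rd' in pull_rt_r oD dD t' sq2 h)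
  _ _ _ _ _ _ _ _ _ _ _ _ _ _ _ _ Hw1 Hw2 Hwr1 Hwr2 Hwt1 Hwt2 Hwrt1 Hwrt2 _ _
  Hk1r Hk1t Hk2 Hk2t He1 He2 flat' _ _ rd t02).
- by move=> r' t' rd'; have [h1 h2 _] := dom _ rd'; exact: (k1_r h2 (denP r' t' h1)).
- by move=> r' t' rd'; have [h1 h2 _] := dom _ rd'; exact: (k1_t h2 (denP r' t' h1)).
- by move=> r' t' rd'; have [h1 h2 _] := dom _ rd'; exact: (k2_t h2 (denP r' t' h1)).
- by move=> r' rd'; exact: (cpt _ _ sq1 rd').
- by move=> r' rd'; exact: (cpt _ _ sq2 rd').
- by move=> r' rd'; exact: (cprt _ _ sq1 rd').
- by move=> r' rd'; exact: (cprt _ _ sq2 rd').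
- move=> r' rd'; have ca := sub _ _ st1 rd'; have cb := sub _ _ st2 rd'.
  have car := cpr _ _ st1 rd'; have cbr := cpr _ _ st2 rd'; have civ := ci _ rd'.
  by rewrite -/a -/b -/ar -/br in ca cb car cbr; rewrite /k1r /denr; ctn.
- move=> r' rd'; have ca := sub _ _ st1 rd'; have cb := sub _ _ st2 rd'.
  have cat := cpt _ _ st1 rd'; have cbt := cpt _ _ st2 rd'; have civ := ci _ rd'.
  by rewrite -/a -/b -/at_ -/bt in ca cb cat cbt; rewrite /k1t /dent; ctn.
- move=> r' rd'; have ca := sub _ _ st1 rd'; have cb := sub _ _ st2 rd'.
  have cat := cpt _ _ st1 rd'; have cbt := cpt _ _ st2 rd'; have civ := ci _ rd'.
  by rewrite -/a -/b -/at_ -/bt in ca cb cat cbt; rewrite /k2t /dent /numt /num; ctn.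
- by move=> r' _; exact: pull_per.
- by move=> r' _; exact: pull_per.
- by move=> r' _; exact: per.
- by move=> r' _; exact: per.
- by move=> r' _; case: (kper r').
- by move=> r' _; case: (kper r').
- by move=> r' t' /dom[_ _ rk]; exact: k1P.
- by move=> r' t' rd'; exact: le_trans (ler_norm _) (Hk1 r' t' rd').
Qed.

End Bounds.
Lemma unique_continuation_normalized : exists2 d : R, 0 < d &
  forall u, `|u - p| < d -> q1 u = 0 /\ q2 u = 0.
Proof.
have [d d0 dD] := ball_D; have [dl dl0 H] := uc_core d0 dD.
have [B [e [B0 e0 HB]]] := flat 1.
(* Halved because [polar_repr] bounds the radius by twice the norm. *)
exists (dl / 2); first by rewrite divr_gt0.
move=> u ud; have [r [t [r0 ru t02 ->]]] := polar_repr p u.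
(* The centre lies on none of the circles of [uc_core]; there the flatness of order 1 gives the
   zero. *)
have [->|rn] := eqVneq r 0.
  have pE : polar p 0 t = p by apply/rowP => i; rewrite !mxE mul0r addr0.
  rewrite pE; have := HB p; rewrite subrr normr0 expr1 mulr0 !normr_le0.
  by move=> /(_ e0)[/eqP -> /eqP ->].
apply: H => //; rewrite lt_neqAle eq_sym rn r0 /=.
by apply: le_lt_trans ru _; rewrite mulrC -ltr_pdivlMr.
Qed.
End UniqueContinuation.

Section Coord.
Variable R : realType.
Local Notation plane := 'rV[R]_2.
Local Notation e i := (delta_mx 0 i : plane).

Lemma is_derive_coord (u v : plane) (j : 'I_2) : is_derive u v (fun w : plane => w 0 j) (v 0 j).
Proof.
have did : derivable (id : plane -> plane) u v by exact: derivable_id.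
apply: DeriveDef; first by move/derivable_mxP : did; apply.
have := derive_mx did; rewrite derive_id => /(congr1 (fun M : plane => M 0 j)).
by rewrite mxE.
Qed.

Lemma smooth_coord (D : set plane) (j : 'I_2) : open D -> smooth D (fun w : plane => w 0 j).
Proof.
move=> oD k; case: k => [|k]; (split=> [u _|]; first exact: coord_continuous) => //.
move=> i; split=> [u _|]; first by case: (is_derive_coord u (e i) j).
apply: (Ck_ext oD _ (Ck_cst k D ((e i) 0 j))) => u _.
by case: (is_derive_coord u (e i) j) => _ <-.
Qed.

End Coord.

Section UniqueContinuationBeltrami.
Variable R : realType.
Local Notation plane := 'rV[R]_2.
Local Notation e i := (delta_mx 0 i : plane).
Variables (p : plane) (D : set plane) (q1 q2 t1 t2 : plane -> R) (K : R).
Hypotheses (oD : open D) (Dp : D p).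
Hypotheses (sq1 : smooth D q1) (sq2 : smooth D q2).
Hypotheses (st1 : smooth D t1) (st2 : smooth D t2) (t2p : 0 < t2 p).
Hypothesis K0 : 0 <= K.
Hypothesis eq1 : forall u, D u ->
  `|partial 0 q1 u - t1 u * partial 1 q1 u - t2 u * partial 1 q2 u| <= K * (`|q1 u| + `|q2 u|).
Hypothesis eq2 : forall u, D u ->
  `|partial 0 q2 u - t1 u * partial 1 q2 u + t2 u * partial 1 q1 u| <= K * (`|q1 u| + `|q2 u|).
Hypothesis flat : forall k, exists B d : R, [/\ 0 <= B, 0 < d & forall u, `|u - p| < d ->
  `|q1 u| <= B * `|u - p| ^+ k /\ `|q2 u| <= B * `|u - p| ^+ k].

Let al := t1 p.
Let be := t2 p.
(** The coordinate fields of [L] are [d_0 - al d_1] and [be d_1], so the Beltrami coefficient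
    becomes [(tau - al) / be], which is [i] at the origin. *)
Let L (v : plane) : plane := \row_(i < 2)
  (if i == 0 then p 0 0 + v 0 0 else p 0 1 + (- al * v 0 0 + be * v 0 1)).
Let L0 v : (L v) 0 0 = p 0 0 + v 0 0. Proof. by rewrite mxE. Qed.
Let L1 v : (L v) 0 1 = p 0 1 + (- al * v 0 0 + be * v 0 1). Proof. by rewrite mxE. Qed.
Let DL : set plane := [set v | D (L v)].
Let M : R := 1 + `|al| + be.
Let be0 : be != 0. Proof. by rewrite gt_eqF. Qed.
Let M0 : 0 < M. Proof. by rewrite ltr_wpDr ?(ltW t2p) // ltr_wpDr. Qed.

Let LB u v : `|L u - L v| <= M * `|u - v|.
Proof.
have uv i : `|u 0 i - v 0 i| <= `|u - v|.
  by apply: le_trans (norm_le2 i (u - v)); rewrite [X in _ <= `|X|]mxE [X in _ <= `|_ + X|]mxE.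
rewrite [leLHS]plane_normE.
have -> : (L u - L v) 0 0 = u 0 0 - v 0 0.
  by rewrite [LHS]mxE [X in _ + X]mxE !L0; ring.
have -> : (L u - L v) 0 1 = - al * (u 0 0 - v 0 0) + be * (u 0 1 - v 0 1).
  by rewrite [LHS]mxE [X in _ + X]mxE !L1; ring.
rewrite ge_max; apply/andP; split.
  by apply: le_trans (uv 0) _; rewrite ler_peMl // /M -addrA lerDl addr_ge0 // ltW.
apply: le_trans (ler_normD _ _) _; rewrite !normrM normrN (gtr0_norm t2p) /M mulrDl.
apply: lerD; last by rewrite ler_wpM2l // ltW.
rewrite mulrDl mul1r; apply: ler_wpDl => //; exact: ler_wpM2l.
Qed.

Let L00 : L 0 = p.
Proof. by apply/rowP; elim/forall2; rewrite ?L0 ?L1 !mxE ?mulr0 !addr0. Qed.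

Let oDL : open DL.
Proof.
apply/openP => v Dv; have [d d0 dD] := (openP _).1 oD _ Dv.
exists (d / M); first by rewrite divr_gt0.
move=> w wv; apply: dD; apply: le_lt_trans (LB w v) _.
by rewrite mulrC -ltr_pdivlMr.
Qed.

Let sL i : smooth DL (fun v => L v 0 i).
Proof.
have sc j := smooth_coord j oDL.
elim/forall2: i.
  apply: (smooth_ext oDL (F := fun v : plane => p 0 0 + v 0 0)) => [v _|]; first by rewrite L0.
  by apply: smoothD => //; exact: smooth_cst.
apply: (smooth_ext oDL (F := fun v : plane => p 0 1 + (- al * v 0 0 + be * v 0 1))) => [v _|]; first by rewrite L1.
apply: smoothD => //; first exact: smooth_cst.
by apply: smoothD => //; apply: smoothM => //; exact: smooth_cst.
Qed.

Let sLc (F : plane -> R) : smooth D F -> smooth DL (fun v => F (L v)).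
Proof. by move=> sF k; apply: (Ck_comp oDL oD _ (sF k) (fun i => sL i k)) => v. Qed.

Let dL (F : plane -> R) v : smooth D F -> DL v ->
  partial 0 (fun v => F (L v)) v = partial 0 F (L v) - al * partial 1 F (L v) /\
  partial 1 (fun v => F (L v)) v = be * partial 1 F (L v).
Proof.
move=> sF Dv; have dF := smooth_is_diff oD sF Dv.
have d0 i : is_derive v (e i) (fun s => L s 0 0) ((e i) 0 0).
  under eq_fun do rewrite L0.
  by apply: (der_eq (derD (derC _ _ _) (is_derive_coord v (e i) 0))); rewrite add0r.
have d1 i : is_derive v (e i) (fun s => L s 0 1) (- al * (e i) 0 0 + be * (e i) 0 1).
  under eq_fun do rewrite L1.
  apply: (der_eq (derD (derC _ _ _) (derD (derM (derC _ _ _) (is_derive_coord v (e i) 0))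
     (derM (derC _ _ _) (is_derive_coord v (e i) 1))))).
  by rewrite !mulr0 !addr0 add0r.
have c i := chain2 dF (d0 i) (d1 i).
by split; [have [_ E] := c 0|have [_ E] := c 1]; rewrite [LHS]E !eE;
  move: (partial 0 F _) (partial 1 F _) => x y; ring.
Qed.

(* A linear change of coordinates moves the Beltrami coefficient at [p] to [i]. *)
Lemma unique_continuation : exists2 d : R, 0 < d &
  forall u, `|u - p| < d -> q1 u = 0 /\ q2 u = 0.
Proof.
have sT1 : smooth DL (fun v => (t1 (L v) + - al) * be^-1).
  by apply: smoothM => //; [apply: smoothD => //; [exact: sLc|exact: smooth_cst]|exact: smooth_cst].
have sT2 : smooth DL (fun v => t2 (L v) * be^-1).
  by apply: smoothM => //; [exact: sLc|exact: smooth_cst].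
have Dp0 : DL 0 by rewrite /DL /= L00.
have T1p : (t1 (L 0) + - al) * be^-1 = 0 by rewrite L00 subrr mul0r.
have T2p : t2 (L 0) * be^-1 = 1 by rewrite L00 mulfV.
have [//|u Du|u Du|k|d d0 H] := @unique_continuation_normalized R 0 DL (fun v => q1 (L v)) (fun v => q2 (L v))
  (fun v => (t1 (L v) + - al) * be^-1) (fun v => t2 (L v) * be^-1) K oDL Dp0 (sLc sq1) (sLc sq2) sT1 sT2 T1p T2p.
- have [-> ->] := dL sq1 Du; have [_ ->] := dL sq2 Du.
  have := eq1 Du; move: (partial 0 q1 _) (partial 1 q1 _) (partial 1 q2 _) (t1 _) (t2 _) => x y z t t'.
  by rewrite (_ : x - al * y - (t + - al) / be * (be * y) - t' / be * (be * z) = x - t * y - t' * z) //; field.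
- have [-> ->] := dL sq2 Du; have [_ ->] := dL sq1 Du.
  have := eq2 Du; move: (partial 0 q2 _) (partial 1 q2 _) (partial 1 q1 _) (t1 _) (t2 _) => x y z t t'.
  by rewrite (_ : x - al * y - (t + - al) / be * (be * y) + t' / be * (be * z) = x - t * y + t' * z) //; field.
- have [B [d [B0 d0 HB]]] := flat k; exists (B * M ^+ k), (d / M).
  split; [by rewrite mulr_ge0 // exprn_ge0 // ltW|by rewrite divr_gt0|].
  move=> u; rewrite subr0 => ud.
  have up : `|L u - p| <= M * `|u| by rewrite -L00 -[u in leRHS]subr0; exact: LB.
  have := HB (L u) (le_lt_trans up _); rewrite mulrC -ltr_pdivlMr // => /(_ ud).
  have le1 : B * `|L u - p| ^+ k <= B * M ^+ k * `|u| ^+ k.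
    rewrite -mulrA -exprMn ler_wpM2l //; apply: lerXn2r => //; rewrite nnegrE //.
    by rewrite mulr_ge0 // ltW.
  by move=> [h1 h2]; split; [apply: le_trans h1 le1|apply: le_trans h2 le1].
(* The inverse of [L]; the constant [m] bounds its linear part, so that a ball around the origin
   contains the image of a ball around [p]. *)
pose inv (u : plane) : plane := \row_(i < 2)
  (if i == 0 then u 0 0 - p 0 0 else (u 0 1 - p 0 1 + al * (u 0 0 - p 0 0)) / be).
have invK u : L (inv u) = u.
  apply/rowP; elim/forall2; first by rewrite L0 mxE /= addrC subrK.
  by rewrite L1 !mxE /=; field.
pose m : R := 1 + (1 + `|al|) / be.
have m0 : 0 < m by rewrite ltr_wpDr // divr_ge0 ?addr_ge0 // ltW.
exists (d / m); first by rewrite divr_gt0.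
move=> u ud; rewrite -(invK u); apply: H; rewrite subr0.
apply: (@le_lt_trans _ _ (m * `|u - p|)); last by rewrite mulrC -ltr_pdivlMr.
have h i : `|u 0 i - p 0 i| <= `|u - p|.
  by apply: le_trans (norm_le2 i (u - p)); rewrite [X in _ <= `|X|]mxE [X in _ <= `|_ + X|]mxE.
have ex : 0 <= (1 + `|al|) / be by rewrite divr_ge0 ?addr_ge0 // ltW.
rewrite plane_normE ge_max !mxE /=; apply/andP; split.
  by apply: le_trans (h 0) _; rewrite ler_peMl // lerDl.
rewrite normrM normfV (gtr0_norm t2p) ler_pdivrMr //.
have E : m * `|u - p| * be = be * `|u - p| + (`|u - p| + `|al| * `|u - p|) by rewrite /m; field.
rewrite E; apply: ler_wpDl; first by rewrite mulr_ge0 // ltW.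
apply: le_trans (ler_normD _ _) _; rewrite normrM; apply: lerD; first exact: h.
by rewrite ler_wpM2l.
Qed.
End UniqueContinuationBeltrami.

(** * Order of vanishing and leading terms *)

Section Flat.
Variable R : realType.
Local Notation plane := 'rV[R]_2.
Local Notation e i := (delta_mx 0 i : plane).
Variables (D : set plane) (p : plane).
Hypotheses (oD : open D) (Dp : D p).
Implicit Types (F G : plane -> R) (k : nat).

(** Encodes the vanishing of all derivatives of order at most [k] without multi-indices. *)
Fixpoint flat_at k (F : plane -> R) : Prop :=
  F p = 0 /\ match k with 0%N => True | k'.+1 => forall i, flat_at k' (partial i F) end.

Lemma flat_at0 k F : flat_at k F -> F p = 0.
Proof. by case: k => [|k] []. Qed.

Lemma flat_ext k F G : (forall v, D v -> F v = G v) -> flat_at k F -> flat_at k G.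
Proof.
elim: k F G => [|k IH] F G FG [Fp dF]; split; rewrite -?FG // => i.
by apply: (IH _ _ _ (dF i)) => v Dv; exact: (partial_ext i oD Dv FG).
Qed.

Lemma flat_atW k F : flat_at k.+1 F -> flat_at k F.
Proof. by elim: k F => [|k IH] F [Fp dF]; split=> // i; exact/IH. Qed.

Lemma flat_add k F G : smooth D F -> smooth D G -> flat_at k F -> flat_at k G ->
  flat_at k (fun v => F v + G v).
Proof.
elim: k F G => [|k IH] F G sF sG [Fp dF] [Gp dG]; split; rewrite ?Fp ?Gp ?addr0 // => i.
apply: (flat_ext (F := fun v => partial i F v + partial i G v)).
  by move=> v Dv; rewrite partialD //; exact: smooth_derivable.
by apply: IH; [exact: smooth_partial|exact: smooth_partial|exact: dF|exact: dG].
Qed.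

Lemma flat_mul k F G : smooth D F -> smooth D G -> flat_at k G ->
  flat_at k (fun v => F v * G v).
Proof.
elim: k F G => [|k IH] F G sF sG fG; have [Gp dG] := fG; split; rewrite ?Gp ?mulr0 // => i.
apply: (flat_ext (F := fun v => F v * partial i G v + partial i F v * G v)).
  by move=> v Dv; rewrite partialM; [congr (_ + _); exact: mulrC|exact: smooth_derivable sF Dv|exact: smooth_derivable sG Dv].
have sFi := smooth_partial i sF; have sGi := smooth_partial i sG.
apply: flat_add.
- exact: smoothM.
- exact: smoothM.
- by apply: IH => //; exact: dG.
- by apply: IH => //; exact: flat_atW.
Qed.

Lemma flat_opp k F : smooth D F -> flat_at k F -> flat_at k (fun v => - F v).
Proof.
move=> sF fF; apply: (flat_ext (F := fun v => -1 * F v)) => [v _|]; first by rewrite mulN1r.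
by apply: flat_mul => //; exact: smooth_cst.
Qed.

Lemma mean_value (d : R) F : 0 < d -> (forall u, `|u - p| < d -> D u) -> smooth D F ->
  forall u, `|u - p| < d -> exists2 w, `|w - p| <= `|u - p| &
    `|F u - F p| <= `|u - p| * (`|partial 0 F w| + `|partial 1 F w|).
Proof.
move=> d0 dD sF u ud; pose v := u - p.
have dist (s : R) : `|s| <= `|1 : R| -> `|p + s *: v - p| <= `|v|.
  by move=> s1; rewrite addrC addKr normrZ ler_piMl // -(normr1 R).
have Ds (s : R) : `|s| <= `|1 : R| -> D (p + s *: v).
  by move=> s1; apply: dD; exact: le_lt_trans (dist s s1) ud.
have der (s : R) : `|s| <= `|1 : R| -> derivable F (p + s *: v) v.
  by move=> /Ds Dsv; apply: diff_derivable; case: (smooth_is_diff oD sF Dsv).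
have [s s1] := line_MVT der.
rewrite scale1r mul1r [p + v]addrC subrK => E; exists (p + s *: v); first exact: dist.
rewrite E deriveE; last by case: (smooth_is_diff oD sF (Ds _ s1)).
have [_ ->] := smooth_is_diff oD sF (Ds _ s1).
rewrite /lin2; apply: le_trans (ler_normD _ _) _; rewrite !normrM mulrDr.
by apply: lerD; rewrite ler_wpM2r // norm_le2.
Qed.

Definition bigO k F := exists B d : R, [/\ 0 <= B, 0 < d &
  forall u, `|u - p| < d -> `|F u| <= B * `|u - p| ^+ k].

Let ball_D : exists2 d : R, 0 < d & forall u, `|u - p| < d -> D u.
Proof. by have /openP := oD; apply. Qed.

Lemma bigO_add k F G : bigO k F -> bigO k G -> bigO k (fun u => F u + G u).
Proof.
move=> [B [d [B0 d0 H]]] [B' [d' [B'0 d'0 H']]].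
exists (B + B'), (Num.min d d'); split; [exact: addr_ge0|by rewrite lt_min d0|].
move=> u; rewrite lt_min => /andP[ud ud']; apply: le_trans (ler_normD _ _) _.
by rewrite mulrDl lerD // ?H // H'.
Qed.

Lemma bigO_opp k F : bigO k F -> bigO k (fun u => - F u).
Proof. by move=> [B [d [B0 d0 H]]]; exists B, d; split=> // u /H; rewrite normrN. Qed.

Lemma bigO_partial k F : smooth D F -> F p = 0 ->
  bigO k (partial 0 F) -> bigO k (partial 1 F) -> bigO k.+1 F.
Proof.
move=> sF Fp [B [d [B0 d0 H]]] [B' [d' [B'0 d'0 H']]].
have [d1 d10 dD] := ball_D.
exists (B + B'), (Num.min d1 (Num.min d d')).
split; [exact: addr_ge0|by rewrite !lt_min d10 d0|].
move=> u; rewrite !lt_min => /and3P[ud1 ud ud'].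
have [w wu] := mean_value d10 dD sF ud1; rewrite Fp subr0 => /le_trans; apply.
have pw : `|w - p| ^+ k <= `|u - p| ^+ k by apply: lerXn2r => //; rewrite nnegrE.
rewrite exprS mulrCA ler_wpM2l // mulrDl.
apply: lerD.
  by apply: le_trans (H w (le_lt_trans wu ud)) _; rewrite ler_wpM2l.
by apply: le_trans (H' w (le_lt_trans wu ud')) _; rewrite ler_wpM2l.
Qed.

Lemma bigO0 F : smooth D F -> bigO 0 F.
Proof.
move=> sF; have [d d0 H] := (continuousP _ _).1 (smooth_cont sF Dp) 1 ltr01.
exists (`|F p| + 1), d; split=> [||u /H /ltW ud]; [by rewrite addr_ge0|by []|].
by rewrite expr0 mulr1 -lerBlDl (le_trans (lerB_dist _ _)).
Qed.

(** Taylor's estimate without Taylor polynomials: each step of the induction integrates a bound on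
    the gradient by the mean value inequality and gains one order. *)
Lemma flat_bigO k F : smooth D F -> flat_at k F -> bigO k.+1 F.
Proof.
elim: k F => [|k IH] F sF [Fp dF]; apply: bigO_partial => //.
- exact/bigO0/smooth_partial.
- exact/bigO0/smooth_partial.
- by apply: IH; [exact: smooth_partial|exact: dF].
- by apply: IH; [exact: smooth_partial|exact: dF].
Qed.

End Flat.

Section LeadingTerm.
Variable R : realType.
Local Notation plane := 'rV[R]_2.
Local Notation e i := (delta_mx 0 i : plane).
Variables (D : set plane) (p : plane).
Hypotheses (oD : open D) (Dp : D p).
Implicit Types (F G q : plane -> R) (k : nat).

Definition zcoord (u : plane) : R[i] := (u 0 0 - p 0 0) +i* (u 0 1 - p 0 1).
Definition zre k u : R := complex.Re (zcoord u ^+ k).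
Definition zim k u : R := complex.Im (zcoord u ^+ k).

Lemma zreS k u : zre k.+1 u = (u 0 0 - p 0 0) * zre k u - (u 0 1 - p 0 1) * zim k u.
Proof. by rewrite /zre /zim exprS; case: (zcoord u ^+ k). Qed.

Lemma zimS k u : zim k.+1 u = (u 0 0 - p 0 0) * zim k u + (u 0 1 - p 0 1) * zre k u.
Proof. by rewrite /zre /zim exprS; case: (zcoord u ^+ k). Qed.

Let dX (i : 'I_2) u : is_derive u (e i) (fun w : plane => w 0 0 - p 0 0) ((e i) 0 0).
Proof. by apply: (der_eq (derB (is_derive_coord u (e i) 0) (derC _ _ _))); rewrite subr0. Qed.
Let dY (i : 'I_2) u : is_derive u (e i) (fun w : plane => w 0 1 - p 0 1) ((e i) 0 1).
Proof. by apply: (der_eq (derB (is_derive_coord u (e i) 1) (derC _ _ _))); rewrite subr0. Qed.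

Lemma is_derive_zpow k u :
  [/\ is_derive u (e 0) (zre k.+1) (k.+1%:R * zre k u),
      is_derive u (e 1) (zre k.+1) (- (k.+1%:R * zim k u)),
      is_derive u (e 0) (zim k.+1) (k.+1%:R * zim k u)
    & is_derive u (e 1) (zim k.+1) (k.+1%:R * zre k u)].
Proof.
elim: k => [|k [h1 h2 h3 h4]].
  have E1 : zre 1 = fun w => w 0 0 - p 0 0 by apply/funext => w.
  have E2 : zim 1 = fun w => w 0 1 - p 0 1 by apply/funext => w.
  have z0 : zre 0 u = 1 by rewrite /zre expr0.
  have z1 : zim 0 u = 0 by rewrite /zim expr0.
  rewrite E1 E2 z0 z1.
  have e0 := dX 0 u; have e1 := dX 1 u; have e2 := dY 0 u; have e3 := dY 1 u.
  rewrite !eE in e0 e1 e2 e3.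
  by split; [apply: (der_eq e0)|apply: (der_eq e1)|apply: (der_eq e2)|apply: (der_eq e3)]; ring.
have E1 : zre k.+2 = fun w => (w 0 0 - p 0 0) * zre k.+1 w - (w 0 1 - p 0 1) * zim k.+1 w.
  by apply/funext => w; exact: zreS.
have E2 : zim k.+2 = fun w => (w 0 0 - p 0 0) * zim k.+1 w + (w 0 1 - p 0 1) * zre k.+1 w.
  by apply/funext => w; exact: zimS.
have N : k.+2%:R = 1 + k.+1%:R :> R by rewrite -natr1 addrC.
rewrite E1 E2; split.
- apply: (der_eq (derB (derM (dX 0 u) h1) (derM (dY 0 u) h3))).
  by rewrite !eE N !(zreS k) !(zimS k); ring.
- apply: (der_eq (derB (derM (dX 1 u) h2) (derM (dY 1 u) h4))).
  by rewrite !eE N !(zreS k) !(zimS k); ring.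
- apply: (der_eq (derD (derM (dX 0 u) h3) (derM (dY 0 u) h1))).
  by rewrite !eE N !(zreS k) !(zimS k); ring.
- apply: (der_eq (derD (derM (dX 1 u) h4) (derM (dY 1 u) h2))).
  by rewrite !eE N !(zreS k) !(zimS k); ring.
Qed.

Lemma smooth_zpow k : smooth D (zre k) /\ smooth D (zim k).
Proof.
elim: k => [|k [h1 h2]].
  split.
    by apply: (smooth_ext oD (F := fun _ : plane => 1 : R)) => [u _|]; [rewrite /zre expr0|exact: smooth_cst].
  by apply: (smooth_ext oD (F := fun _ : plane => 0 : R)) => [u _|]; [rewrite /zim expr0|exact: smooth_cst].
have sX : smooth D (fun w => w 0 0 - p 0 0).
  by apply: smoothB => //; [exact: smooth_coord|exact: smooth_cst].
have sY : smooth D (fun w => w 0 1 - p 0 1).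
  by apply: smoothB => //; [exact: smooth_coord|exact: smooth_cst].
split.
  apply: (smooth_ext oD (F := fun w => (w 0 0 - p 0 0) * zre k w - (w 0 1 - p 0 1) * zim k w)).
    by move=> u _; rewrite zreS.
  by apply: smoothB => //; exact: smoothM.
apply: (smooth_ext oD (F := fun w => (w 0 0 - p 0 0) * zim k w + (w 0 1 - p 0 1) * zre k w)).
  by move=> u _; rewrite zimS.
by apply: smoothD => //; exact: smoothM.
Qed.

Lemma bigO_ext k F G : (forall v, D v -> F v = G v) -> bigO p k F -> bigO p k G.
Proof.
move=> FG [B [d [B0 d0 H]]]; have [d' d'0 dD] := (openP _).1 oD _ Dp.
exists B, (Num.min d d'); split; [by []|by rewrite lt_min d0|].
by move=> u; rewrite lt_min => /andP[ud /dD /FG <-]; exact: H.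
Qed.

(** The index of [flat_at] shifted by one, so that the case [k = 0] is void and the induction of
    [leading_term] can start there. *)
Let fl k F := match k with 0%N => True | k'.+1 => flat_at p k' F end.

Let fl_partial k i F : flat_at p k F -> fl k (partial i F).
Proof. by case: k => [|k] /= [_ dF] //; exact: dF. Qed.

Let fl_ext k F G : (forall v, D v -> F v = G v) -> fl k F -> fl k G.
Proof. by case: k => [|k] //; exact: flat_ext. Qed.

(** The induction passes through [d_0 q] alone: a leading term [c z^k] there integrates to
    [c / (k + 1) z^(k+1)], and the Cauchy-Riemann defect is small enough to give the matching bound
    on [d_1] of the difference. The last clause is what excludes [c = 0] at the least order where
    flatness fails. *)
Lemma leading_term k q1 q2 : smooth D q1 -> smooth D q2 ->
  fl k q1 -> fl k q2 ->
  fl k (fun u => partial 0 q1 u - partial 1 q2 u) ->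
  fl k (fun u => partial 0 q2 u + partial 1 q1 u) ->
  exists c1 c2 : R,
   [/\ bigO p k.+1 (fun u => q1 u - (c1 * zre k u - c2 * zim k u)),
       bigO p k.+1 (fun u => q2 u - (c1 * zim k u + c2 * zre k u))
     & c1 = 0 -> c2 = 0 -> flat_at p k q1 /\ flat_at p k q2].
Proof.
elim: k q1 q2 => [|k IH] q1 q2 s1 s2 f1 f2 g1 g2.
  exists (q1 p), (q2 p); split=> [||h1 h2]; last by split; split.
    apply: (flat_bigO oD Dp (k := 0)).
      apply: smoothB => //; apply: smoothB => //; apply: smoothM => //;
        [exact: smooth_cst|exact: (smooth_zpow 0).1|exact: smooth_cst|exact: (smooth_zpow 0).2].
    by split=> //; rewrite /zre /zim expr0 /=; ring.
  apply: (flat_bigO oD Dp (k := 0)).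
    apply: smoothB => //; apply: smoothD => //; apply: smoothM => //;
      [exact: smooth_cst|exact: (smooth_zpow 0).2|exact: smooth_cst|exact: (smooth_zpow 0).1].
  by split=> //; rewrite /zre /zim expr0 /=; ring.
rewrite /= in f1 f2 g1 g2.
have s10 := smooth_partial 0 s1; have s11 := smooth_partial 1 s1.
have s20 := smooth_partial 0 s2; have s21 := smooth_partial 1 s2.
have [||||c1 [c2 [b1 b2 fz]]] := IH (partial 0 q1) (partial 0 q2) s10 s20.
- exact: fl_partial.
- exact: fl_partial.
- apply: (fl_ext (F := partial 0 (fun u => partial 0 q1 u - partial 1 q2 u))).
    move=> v Dv; rewrite partialD; [|exact: smooth_derivable s10 Dv|apply: derivN; exact: smooth_derivable s21 Dv].
    by rewrite partialN; [rewrite (Schwarz oD (s2 2%N) Dv)|exact: smooth_derivable s21 Dv].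
  exact: fl_partial.
- apply: (fl_ext (F := partial 0 (fun u => partial 0 q2 u + partial 1 q1 u))).
    move=> v Dv; rewrite partialD; [|exact: smooth_derivable s20 Dv|exact: smooth_derivable s11 Dv].
    by rewrite (Schwarz oD (s1 2%N) Dv).
  exact: fl_partial.
have sL1 : smooth D (fun u => partial 0 q1 u - partial 1 q2 u) by exact: smoothB.
have sL2 : smooth D (fun u => partial 0 q2 u + partial 1 q1 u) by exact: smoothD.
have bL1 := flat_bigO oD Dp sL1 g1; have bL2 := flat_bigO oD Dp sL2 g2.
pose n : R := k.+1%:R; have n0 : n != 0 by rewrite pnatr_eq0.
have sc c : smooth D (fun _ : plane => c : R) by exact: smooth_cst.
have [sre sim] := smooth_zpow k.+1.
have zp : zre k.+1 p = 0 /\ zim k.+1 p = 0.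
  by rewrite zreS zimS !subrr !mul0r subr0 addr0.
have dF1 (i : 'I_2) v a b : is_derive v (e i) (zre k.+1) a -> is_derive v (e i) (zim k.+1) b ->
    D v -> partial i (fun u => q1 u - (c1 / n * zre k.+1 u - c2 / n * zim k.+1 u)) v =
    partial i q1 v - (c1 / n * a - c2 / n * b).
  move=> da db Dv.
  have [_ E] := derB (derivableP (smooth_derivable (i := i) s1 Dv))
     (derB (derM (derC (c1 / n) _ _) da) (derM (derC (c2 / n) _ _) db)).
  by rewrite [LHS]E !mulr0 !addr0.
have dF2 (i : 'I_2) v a b : is_derive v (e i) (zre k.+1) a -> is_derive v (e i) (zim k.+1) b ->
    D v -> partial i (fun u => q2 u - (c1 / n * zim k.+1 u + c2 / n * zre k.+1 u)) v =
    partial i q2 v - (c1 / n * b + c2 / n * a).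
  move=> da db Dv.
  have [_ E] := derB (derivableP (smooth_derivable (i := i) s2 Dv))
     (derD (derM (derC (c1 / n) _ _) db) (derM (derC (c2 / n) _ _) da)).
  by rewrite [LHS]E !mulr0 !addr0.
exists (c1 / n), (c2 / n); split.
- apply: (bigO_partial oD Dp).
  + by apply: smoothB => //; apply: smoothB => //; apply: smoothM.
  + by rewrite zp.1 zp.2 (flat_at0 f1) !mulr0 !subr0.
  + apply: (bigO_ext _ b1) => v Dv; have [h1 h2 h3 h4] := is_derive_zpow k v.
    rewrite (dF1 _ _ _ _ h1 h3 Dv); move: (partial 0 q1 v) (zre k v) (zim k v) => x y z.
    by rewrite -/n; field.
  + apply: (bigO_ext _ (bigO_add bL2 (bigO_opp b2))) => v Dv; have [h1 h2 h3 h4] := is_derive_zpow k v.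
    rewrite (dF1 _ _ _ _ h2 h4 Dv); move: (partial 0 q2 v) (partial 1 q1 v) (zre k v) (zim k v) => x w y z.
    by rewrite -/n; field.
- apply: (bigO_partial oD Dp).
  + by apply: smoothB => //; apply: smoothD => //; apply: smoothM.
  + by rewrite zp.1 zp.2 (flat_at0 f2) !mulr0 addr0 subr0.
  + apply: (bigO_ext _ b2) => v Dv; have [h1 h2 h3 h4] := is_derive_zpow k v.
    rewrite (dF2 _ _ _ _ h1 h3 Dv); move: (partial 0 q2 v) (zre k v) (zim k v) => x y z.
    by rewrite -/n; field.
  + apply: (bigO_ext _ (bigO_add b1 (bigO_opp bL1))) => v Dv; have [h1 h2 h3 h4] := is_derive_zpow k v.
    rewrite (dF2 _ _ _ _ h2 h4 Dv); move: (partial 0 q1 v) (partial 1 q2 v) (zre k v) (zim k v) => x w y z.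
    by rewrite -/n; field.
move=> /eqP; rewrite mulf_eq0 invr_eq0 (negbTE n0) orbF => /eqP c10.
move=> /eqP; rewrite mulf_eq0 invr_eq0 (negbTE n0) orbF => /eqP c20.
have [fr1 fr2] := fz c10 c20.
split; split; [exact: flat_at0 f1| |exact: flat_at0 f2| ].
  apply: forall2 => //.
  apply: (flat_ext oD Dp (F := fun u => (partial 0 q2 u + partial 1 q1 u) - partial 0 q2 u)) => //.
    by move=> v _; rewrite addrC addKr.
  by apply: (flat_add oD Dp) => //; [exact: smoothN|exact: (flat_opp oD Dp)].
apply: forall2 => //.
apply: (flat_ext oD Dp (F := fun u => partial 0 q1 u - (partial 0 q1 u - partial 1 q2 u))) => //.
  by move=> v _; rewrite opprB addrC subrK.
by apply: (flat_add oD Dp) => //; [exact: smoothN|exact: (flat_opp oD Dp)].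
Qed.
End LeadingTerm.

(** * Index of the line field at a zero of finite order *)

Section Index.
Variable R : realType.
Local Notation plane := 'rV[R]_2.
Variables (D : set plane) (p : plane).
Hypotheses (oD : open D) (Dp : D p).

Lemma zpow_polar k (r s : R) :
  zre p k (polar p r s) = r ^+ k * cos (k%:R * s) /\
  zim p k (polar p r s) = r ^+ k * sin (k%:R * s).
Proof.
elim: k => [|k [h1 h2]].
  by rewrite /zre /zim !expr0 mul0r cos0 sin0 mulr1 mulr0.
have E : k.+1%:R * s = k%:R * s + s by rewrite -natr1 mulrDl mul1r.
rewrite zreS zimS polarE0 polarE1 h1 h2 E cosD sinD exprS.
by split; ring.
Qed.

(** At the least order where [q] is not flat, the right-hand sides are flat to the preceding order,
    because they are linear in [q]. So is the Cauchy-Riemann defect, and [leading_term] applies. *)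
Lemma finite_order (q1 q2 a11 a12 a21 a22 : plane -> R) :
  smooth D q1 -> smooth D q2 -> smooth D a11 -> smooth D a12 -> smooth D a21 -> smooth D a22 ->
  (forall u, D u -> partial 0 q1 u - partial 1 q2 u = a11 u * q1 u + a12 u * q2 u) ->
  (forall u, D u -> partial 0 q2 u + partial 1 q1 u = a21 u * q1 u + a22 u * q2 u) ->
  q1 p = 0 -> q2 p = 0 ->
  (forall k, flat_at p k q1 /\ flat_at p k q2) \/
  exists (k : nat) (c1 c2 : R), [/\ (0 < k)%N, c1 != 0 \/ c2 != 0,
    bigO p k.+1 (fun u => q1 u - (c1 * zre p k u - c2 * zim p k u)) &
    bigO p k.+1 (fun u => q2 u - (c1 * zim p k u + c2 * zre p k u))].
Proof.
move=> s1 s2 sa11 sa12 sa21 sa22 e1 e2 q1p q2p.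
pose P k := `[< ~ (flat_at p k q1 /\ flat_at p k q2) >].
have [[k0 Pk0]|nP] := pselect (exists k, P k); last first.
  by left=> k; apply: contrapT => nf; apply: nP; exists k; apply/asboolP.
right; have exP : exists k, P k by exists k0.
have Pk := ex_minnP exP; case: Pk => k /asboolP nfk mink.
(* Flatness of order 0 is the vanishing of [q] at [p]. *)
have k_gt0 : (0 < k)%N by case: (k) nfk => // -[]; do 2 split.
case: k k_gt0 nfk mink => // k _ nfk mink.
have [f1 f2] : flat_at p k q1 /\ flat_at p k q2.
  by apply: contrapT => nf; have := mink k (asboolT nf); rewrite ltnn.
have flin (a a' : plane -> R) : smooth D a -> smooth D a' -> flat_at p k (fun u => a u * q1 u + a' u * q2 u).
  move=> sa sa'; apply: (flat_add oD Dp).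
  - exact: smoothM.
  - exact: smoothM.
  - exact: (flat_mul oD Dp).
  - exact: (flat_mul oD Dp).
have g1 : flat_at p k (fun u => partial 0 q1 u - partial 1 q2 u).
  by apply: (flat_ext oD Dp _ (flin _ _ sa11 sa12)) => v Dv; rewrite e1.
have g2 : flat_at p k (fun u => partial 0 q2 u + partial 1 q1 u).
  by apply: (flat_ext oD Dp _ (flin _ _ sa21 sa22)) => v Dv; rewrite e2.
have [c1 [c2 [b1 b2 fz]]] := @leading_term R D p oD Dp k.+1 q1 q2 s1 s2 f1 f2 g1 g2.
exists k.+1, c1, c2; split=> //.
have [c10|c10] := eqVneq c1 0; last by left.
by right; apply/eqP => c20; apply: nfk; exact: fz.
Qed.

Section LeadingIndex.
Variables (Q : plane -> R[i]) (k : nat) (c1 c2 : R).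
Hypotheses (k_gt0 : (0 < k)%N) (c_neq0 : c1 != 0 \/ c2 != 0).
Let q1 u := complex.Re (Q u).
Let q2 u := complex.Im (Q u).
Hypotheses (cq1 : forall u, D u -> {for u, continuous q1}).
Hypotheses (cq2 : forall u, D u -> {for u, continuous q2}).
Hypothesis b1 : bigO p k.+1 (fun u => q1 u - (c1 * zre p k u - c2 * zim p k u)).
Hypothesis b2 : bigO p k.+1 (fun u => q2 u - (c1 * zim p k u + c2 * zre p k u)).

Let m := c1 ^+ 2 + c2 ^+ 2.
Let m_gt0 : 0 < m.
Proof.
have m0 : 0 <= m by rewrite addr_ge0 ?sqr_ge0.
rewrite lt_neqAle m0 andbT eq_sym paddr_eq0 ?sqr_ge0 // !sqrf_eq0 negb_and.
by case: c_neq0 => ->; rewrite ?orbT.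
Qed.

(** [C + i S] is [c e^(i k s)], the leading term on the unit circle, and [Wr + i Wi] is [Q] times
    its conjugate. *)
Let C s := c1 * cos (k%:R * s) - c2 * sin (k%:R * s).
Let S s := c1 * sin (k%:R * s) + c2 * cos (k%:R * s).
Let Wr r s := q1 (polar p r s) * C s + q2 (polar p r s) * S s.
Let Wi r s := q2 (polar p r s) * C s - q1 (polar p r s) * S s.

Let CS s : C s ^+ 2 + S s ^+ 2 = m.
Proof.
rewrite /C /S /m; have := cos2sin2 (k%:R * s).
by move: (cos _) (sin _) => x y h; ring: h.
Qed.

(** [Wr] is [m t^k] up to [O(t^(k+1))]: on small circles [Q] stays in the open half plane around its
    leading term. *)
Let small : exists r0 : R, [/\ 0 < r0, forall t s, 0 < t <= r0 -> D (polar p t s) &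
  forall t s, 0 < t <= r0 -> 0 < Wr t s].
Proof.
have [B1 [d1 [B10 d10 H1]]] := b1; have [B2 [d2 [B20 d20 H2]]] := b2.
have [d d0 dD] := (openP _).1 oD _ Dp.
pose n := `|c1| + `|c2|; have n0 : 0 <= n by rewrite addr_ge0.
pose M := (B1 + B2) * n + 1; have M0 : 0 < M by rewrite ltr_wpDl // mulr_ge0 // addr_ge0.
(* The last entry gives [t * M <= m / 2], which keeps the error below the main term; the halves turn
   [t <= r0] into strict bounds. *)
pose r0 := Num.min (d / 2) (Num.min (d1 / 2) (Num.min (d2 / 2) (m / M / 2))).
have h2 (x : R) : 0 < x -> 0 < x / 2 by move=> x0; rewrite divr_gt0.
have r00 : 0 < r0 by rewrite !lt_min !h2 // divr_gt0.
have half (x t : R) : 0 < x -> t <= x / 2 -> t < x by lra.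
exists r0; split=> // t s /andP[t0]; rewrite !le_min => /and4P[td td1 td2 tm].
  apply: dD; apply: le_lt_trans (polar_dist _ _ _) _; rewrite gtr0_norm //.
  exact: half.
have pt : `|polar p t s - p| <= t by rewrite -[leRHS](gtr0_norm t0) polar_dist.
have := H1 (polar p t s) (le_lt_trans pt (half _ _ d10 td1)).
have := H2 (polar p t s) (le_lt_trans pt (half _ _ d20 td2)).
have [-> ->] := zpow_polar k t s.
set e2 := _ - (c1 * _ + _); set e1 := _ - (c1 * _ - _) => E2 E1.
have pk : `|polar p t s - p| ^+ k.+1 <= t ^+ k.+1.
  by apply: lerXn2r => //; rewrite nnegrE // ltW.
have {}E1 := le_trans E1 (ler_wpM2l B10 pk); have {}E2 := le_trans E2 (ler_wpM2l B20 pk).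
have csb (x : R) : `|cos x| <= 1 /\ `|sin x| <= 1.
  by rewrite !ler_norml cos_le1 cos_geN1 sin_le1 sin_geN1.
have Cb : `|C s| <= n.
  apply: le_trans (ler_normB _ _) _; rewrite !normrM; have [x1 x2] := csb (k%:R * s).
  by apply: lerD; rewrite ler_piMr.
have Sb : `|S s| <= n.
  apply: le_trans (ler_normD _ _) _; rewrite !normrM; have [x1 x2] := csb (k%:R * s).
  by apply: lerD; rewrite ler_piMr.
have tk : 0 < t ^+ k by rewrite exprn_gt0.
have WE : Wr t s = t ^+ k * m + (e1 * C s + e2 * S s).
  rewrite -(CS s) /Wr /e1 /e2 /C /S.
  by move: (cos _) (sin _) (q1 _) (q2 _) => x y z w; ring.
have eb : `|e1 * C s + e2 * S s| <= t ^+ k * (t * ((B1 + B2) * n)).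
  apply: le_trans (ler_normD _ _) _; rewrite !normrM.
  apply: (@le_trans _ _ (B1 * t ^+ k.+1 * n + B2 * t ^+ k.+1 * n)).
    by apply: lerD; apply: ler_pM.
  by rewrite exprS le_eqVlt; apply/orP; left; apply/eqP; ring.
rewrite WE; move: eb; rewrite ler_norml => /andP[eb _].
apply: (@lt_le_trans _ _ (t ^+ k * (m - t * ((B1 + B2) * n)))); last by rewrite mulrBr; lra.
rewrite mulr_gt0 // subr_gt0.
have tM : t * M <= m / 2 by rewrite -ler_pdivlMr // mulrAC.
have : t * ((B1 + B2) * n) <= t * M by rewrite ler_wpM2l ?ltW // /M ltrDl.
have : m / 2 < m by rewrite ltr_pdivrMr // ltr_pMr // ltr1n.
lra.
Qed.

Let Q_neq0 t s : 0 < Wr t s -> Q (polar p t s) != 0.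
Proof. by apply: contraTneq; rewrite /Wr /q1 /q2 => ->; rewrite !mul0r addr0 ltxx. Qed.

Lemma leading_isolated : \forall u \near p^', Q u != 0.
Proof.
have [r0 [r00 _ HW]] := small.
suff : \forall u \near p, u != p -> Q u != 0 by rewrite /dnbhs near_withinE.
apply/near_normP; exists (r0 / 2); first by rewrite divr_gt0.
move=> u ud up; have [r [t [rge rle _ uE]]] := polar_repr p u.
rewrite uE; apply/Q_neq0/HW; rewrite lt_neqAle rge andbT; apply/andP; split.
  apply/eqP => r_eq; move/eqP : up; apply; rewrite uE -r_eq.
  by apply/rowP => i; rewrite !mxE mul0r addr0.
apply: le_trans rle _; rewrite mulrC -ler_pdivlMr //; exact: ltW.
Qed.

(** Since [Wr > 0], an argument of [Q] is [arg c + k s + atan (Wi / Wr)], continuous in [s], and a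
    direction of the line field is minus half of it. Over one turn only [k s] changes, by [2 pi k],
    whence the index [- k / 2]. *)
Lemma leading_index : exists2 j : R, line_field_index D Q p j & j < 0.
Proof.
have [r0 [r00 HD HW]] := small.
exists (- (k%:R / 2)); last by rewrite oppr_lt0 divr_gt0 // ltr0n.
exists r0; split=> // [t s t0|]; first by split; [exact: HD|exact/Q_neq0/HW].
have r0r : 0 < r0 <= r0 by rewrite r00 lexx.
have can (x : R) : cos (atan x) != 0.
  by rewrite cos_atan invr_eq0 gt_eqF // sqrtr_gt0 ltr_wpDr // sqr_ge0.
(* An argument of [c], determined only up to multiples of [pi]; a shift by [pi] exchanges the two
   orthogonal solutions of the line field equation. *)
have [al alE] : exists al : R, c2 * cos al = c1 * sin al.
  have [c10|c10] := eqVneq c1 0.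
    by exists (pi / 2); rewrite c10 cos_pihalf mulr0 mul0r.
  exists (atan (c2 / c1)).
  have /eqP := atanK (c2 / c1); rewrite /tan eqr_div // => /eqP <-.
  by rewrite mulrC.
pose be s := atan (Wi r0 s / Wr r0 s).
have beE s : Wi r0 s * cos (be s) = Wr r0 s * sin (be s).
  have Wn : Wr r0 s != 0 by rewrite gt_eqF // HW.
  have cn : cos (be s) != 0 by exact: can.
  have /eqP := atanK (Wi r0 s / Wr r0 s); rewrite -/(be s) /tan eqr_div // => /eqP E.
  by rewrite [RHS]mulrC E.
have Qc (q : plane -> R) : (forall u, D u -> {for u, continuous q}) -> cont (fun s => q (polar p r0 s)).
  move=> cq s; have pc : {for s, continuous (polar p r0)}.
    have h0 := derD (derC (p 0 0) s (1 : R)) (derM (derC r0 s (1 : R)) (is_derive_cos s)).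
    have h1 := derD (derC (p 0 1) s (1 : R)) (derM (derC r0 s (1 : R)) (is_derive_sin s)).
    have dp : derivable (polar p r0) s 1.
      apply/derivable_mxP => i j; rewrite (ord1 i); elim/forall2: j.
        by under eq_fun do rewrite polarE0; case: h0.
      by under eq_fun do rewrite polarE1; case: h1.
    exact/differentiable_continuous/derivable1_diffP.
  exact: (continuous_comp pc (cq _ (HD r0 s r0r))).
have q1c := Qc _ cq1; have q2c := Qc _ cq2.
have ks_c : cont (fun s : R => k%:R * s).
  by apply: cont_mul; [exact: cont_const|move=> s; exact: cvg_id].
have cosc : cont (fun s : R => cos (k%:R * s)).
  by move=> s; exact: (continuous_comp (ks_c s) (@continuous_cos R _)).
have sinc : cont (fun s : R => sin (k%:R * s)).
  by move=> s; exact: (continuous_comp (ks_c s) (@continuous_sin R _)).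
have Wr_c : cont (Wr r0) by rewrite /Wr /C /S; ctn.
have Wi_c : cont (Wi r0) by rewrite /Wi /C /S; ctn.
have be_c : cont be.
  move=> s; have Wn : Wr r0 s != 0 by rewrite gt_eqF // HW.
  apply: (@continuous_comp _ _ _ (fun s => Wi r0 s / Wr r0 s) (@atan R)).
    exact: (contM (Wi_c s) (contV Wn (Wr_c s))).
  exact: continuous_atan.
exists (fun s => - (2^-1 * (al + (k%:R * s + be s)))); split.
- apply: continuous_subspaceT.
  have : cont (fun s => - (2^-1 * (al + (k%:R * s + be s)))) by ctn.
  exact.
- move=> s _; set th := - _.
  have th2 : th + th = - (al + (k%:R * s + be s)) by rewrite /th; field.
  have c2E : cos th * cos th - sin th * sin th = cos (al + (k%:R * s + be s)).
    by rewrite -cosD th2 cosN.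
  have s2E : sin th * cos th + cos th * sin th = - sin (al + (k%:R * s + be s)).
    by rewrite -sinD th2 sinN.
  have QE : complex.Im (Q (polar p r0 s) * (cos th +i* sin th) ^+ 2) =
     q2 (polar p r0 s) * (cos th * cos th - sin th * sin th) +
     q1 (polar p r0 s) * (sin th * cos th + cos th * sin th).
    rewrite /q1 /q2 expr2; case: (Q _) => x y /=; ring.
  rewrite QE c2E s2E; apply: (mulfI (lt0r_neq0 m_gt0)); rewrite mulr0.
  have h1 := beE s; rewrite cosD sinD cosD sinD -[m](CS s).
  (* With [m] written as [|C + i S|^2], everything is expressed through [Wr] and [Wi]; the two
     summands vanish by the choice of [be] and of [al]. *)
  transitivity ((cos (k%:R * s) ^+ 2 + sin (k%:R * s) ^+ 2) *
    ((c1 * cos al + c2 * sin al) * (Wi r0 s * cos (be s) - Wr r0 s * sin (be s)) +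
     (c2 * cos al - c1 * sin al) * (Wr r0 s * cos (be s) + Wi r0 s * sin (be s)))).
    rewrite /Wr /Wi /C /S; move: (cos al) (sin al) (cos (be s)) (sin (be s))
      (cos (k%:R * s)) (sin (k%:R * s)) (q1 _) (q2 _) => x0 x1 x2 x3 x4 x5 x6 x7; ring.
  by rewrite h1 alE !subrr mulr0 mul0r addr0 mulr0.
- have be_per : be (2 * pi) = be 0.
    have per (u : R) : cos (u + k%:R * (2 * pi)) = cos u /\ sin (u + k%:R * (2 * pi)) = sin u.
      elim: (k) => [|n [h1 h2]]; first by rewrite mul0r addr0.
      rewrite -natr1 mulrDl mul1r addrA (mulr_natl pi 2) cosD2pi sinD2pi.
      by rewrite -(mulr_natl pi 2).
    have pE : polar p r0 (2 * pi) = polar p r0 0.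
      by apply/rowP => i; elim/forall2: i; rewrite ?polarE0 ?polarE1 (mulr_natl pi 2) ?cos2pi ?sin2pi ?cos0 ?sin0.
    have [p1 p2] := per 0; rewrite add0r in p1 p2.
    by rewrite /be /Wi /Wr /C /S pE p1 p2 mulr0.
  by rewrite be_per; field.
Qed.

End LeadingIndex.
End Index.

(** * Real analytic functions and the identity theorem *)

Section Analytic.
Variable R : realType.
Implicit Types (f g : R -> R) (s : R^nat) (x y r : R).

Definition represents s r f x := forall y, `|y - x| < r -> pseries s (y - x) @ \oo --> f y.
(** Two-sided, in contrast with [analytic_on], which does not test points outside its set. *)
Definition analytic_at f x := exists s r, 0 < r /\ represents s r f x.

(** [1 - q^(n+1)] is [1 - q] times a sum of [n + 1] powers of [q], each at least [q^n]. *)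
Lemma geometric_bound (q : R) n : 0 <= q -> q < 1 -> n.+1%:R * q ^+ n * (1 - q) <= 1 - q ^+ n.+1.
Proof.
move=> q0 q1; elim: n => [|n IH]; first by rewrite expr0 expr1 !mul1r.
have h := ler_wpM2l q0 IH.
have pq : 0 <= (1 - q) * (1 - q ^+ n.+1).
  by rewrite mulr_ge0 // subr_ge0 ?exprn_ile1 // ltW.
rewrite -natr1 (exprS q n.+1); move: h pq; rewrite (exprS q n); nra.
Qed.

(** There is room for [K1 < K] between [|z|] and [r]: convergence at [K] gives absolute convergence
    at [K1], and [geometric_bound] absorbs the factor [n + 1] into the powers of [|z| / K1]. *)
Lemma diffs_cvg s r z : (forall w, `|w| < r -> cvgn (pseries s w)) -> `|z| < r ->
  cvgn (pseries (pseries_diffs s) z).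
Proof.
move=> cs zr; pose K := (`|z| + r) / 2; pose K1 := (`|z| + K) / 2.
have [zK Kr] : `|z| < K /\ K < r by split; rewrite /K; lra.
have [zK1 K1K] : `|z| < K1 /\ K1 < K by split; rewrite /K1; lra.
have K10 : 0 < K1 by exact: le_lt_trans zK1.
have K0 : 0 < K by exact: lt_trans K1K.
have c1 : cvgn (pseries (fun i => `|s i|) K1).
  by apply: (@is_cvg_pseries_inside_norm _ s K); [apply: cs|]; rewrite !gtr0_norm.
pose q := `|z| / K1.
have q0 : 0 <= q by rewrite divr_ge0 // ltW.
have q1 : q < 1 by rewrite ltr_pdivrMr // mul1r.
have q1' : 0 < 1 - q by rewrite subr_gt0.
apply: normed_cvg.
have c2 : cvgn [series (1 - q)^-1 * K1^-1 * (`|s i.+1| * K1 ^+ i.+1)]_i.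
  have /cvg_ex[l cl] := c1; apply/cvg_ex.
  exists ((1 - q)^-1 * K1^-1 * (l - `|s 0%N| * K1 ^+ 0)).
  have E : [series (1 - q)^-1 * K1^-1 * (`|s i.+1| * K1 ^+ i.+1)]_i =
    fun n => (1 - q)^-1 * K1^-1 * (pseries (fun i => `|s i|) K1 n.+1 - `|s 0%N| * K1 ^+ 0).
    apply/funext => n; rewrite /pseries /series /= -mulr_sumr; congr (_ * _).
    by rewrite [in RHS]big_nat_recl //= addrC addKr.
  rewrite E; apply: cvgM; first exact: cvg_cst.
  by apply: cvgB; [rewrite (cvg_shiftS (pseries _ K1))|exact: cvg_cst].
apply: (series_le_cvg _ _ _ c2) => [n|n|n] /=.
- exact: normr_ge0.
- by rewrite !mulr_ge0 ?invr_ge0 ?exprn_ge0 // ltW.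
rewrite /pseries_diffs normrM normrM normr_nat normrX.
have -> : n.+1%:R * `|s n.+1| * `|z| ^+ n = `|s n.+1| * K1 ^+ n * (n.+1%:R * q ^+ n).
  have kn : K1 ^+ n != 0 by rewrite expf_neq0 // gt_eqF.
  have -> : q ^+ n = `|z| ^+ n / K1 ^+ n by rewrite /q expr_div_n.
  move: (K1 ^+ n) kn (`|z| ^+ n) n.+1%:R => v vn w N.
  by field.
have -> : (1 - q)^-1 * K1^-1 * (`|s n.+1| * K1 ^+ n.+1) = `|s n.+1| * K1 ^+ n * (1 - q)^-1.
  rewrite exprS; move: (K1 ^+ n) => v; by field; rewrite !gt_eqF.
rewrite ler_wpM2l ?mulr_ge0 ?exprn_ge0 ?(ltW K10) //.
rewrite -[leRHS]mul1r ler_pdivlMr //; apply: le_trans (geometric_bound n q0 q1) _.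
by rewrite gerBl exprn_ge0.
Qed.

Lemma represents_derive s r f x : represents s r f x ->
  (forall y, `|y - x| < r -> derivable f y 1) /\ represents (pseries_diffs s) r f^`()%classic x.
Proof.
move=> rep.
have cs w : `|w| < r -> cvgn (pseries s w).
  move=> wr; have := rep (x + w); rewrite addrAC subrr add0r => h.
  by apply/cvg_ex; exists (f (x + w)); exact: h.
have cs1 w : `|w| < r -> cvgn (pseries (pseries_diffs s) w) by exact: diffs_cvg.
have cs2 w : `|w| < r -> cvgn (pseries (pseries_diffs (pseries_diffs s)) w) by exact: diffs_cvg.
have key y : `|y - x| < r -> is_derive y 1 f (limn (pseries (pseries_diffs s) (y - x))).
  move=> yr; pose K := (`|y - x| + r) / 2.
  have [yK Kr] : `|y - x| < K /\ K < r by split; rewrite /K; lra.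
  have K0 : 0 < K by exact: le_lt_trans yK.
  have Kn : `|K| < r by rewrite gtr0_norm.
  have d := @pseries_snd_diffs _ s K (y - x) (cs _ Kn) (cs1 _ Kn) (cs2 _ Kn).
  rewrite (gtr0_norm K0) in d; have {}d := d yK.
  have d2 : is_derive y 1 ((fun z => limn (pseries s z)) \o (fun w => w - x)) (limn (pseries (pseries_diffs s) (y - x))).
    apply: (der_eq (@is_derive1_comp R _ (fun w => w - x) y _ _ d (derB (is_derive_id y 1) (derC x y 1)))).
    by rewrite subr0 mulr1.
  apply: (near_eq_is_derive _ d2).
  apply/near_normP; exists (r - `|y - x|); first by rewrite subr_gt0.
  move=> w wy; apply: cvg_lim => //; apply: rep.
  apply: le_lt_trans (ler_distD y _ _) _; lra.
split=> [y yr|y yr]; first by case: (key y yr).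
rewrite derive1E; have [_ ->] := key y yr.
by have := cs1 _ yr.
Qed.

Lemma analytic_derivable f x : analytic_at f x -> derivable f x 1.
Proof.
by move=> [s [r [r0 /represents_derive[+ _]]]]; apply; rewrite subrr normr0.
Qed.

Lemma analytic_derive f x : analytic_at f x -> analytic_at f^`()%classic x.
Proof. by move=> [s [r [r0 /represents_derive[_ h]]]]; exists (pseries_diffs s), r. Qed.

Lemma analytic_add f g x : analytic_at f x -> analytic_at g x ->
  analytic_at (fun y => f y + g y) x.
Proof.
move=> [s [r [r0 H]]] [s' [r' [r'0 H']]]; exists (fun n => s n + s' n), (Num.min r r').
split; first by rewrite lt_min r0.
move=> y; rewrite lt_min => /andP[yr yr'].
rewrite (_ : pseries _ _ = fun n => pseries s (y - x) n + pseries s' (y - x) n).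
  by apply: cvgD; [exact: H|exact: H'].
apply/funext => n; rewrite /pseries /series /= -big_split /=.
by apply: eq_bigr => i _; rewrite mulrDl.
Qed.

Lemma analytic_scale (a : R) f x : analytic_at f x -> analytic_at (fun y => a * f y) x.
Proof.
move=> [s [r [r0 H]]]; exists (fun n => a * s n), r; split=> // y yr.
rewrite (_ : pseries _ _ = fun n => a * pseries s (y - x) n).
  by apply: cvgM; [exact: cvg_cst|exact: H].
apply/funext => n; rewrite /pseries /series /= mulr_sumr.
by apply: eq_bigr => i _; rewrite mulrA.
Qed.

Lemma analytic_cst (a : R) x : analytic_at (fun _ => a) x.
Proof.
exists (fun n => if n == 0%N then a else 0), 1; split=> // y _.
rewrite -(cvg_shiftS (pseries _ (y - x))).
rewrite (_ : (fun n => _) = fun=> a); first exact: cvg_cst.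
apply/funext => n; rewrite /pseries /series /= big_nat_recl //= expr0 mulr1.
by rewrite big1 ?addr0 // => i _; rewrite mul0r.
Qed.

Lemma analytic_mulX f x : analytic_at f x -> analytic_at (fun y => y * f y) x.
Proof.
move=> Af; have [s [r [r0 H]]] := Af.
suff h : analytic_at (fun y => (y - x) * f y) x.
  have -> : (fun y => y * f y) = fun y => (y - x) * f y + x * f y.
    by apply/funext => y; rewrite mulrBl subrK.
  by apply: analytic_add => //; exact: analytic_scale.
exists (fun n => if n is n'.+1 then s n' else 0), r; split=> // y yr.
rewrite -(cvg_shiftS (pseries _ (y - x))).
rewrite (_ : (fun n => _) = fun n => (y - x) * pseries s (y - x) n).
  by apply: cvgM; [exact: cvg_cst|exact: H].
apply/funext => n; rewrite /pseries /series /= big_nat_recl //= mul0r add0r mulr_sumr.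
by apply: eq_bigr => i _; rewrite exprS mulrCA.
Qed.

(** As [x] may be an end of the interval, the zero reaches it by continuity only; the higher
    coefficients follow by the same argument for the derivatives. *)
Lemma represents_zero s r f x (a b : R) : 0 < r -> represents s r f x -> a < b -> a <= x <= b ->
  (forall y, a < y < b -> f y = 0) -> forall n, s n = 0.
Proof.
move=> r0 + ab axb + n; elim: n s f => [|n IH] s f rep fz; have [df drep] := represents_derive rep.
  have xr : `|x - x| < r by rewrite subrr normr0.
  have fx : f x = s 0%N.
    have := rep _ xr; rewrite subrr -(cvg_shiftS (pseries s 0)) => h.
    have h' : (fun n => pseries s 0 n.+1) @ \oo --> s 0%N.
      rewrite (_ : (fun n => _) = fun=> s 0%N); first exact: cvg_cst.
      apply/funext => n; rewrite /pseries /series /= big_nat_recl //= expr0 mulr1.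
      by rewrite big1 ?addr0 // => i _; rewrite exprS mul0r mulr0.
    exact: (cvg_unique _ h h').
  rewrite -fx; apply/eqP; apply: contraT => fn.
  have fp : 0 < `|f x| by rewrite normr_gt0.
  have cf : {for x, continuous f} by apply/differentiable_continuous/derivable1_diffP/df.
  have [d d0 H] := (continuousP _ _).1 cf _ fp.
  have [ax xb] := andP axb.
  suff [y yab yx] : exists2 y, a < y < b & `|y - x| < d.
    by have := H y yx; rewrite fz // sub0r normrN ltxx.
  (* A point of []a, b[] within [d] of [x] is taken on the side where the interval leaves room. *)
  have [xab|xab] := ltP x ((a + b) / 2).
    exists (Num.min ((a + b) / 2) (x + d / 2)).
      apply/andP; split; first by rewrite lt_min; apply/andP; split; lra.
      by rewrite gt_min; apply/orP; left; lra.
    rewrite gtr0_norm; last by rewrite subr_gt0 lt_min xab /=; lra.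
    have : Num.min ((a + b) / 2) (x + d / 2) <= x + d / 2 by rewrite ge_min lexx orbT.
    lra.
  exists (Num.max ((3 * a + b) / 4) (x - d / 2)).
    apply/andP; split; first by rewrite lt_max; apply/orP; left; lra.
    by rewrite gt_max; apply/andP; split; lra.
  rewrite ltr0_norm; last by rewrite subr_lt0 gt_max; apply/andP; split; lra.
  have : x - d / 2 <= Num.max ((3 * a + b) / 4) (x - d / 2) by rewrite le_max lexx orbT.
  lra.
have dz y : a < y < b -> f^`()%classic y = 0.
  move=> /andP[ay yb]; rewrite derive1E.
  have -> : 'D_1 f y = 'D_1 (fun _ : R => 0 : R) y.
    apply: near_eq_derive; apply/near_normP.
    exists (Num.min (y - a) (b - y)); first by rewrite lt_min !subr_gt0 ay.
    move=> w; rewrite lt_min !ltr_norml => /andP[/andP[w1 w2] /andP[w3 w4]].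
    by apply: fz; apply/andP; split; lra.
  exact: derive_cst.
have := IH _ _ drep dz; rewrite /pseries_diffs => /eqP.
by rewrite mulf_eq0 pnatr_eq0 /= => /eqP.
Qed.

(** The supremum of the [b] with [f = 0] on []0, b[] cannot lie below 1, because the power series at
    it vanishes and extends the zeros beyond. *)
Lemma identity_theorem f (a : R) : 0 < a -> a <= 1 ->
  (forall x, 0 <= x <= 1 -> analytic_at f x) ->
  (forall y, 0 < y < a -> f y = 0) -> forall x, 0 <= x <= 1 -> f x = 0.
Proof.
move=> a0 a1 Af fz.
have ext x b : 0 < b -> b <= 1 -> 0 <= x <= b -> (forall y, 0 < y < b -> f y = 0) ->
    exists2 r, 0 < r & forall y, `|y - x| < r -> f y = 0.
  move=> b0 b1 /andP[x0 xb] fb; have [|s [r [r0 rep]]] := Af x.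
    by rewrite x0 (le_trans xb).
  have xb' : 0 <= x <= b by rewrite x0.
  have s0 := represents_zero r0 rep b0 xb' fb.
  exists r => // y yr; have := rep y yr.
  rewrite (_ : pseries _ _ = fun=> 0).
    have h' : (fun _ : nat => 0 : R) @ \oo --> (0 : R) by exact: cvg_cst.
    by move=> h; exact: (cvg_unique _ h h').
  by apply/funext => n; rewrite /pseries /series /= big1 // => i _; rewrite s0 mul0r.
pose E := [set b | a <= b <= 1 /\ forall y, 0 < y < b -> f y = 0].
have Ea : E a by split; rewrite ?lexx.
have Esup : has_sup E by split; [exists a|exists 1 => b [/andP[]]].
set b := sup E.
have ab : a <= b by exact: ub_le_sup Esup.2 _ Ea.
have b1 : b <= 1 by apply: ge_sup; [exists a|move=> x [/andP[]]].
have b0 : 0 < b by exact: lt_le_trans ab.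
have fb y : 0 < y < b -> f y = 0.
  move=> /andP[y0 yb]; have yb' : 0 < b - y by rewrite subr_gt0.
  have [c [_ Ec] cb] := sup_adherent yb' Esup.
  apply: Ec; rewrite y0 /=; move: cb; rewrite -/b; lra.
have b_eq : b = 1.
  apply/eqP; rewrite eq_le b1 leNgt; apply/negP => blt.
  have [|r r0 fr] := ext b b b0 b1 _ fb; first by rewrite lexx ltW.
  pose c := Num.min 1 (b + r / 2).
  have bc : b < c by rewrite lt_min blt /=; lra.
  have : E c.
    split; first by rewrite (le_trans ab (ltW bc)) /= ge_min lexx.
    move=> y /andP[y0 yc]; have [yb|by_] := ltP y b; first by apply: fb; rewrite y0.
    apply: fr; rewrite ger0_norm ?subr_ge0 //.
    have : c <= b + r / 2 by rewrite ge_min lexx orbT.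
    lra.
  by move=> /(ub_le_sup Esup.2); rewrite leNgt -/b bc.
rewrite b_eq in fb b0.
move=> x x01; have [r r0 fr] := ext x 1 b0 (lexx 1) x01 fb.
by apply: fr; rewrite subrr normr0.
Qed.

(** The induction on the order ranges over all analytic [f]: the chain rule replaces [f] by its
    derivative, which is analytic again. *)
Lemma smooth_comp_analytic (D : set 'rV[R]_2) (F : 'rV[R]_2 -> R) f : open D -> smooth D F ->
  (forall u, D u -> analytic_at f (F u)) ->
  smooth D (fun u => f (F u)) /\
  forall i u, D u -> partial i (fun u => f (F u)) u = partial i F u * f^`()%classic (F u).
Proof.
move=> oD sF.
have der g i u : (forall u, D u -> analytic_at g (F u)) -> D u ->
    is_derive u (delta_mx 0 i) (fun u => g (F u)) (partial i F u * g^`()%classic (F u)).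
  move=> Ag Du; apply: is_derive_comp; first exact/derivableP/smooth_derivable.
  by rewrite derive1E; apply: derivableP; apply: analytic_derivable; exact: Ag.
move=> Af; split; last by move=> i u Du; case: (der f i u Af Du) => _ <-.
move=> k; elim: k f Af => [|k IH] f Af.
  split=> [u Du|//]; apply: (continuous_comp (smooth_cont sF Du)).
  apply/differentiable_continuous/derivable1_diffP/analytic_derivable; exact: Af.
split=> [u Du|i].
  apply: (continuous_comp (smooth_cont sF Du)).
  apply/differentiable_continuous/derivable1_diffP/analytic_derivable; exact: Af.
split=> [u Du|]; first by case: (der f i u Af Du).
apply: (Ck_ext oD (F := fun u => partial i F u * f^`()%classic (F u))).
  by move=> u Du; case: (der f i u Af Du) => _ <-.
apply: CkM => //; first exact: (smooth_partial i sF).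
by apply: IH => u Du; apply: analytic_derive; exact: Af.
Qed.

End Analytic.

(* The values of [f] outside [0, 1] are arbitrary in [analytic_on], so that [f]
   may fail to be differentiable at 0 and 1; its Taylor series there extend it. *)
Lemma analytic_extension (R : realType) (f : R -> R) :
  analytic_on [set t | 0 <= t <= 1] f ->
  exists g : R -> R, (forall t, 0 <= t <= 1 -> g t = f t) /\
    forall t, 0 <= t <= 1 -> analytic_at g t.
Proof.
move=> Af; have I0 : [set t : R | 0 <= t <= 1] 0 by rewrite /= lexx ler01.
have I1 : [set t : R | 0 <= t <= 1] 1 by rewrite /= lexx ler01.
have [s0 [r0 [r00 H0]]] := Af 0 I0; have [s1 [r1 [r10 H1]]] := Af 1 I1.
pose g y : R := if y < 0 then limn (pseries s0 (y - 0)) else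
  if 1 < y then limn (pseries s1 (y - 1)) else f y.
have gf t : 0 <= t <= 1 -> g t = f t.
  by move=> /andP[t0 t1]; rewrite /g ltNge t0 /= ltNge t1.
(* Convergence on one side of the centre already gives convergence in the whole disc. *)
have cvg_out (s : R^nat) (r y : R) : (forall z, 0 <= z < r -> cvgn (pseries s z)) \/
    (forall z, - r < z <= 0 -> cvgn (pseries s z)) -> `|y| < r -> cvgn (pseries s y).
  move=> cs yr; pose z := (`|y| + r) / 2.
  have [yz zr] : `|y| < z /\ z < r by split; rewrite /z; lra.
  have z0 : 0 < z by exact: le_lt_trans yz.
  case: cs => cs.
    apply: (@is_cvg_pseries_inside _ s z); last by rewrite (gtr0_norm z0).
    by apply: cs; rewrite zr ltW.
  apply: (@is_cvg_pseries_inside _ s (- z)); last by rewrite normrN (gtr0_norm z0).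
  by apply: cs; rewrite ltrN2 zr oppr_le0 ltW.
exists g; split=> // t t01; have [t0|tn0] := eqVneq t 0.
  rewrite t0; pose r := Num.min r0 1; exists s0, r; split; first by rewrite lt_min r00 ltr01.
  have r0r : r <= r0 by rewrite ge_min lexx. have r1' : r <= 1 by rewrite ge_min lexx orbT.
  have pos z : 0 <= z < r -> cvgn (pseries s0 z).
    move=> /andP[z0 zr]; apply/cvg_ex; exists (f z); rewrite -[z in pseries s0 z]subr0.
    apply: H0; first by rewrite /= z0 (le_trans (ltW zr)).
    by rewrite subr0 ger0_norm // (lt_le_trans zr).
  move=> y; rewrite subr0 => yr; rewrite /g; have [y0|y0] := ltP y 0.
    by rewrite subr0; exact: (cvg_out _ _ _ (or_introl pos) yr).
  have y1 : y <= 1 by rewrite (le_trans (ler_norm _)) // (le_trans (ltW yr)).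
  rewrite ltNge y1 /= -[y in pseries s0 y]subr0; apply: H0; first by rewrite /= y0.
  by rewrite subr0 (lt_le_trans yr).
have [t1|tn1] := eqVneq t 1.
  rewrite t1; pose r := Num.min r1 1; exists s1, r; split; first by rewrite lt_min r10 ltr01.
  have r1r : r <= r1 by rewrite ge_min lexx. have r1' : r <= 1 by rewrite ge_min lexx orbT.
  have neg z : - r < z <= 0 -> cvgn (pseries s1 z).
    move=> /andP[zr z0]; apply/cvg_ex; exists (f (1 + z)); rewrite -[z in pseries s1 z](addKr 1) addrC.
    apply: H1; first by rewrite /=; apply/andP; split; lra.
    by rewrite addrAC subrr add0r ler0_norm // ltrNl (le_lt_trans _ zr) // lerN2.
  move=> y yr; rewrite /g; have [y1|y1] := ltP 1 y.
    rewrite ltNge (le_trans ler01 (ltW y1)) /=.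
    exact: (cvg_out _ _ _ (or_intror neg) yr).
  have y0 : 0 <= y by move: yr; rewrite ltr_norml => /andP[+ _]; lra.
  rewrite ltNge y0 /=; apply: H1; first by rewrite /= y0.
  exact: lt_le_trans yr _.
have [s [r [rp H]]] := Af t t01.
have [tp tl] : 0 < t /\ t < 1.
  by case/andP: t01 => h0 h1; rewrite !lt_neqAle eq_sym tn0 tn1.
exists s, (Num.min r (Num.min t (1 - t))); split; first by rewrite !lt_min rp tp subr_gt0.
move=> y; rewrite !lt_min => /and3P[yr]; rewrite !ltr_norml => /andP[y1 _] /andP[_ y2].
have y01 : 0 <= y <= 1 by apply/andP; split; lra.
by rewrite gf //; apply: H.
Qed.

(** * The differential equation of [f] *)

Section ODE.
Variable R : realType.
Variables (eps a b c : R) (f : R -> R).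
Hypotheses (eps_pm : eps = 1 \/ eps = -1) (a0 : a != 0) (ab0 : a + b != 0).
Hypothesis A_neq0 : c - eps * a != 0.
Hypothesis f_an : forall t, 0 <= t <= 1 -> analytic_at f t.
Hypothesis f_formula : forall t, 0 < t <= 1 -> 0 < (c - eps * a * (1 - t)) * (c - eps * a) ->
  f t = (- eps * (2 * a + b) * (c - eps * a) * t - (c - eps * a) ^+ 2
         + `|c - eps * a * (1 - t)| `^ ((2 * a + b) / a) * `|c - eps * a| `^ (- (b / a)))
        / (eps * (a + b) * (c - eps * a) * t ^+ 2).

Let A := c - eps * a.
Let s t := c - eps * a * (1 - t).
Let A0 : A != 0. Proof. exact: A_neq0. Qed.
Let eps0 : eps != 0.
Proof. by case: eps_pm => ->; rewrite ?oppr_eq0 oner_neq0. Qed.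
Let eps2 : eps * eps = 1.
Proof. by case: eps_pm => ->; rewrite ?mulrNN mulr1. Qed.
Let al := (2 * a + b) / a.
Let K := `|A| `^ (- (b / a)).

(** The power [g] satisfies [s g' = eps (2 a + b) g]. Differentiating the formula for [f], cleared
    of its denominator, and eliminating [g] leaves the equation. *)
Let ode_near : exists2 d : R, 0 < d & forall t, 0 < t < d ->
  s t * (t * f^`()%classic t + 2 * f t) = eps * (2 * a + b) * (1 + t * f t).
Proof.
have a_gt0 : 0 < `|a| by rewrite normr_gt0.
have A_gt0 : 0 < `|A| by rewrite normr_gt0.
(* For [t < |A| / |a|] the base [s t] keeps the sign of [A], its value at 0; the factor [sg] then
   makes both bases positive. *)
exists (Num.min 1 (`|A| / `|a|)); first by rewrite lt_min ltr01 divr_gt0.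
pose sg := Num.sg A; have sgA : sg * A = `|A| by rewrite normrEsg.
have sg2 : sg * sg = 1 by rewrite /sg -expr2 sqr_sg A0.
have spos t : 0 < t < Num.min 1 (`|A| / `|a|) -> 0 < sg * s t.
  rewrite lt_min => /and3P[t0 _ tA].
  have -> : sg * s t = `|A| + sg * eps * a * t by rewrite -sgA /s /A; ring.
  have : `|sg * eps * a * t| < `|A|.
    have e1 : `|eps| = 1 by case: eps_pm => ->; rewrite ?normrN normr1.
    by rewrite !normrM e1 normr_sg A0 !mul1r (gtr0_norm t0) mulrC -ltr_pdivlMr.
  by rewrite ltr_norml => /andP[+ _]; lra.
have sE t : 0 < t < Num.min 1 (`|A| / `|a|) -> `|s t| = sg * s t.
  by move=> /spos st; rewrite -[RHS](gtr0_norm st) normrM /sg normr_sg A0 mul1r.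
pose g t := (sg * s t) `^ al * K.
have fE t : 0 < t < Num.min 1 (`|A| / `|a|) ->
    f t * (eps * (a + b) * A * (t * t)) = - eps * (2 * a + b) * A * t - A * A + g t.
  move=> td; rewrite f_formula.
  - rewrite -/A -/(s t) -/al -/K sE // -/(g t); move: td; rewrite lt_min => /and3P[t0 _ _].
    have tn : t != 0 by rewrite gt_eqF.
    by move: (g t) => G; field; rewrite eps0 A0 tn ab0.
  - by move: td; rewrite lt_min => /and3P[-> /ltW -> _].
  have := spos t td => st; rewrite -/A -/(s t).
  have -> : s t * A = (sg * s t) * (sg * A) by rewrite mulrACA sg2 mul1r.
  by rewrite mulr_gt0 // sgA.
have dg t : 0 < t < Num.min 1 (`|A| / `|a|) ->
    is_derive t 1 g (al * (sg * s t) `^ (al - 1) * (sg * (eps * a)) * K).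
  move=> td; have st := spos t td.
  have ds : is_derive t 1 (fun t => sg * s t) (sg * (eps * a)).
    apply: (der_eq (derM (derC sg t (1 : R)) (derB (derC c t (1 : R)) (derM (derC (eps * a) t (1 : R)) (derB (derC 1 t (1 : R)) (is_derive_id t 1)))))).
    ring.
  apply: (der_eq (derM (@is_derive1_comp R (fun x => x `^ al) (fun t => sg * s t) t _ _ (is_derive1_powR al st) ds) (derC K t (1 : R)))).
  by rewrite mulr0 add0r mulrC.
move=> t td; have st := spos t td; have [t0 t1 tA] : [/\ 0 < t, t < 1 & t < `|A| / `|a|].
  by move: td; rewrite lt_min => /and3P[-> -> ->].
have df : derivable f t 1.
  by apply/analytic_derivable/f_an; rewrite (ltW t0) (ltW t1).
have E : f^`()%classic t * (eps * (a + b) * A * (t * t)) + f t * (eps * (a + b) * A * (2 * t)) =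
    - eps * (2 * a + b) * A + al * (sg * s t) `^ (al - 1) * (sg * (eps * a)) * K.
  have d1 : is_derive t 1 (fun t => f t * (eps * (a + b) * A * (t * t)))
     (f^`()%classic t * (eps * (a + b) * A * (t * t)) + f t * (eps * (a + b) * A * (2 * t))).
    have df' : is_derive t 1 f (f^`()%classic t) by rewrite derive1E; exact: derivableP.
    apply: (der_eq (derM df' (derM (derC (eps * (a + b) * A) t (1 : R)) (derM (is_derive_id t 1) (is_derive_id t 1))))).
    move: (f^`()%classic t) (f t) => x y; ring.
  have d2 : is_derive t 1 (fun t => - eps * (2 * a + b) * A * t - A * A + g t)
     (- eps * (2 * a + b) * A + al * (sg * s t) `^ (al - 1) * (sg * (eps * a)) * K).
    apply: (der_eq (derD (derB (derM (derC (- eps * (2 * a + b) * A) t (1 : R)) (is_derive_id t 1)) (derC (A * A) t (1 : R))) (dg t td))).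
    by rewrite mulr0 addr0 mulr1 subr0.
  have d3 : is_derive t 1 (fun t => f t * (eps * (a + b) * A * (t * t)))
     (- eps * (2 * a + b) * A + al * (sg * s t) `^ (al - 1) * (sg * (eps * a)) * K).
    apply: (near_eq_is_derive _ d2); apply/near_normP.
    exists (Num.min t (Num.min 1 (`|A| / `|a|) - t)).
      by rewrite lt_min t0 subr_gt0; case/andP: td.
    move=> w; rewrite lt_min !ltr_norml => /andP[/andP[w1 w2] /andP[w3 w4]].
    by apply/esym/fE; apply/andP; split; lra.
  by case: d1 => _ <-; case: d3 => _ <-.
have pw : (sg * s t) * (sg * s t) `^ (al - 1) = (sg * s t) `^ al.
  have xn : sg * s t != 0 by rewrite gt_eqF.
  move: (sg * s t) (ltW st) xn => x x0 xn.
  have e : 1 + (al - 1) = al by rewrite addrC subrK.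
  by rewrite -[in RHS]e (powRD (r := 1)) ?powRr1 //; apply/implyP.
have sg' : s t * (al * (sg * s t) `^ (al - 1) * (sg * (eps * a)) * K) = eps * (2 * a + b) * g t.
  rewrite /g -pw /al; move: (_ `^ _) => P; by field.
have sF := fE t td.
have tn : eps * (a + b) * A * t != 0.
  by rewrite !mulf_neq0 // gt_eqF.
apply: (mulfI tn).
have E2 : s t * (f^`()%classic t * (eps * (a + b) * A * (t * t)) + f t * (eps * (a + b) * A * (2 * t))) =
    s t * (- eps * (2 * a + b) * A) + eps * (2 * a + b) * g t.
  by rewrite E mulrDr sg'.
have gE : g t = f t * (eps * (a + b) * A * (t * t)) + eps * (2 * a + b) * A * t + A * A.
  by rewrite sF; ring.
rewrite gE in E2.
have sA : s t = A + eps * a * t by rewrite /s /A; ring.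
transitivity (s t * (f^`()%classic t * (eps * (a + b) * A * (t * t)) + f t * (eps * (a + b) * A * (2 * t)))).
  move: (f^`()%classic t) (f t) => x y; ring.
rewrite E2 sA; move: (f t) => x; ring: eps2.
Qed.

(** The formula speaks of [f] only where the two bases have the same sign; the identity theorem
    carries the equation from a neighbourhood of 0 to all of [[0, 1]]. *)
Lemma f_ode t : 0 <= t <= 1 ->
  (c - eps * a * (1 - t)) * (t * f^`()%classic t + 2 * f t) = eps * (2 * a + b) * (1 + t * f t).
Proof.
move=> t01; have [d d0 H] := ode_near.
(* The difference of the two sides, built only from sums, scalar multiples and multiplication by the
   variable, which preserve analyticity by the lemmas above. *)
pose W t := A * (t * f^`()%classic t) + (A * 2) * f t
  + ((eps * a) * (t * (t * f^`()%classic t)) + (eps * a * 2) * (t * f t))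
  + (- (eps * (2 * a + b)) + - (eps * (2 * a + b)) * (t * f t)).
have WE x : W x = s x * (x * f^`()%classic x + 2 * f x) - eps * (2 * a + b) * (1 + x * f x).
  by rewrite /W /s /A; move: (f^`()%classic x) (f x) => y z; ring.
have AW x : 0 <= x <= 1 -> analytic_at W x.
  move=> x01; have Af := f_an x01; have Adf := analytic_derive Af.
  by rewrite /W; repeat first [exact: analytic_cst | exact: Af | exact: Adf
    | apply: analytic_add | apply: analytic_scale | apply: analytic_mulX].
have : W t = 0.
  apply: (@identity_theorem _ W (Num.min 1 d)) => //.
  - by rewrite lt_min ltr01.
  - by rewrite ge_min lexx.
  - by move=> y; rewrite lt_min => /and3P[y0 _ yd]; rewrite WE H ?subrr // y0.
by rewrite WE => /eqP; rewrite subr_eq0 => /eqP.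
Qed.

End ODE.

(** * The algebra behind the equation for [q] *)

Section QAlgebra.
Variable C : numFieldType.
Variables (eps a b c : C) (g00 g01 g11 h0 h1 nu nu0 nu1 t t' be : C).
(* [Gk_ij] stands for [Gamma_ij^k] and [bk_ij] for [d_k B_ij]. *)
Variables (G0_00 G0_01 G0_11 G1_00 G1_01 G1_11 : C).
Variables (b0_00 b0_01 b0_11 b1_00 b1_01 b1_11 : C).

(** [t] and [t'] play the roles of [tau] and its conjugate but are independent here; [B] is the
    general form that is null on [d_0 - t d_1] and on [d_0 - t' d_1]. *)
Let B00 := t * t' * be.
Let B01 := (t + t') / 2 * be.
Let B11 := be.
Let dg := g00 * g11 - g01 * g01.
Let sg := c - eps * a * (nu * nu).

Hypotheses (be0 : be != 0) (tt' : t - t' != 0) (sg0 : sg != 0) (dg0 : dg != 0) (ab0 : a + b != 0).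
Hypothesis weingarten0 : dg * nu0 = - (B00 * (g11 * h0 - g01 * h1) + B01 * (g00 * h1 - g01 * h0)).
Hypothesis weingarten1 : dg * nu1 = - (B01 * (g11 * h0 - g01 * h1) + B11 * (g00 * h1 - g01 * h0)).
Hypothesis codazzi0 : b0_01 - b1_00 = - (G0_01 * B00 + G1_01 * B01) + (G0_00 * B01 + G1_00 * B11)
  - eps * nu * (h0 * g01 - h1 * g00).
Hypothesis codazzi1 : b0_11 - b1_01 = - (G0_11 * B00 + G1_11 * B01) + (G0_01 * B01 + G1_01 * B11)
  - eps * nu * (h0 * g11 - h1 * g01).
Hypothesis W : (a + b) * (B00 * B11 - B01 * B01) = sg * dg.
Hypothesis dW0 : (a + b) * (b0_00 * B11 + B00 * b0_11 - 2 * (B01 * b0_01)) =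
  - (2 * eps * a * nu * nu0) * dg + sg * (2 * (G0_00 + G1_01) * dg).
Hypothesis dW1 : (a + b) * (b1_00 * B11 + B00 * b1_11 - 2 * (B01 * b1_01)) =
  - (2 * eps * a * nu * nu1) * dg + sg * (2 * (G0_01 + G1_11) * dg).

(** Let [Z = d_0 - t d_1] and [Z' = d_0 - t' d_1]. Then [E], [E'] and [F] are [I(Z, Z)], [I(Z', Z')]
    and [I(Z, Z')]; [et] and [et'] are the values of [dh], [N] and [N'] those of the differential of
    [nu]; [r] is [II(Z, Z')], and [D] is the determinant of [I] in the frame [Z], [Z']. *)
Let E := g00 - 2 * t * g01 + t * t * g11.
Let E' := g00 - 2 * t' * g01 + t' * t' * g11.
Let F := g00 - (t + t') * g01 + t * t' * g11.
Let et := h0 - t * h1.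
Let et' := h0 - t' * h1.
Let r := - (be * (t - t') * (t - t') / 2).
Let D := dg * ((t - t') * (t - t')).
Let N := nu0 - t * nu1.
Let N' := nu0 - t' * nu1.
(** [c0] and [c1] are the components of [nabla_Z' Z], where [x] is [- Z' t] expressed through the
    derivatives of [II]; in the frame, [nabla_Z' Z = p Z + s Z']. *)
Let c0 := G0_00 - (t + t') * G0_01 + t * t' * G0_11.
Let Z'B := b0_00 - t' * b1_00 - 2 * t * (b0_01 - t' * b1_01) + t * t * (b0_11 - t' * b1_11).
Let x := Z'B / (be * (t - t')).
Let c1 := G1_00 - (t + t') * G1_01 + t * t' * G1_11 + x.
Let s := (c1 + t * c0) / (t - t').
Let p := (c1 + t' * c0) / (t' - t).
Let kap := eps * (2 * a + b) / sg.

Ltac fld := by field; rewrite ?pnatr_eq0 ?be0 ?tt' ?sg0.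

Let DN : D * N = - r * (E * et' - F * et).
Proof.
have -> : D * N = (t - t') * (t - t') * (dg * nu0 - t * (dg * nu1)) by rewrite /D /N; ring.
rewrite weingarten0 weingarten1 /B00 /B01 /B11 /r /E /F /et /et'; fld.
Qed.

Let DN' : D * N' = - r * (E' * et - F * et').
Proof.
have -> : D * N' = (t - t') * (t - t') * (dg * nu0 - t' * (dg * nu1)) by rewrite /D /N'; ring.
rewrite weingarten0 weingarten1 /B00 /B01 /B11 /r /E' /F /et /et'; fld.
Qed.

Let Dr : (a + b) * (r * r) = - sg * D.
Proof.
have -> : - sg * D = - (sg * dg) * ((t - t') * (t - t')) by rewrite /D; ring.
rewrite -W /r /B00 /B01 /B11; fld.
Qed.

(** Codazzi turns the derivative of [II] along [Z'] into one along [Z], which the derivative of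
    [(a + b) det II = sg det I] determines. The factor [2 a + b] is a sum: [a] from the derivative
    of [sg], and [a + b] from the curvature term of Codazzi, brought to a multiple of [N] by
    [DN]. *)
Let shear : 2 * s = kap * nu * N.
Proof.
pose C0 := - (G0_01 * B00 + G1_01 * B01) + (G0_00 * B01 + G1_00 * B11)
  - eps * nu * (h0 * g01 - h1 * g00).
pose C1 := - (G0_11 * B00 + G1_11 * B01) + (G0_01 * B01 + G1_01 * B11)
  - eps * nu * (h0 * g11 - h1 * g01).
pose ZB := (b0_00 + t * t' * b0_11 - (t + t') * b0_01) - t * (b1_00 + t * t' * b1_11 - (t + t') * b1_01).
have e2 : Z'B = (t' - t) * (C0 - t * C1) + ZB.
  by rewrite /C0 /C1 -codazzi0 -codazzi1 /Z'B /ZB; ring.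
have e3 : (a + b) * (be * ZB) = - (2 * eps * a * nu * N) * dg +
    2 * ((G0_00 + G1_01) - t * (G0_01 + G1_11)) * ((a + b) * (B00 * B11 - B01 * B01)).
  have -> : (a + b) * (be * ZB) = (a + b) * (b0_00 * B11 + B00 * b0_11 - 2 * (B01 * b0_01))
      - t * ((a + b) * (b1_00 * B11 + B00 * b1_11 - 2 * (B01 * b1_01))).
    by rewrite /ZB /B00 /B01 /B11; fld.
  by rewrite dW0 dW1 W /N; ring.
have e1 : 2 * s * (be * (t - t') * (t - t')) = 2 * (be * (t - t') * (G1_00 - (t + t') * G1_01 + t * t' * G1_11 + t * c0)) + 2 * Z'B.
  by rewrite /s /c1 /x; fld.
have key : (a + b) * (be * (2 * s * (be * (t - t') * (t - t')))) =
    2 * (- (2 * eps * a * nu * N) * dg) - (a + b) * (2 * be * (eps * nu * (E * et' - F * et))).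
  rewrite e1 e2.
  have -> : (a + b) * (be * (2 * (be * (t - t') * (G1_00 - (t + t') * G1_01 + t * t' * G1_11 + t * c0)) +
      2 * ((t' - t) * (C0 - t * C1) + ZB))) =
    (a + b) * (be * (2 * (be * (t - t') * (G1_00 - (t + t') * G1_01 + t * t' * G1_11 + t * c0)) +
      2 * ((t' - t) * (C0 - t * C1)))) + 2 * ((a + b) * (be * ZB)) by ring.
  by rewrite e3 /C0 /C1 /c0 /B00 /B01 /B11 /E /F /et /et'; fld.
have k2 : (a + b) * (be * (be * (t - t') * (t - t'))) * sg * (2 * s) =
    (a + b) * (be * (be * (t - t') * (t - t'))) * (eps * (2 * a + b) * nu * N).
  have w : (a + b) * (be * (be * (t - t') * (t - t'))) = - 4 * (sg * dg).
    by rewrite -W /B00 /B01 /B11; fld.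
  have dn : be * (E * et' - F * et) = 2 * dg * N.
    apply: (mulfI (mulf_neq0 tt' tt')).
    have := DN; rewrite /D /r => h.
    have -> : (t - t') * (t - t') * (2 * dg * N) = 2 * (dg * ((t - t') * (t - t')) * N) by ring.
    by rewrite h; fld.
  have -> : (a + b) * (be * (be * (t - t') * (t - t'))) * sg * (2 * s) =
     sg * ((a + b) * (be * (2 * s * (be * (t - t') * (t - t'))))) by ring.
  rewrite key w.
  have -> : sg * (2 * (- (2 * eps * a * nu * N) * dg) - (a + b) * (2 * be * (eps * nu * (E * et' - F * et)))) =
    sg * (2 * (- (2 * eps * a * nu * N) * dg) - (a + b) * (2 * (eps * nu * (be * (E * et' - F * et))))) by ring.
  by rewrite dn; ring.
have w0 : (a + b) * (be * (be * (t - t') * (t - t'))) != 0 by rewrite !mulf_neq0.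
apply: (mulfI w0); apply: (mulfI sg0).
have -> : sg * ((a + b) * (be * (be * (t - t') * (t - t'))) * (2 * s)) =
  (a + b) * (be * (be * (t - t') * (t - t'))) * sg * (2 * s) by ring.
by rewrite k2 /kap; fld.
Qed.

Variables (f f' : C).
Let tt := 1 - nu * nu.
Hypothesis norm_h : dg * tt = g11 * h0 * h0 - 2 * g01 * h0 * h1 + g00 * h1 * h1.
Hypothesis ode : sg * (tt * f' + 2 * f) = eps * (2 * a + b) * (1 + tt * f).

Let q := E + f * (et * et).
Let q' := E' + f * (et' * et').
Let P := F + f * (et * et').

Let tD : tt * D = E' * et * et + E * et' * et' - 2 * F * et * et'.
Proof.
have -> : tt * D = (t - t') * (t - t') * (dg * tt) by rewrite /D; ring.
by rewrite norm_h /E /E' /F /et /et'; ring.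
Qed.

Let kode : tt * f' + 2 * f = kap * (1 + tt * f).
Proof. by apply: (mulfI sg0); rewrite ode /kap; field. Qed.

(** [Qc1] and [Qc2] are the cofactors of [q] and [q'] in [bracket]. They are polynomial, hence
    remain smooth where [et] or [tt] vanishes. *)
Definition Qc1 (f f' kap et et' q' P tt : C) :=
  et * (kap * f - f') * (et' * et' - tt * q' + tt * f * (et' * et'))
  - kap * P * et' + 2 * f * et * (q' - f * (et' * et')).
Definition Qc2 (f f' kap et tt : C) :=
  et * (kap * f - f') * (et * et + tt * f * (et * et)) + 2 * f' * (et * et * et)
  - 2 * f * f * (et * et * et).

(** The differential equation of [f] enters here. Up to the factor [nu * r], the left side collects
    the terms of [D] times [Z' q] other than [2 * p * D * q]; the equation turns it into a
    combination of [q] and [q']. *)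
Let bracket : - kap * (E * et' - F * et) * P + 2 * f' * (E' * et - F * et') * (et * et)
    + 2 * f * et * D = Qc1 f f' kap et et' q' P tt * q + Qc2 f f' kap et tt * q'.
Proof.
have DE : D = E * E' - F * F by rewrite /D /E /E' /F /dg; ring.
have td := tD; rewrite DE in td; rewrite DE.
move: kode td; rewrite /q /q' /P /Qc1 /Qc2; move: kap E E' F et et' tt => k e e' ff x1 x2 y ko td.
(* In terms of [m] the differential equation reads [k = 2 f - y m]. This eliminates [k] and [f']
   polynomially, and the difference of the two sides becomes a multiple of the relation [td]. *)
pose m := k * f - f'.
have f'E : f' = k * f - m by rewrite /m; ring.
have kE : k = 2 * f - y * m by rewrite -[LHS](addrK (y * (k * f))) -[k in k + _]mulr1; apply/eqP;
  rewrite subr_eq; apply/eqP; transitivity (k * (1 + y * f)); [ring|rewrite -ko /m; ring].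
have td0 : x1 * m * (y * (e * e' - ff * ff) - (e' * x1 * x1 + e * x2 * x2 - 2 * ff * x1 * x2)) = 0.
  by rewrite td subrr mulr0.
apply/eqP; rewrite -subr_eq0; apply/eqP.
rewrite -[RHS]td0 f'E kE. ring.
Qed.

(* [dq] is the derivative of [q] along [d_0 - t' d_1]. *)
Let Dq_equation (dq : C) :
  dq = (2 * p * E + 2 * s * F) - f' * (2 * nu * N') * (et * et) + 2 * f * et * (p * et + s * et' + nu * r) ->
  D * dq = (2 * p * D + nu * r * Qc1 f f' kap et et' q' P tt) * q + nu * r * Qc2 f f' kap et tt * q'.
Proof.
move=> ->.
have -> : (2 * p * D + nu * r * Qc1 f f' kap et et' q' P tt) * q + nu * r * Qc2 f f' kap et tt * q' =
  2 * p * D * q + nu * r * (Qc1 f f' kap et et' q' P tt * q + Qc2 f f' kap et tt * q') by ring.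
rewrite -bracket.
have -> : D * (2 * p * E + 2 * s * F - f' * (2 * nu * N') * (et * et) + 2 * f * et * (p * et + s * et' + nu * r)) =
  2 * p * D * q + 2 * s * D * P - 2 * nu * f' * (D * N') * (et * et) + 2 * f * et * (nu * r * D).
  by rewrite /q /P; ring.
rewrite shear DN'.
have -> : kap * nu * N * D = kap * nu * (D * N) by ring.
by rewrite DN; ring.
Qed.

Variables (q0 q1 dt0 dt1 : C).
Let T_ hj hk := f * (hj * hk).
Let k_ (nui hij hik hj hk : C) := - f' * (2 * nu * nui) * (hj * hk) + f * (hij * hk + hik * hj).
Let h00 := G0_00 * h0 + G1_00 * h1 + B00 * nu.
Let h01 := G0_01 * h0 + G1_01 * h1 + B01 * nu.
Let h11 := G0_11 * h0 + G1_11 * h1 + B11 * nu.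

(** The hypotheses on [dt0] and [dt1] are [II(Z, Z) = 0] differentiated. Those on [q0] and [q1] are
    the derivatives of [T(Z, Z)], with the derivatives of the metric and of [dh] expressed by
    Christoffel symbols and the Hessian of the height. *)
Lemma Q_equation :
  be * (t - t') * dt0 = - (b0_00 - 2 * t * b0_01 + t * t * b0_11) ->
  be * (t - t') * dt1 = - (b1_00 - 2 * t * b1_01 + t * t * b1_11) ->
  q0 = (2 * (G0_00 * g00 + G1_00 * g01) + k_ nu0 h00 h00 h0 h0)
     - 2 * t * (G0_00 * g01 + G1_00 * g11 + G0_01 * g00 + G1_01 * g01 + k_ nu0 h00 h01 h0 h1)
     + t * t * (2 * (G0_01 * g01 + G1_01 * g11) + k_ nu0 h01 h01 h1 h1)
     + 2 * (t * (g11 + T_ h1 h1) - (g01 + T_ h0 h1)) * dt0 ->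
  q1 = (2 * (G0_01 * g00 + G1_01 * g01) + k_ nu1 h01 h01 h0 h0)
     - 2 * t * (G0_01 * g01 + G1_01 * g11 + G0_11 * g00 + G1_11 * g01 + k_ nu1 h01 h11 h0 h1)
     + t * t * (2 * (G0_11 * g01 + G1_11 * g11) + k_ nu1 h11 h11 h1 h1)
     + 2 * (t * (g11 + T_ h1 h1) - (g01 + T_ h0 h1)) * dt1 ->
  q0 - t' * q1 =
  (2 * ((G1_00 - (t + t') * G1_01 + t * t' * G1_11 - (dt0 - t' * dt1) + t' * c0) / (t' - t))
    + nu * r * Qc1 f f' kap et et' q' P tt / D) * q + nu * r * Qc2 f f' kap et tt * q' / D.
Proof.
move=> hd0 hd1 -> ->.
have D0 : D != 0 by rewrite /D !mulf_neq0.
have bt : be * (t - t') != 0 by rewrite mulf_neq0.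
have xE : x = - (dt0 - t' * dt1).
  apply: (mulfI bt); rewrite /x mulrC divfK //.
  have -> : be * (t - t') * (- (dt0 - t' * dt1)) = - (be * (t - t') * dt0) + t' * (be * (t - t') * dt1) by ring.
  by rewrite hd0 hd1 /Z'B; ring.
have pE : (G1_00 - (t + t') * G1_01 + t * t' * G1_11 - (dt0 - t' * dt1) + t' * c0) / (t' - t) = p.
  by rewrite /p /c1 xE.
rewrite pE; apply: (mulfI D0).
have -> : D * ((2 * p + nu * r * Qc1 f f' kap et et' q' P tt / D) * q + nu * r * Qc2 f f' kap et tt * q' / D) =
  (2 * p * D + nu * r * Qc1 f f' kap et et' q' P tt) * q + nu * r * Qc2 f f' kap et tt * q'.
  by move: (Qc1 _ _ _ _ _ _ _ _) (Qc2 _ _ _ _ _) (p) D0 => x1 x2 x3 D0; field.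
apply: Dq_equation.
have cs : c0 = p + s.
  by rewrite /p /s; field; rewrite tt' -oppr_eq0 opprB tt'.
have c1s : c1 = - (t * p + t' * s).
  by rewrite /p /s; field; rewrite tt' -oppr_eq0 opprB tt'.
(* Trading [G0_00] and [G1_00] for [p] and [s] allows these two to be treated as free variables by
   [field]. *)
have G0E : G0_00 = p + s + (t + t') * G0_01 - t * t' * G0_11 by rewrite -cs /c0; ring.
have G1E : G1_00 = - (t * p + t' * s) + (t + t') * G1_01 - t * t' * G1_11 + (dt0 - t' * dt1).
  by rewrite -c1s /c1 xE; ring.
clearbody x; rewrite /k_ /T_ /h00 /h01 /h11 G0E G1E /N' /E /F /et /et' /r /B00 /B01 /B11.
clearbody p s.
by fld.
Qed.

End QAlgebra.

(** * Structure equations *)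

(* Vectors of [R^4] are functions on [nat] restricted to [0, 1, 2, 3]. *)
Section FormAlgebra.
Variables (R : realType) (eps : R).
Implicit Types X Y : nat -> R.

Definition ip X Y := X 0%N * Y 0%N + X 1%N * Y 1%N + eps * (X 2%N * Y 2%N) + X 3%N * Y 3%N.

Lemma ipC X Y : ip X Y = ip Y X.
Proof. by rewrite /ip; ring. Qed.

Variables (x p0 p1 n : nat -> R).
Hypotheses (eps2 : eps * eps = 1) (xx : ip x x = eps) (x0 : ip x p0 = 0) (x1 : ip x p1 = 0).
Hypotheses (xn : ip x n = 0) (nn : ip n n = 1) (n0 : ip p0 n = 0) (n1 : ip p1 n = 0).
Let dg := ip p0 p0 * ip p1 p1 - ip p0 p1 * ip p0 p1.
Hypothesis dg0 : dg != 0.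

(** A linear relation between [x], [p0], [p1] and [n], paired with each of them, must be trivial,
    since their Gram matrix is block diagonal with determinant [eps * dg]. *)
Lemma frame_decomposition Y : exists k : nat -> R,
  forall m, (m < 4)%N -> Y m = k 0%N * x m + k 1%N * p0 m + k 2%N * p1 m + k 3%N * n m.
Proof.
pose r (i : nat) := nth x [:: x; p0; p1; n] i.
pose M : 'M[R]_4 := \matrix_(i, j) r i j.
have eps0 : eps != 0 by apply/eqP => e0; move: eps2; rewrite e0 mul0r => /eqP; rewrite eq_sym oner_eq0.
have Msum (v : 'rV[R]_4) (j : 'I_4) : (v *m M) 0 j =
    v 0 (inord 0) * x j + v 0 (inord 1) * p0 j + v 0 (inord 2) * p1 j + v 0 (inord 3) * n j.
  rewrite !mxE !big_ord_recl big_ord0 /= !mxE /= addr0 !addrA.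
  by do 3?[congr (_ + _)]; congr (v _ _ * _); apply/val_inj; rewrite /= inordK.
have Mu : M \in unitmx.
  rewrite unitmxE unitfE; apply/negP => /det0P[v v0 vM].
  have key k0 k1 k2 k3 : (forall j, (j < 4)%N -> k0 * x j + k1 * p0 j + k2 * p1 j + k3 * n j = 0) ->
      [/\ k0 = 0, k1 = 0, k2 = 0 & k3 = 0].
    move=> H; have L X : k0 * ip x X + k1 * ip p0 X + k2 * ip p1 X + k3 * ip n X = 0.
      have -> : k0 * ip x X + k1 * ip p0 X + k2 * ip p1 X + k3 * ip n X =
        (k0 * x 0%N + k1 * p0 0%N + k2 * p1 0%N + k3 * n 0%N) * X 0%N
        + (k0 * x 1%N + k1 * p0 1%N + k2 * p1 1%N + k3 * n 1%N) * X 1%N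
        + eps * ((k0 * x 2%N + k1 * p0 2%N + k2 * p1 2%N + k3 * n 2%N) * X 2%N)
        + (k0 * x 3%N + k1 * p0 3%N + k2 * p1 3%N + k3 * n 3%N) * X 3%N by rewrite /ip; ring.
      by rewrite !H // !mul0r mulr0 !addr0.
    have := L x; rewrite xx (ipC p0) x0 (ipC p1) x1 (ipC n) xn !mulr0 !addr0 => /eqP.
    rewrite mulf_eq0 (negbTE eps0) orbF => /eqP k00.
    have := L n; rewrite xn n0 n1 nn !mulr0 !add0r mulr1 => k30.
    have := L p0; rewrite x0 (ipC p1) (ipC n) n0 !mulr0 addr0 add0r => e0.
    have := L p1; rewrite x1 (ipC n) n1 !mulr0 addr0 add0r => e1.
    have k10 : dg * k1 = 0.
      have -> : dg * k1 = ip p1 p1 * (k1 * ip p0 p0 + k2 * ip p0 p1) - ip p0 p1 * (k1 * ip p0 p1 + k2 * ip p1 p1).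
        by rewrite /dg; ring.
      by rewrite e0 e1 !mulr0 subrr.
    have k20 : dg * k2 = 0.
      have -> : dg * k2 = ip p0 p0 * (k1 * ip p0 p1 + k2 * ip p1 p1) - ip p0 p1 * (k1 * ip p0 p0 + k2 * ip p0 p1).
        by rewrite /dg; ring.
      by rewrite e0 e1 !mulr0 subrr.
    by split=> //; apply: (mulfI dg0); rewrite mulr0.
  have [|a0 a1 a2 a3] := key (v 0 (inord 0)) (v 0 (inord 1)) (v 0 (inord 2)) (v 0 (inord 3)).
    by move=> j j4; have := Msum v (Ordinal j4); rewrite vM mxE => /esym.
  move: v0 => /negP; apply; apply/eqP/rowP => i; rewrite mxE -(inord_val i).
  by case: i => [[|[|[|[|i]]]] i4].
pose w := (\row_(j < 4) Y j) *m invmx M.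
exists (fun k => w 0 (inord k)) => m m4.
by rewrite -(Msum w (Ordinal m4)) /w mulmxKV // mxE.
Qed.

(** Parseval's identity for the frame [x], [p0], [p1], [n], cleared of the denominator [dg]. The
    structure equations are read off from it by a choice of [X] and [Y]. *)
Lemma form_completeness X Y :
  dg * (ip X Y - eps * (ip X x * ip Y x) - ip X n * ip Y n) =
  ip p1 p1 * (ip X p0 * ip Y p0) - ip p0 p1 * (ip X p0 * ip Y p1 + ip X p1 * ip Y p0)
  + ip p0 p0 * (ip X p1 * ip Y p1).
Proof.
have [k kY] := frame_decomposition Y.
have L Z : ip Z Y = k 0%N * ip Z x + k 1%N * ip Z p0 + k 2%N * ip Z p1 + k 3%N * ip Z n.
  by rewrite {1}/ip !kY // /ip; ring.
rewrite (ipC Y x) (ipC Y n) (ipC Y p0) (ipC Y p1) !L.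
rewrite xx x0 x1 xn nn (ipC n x) (ipC n p0) (ipC n p1) (ipC p0 x) (ipC p1 x) xn x0 x1 n0 n1 (ipC p1 p0).
rewrite /dg; ring: eps2.
Qed.

End FormAlgebra.

(* Locked: the unifier would otherwise unfold [partial] when comparing
   derivatives in different directions. *)
HB.lock Definition dX (R : realType) (i : 'I_2) (X : nat -> 'rV[R]_2 -> R) (m : nat)
  (u : 'rV[R]_2) : R := partial i (X m) u.

Section StructureEquations.
Variables (R : realType) (eps : R) (D : set 'rV[R]_2).
Local Notation plane := 'rV[R]_2.
Local Notation field := (nat -> plane -> R).
Implicit Types (X Y : field) (i j k : 'I_2) (u : plane).

Definition ev X u : nat -> R := fun m => X m u.
Definition fsmooth X := forall m, smooth D (X m).

Hypotheses (oD : open D) (eps2 : eps * eps = 1).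

Lemma dXE i X m : dX i X m = partial i (X m). Proof. by apply/funext => u; rewrite dX.unlock. Qed.

Lemma fsmooth_dX i X : fsmooth X -> fsmooth (dX i X).
Proof. by move=> sX m; rewrite dXE; exact: smooth_partial. Qed.

Lemma smooth_ip X Y : fsmooth X -> fsmooth Y -> smooth D (fun u => ip eps (ev X u) (ev Y u)).
Proof.
move=> sX sY; apply: (smoothD oD); last by apply: (smoothM oD); [exact: sX|exact: sY].
apply: (smoothD oD); last first.
  by apply: (smoothM oD); [exact: smooth_cst|apply: (smoothM oD); [exact: sX|exact: sY]].
by apply: (smoothD oD); apply: (smoothM oD); try exact: sX; exact: sY.
Qed.

Lemma partial_ip i X Y u : fsmooth X -> fsmooth Y -> D u ->
  partial i (fun u => ip eps (ev X u) (ev Y u)) u =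
  ip eps (ev (dX i X) u) (ev Y u) + ip eps (ev X u) (ev (dX i Y) u).
Proof.
move=> sX sY Du.
have d Z m : fsmooth Z -> is_derive u (delta_mx 0 i) (Z m) (partial i (Z m) u).
  by move=> sZ; apply: derivableP; exact: smooth_derivable (sZ m) Du.
have dM m : is_derive u (delta_mx 0 i) (fun v => X m v * Y m v)
    (X m u * partial i (Y m) u + Y m u * partial i (X m) u).
  exact: (derM (d X m sX) (d Y m sY)).
have [_ E] := derD (derD (derD (dM 0%N) (dM 1%N)) (derM (derC eps u (delta_mx 0 i)) (dM 2%N))) (dM 3%N).
rewrite [LHS]E /ip /ev !dXE mulr0 addr0.
move: (partial i (X 0%N) u) (partial i (X 1%N) u) (partial i (X 2%N) u) (partial i (X 3%N) u).
move: (partial i (Y 0%N) u) (partial i (Y 1%N) u) (partial i (Y 2%N) u) (partial i (Y 3%N) u).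
by move=> *; ring.
Qed.

Lemma ip_cst i X Y (e : R) u : fsmooth X -> fsmooth Y -> D u ->
  (forall v, D v -> ip eps (ev X v) (ev Y v) = e) ->
  ip eps (ev X u) (ev (dX i Y) u) = - ip eps (ev (dX i X) u) (ev Y u).
Proof.
move=> sX sY Du H; apply/eqP; rewrite -addr_eq0 addrC; apply/eqP.
by rewrite -partial_ip // (partial_ext i oD Du H) partial_cst.
Qed.

Lemma dX_sym X u : fsmooth X -> D u -> ev (dX 0 (dX 1 X)) u = ev (dX 1 (dX 0 X)) u.
Proof. by move=> sX Du; apply/funext => m; rewrite /ev !dXE; exact: Schwarz oD (sX m 2%N) Du. Qed.

Lemma dX_sym2 X u i j : fsmooth X -> D u -> ev (dX i (dX j X)) u = ev (dX j (dX i X)) u.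
Proof.
move=> sX Du; have s := dX_sym sX Du.
by elim/forall2: i; elim/forall2: j; [exact: erefl|exact: s|exact: esym s|exact: erefl].
Qed.

Lemma dX_ext X Y u i : D u -> (forall v, D v -> ev X v = ev Y v) -> ev (dX i X) u = ev (dX i Y) u.
Proof.
move=> Du H; apply/funext => m; rewrite /ev !dXE; apply: (partial_ext i oD Du) => v Dv.
exact: (congr1 (fun f => f m) (H v Dv)).
Qed.

Variables P n : field.
Hypotheses (sP : fsmooth P) (sn : fsmooth n).
(** Applied to the position [P], this gives a normal of [M^2(eps) x R] in [R^4], as the vertical
    coordinate is absent from the equation of [M^2(eps)]. *)
Definition horizontal X : field := fun m => if m == 3%N then fun _ => 0 else X m.
Local Notation x := (horizontal P).
Local Notation p i := (dX i P).
Local Notation "<< X , Y >>" := (fun u => ip eps (ev X u) (ev Y u)).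
Definition gI i j u := ip eps (ev (p i) u) (ev (p j) u).
Definition gII i j u := ip eps (ev (dX i (p j)) u) (ev n u).
Definition gam i j k u := ip eps (ev (dX i (p j)) u) (ev (p k) u).
Definition detI u := gI 0 0 u * gI 1 1 u - gI 0 1 u * gI 0 1 u.
Definition detII u := gII 0 0 u * gII 1 1 u - gII 0 1 u * gII 0 1 u.

Hypothesis xx : forall u, D u -> ip eps (ev x u) (ev x u) = eps.
Hypothesis xn : forall u, D u -> ip eps (ev x u) (ev n u) = 0.
Hypothesis nn : forall u, D u -> ip eps (ev n u) (ev n u) = 1.
Hypothesis pn : forall i u, D u -> ip eps (ev (p i) u) (ev n u) = 0.
Hypothesis dI : forall u, D u -> detI u != 0.

Lemma fsmooth_hor X : fsmooth X -> fsmooth (horizontal X).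
Proof. by move=> sX m; rewrite /horizontal; case: (m == 3%N); [exact: smooth_cst|exact: sX]. Qed.

Lemma ip_dhor i X u Z : ip eps (ev (dX i (horizontal X)) u) Z =
  ip eps (ev (dX i X) u) Z - partial i (X 3%N) u * Z 3%N.
Proof. by rewrite /ip /ev !dXE /horizontal /= partial_cst; ring. Qed.

Let sx : fsmooth x := fsmooth_hor sP.
Let sp i : fsmooth (p i) := fsmooth_dX i sP.

Lemma gI_sym i j u : gI i j u = gI j i u. Proof. exact: ipC. Qed.
Lemma gII_sym i j u : D u -> gII i j u = gII j i u.
Proof. by move=> Du; rewrite /gII /gam (dX_sym2 i j sP Du). Qed.
Lemma gam_sym i j k u : D u -> gam i j k u = gam j i k u.
Proof. by move=> Du; rewrite /gII /gam (dX_sym2 i j sP Du). Qed.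

Lemma smooth_gI i j : smooth D (gI i j).
Proof. exact: (smooth_ip (sp i) (sp j)). Qed.
Lemma smooth_gII i j : smooth D (gII i j).
Proof. exact: (smooth_ip (fsmooth_dX i (sp j)) sn). Qed.
Lemma smooth_gam i j k : smooth D (gam i j k).
Proof. exact: (smooth_ip (fsmooth_dX i (sp j)) (sp k)). Qed.

Lemma xp i u : D u -> ip eps (ev x u) (ev (p i) u) = 0.
Proof.
move=> Du; have := ip_cst i sx sx Du xx; rewrite ip_dhor ipC ip_dhor {2 4}/ev /horizontal /= mulr0 subr0 => /eqP.
rewrite ipC -addr_eq0 -mulr2n mulrn_eq0 /= => /eqP.
by rewrite ipC.
Qed.

(** Up to normalisation, the second fundamental form of [M^2(eps) x R] in [R^4] along the surface:
    the metric without its vertical part. The ambient curvature terms below come from it. *)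
Lemma xpp i j u : D u -> ip eps (ev x u) (ev (dX i (p j)) u) =
  - (gI i j u - partial i (P 3%N) u * partial j (P 3%N) u).
Proof.
move=> Du; rewrite (ip_cst i sx (sp j) Du (fun v Dv => xp j Dv)) ip_dhor.
by rewrite [X in _ * X]/ev dXE.
Qed.

Lemma pN i j u : D u -> ip eps (ev (p j) u) (ev (dX i n) u) = - gII i j u.
Proof. by move=> Du; exact: (ip_cst i (sp j) sn Du (fun v Dv => pn j Dv)). Qed.

Lemma nN i u : D u -> ip eps (ev n u) (ev (dX i n) u) = 0.
Proof.
move=> Du; have := ip_cst i sn sn Du nn => /eqP.
by rewrite ipC -addr_eq0 -mulr2n mulrn_eq0 /= => /eqP; rewrite ipC.
Qed.

Lemma xN i u : D u -> ip eps (ev x u) (ev (dX i n) u) = partial i (P 3%N) u * n 3%N u.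
Proof. by move=> Du; rewrite (ip_cst i sx sn Du xn) ip_dhor pn // sub0r opprK. Qed.

Lemma completeness u (X Y : nat -> R) : D u ->
  detI u * (ip eps X Y - eps * (ip eps X (ev x u) * ip eps Y (ev x u)) - ip eps X (ev n u) * ip eps Y (ev n u)) =
  gI 1 1 u * (ip eps X (ev (p 0) u) * ip eps Y (ev (p 0) u))
  - gI 0 1 u * (ip eps X (ev (p 0) u) * ip eps Y (ev (p 1) u) + ip eps X (ev (p 1) u) * ip eps Y (ev (p 0) u))
  + gI 0 0 u * (ip eps X (ev (p 1) u) * ip eps Y (ev (p 1) u)).
Proof.
move=> Du; apply: (form_completeness eps2 (xx Du) (xp 0 Du) (xp 1 Du) (xn Du) (nn Du) (pn 0 Du) (pn 1 Du)).
exact: dI.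
Qed.

Let vert : nat -> R := fun m => (m == 3%N)%:R.
Let ip_vert (X : nat -> R) : ip eps vert X = X 3%N.
Proof. by rewrite /ip /vert /=; ring. Qed.

(** Parseval for the vertical unit vector, whose tangential part is the gradient of the height and
    whose normal component is the angle. *)
Lemma norm_dh u : D u -> detI u * (1 - n 3%N u * n 3%N u) =
  gI 1 1 u * partial 0 (P 3%N) u * partial 0 (P 3%N) u
  - 2 * gI 0 1 u * partial 0 (P 3%N) u * partial 1 (P 3%N) u
  + gI 0 0 u * partial 1 (P 3%N) u * partial 1 (P 3%N) u.
Proof.
move=> Du; have := completeness vert vert Du; rewrite !ip_vert /vert /= {1 2}/ev /horizontal /= !mulr0 subr0.
rewrite /ev !dXE => ->.
move: (partial 0 (P 3%N) u) (partial 1 (P 3%N) u) => a b; ring.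
Qed.

Lemma weingarten i u : D u -> detI u * partial i (n 3%N) u =
  - (gII i 0 u * (gI 1 1 u * partial 0 (P 3%N) u - gI 0 1 u * partial 1 (P 3%N) u)
     + gII i 1 u * (gI 0 0 u * partial 1 (P 3%N) u - gI 0 1 u * partial 0 (P 3%N) u)).
Proof.
move=> Du; have := completeness vert (ev (dX i n) u) Du.
have e k : ip eps (ev (dX i n) u) (ev (p k) u) = - gII i k u by rewrite ipC pN // gII_sym.
have e' : ip eps (ev (dX i n) u) (ev n u) = 0 by rewrite ipC nN.
rewrite !ip_vert !e e' {1 2}/ev {2}/horizontal /= mul0r mulr0 mulr0 !subr0.
rewrite /ev !dXE => ->.
move: (partial 0 (P 3%N) u) (partial 1 (P 3%N) u) => a b; ring.
Qed.

(** Christoffel symbols of the second kind, obtained by Cramer's rule from those of the first kind,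
    [gam]. *)
Definition Gam (k i j : 'I_2) u : R := (detI u)^-1 *
  (if k == 0 then gI 1 1 u * gam i j 0 u - gI 0 1 u * gam i j 1 u
   else gI 0 0 u * gam i j 1 u - gI 0 1 u * gam i j 0 u).

Lemma Gam_sym k i j u : D u -> Gam k i j u = Gam k j i u.
Proof. by move=> Du; rewrite /Gam (gam_sym i j 0 Du) (gam_sym i j 1 Du). Qed.

Lemma smooth_detI : smooth D detI.
Proof. by apply: (smoothB oD); apply: (smoothM oD); exact: smooth_gI. Qed.

Lemma smooth_Gam k i j : smooth D (Gam k i j).
Proof.
apply: (smoothM oD); first by apply: (smoothV oD) => //; exact: smooth_detI.
elim/forall2: k; (apply: (smoothB oD); apply: (smoothM oD);
  [exact: smooth_gI|exact: smooth_gam|exact: smooth_gI|exact: smooth_gam]).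
Qed.

Lemma gamE i j k u : D u -> gam i j k u = Gam 0 i j u * gI 0 k u + Gam 1 i j u * gI 1 k u.
Proof.
move=> Du; have := dI Du; rewrite /Gam /=.
by elim/forall2: k; rewrite ?(gI_sym 1 0) /detI;
  move: (gam i j 0 u) (gam i j 1 u) (gI 0 0 u) (gI 0 1 u) (gI 1 1 u) => x0 x1 x2 x3 x4 h; field.
Qed.

Lemma partial_gI k i j u : D u -> partial k (gI i j) u = gam k i j u + gam k j i u.
Proof.
move=> Du; rewrite [LHS](partial_ip k (sp i) (sp j) Du).
by congr (_ + _); rewrite ipC.
Qed.

Lemma hessian_height i j u : D u -> partial i (partial j (P 3%N)) u =
  Gam 0 i j u * partial 0 (P 3%N) u + Gam 1 i j u * partial 1 (P 3%N) u + gII i j u * n 3%N u.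
Proof.
move=> Du; have := completeness vert (ev (dX i (p j)) u) Du.
rewrite !ip_vert -/(gII i j u) -/(gam i j 0 u) -/(gam i j 1 u).
rewrite {1 2}/ev {2}/horizontal /= mul0r mulr0 subr0 /ev !dXE => E.
have d0 := dI Du; apply: (mulfI d0).
move: E; rewrite mulrBr => /eqP; rewrite subr_eq => /eqP ->.
rewrite /Gam /=.
move: (gam i j 0 u) (gam i j 1 u) (partial 0 (P 3%N) u) (partial 1 (P 3%N) u) (detI u) d0 => x0 x1 x2 x3 x4 d0.
by field.
Qed.

Local Notation h i := (partial i (P 3%N)).

(** The third derivatives of [P] cancel and the products of [d_j d_k P] with [d_i n] are expanded in
    the frame. The tangential parts give the Christoffel terms; the components along [x], known from
    [xN] and [xpp], give the curvature term. *)
Lemma codazzi k u : D u -> partial 0 (gII 1 k) u - partial 1 (gII 0 k) u =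
  - (Gam 0 1 k u * gII 0 0 u + Gam 1 1 k u * gII 0 1 u)
  + (Gam 0 0 k u * gII 1 0 u + Gam 1 0 k u * gII 1 1 u)
  - eps * n 3%N u * (h 0 u * gI 1 k u - h 1 u * gI 0 k u).
Proof.
move=> Du; have pg i j : partial i (gII j k) u = ip eps (ev (dX i (dX j (p k))) u) (ev n u) +
    ip eps (ev (dX j (p k)) u) (ev (dX i n) u).
  by rewrite [LHS](partial_ip i (fsmooth_dX j (sp k)) sn Du).
have key i j : detI u * ip eps (ev (dX j (p k)) u) (ev (dX i n) u) =
   detI u * (- (Gam 0 j k u * gII i 0 u + Gam 1 j k u * gII i 1 u)
     - eps * n 3%N u * (h i u * (gI j k u - h j u * h k u))).
  have := completeness (ev (dX j (p k)) u) (ev (dX i n) u) Du.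
  have e l : ip eps (ev (dX i n) u) (ev (p l) u) = - gII i l u by rewrite ipC pN // gII_sym.
  have e' : ip eps (ev (dX i n) u) (ev n u) = 0 by rewrite ipC nN.
  have ex : ip eps (ev (dX i n) u) (ev x u) = h i u * n 3%N u by rewrite ipC xN.
  have ex' : ip eps (ev (dX j (p k)) u) (ev x u) = - (gI j k u - h j u * h k u) by rewrite ipC xpp.
  rewrite !e e' ex ex' mulr0 subr0 -/(gam j k 0 u) -/(gam j k 1 u) mulrBr => /eqP.
  rewrite subr_eq => /eqP ->; have d0 := dI Du; rewrite /Gam /=.
  move: (gam j k 0 u) (gam j k 1 u) (h i u) (h j u) (h k u) (detI u) d0 => x0 x1 x2 x3 x4 x5 d0.
  by field.
have {}key i j := mulfI (dI Du) (key i j).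
rewrite !pg !key (dX_sym (sp k) Du).
move: (ip _ _ _) (h 0 u) (h 1 u) (h k u) => x0 x1 x2 x3; ring.
Qed.

(* The left-hand side is [\sum_k riemann g k u * g u k 0]. *)
Lemma gauss u : D u ->
  gI 0 0 u * (partial 0 (Gam 0 1 1) u - partial 1 (Gam 0 0 1) u
    + (Gam 0 1 1 u * Gam 0 0 0 u - Gam 0 0 1 u * Gam 0 1 0 u)
    + (Gam 1 1 1 u * Gam 0 0 1 u - Gam 1 0 1 u * Gam 0 1 1 u)) +
  gI 1 0 u * (partial 0 (Gam 1 1 1) u - partial 1 (Gam 1 0 1) u
    + (Gam 0 1 1 u * Gam 1 0 0 u - Gam 0 0 1 u * Gam 1 1 0 u)
    + (Gam 1 1 1 u * Gam 1 0 1 u - Gam 1 0 1 u * Gam 1 1 1 u)) =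
  detII u + eps * (n 3%N u * n 3%N u) * detI u.
Proof.
move=> Du.
have dgam i j l k : partial i (gam j l k) u = ip eps (ev (dX i (dX j (p l))) u) (ev (p k) u) +
    ip eps (ev (dX j (p l)) u) (ev (dX i (p k)) u).
  by rewrite [LHS](partial_ip i (fsmooth_dX j (sp l)) (sp k) Du).
have dG i j l k : partial i (gam j l k) u =
  partial i (Gam 0 j l) u * gI 0 k u + Gam 0 j l u * (gam i 0 k u + gam i k 0 u)
  + (partial i (Gam 1 j l) u * gI 1 k u + Gam 1 j l u * (gam i 1 k u + gam i k 1 u)).
  rewrite (partial_ext i oD Du (fun v Dv => gamE j l k Dv)).
  have dd (F : plane -> R) : smooth D F -> is_derive u (delta_mx 0 i) F (partial i F u).
    by move=> sF; apply: derivableP; exact: smooth_derivable sF Du.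
  have [_ E] := derD (derM (dd _ (smooth_Gam 0 j l)) (dd _ (smooth_gI 0 k)))
                 (derM (dd _ (smooth_Gam 1 j l)) (dd _ (smooth_gI 1 k))).
  rewrite [LHS]E !partial_gI //; move: (partial i (Gam 0 j l) u) (partial i (Gam 1 j l) u) => x0 x1; ring.
(* In this antisymmetric combination the third derivatives of [P] cancel. *)
have E : partial 0 (gam 1 1 0) u - partial 1 (gam 0 1 0) u =
    ip eps (ev (dX 1 (p 1)) u) (ev (dX 0 (p 0)) u) - ip eps (ev (dX 0 (p 1)) u) (ev (dX 0 (p 1)) u).
  rewrite !dgam (dX_sym (sp 1) Du) (dX_sym sP Du).
  by move: (ip _ _ _) (ip _ _ _) (ip _ _ _) => x0 x1 x2; ring.
(* Expanded in the frame, the components along [n] will produce [det II] and those along [x] the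
   ambient curvature. *)
have key i j k l : detI u * ip eps (ev (dX i (p j)) u) (ev (dX k (p l)) u) =
   detI u * ((Gam 0 i j u * gam k l 0 u + Gam 1 i j u * gam k l 1 u)
     + eps * ((gI i j u - h i u * h j u) * (gI k l u - h k u * h l u)) + gII i j u * gII k l u).
  have := completeness (ev (dX i (p j)) u) (ev (dX k (p l)) u) Du.
  have ex i1 j1 : ip eps (ev (dX i1 (p j1)) u) (ev x u) = - (gI i1 j1 u - h i1 u * h j1 u) by rewrite ipC xpp.
  rewrite !ex -/(gam i j 0 u) -/(gam i j 1 u) -/(gam k l 0 u) -/(gam k l 1 u) -/(gII i j u) -/(gII k l u).
  have d0 := dI Du; rewrite /Gam /=.
  move: (ip _ _ _) (gam i j 0 u) (gam i j 1 u) (gam k l 0 u) (gam k l 1 u) (h i u) (h j u) (h k u) (h l u) (detI u) d0 => x x0 x1 x2 x3 x4 x5 x6 x7 x8 d0 E0.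
  have -> : x8 * x = gI 1 1 u * (x0 * x2) - gI 0 1 u * (x0 * x3 + x1 * x2) + gI 0 0 u * (x1 * x3)
     + x8 * (eps * ((gI i j u - x4 * x5) * (gI k l u - x6 * x7)) + gII i j u * gII k l u).
    by rewrite -E0; ring.
  by field.
have {}key i j k l := mulfI (dI Du) (key i j k l).
rewrite !key !dG in E.
have dh := norm_dh Du.
rewrite (Gam_sym 0 1 0 Du) (Gam_sym 1 1 0 Du) (gI_sym 1 0 u).
rewrite (gI_sym 1 0 u) !gamE // (gI_sym 1 0 u) in E.
have -> : detII u + eps * (n 3%N u * n 3%N u) * detI u =
  detII u + eps * detI u - eps * (detI u * (1 - n 3%N u * n 3%N u)) by ring.
rewrite dh /detII.
rewrite ?(Gam_sym 0 1 0 Du) ?(Gam_sym 1 1 0 Du) in E.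
move: E; rewrite /detI.
move: (partial 0 (Gam 0 1 1) u) (partial 1 (Gam 0 0 1) u) (partial 0 (Gam 1 1 1) u) (partial 1 (Gam 1 0 1) u) (h 0 u) (h 1 u) (Gam 0 0 0 u) (Gam 1 0 0 u) (Gam 0 0 1 u) (Gam 1 0 1 u) (Gam 0 1 1 u) (Gam 1 1 1 u) (gI 0 0 u) (gI 0 1 u) (gI 1 1 u) (gII 0 0 u) (gII 0 1 u) (gII 1 1 u).
move=> x0 x1 x2 x3 x4 x5 x6 x7 x8 x9 y0 y1 y2 y3 y4 y5 y6 y7 E.
apply/eqP; rewrite -subr_eq0; apply/eqP.
move: E => /eqP; rewrite -subr_eq0 => /eqP <-; ring.
Qed.

End StructureEquations.

(** * From vectors to components *)

Section Components.
Variable R : realType.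
Local Notation plane := 'rV[R]_2.
Local Notation space := ('rV[R]_3 * R)%type.

Lemma is_derive_linear (W W' : normedModType R) (L : W -> W') (F : plane -> W) u v (d : W) :
  (forall k x, L (k *: x) = k *: L x) -> (forall x y, L (x + y) = L x + L y) -> continuous L ->
  is_derive u v F d -> is_derive u v (fun w => L (F w)) (L d).
Proof.
move=> LZ LD cL [dF <-].
have LB x y : L (x - y) = L x - L y by rewrite -[- y]scaleN1r LD LZ scaleN1r.
have E : (fun h : R => h^-1 *: (L (F (h *: v + u)) - L (F u))) =
    L \o (fun h : R => h^-1 *: (F (h *: v + u) - F u)).
  by apply/funext => h; rewrite /= LZ LB.
have c : (fun h : R => h^-1 *: (L (F (h *: v + u)) - L (F u))) @ 0^' --> L ('D_v F u).
  by rewrite E; apply: continuous_cvg; [exact: cL|exact: dF].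
by apply: DeriveDef; [apply/cvg_ex; exists (L ('D_v F u))|exact: cvg_lim c].
Qed.

Lemma Ck_linear k (W W' : normedModType R) (L : W -> W') (D : set plane) (F : plane -> W) :
  (forall k x, L (k *: x) = k *: L x) -> (forall x y, L (x + y) = L x + L y) -> continuous L ->
  open D -> Ck k D F -> Ck k D (fun w => L (F w)).
Proof.
move=> LZ LD cL oD; elim: k F => [|k IH] F [cF dF].
  by split=> // u Du; apply: continuous_comp; [exact: cF|exact: cL].
split=> [u Du|i]; first by apply: continuous_comp; [exact: cF|exact: cL].
have [de Ci] := dF i.
have key u : D u -> is_derive u (delta_mx 0 i) (fun w => L (F w)) (L (partial i F u)).
  by move=> Du; apply: is_derive_linear => //; apply: derivableP; exact: de.
split=> [u Du|]; first by case: (key u Du).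
by apply: (Ck_ext oD _ (IH _ Ci)) => u /key[_ <-].
Qed.

(** Every index from 3 on returns the vertical coordinate, so that [fsmooth], which quantifies over
    all indices, can hold. *)
Definition comp (X : space) (m : nat) : R :=
  match m with 0%N => X.1 0 0 | 1%N => X.1 0 1 | 2%N => X.1 0 2%:R | _ => X.2 end.

Lemma innerE eps (X Y : space) : inner eps X Y = ip eps (comp X) (comp Y).
Proof. by []. Qed.

Definition comp_field (F : plane -> space) (m : nat) (u : plane) : R := comp (F u) m.

Let basis (m : nat) : space := (\row_i (i == m :> nat)%:R, (m == 3%N)%:R).

Lemma comp_basis (X : space) :
  X = comp X 0 *: basis 0 + comp X 1 *: basis 1 + comp X 2 *: basis 2 + comp X 3 *: basis 3.
Proof.
case: X => x y; rewrite /comp /basis /=; congr (_, _); last first.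
  by rewrite /= /GRing.scale /= !mulr0 !add0r mulr1.
apply/rowP => i; rewrite !mxE /=.
by case: i => [[|[|[|//]]] h]; rewrite /= ?mulr0 ?mulr1 ?addr0 ?add0r; congr (x _ _); apply/val_inj.
Qed.

Lemma is_derive_comp_field (F : plane -> space) u v (d : nat -> R) :
  (forall m, is_derive u v (comp_field F m) (d m)) ->
  is_derive u v F (d 0%N *: basis 0 + d 1%N *: basis 1 + d 2%N *: basis 2 + d 3%N *: basis 3).
Proof.
move=> H.
have key m : is_derive u v (fun w => comp_field F m w *: basis m) (d m *: basis m).
  apply: (is_derive_linear (L := fun r : R => r *: basis m) _ _ _ (H m)).
  - by move=> k x; rewrite /= -scalerA.
  - by move=> x y; rewrite scalerDl.
  - by move=> x; exact: scalel_continuous.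
have -> : F = fun w => comp_field F 0 w *: basis 0 + comp_field F 1 w *: basis 1
   + comp_field F 2 w *: basis 2 + comp_field F 3 w *: basis 3.
  by apply/funext => w; exact: comp_basis.
exact: (is_deriveD (is_deriveD (is_deriveD (key 0%N) (key 1%N)) (key 2%N)) (key 3%N)).
Qed.

Lemma comp_continuous m : continuous (comp ^~ m).
Proof.
have c i : continuous (fun X : space => X.1 0 i).
  by move=> X; apply: (@continuous_comp _ _ _ fst (fun x : 'rV[R]_3 => x 0 i)); [exact: cvg_fst|exact: coord_continuous].
by case: m => [|[|[|m]]]; [exact: c|exact: c|exact: c|move=> X; exact: cvg_snd].
Qed.

Lemma compD m (X Y : space) : comp (X + Y) m = comp X m + comp Y m.
Proof. by case: m => [|[|[|m]]] //=; rewrite mxE. Qed.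

Lemma compZ m k (X : space) : comp (k *: X) m = k * comp X m.
Proof. by case: m => [|[|[|m]]] //=; rewrite mxE. Qed.

Lemma fsmooth_comp_field (D : set plane) F : open D -> smooth D F -> fsmooth D (comp_field F).
Proof.
move=> oD sF m k; apply: (Ck_linear (L := comp ^~ m)) => // [r x|x y|].
- exact: compZ.
- exact: compD.
- exact: comp_continuous.
Qed.

(** Smoothness is assumed for the components only; the derivative of [F] is assembled from theirs
    first. *)
Lemma comp_derive (D : set plane) F u v m : open D -> fsmooth D (comp_field F) -> D u ->
  comp ('D_v F u) m = 'D_v (comp_field F m) u.
Proof.
move=> oD sF Du.
have dm k : is_derive u v (comp_field F k) ('D_v (comp_field F k) u).
  apply: derivableP; apply/diff_derivable.
  by have [] := smooth_is_diff oD (sF k) Du.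
have dF : is_derive u v F ('D_v F u) by apply: derivableP; case: (is_derive_comp_field dm).
by case: (is_derive_linear (L := comp ^~ m) (compZ m) (compD m) (@comp_continuous m) dF) => _ <-.
Qed.

Lemma comp_partial (D : set plane) F u i : open D -> fsmooth D (comp_field F) -> D u ->
  comp (partial i F u) = ev (dX i (comp_field F)) u.
Proof.
move=> oD sF Du; apply/funext => m; rewrite /ev dXE; exact: comp_derive oD sF Du.
Qed.

Lemma comp_partial2 (D : set plane) F u i j : open D -> fsmooth D (comp_field F) -> D u ->
  comp (partial i (partial j F) u) = ev (dX i (dX j (comp_field F))) u.
Proof.
move=> oD sF Du.
have E v : D v -> ev (comp_field (partial j F)) v = ev (dX j (comp_field F)) v.
  by move=> Dv; exact: comp_partial oD sF Dv.
have s' : fsmooth D (comp_field (partial j F)).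
  move=> m; apply: (smooth_ext oD _ (fsmooth_dX j sF m)) => v Dv.
  exact/esym/(congr1 (fun f => f m) (E v Dv)).
by rewrite (comp_partial i oD s' Du) (dX_ext oD i Du E).
Qed.

Lemma first_formE eps (D : set plane) F u i j : open D -> fsmooth D (comp_field F) -> D u ->
  first_form eps F u i j = gI eps (comp_field F) i j u.
Proof.
move=> oD sF Du; rewrite mxE /gI -(comp_partial i oD sF Du) -(comp_partial j oD sF Du).
exact: erefl.
Qed.

Lemma second_formE eps (D : set plane) F n u i j : open D -> fsmooth D (comp_field F) -> D u ->
  second_form eps F n u i j = gII eps (comp_field F) (comp_field n) i j u.
Proof.
move=> oD sF Du; rewrite mxE /gII -(comp_partial2 i j oD sF Du); exact: erefl.
Qed.

End Components.

Lemma sum2 (V : nmodType) (F : 'I_2 -> V) : \sum_i F i = F 0 + F 1.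
Proof. by rewrite !big_ord_recl big_ord0 addr0; congr (_ + F _); apply/val_inj. Qed.

Lemma det2 (R : comRingType) (A : 'M[R]_2) : \det A = A 0 0 * A 1 1 - A 0 1 * A 1 0.
Proof.
rewrite (expand_det_row A 0) sum2 /cofactor !det_mx11 !mxE /= !expr0 !expr1 mul1r mulN1r mulrN.
by congr (_ * A _ _ - _ * A _ _); apply/val_inj.
Qed.

Lemma posdef2 (R : realType) (A : 'M[R]_2) : A 1 0 = A 0 1 -> posdef A ->
  0 < A 0 0 /\ 0 < A 0 0 * A 1 1 - A 0 1 * A 0 1.
Proof.
move=> sA pA.
have q (v : 'rV[R]_2) : (v *m A *m v^T) 0 0 =
    v 0 0 * v 0 0 * A 0 0 + 2 * (v 0 0 * v 0 1 * A 0 1) + v 0 1 * v 0 1 * A 1 1.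
  by rewrite !mxE sum2 !mxE !sum2 sA; ring.
have A0 : 0 < A 0 0.
  have /pA : (delta_mx 0 0 : 'rV[R]_2) != 0.
    by apply/eqP => /rowP/(_ 0); rewrite !mxE /= => /eqP; rewrite oner_eq0.
  by rewrite q !mxE /= !(mulr1, mul0r, mulr0, mul1r, addr0).
split=> //.
(* On this vector the form takes the value [A 0 0 * \det A]. *)
pose v : 'rV[R]_2 := - A 0 1 *: delta_mx 0 0 + A 0 0 *: delta_mx 0 1.
have v0 : v != 0.
  apply/eqP => /rowP/(_ 1); rewrite !mxE /= mulr0 add0r mulr1 => A00.
  by rewrite A00 ltxx in A0.
have := pA v v0; rewrite q !mxE /= !(mulr1, mulr0, addr0, add0r).
have -> : - A 0 1 * - A 0 1 * A 0 0 + 2 * (- A 0 1 * A 0 0 * A 0 1) + A 0 0 * A 0 0 * A 1 1 =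
  A 0 0 * (A 0 0 * A 1 1 - A 0 1 * A 0 1) by ring.
by rewrite pmulr_rgt0.
Qed.

(** * Smoothness of the normal, and patches *)

Section NormalField.
Variables (R : realType) (eps : R) (D : set 'rV[R]_2).
Local Notation field := (nat -> 'rV[R]_2 -> R).
Hypotheses (oD : open D) (eps2 : eps * eps = 1).

Let det3 (a b c : nat -> R) i j k := a i * (b j * c k - b k * c j) - a j * (b i * c k - b k * c i)
  + a k * (b i * c j - b j * c i).
(** The cross product of three vectors of [R^4]: cofactors of a determinant of order 4, with the
    index raised by the form, whence [eps] in slot 2. Its norm is a Gram determinant, see
    [cross_norm]. *)
Let cross (a b c : nat -> R) (m : nat) : R := match m with
  | 0%N => det3 a b c 1 2 3 | 1%N => - det3 a b c 0 2 3 | 2%N => eps * det3 a b c 0 1 3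
  | _ => - det3 a b c 0 1 2 end.

Let cross_orth a b c : [/\ ip eps (cross a b c) a = 0, ip eps (cross a b c) b = 0 & ip eps (cross a b c) c = 0].
Proof. by rewrite /ip /cross /det3; split; ring: eps2. Qed.

Let cross_norm a b c : ip eps (cross a b c) (cross a b c) =
  eps * (ip eps a a * (ip eps b b * ip eps c c - ip eps b c * ip eps b c)
   - ip eps a b * (ip eps a b * ip eps c c - ip eps b c * ip eps a c)
   + ip eps a c * (ip eps a b * ip eps b c - ip eps b b * ip eps a c)).
Proof. by rewrite /ip /cross /det3; ring: eps2. Qed.

Variables P n : field.
Hypothesis sP : fsmooth D P.
Local Notation p i := (dX i P).
Local Notation x := (horizontal P).
Hypothesis xx : forall u, D u -> ip eps (ev x u) (ev x u) = eps.
Hypothesis xn : forall u, D u -> ip eps (ev x u) (ev n u) = 0.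
Hypothesis nn : forall u, D u -> ip eps (ev n u) (ev n u) = 1.
Hypothesis pn : forall i u, D u -> ip eps (ev (p i) u) (ev n u) = 0.
Hypothesis dI : forall u, D u -> 0 < detI eps P u.
Hypothesis B0 : forall u, D u -> 0 < gII eps P n 0 0 u.

(* The normal is the cross product normalised by a smooth factor, since the
   positivity of [II] determines its sign. *)
Lemma fsmooth_normal m : (m < 4)%N -> smooth D (n m).
Proof.
move=> m4; pose V m u := cross (ev x u) (ev (p 0) u) (ev (p 1) u) m.
pose s u := ip eps (ev (dX 0 (p 0)) u) (ev V u).
have sp i := fsmooth_dX i sP; have sx := fsmooth_hor sP.
have sV : fsmooth D V.
  have s3 i j k : smooth D (fun u => det3 (ev x u) (ev (p 0) u) (ev (p 1) u) i j k).
    have m2 (X Y : field) a b : fsmooth D X -> fsmooth D Y ->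
        smooth D (fun u => ev X u a * ev Y u b - ev X u b * ev Y u a).
      by move=> sX sY; exact: (smoothB oD (smoothM oD (sX a) (sY b)) (smoothM oD (sX b) (sY a))).
    have M a b := m2 _ _ a b (sp 0) (sp 1).
    exact: (smoothD oD (smoothB oD (smoothM oD (sx i) (M j k)) (smoothM oD (sx j) (M i k))) (smoothM oD (sx k) (M i j))).
  move=> [|[|[|k]]]; first exact: s3.
  - exact: (smoothN oD (s3 _ _ _)).
  - exact: (smoothM oD (smooth_cst D eps) (s3 _ _ _)).
  - exact: (smoothN oD (s3 _ _ _)).
have ss : smooth D s by exact: (smooth_ip eps oD (fsmooth_dX 0 (sp 0)) sV).
have sd : smooth D (detI eps P).
  by apply: (smoothB oD); apply: (smoothM oD); exact: (smooth_gI eps oD sP).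
(* [V = w n] with [w^2 = det I], the sign of [w] being unknown; [s] is [gII 0 0] times [w], so the
   product [V s] is a positive multiple of [n]. *)
have key u : D u -> 0 < s u * s u * detI eps P u /\ n m u = V m u * s u / Num.sqrt (s u * s u * detI eps P u).
  move=> Du; have d0 := lt0r_neq0 (dI Du).
  have [V0 V1 V2] := cross_orth (ev x u) (ev (p 0) u) (ev (p 1) u).
  have xp i : ip eps (ev x u) (ev (p i) u) = 0 by exact: (xp oD sP xx).
  have comp X : ip eps X (ev V u) = ip eps X (ev n u) * ip eps (ev V u) (ev n u).
    have := form_completeness eps2 (xx Du) (xp 0) (xp 1) (xn Du) (nn Du) (pn 0 Du) (pn 1 Du) d0 X (ev V u).
    rewrite [ip eps (ev V u) (ev x u)]V0 [ip eps (ev V u) (ev (p 0) u)]V1 [ip eps (ev V u) (ev (p 1) u)]V2.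
    rewrite !(mulr0, addr0, subr0) => /eqP; rewrite mulf_eq0 => /orP[h|]; last by rewrite subr_eq0 => /eqP.
    by move: d0; rewrite /detI /gI (eqP h) eqxx.
  set w := ip eps (ev V u) (ev n u) in comp.
  have Vn : V m u = n m u * w.
    (* Testing with the [k]-th basis vector extracts the [k]-th component, up to [eps] in slot 2. *)
    have E k : (k < 4)%N -> V k u * (if k == 2%N then eps else 1) = n k u * (if k == 2%N then eps else 1) * w.
      move=> k4; have := comp (fun j => (j == k)%:R).
      by case: k k4 => [|[|[|[|k]]]] // _; rewrite /ip /ev /= !(mul0r, mul1r, mulr0, addr0, add0r, mulr1) // => h; ring: h.
    have := E m m4; case: (m == 2%N); last by rewrite !mulr1.
    move=> h; rewrite -[V m u]mulr1 -[n m u]mulr1 -eps2 !mulrA h.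
    by rewrite -!mulrA; congr (_ * (_ * _)); rewrite mulrC.
  have ww : detI eps P u = w * w.
    have := comp (ev V u); rewrite -/w => <-.
    rewrite [RHS]cross_norm xx // !xp !mul0r subr0 addr0 mulrA eps2 mul1r.
    by rewrite /detI /gI.
  have sw : s u = gII eps P n 0 0 u * w by exact: comp.
  have w0 : w != 0 by apply: contra_neq d0 => w0; rewrite ww w0 mulr0.
  have B := B0 Du; have Bn := lt0r_neq0 B.
  rewrite ww sw; move: (gII eps P n 0 0 u) B Bn => b b0 bn.
  have -> : b * w * (b * w) * (w * w) = (b * (w * w)) ^+ 2 by ring.
  have ww0 : 0 < w * w by rewrite -ww dI.
  have bw : 0 < b * (w * w) by rewrite mulr_gt0.
  split; first by rewrite exprn_gt0.
  rewrite sqrtr_sqr (gtr0_norm bw) [in RHS]Vn; field; by rewrite w0.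
apply: (smooth_ext oD (F := fun u => V m u * s u * (Num.sqrt (s u * s u * detI eps P u))^-1)).
  by move=> u Du; case: (key u Du) => _ ->.
have sss : smooth D (fun u => s u * s u * detI eps P u).
  by apply: (smoothM oD) => //; exact: smoothM.
apply: (smoothM oD); first by apply: (smoothM oD); [exact: sV|].
apply: (smoothV oD) => [u Du|]; first by rewrite gt_eqF // sqrtr_gt0; case: (key u Du).
by apply: (smooth_sqrt oD) => // u Du; case: (key u Du).
Qed.

End NormalField.

(** What the local theory uses of a surface over a plane domain, in or out of the atlas. [patch_W]
    is the curvature condition after the Gauss equation [Ki = Ke + eps nu^2]. *)
Record patch (R : realType) (eps a b c : R) (D : set 'rV[R]_2)
    (P n : nat -> 'rV[R]_2 -> R) : Prop := Patch {
  patch_open : open D;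
  patch_P : fsmooth D P;
  patch_n : fsmooth D n;
  patch_xx : forall u, D u -> ip eps (ev (horizontal P) u) (ev (horizontal P) u) = eps;
  patch_xn : forall u, D u -> ip eps (ev (horizontal P) u) (ev n u) = 0;
  patch_nn : forall u, D u -> ip eps (ev n u) (ev n u) = 1;
  patch_pn : forall i u, D u -> ip eps (ev (dX i P) u) (ev n u) = 0;
  patch_dI : forall u, D u -> 0 < detI eps P u;
  patch_II0 : forall u, D u -> 0 < gII eps P n 0 0 u;
  patch_dII : forall u, D u -> 0 < detII eps P n u;
  patch_W : forall u, D u ->
    (a + b) * detII eps P n u = (c - eps * a * (n 3%N u * n 3%N u)) * detI eps P u }.

Section GaussCurvature.
Variables (R : realType) (eps : R) (D : set 'rV[R]_2) (F n : 'rV[R]_2 -> 'rV[R]_3 * R).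
Hypotheses (oD : open D) (sF : fsmooth D (comp_field F)).
Hypothesis dI : forall u, D u -> detI eps (comp_field F) u != 0.
Local Notation P := (comp_field F).
Local Notation g := (first_form eps F).

Lemma det_first_form u : D u -> \det (g u) = detI eps P u.
Proof.
by move=> Du; rewrite det2 !(first_formE eps _ _ oD sF Du) (gI_sym eps P 1 0).
Qed.

Lemma det_second_form u : D u -> \det (second_form eps F n u) = detII eps P (comp_field n) u.
Proof.
move=> Du; rewrite det2 !(second_formE eps _ _ _ oD sF Du) (gII_sym eps oD _ sF 1 0 Du).
exact: erefl.
Qed.

Lemma inv_first_form u (k : 'I_2) (a : 'I_2 -> R) : D u ->
  \sum_l invmx (g u) k l * a l = (detI eps P u)^-1 *
   (if k == 0 then gI eps P 1 1 u * a 0 - gI eps P 0 1 u * a 1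
    else gI eps P 0 0 u * a 1 - gI eps P 0 1 u * a 0).
Proof.
move=> Du; have d0 := dI Du.
have gu : g u \in unitmx by rewrite unitmxE unitfE det_first_form.
pose s k := \sum_l invmx (g u) k l * a l.
have E i : gI eps P i 0 u * s 0 + gI eps P i 1 u * s 1 = a i.
  have := mulmxV gu => /matrixP G.
  rewrite /s !sum2 -!(first_formE eps _ _ oD sF Du).
  have G' j : g u i 0 * invmx (g u) 0 j + g u i 1 * invmx (g u) 1 j = (i == j)%:R.
    by have := G i j; rewrite [LHS]mxE [RHS]mxE sum2.
  have -> : g u i 0 * (invmx (g u) 0 0 * a 0 + invmx (g u) 0 1 * a 1) +
    g u i 1 * (invmx (g u) 1 0 * a 0 + invmx (g u) 1 1 * a 1) =
    (g u i 0 * invmx (g u) 0 0 + g u i 1 * invmx (g u) 1 0) * a 0 +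
    (g u i 0 * invmx (g u) 0 1 + g u i 1 * invmx (g u) 1 1) * a 1.
    by move: (invmx (g u) 0 0) (invmx (g u) 0 1) (invmx (g u) 1 0) (invmx (g u) 1 1) (g u i 0) (g u i 1) => *; ring.
  rewrite !G'; elim/forall2: i {G'} => /=; by rewrite ?mul1r ?mul0r ?addr0 ?add0r.
rewrite -/(s k); apply: (mulfI d0); rewrite mulVKf //.
have E0 := E 0; have E1 := E 1; rewrite (gI_sym eps P 1 0) in E1.
rewrite -E0 -E1 /detI.
by elim/forall2: k => /=; move: (s 0) (s 1) (gI eps P 0 0 u) (gI eps P 0 1 u) (gI eps P 1 1 u) => *; ring.
Qed.

Lemma christoffelE k i j u : D u -> christoffel g k i j u = Gam eps P k i j u.
Proof.
move=> Du.
have E i' j' k' : partial k' (fun v => g v i' j' : R) u = gam eps P k' i' j' u + gam eps P k' j' i' u.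
  rewrite -(partial_gI eps sF k' i' j' Du); apply: (partial_ext k' oD Du) => v Dv.
  exact: (first_formE eps _ _ oD sF Dv).
have E2 : \sum_l invmx (g u) k l * (partial i (fun v => g v j l : R) u + partial j (fun v => g v i l : R) u
     - partial l (fun v => g v i j : R) u) = \sum_l invmx (g u) k l * (2 * gam eps P i j l u).
  apply: eq_bigr => l _; congr (_ * _); rewrite !E (gam_sym eps oD sF i l j Du) (gam_sym eps oD sF j l i Du) (gam_sym eps oD sF j i l Du).
  by move: (gam eps P i j l u) (gam eps P i l j u) (gam eps P j l i u) => x y w; ring.
rewrite /christoffel E2 inv_first_form // /Gam; have d0 := dI Du.
move: (gam eps P i j 0 u) (gam eps P i j 1 u) (detI eps P u) d0 => x y d d0.
by case: (k == 0); field.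
Qed.

Lemma riemannE k u : D u -> riemann g k u =
  partial 0 (Gam eps P k 1 1) u - partial 1 (Gam eps P k 0 1) u
    + (Gam eps P 0 1 1 u * Gam eps P k 0 0 u - Gam eps P 0 0 1 u * Gam eps P k 1 0 u)
    + (Gam eps P 1 1 1 u * Gam eps P k 0 1 u - Gam eps P 1 0 1 u * Gam eps P k 1 1 u).
Proof.
move=> Du; rewrite /riemann sum2 !(christoffelE _ _ _ Du).
rewrite (partial_ext 0 oD Du (fun v Dv => christoffelE k 1 1 Dv)).
by rewrite (partial_ext 1 oD Du (fun v Dv => christoffelE k 0 1 Dv)) addrA.
Qed.

End GaussCurvature.

Section AtlasPatch.
Variables (R : realType) (eps a b c : R) (S : smoothSurface R) (phi N : S -> 'rV[R]_3 * R).
Hypotheses (eps_pm : eps = 1 \/ eps = -1) (im : immersion eps phi) (un : unit_normal eps phi N).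
Hypotheses (pK : positive_Ke eps phi N) (pII : second_form_posdef eps phi N).
Hypothesis WS : W_surface eps a b c phi N.

Lemma atlas_patch z : atlas z ->
  patch eps a b c (cod z) (comp_field (phi \o param z)) (comp_field (N \o param z)).
Proof.
move=> az; have oD := @cod_open _ _ z.
set F := phi \o param z; set n := N \o param z.
have eps2 : eps * eps = 1 by case: eps_pm => ->; rewrite ?mulrNN mulr1.
have sF : fsmooth (cod z) (comp_field F) by apply: fsmooth_comp_field => //; case: (im.2 z az).
have xx u : ip eps (ev (horizontal (comp_field F)) u) (ev (horizontal (comp_field F)) u) = eps.
  have [E _] := im.1 (param z u); rewrite -[RHS]E /ip /ev /horizontal /comp_field /= /lform.
  by rewrite mulr0 addr0.
have xn u : cod z u -> ip eps (ev (horizontal (comp_field F)) u) (ev (comp_field n) u) = 0.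
  move=> Du; have [E _ _] := un az Du; rewrite -[RHS]E /ip /ev /horizontal /comp_field /= /lform.
  by rewrite mul0r addr0.
have nn u : cod z u -> ip eps (ev (comp_field n) u) (ev (comp_field n) u) = 1.
  by move=> Du; have [_ E _] := un az Du; exact: E.
have pn i u : cod z u -> ip eps (ev (dX i (comp_field F)) u) (ev (comp_field n) u) = 0.
  by move=> Du; have [_ _ /(_ (delta_mx 0 i))] := un az Du; rewrite innerE (comp_partial i oD sF Du).
have pd u : cod z u -> 0 < gII eps (comp_field F) (comp_field n) 0 0 u /\
    0 < detII eps (comp_field F) (comp_field n) u.
  move=> Du; have := posdef2 _ (pII az Du); rewrite !(second_formE eps _ _ _ oD sF Du).
  by apply; exact: (gII_sym eps oD _ sF 1 0 Du).
have Kd u : cod z u -> 0 < detI eps (comp_field F) u /\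
    Ke eps F n u = detII eps (comp_field F) (comp_field n) u / detI eps (comp_field F) u.
  move=> Du; have := pK az Du; rewrite -/F -/n /Ke /shape_operator det_mulmx.
  rewrite (det_second_form eps n oD sF Du) => K0; have [_ d2] := pd u Du.
  move: K0; rewrite pmulr_lgt0 // => K0.
  (* [invmx] returns a singular matrix unchanged, so a singular first form would make [Ke]
     vanish. *)
  have gu : first_form eps F u \in unitmx.
    apply: contraT => gu; move: K0; rewrite /invmx (negbTE gu).
    by move: gu; rewrite unitmxE unitfE negbK => /eqP ->; rewrite ltxx.
  move: K0; rewrite det_inv (det_first_form eps oD sF Du) invr_gt0 => K0; split=> //.
  by rewrite mulrC.
have dI u Du := lt0r_neq0 (Kd u Du).1.
have sn : fsmooth (cod z) (comp_field n).
  have s4 := fsmooth_normal oD eps2 sF (fun u _ => xx u) xn nn pn (fun u Du => (Kd u Du).1) (fun u Du => (pd u Du).1).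
  (* All indices from 3 on name the same component. *)
  by move=> [|[|[|m]]]; [exact: s4|exact: s4|exact: s4|exact: (s4 3%N)].
split=> // u Du; [by case: (Kd u Du)|by case: (pd u Du)|by case: (pd u Du)|].
have := WS az Du; rewrite -/F -/n; have [d0 ->] := Kd u Du.
have -> : Ki eps F u = detII eps (comp_field F) (comp_field n) u / detI eps (comp_field F) u
   + eps * (comp_field n 3%N u * comp_field n 3%N u).
  rewrite /Ki /gauss_curvature sum2 !(riemannE oD sF dI _ Du) (det_first_form eps oD sF Du).
  rewrite !(first_formE eps _ _ oD sF Du).
  have := gauss oD eps2 sF (fun u _ => xx u) xn nn pn dI Du.
  rewrite [gI _ _ 0 0 _ * _]mulrC [gI _ _ 1 0 _ * _]mulrC => ->.
  by move: (comp_field n 3%N u) (detI _ _ _) (dI u Du) => *; field.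
move: (comp_field n 3%N u) (detI _ _ _) (dI u Du) => nu d dn <-.
by field.
Qed.

End AtlasPatch.

(** * Change of parameters *)

Section Transport.
Variables (R : realType) (eps : R) (D D' : set 'rV[R]_2).
Local Notation plane := 'rV[R]_2.
Variables (psi : plane -> plane) (P n : nat -> plane -> R).
Hypotheses (oD : open D) (oD' : open D') (psiD : forall u, D' u -> D (psi u)).
Hypothesis spsi : forall i, smooth D' (fun u => psi u 0 i).
Hypotheses (sP : fsmooth D P) (sn : fsmooth D n).

Definition jac (k i : 'I_2) (u : plane) : R := partial i (fun u => psi u 0 k) u.
Definition pullf (X : nat -> plane -> R) : nat -> plane -> R := fun m u => X m (psi u).

Lemma fsmooth_pullf X : fsmooth D X -> fsmooth D' (pullf X).
Proof. by move=> sX m k; apply: (Ck_comp oD' oD psiD (sX m k)) => i; exact: spsi. Qed.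

Lemma partial_comp (F : plane -> R) i u : smooth D F -> D' u ->
  partial i (fun u => F (psi u)) u = jac 0 i u * partial 0 F (psi u) + jac 1 i u * partial 1 F (psi u).
Proof.
move=> sF Du; have d := smooth_is_diff oD sF (psiD Du).
have dj k : is_derive u (delta_mx 0 i) (fun s => psi s 0 k) (jac k i u).
  by apply: derivableP; exact: smooth_derivable (spsi k) Du.
by case: (chain2 d (dj 0) (dj 1)) => _ <-.
Qed.

Lemma ip_dX_pullf X i (Y : nat -> R) u : fsmooth D X -> D' u ->
  ip eps (ev (dX i (pullf X)) u) Y =
  jac 0 i u * ip eps (ev (dX 0 X) (psi u)) Y + jac 1 i u * ip eps (ev (dX 1 X) (psi u)) Y.
Proof.
move=> sX Du.
have E m : ev (dX i (pullf X)) u m = jac 0 i u * ev (dX 0 X) (psi u) m + jac 1 i u * ev (dX 1 X) (psi u) m.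
  by rewrite /ev !dXE; exact: partial_comp.
rewrite {1}/ip !E /ip.
move: (ev (dX 0 X) (psi u)) (ev (dX 1 X) (psi u)) (jac 0 i u) (jac 1 i u) => x y j k; ring.
Qed.

Lemma gI_pullf i j u : D' u -> gI eps (pullf P) i j u =
  jac 0 i u * (jac 0 j u * gI eps P 0 0 (psi u) + jac 1 j u * gI eps P 0 1 (psi u))
  + jac 1 i u * (jac 0 j u * gI eps P 1 0 (psi u) + jac 1 j u * gI eps P 1 1 (psi u)).
Proof.
move=> Du; rewrite /gI ip_dX_pullf //.
by congr (_ * _ + _ * _); rewrite ipC ip_dX_pullf // ipC; congr (_ + _ * _); rewrite ipC.
Qed.

Hypothesis pn : forall i u, D u -> ip eps (ev (dX i P) u) (ev n u) = 0.

Lemma pn_pullf i u : D' u -> ip eps (ev (dX i (pullf P)) u) (ev (pullf n) u) = 0.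
Proof.
move=> Du; rewrite ip_dX_pullf //.
by rewrite [ip _ _ _](pn 0 (psiD Du)) [ip _ _ _](pn 1 (psiD Du)) !mulr0 addr0.
Qed.

(** By [pN] the second form is minus the product of [d_j P] and [d_i n], which involves first
    derivatives only, so no second derivative of [psi] appears. *)
Lemma gII_pullf i j u : D' u -> gII eps (pullf P) (pullf n) i j u =
  jac 0 i u * (jac 0 j u * gII eps P n 0 0 (psi u) + jac 1 j u * gII eps P n 0 1 (psi u))
  + jac 1 i u * (jac 0 j u * gII eps P n 1 0 (psi u) + jac 1 j u * gII eps P n 1 1 (psi u)).
Proof.
move=> Du; have Dp := psiD Du.
have L := pN oD' (fsmooth_pullf sP) (fsmooth_pullf sn) pn_pullf i j Du.
have M := fun i j => pN oD sP sn pn i j Dp.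
rewrite -[LHS]opprK -L ip_dX_pullf // !(ipC _ _ (ev (dX i (pullf n)) u)) !ip_dX_pullf //.
rewrite !(ipC _ (ev (dX _ n) _)) !M.
by move: (gII eps P n 0 0 _) (gII eps P n 0 1 _) (gII eps P n 1 0 _) (gII eps P n 1 1 _)
  (jac 0 i u) (jac 0 j u) (jac 1 i u) (jac 1 j u) => *; ring.
Qed.

Definition jacobian u := jac 0 0 u * jac 1 1 u - jac 0 1 u * jac 1 0 u.

Lemma detI_pullf u : D' u -> detI eps (pullf P) u = jacobian u * jacobian u * detI eps P (psi u).
Proof.
move=> Du; rewrite /detI !gI_pullf // (gI_sym eps P 1 0) /jacobian.
by move: (gI eps P 0 0 _) (gI eps P 0 1 _) (gI eps P 1 1 _)
  (jac 0 0 u) (jac 0 1 u) (jac 1 0 u) (jac 1 1 u) => *; ring.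
Qed.

Lemma detII_pullf u : D' u ->
  detII eps (pullf P) (pullf n) u = jacobian u * jacobian u * detII eps P n (psi u).
Proof.
move=> Du; rewrite /detII !gII_pullf // (gII_sym eps oD n sP 1 0 (psiD Du)) /jacobian.
by move: (gII eps P n 0 0 _) (gII eps P n 0 1 _) (gII eps P n 1 1 _)
  (jac 0 0 u) (jac 0 1 u) (jac 1 0 u) (jac 1 1 u) => *; ring.
Qed.

End Transport.

Lemma patch_pullf (R : realType) (eps a b c : R) (D D' : set 'rV[R]_2)
    (psi : 'rV[R]_2 -> 'rV[R]_2) P n :
  patch eps a b c D P n -> open D' -> (forall u, D' u -> D (psi u)) ->
  (forall i, smooth D' (fun u => psi u 0 i)) -> (forall u, D' u -> jacobian psi u != 0) ->
  patch eps a b c D' (pullf psi P) (pullf psi n).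
Proof.
move=> [oD sP sn xx xn nn pn dI B0 dB W] oD' psiD spsi J0.
have hor u : ev (horizontal (pullf psi P)) u = ev (horizontal P) (psi u).
  by apply/funext => m; rewrite /ev /horizontal; case: (m == 3%N).
have J2 u : D' u -> 0 < jacobian psi u * jacobian psi u.
  by move=> /J0 j0; rewrite -expr2 exprn_even_gt0 //= j0.
have dB' u : D' u -> 0 < detII eps (pullf psi P) (pullf psi n) u.
  by move=> Du; rewrite (detII_pullf oD oD' psiD spsi sP sn pn Du) mulr_gt0 ?J2 // dB //; exact: psiD.
split=> //.
- exact: (fsmooth_pullf oD oD' psiD spsi sP).
- exact: (fsmooth_pullf oD oD' psiD spsi sn).
- by move=> u Du; rewrite hor xx //; exact: psiD.
- by move=> u Du; rewrite hor [LHS]xn //; exact: psiD.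
- by move=> u Du; rewrite [LHS]nn //; exact: psiD.
- by move=> i u Du; exact: (pn_pullf oD psiD spsi sP pn i Du).
- by move=> u Du; rewrite (detI_pullf eps oD psiD spsi sP Du) mulr_gt0 ?J2 // dI //; exact: psiD.
- move=> u Du; have Dp := psiD u Du; rewrite (gII_pullf oD oD' psiD spsi sP sn pn 0 0 Du).
  rewrite (gII_sym eps oD n sP 1 0 Dp); have := B0 _ Dp; have := dB _ Dp; have := J0 u Du.
  rewrite /detII /jacobian; move: (gII eps P n 0 0 _) (gII eps P n 0 1 _) (gII eps P n 1 1 _)
    (jac psi 0 0 u) (jac psi 0 1 u) (jac psi 1 0 u) (jac psi 1 1 u) => x y z j00 j01 j10 j11 jn d x0.
  (* Multiplication by the positive entry [x] of [II] allows the square to be completed. *)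
  rewrite -(pmulr_rgt0 _ x0).
  have -> : x * (j00 * (j00 * x + j10 * y) + j10 * (j00 * y + j10 * z)) =
    (x * j00 + y * j10) ^+ 2 + j10 ^+ 2 * (x * z - y * y) by ring.
  have [j0|j0] := eqVneq j10 0; last first.
    by rewrite ltr_wpDl ?sqr_ge0 // mulr_gt0 // exprn_even_gt0.
  rewrite j0 expr0n mul0r addr0 mulr0 addr0 exprn_even_gt0 //= mulf_neq0 ?(lt0r_neq0 x0) //.
  by apply: contra_neq jn => j0'; rewrite j0' j0 mul0r mulr0 subrr.
move=> u Du; rewrite (detI_pullf eps oD psiD spsi sP Du) (detII_pullf oD oD' psiD spsi sP sn pn Du).
have := W _ (psiD u Du); rewrite /pullf.
move: (detI _ _ _) (detII _ _ _ _) (n _ _) (jacobian _ _) => x y w j E.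
by rewrite mulrCA E mulrCA.
Qed.

(** * The first-order system for [q] *)

Section ComplexSmooth.
Variables (R : realType) (D : set 'rV[R]_2).
Hypothesis oD : open D.
Implicit Types F G : 'rV[R]_2 -> R[i].

(** The coefficients of the system are built over [R[i]] and split into real functions only at the
    end, in [Q_system]. *)
Definition csmooth F := smooth D (fun u => complex.Re (F u)) /\ smooth D (fun u => complex.Im (F u)).

Lemma csmooth_real (F : 'rV[R]_2 -> R) : smooth D F -> csmooth (fun u => (F u)%:C).
Proof. by move=> sF; split=> //; exact: smooth_cst. Qed.

Lemma csmoothD F G : csmooth F -> csmooth G -> csmooth (fun u => F u + G u).
Proof.
move=> [f1 f2] [g1 g2]; split; [apply: (smooth_ext oD _ (smoothD oD f1 g1))|
  apply: (smooth_ext oD _ (smoothD oD f2 g2))] => u _; by case: (F u); case: (G u).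
Qed.

Lemma csmoothN F : csmooth F -> csmooth (fun u => - F u).
Proof.
move=> [f1 f2]; split; [apply: (smooth_ext oD _ (smoothN oD f1))|
  apply: (smooth_ext oD _ (smoothN oD f2))] => u _; by case: (F u).
Qed.

Lemma csmoothM F G : csmooth F -> csmooth G -> csmooth (fun u => F u * G u).
Proof.
move=> [f1 f2] [g1 g2]; split.
  apply: (smooth_ext oD _ (smoothB oD (smoothM oD f1 g1) (smoothM oD f2 g2))) => u _.
  by case: (F u); case: (G u).
apply: (smooth_ext oD _ (smoothD oD (smoothM oD f1 g2) (smoothM oD f2 g1))) => u _.
by case: (F u); case: (G u).
Qed.

Lemma csmoothV F : (forall u, D u -> F u != 0) -> csmooth F -> csmooth (fun u => (F u)^-1).
Proof.
move=> F0 [f1 f2].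
pose d u := complex.Re (F u) * complex.Re (F u) + complex.Im (F u) * complex.Im (F u).
have sd : smooth D d by exact: (smoothD oD (smoothM oD f1 f1) (smoothM oD f2 f2)).
have d0 u : D u -> d u != 0.
  move=> /F0; apply: contra; rewrite /d -!expr2 paddr_eq0 ?sqr_ge0 // !expf_eq0 /=.
  by case: (F u) => x y /= /andP[/eqP -> /eqP ->].
split.
  apply: (smooth_ext oD _ (smoothM oD f1 (smoothV oD d0 sd))) => u _; rewrite /d.
  by case: (F u) => x y; rewrite /= -!expr2.
apply: (smooth_ext oD _ (smoothN oD (smoothM oD f2 (smoothV oD d0 sd)))) => u _; rewrite /d.
by case: (F u) => x y; rewrite /= -!expr2.
Qed.

End ComplexSmooth.

Section RealCoefficients.
Variable R : realType.
Variables (eps a b c g00 g01 g11 h0 h1 nu nu0 nu1 t1 t2 be B00 B01 : R).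
Variables (G0_00 G0_01 G0_11 G1_00 G1_01 G1_11 : R).
Variables (b0_00 b0_01 b0_11 b1_00 b1_01 b1_11 d0t1 d0t2 d1t1 d1t2 f f' : R).
Hypotheses (B00E : B00 = (t1 * t1 + t2 * t2) * be) (B01E : B01 = t1 * be).
Hypothesis b0_01E : b0_01 = t1 * b0_11 + be * d0t1.
Hypothesis b1_01E : b1_01 = t1 * b1_11 + be * d1t1.
Hypothesis b0_00E : b0_00 = (t1 * t1 + t2 * t2) * b0_11 + be * (2 * (t1 * d0t1 + t2 * d0t2)).
Hypothesis b1_00E : b1_00 = (t1 * t1 + t2 * t2) * b1_11 + be * (2 * (t1 * d1t1 + t2 * d1t2)).
Let dg := g00 * g11 - g01 * g01.
Let sg := c - eps * a * (nu * nu).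
Hypotheses (be0 : be != 0) (t20 : t2 != 0) (sg0 : sg != 0) (dg0 : dg != 0) (ab0 : a + b != 0).
Hypothesis weingarten0 : dg * nu0 = - (B00 * (g11 * h0 - g01 * h1) + B01 * (g00 * h1 - g01 * h0)).
Hypothesis weingarten1 : dg * nu1 = - (B01 * (g11 * h0 - g01 * h1) + be * (g00 * h1 - g01 * h0)).
Hypothesis codazzi0 : b0_01 - b1_00 = - (G0_01 * B00 + G1_01 * B01) + (G0_00 * B01 + G1_00 * be)
  - eps * nu * (h0 * g01 - h1 * g00).
Hypothesis codazzi1 : b0_11 - b1_01 = - (G0_11 * B00 + G1_11 * B01) + (G0_01 * B01 + G1_01 * be)
  - eps * nu * (h0 * g11 - h1 * g01).
Hypothesis W : (a + b) * (B00 * be - B01 * B01) = sg * dg.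
Hypothesis dW0 : (a + b) * (b0_00 * be + B00 * b0_11 - 2 * (B01 * b0_01)) =
  - (2 * eps * a * nu * nu0) * dg + sg * (2 * (G0_00 + G1_01) * dg).
Hypothesis dW1 : (a + b) * (b1_00 * be + B00 * b1_11 - 2 * (B01 * b1_01)) =
  - (2 * eps * a * nu * nu1) * dg + sg * (2 * (G0_01 + G1_11) * dg).
Let tt := 1 - nu * nu.
Hypothesis norm_h : dg * tt = g11 * h0 * h0 - 2 * g01 * h0 * h1 + g00 * h1 * h1.
Hypothesis ode : sg * (tt * f' + 2 * f) = eps * (2 * a + b) * (1 + tt * f).

Let T00 := g00 + f * (h0 * h0).
Let T01 := g01 + f * (h0 * h1).
Let T11 := g11 + f * (h1 * h1).
Let h00 := G0_00 * h0 + G1_00 * h1 + B00 * nu.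
Let h01 := G0_01 * h0 + G1_01 * h1 + B01 * nu.
Let h11 := G0_11 * h0 + G1_11 * h1 + be * nu.
Let k_ (nui hij hik hj hk : R) := - f' * (2 * nu * nui) * (hj * hk) + f * (hij * hk + hik * hj).
Let T0_00 := 2 * (G0_00 * g00 + G1_00 * g01) + k_ nu0 h00 h00 h0 h0.
Let T0_01 := G0_00 * g01 + G1_00 * g11 + G0_01 * g00 + G1_01 * g01 + k_ nu0 h00 h01 h0 h1.
Let T0_11 := 2 * (G0_01 * g01 + G1_01 * g11) + k_ nu0 h01 h01 h1 h1.
Let T1_00 := 2 * (G0_01 * g00 + G1_01 * g01) + k_ nu1 h01 h01 h0 h0.
Let T1_01 := G0_01 * g01 + G1_01 * g11 + G0_11 * g00 + G1_11 * g01 + k_ nu1 h01 h11 h0 h1.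
Let T1_11 := 2 * (G0_11 * g01 + G1_11 * g11) + k_ nu1 h11 h11 h1 h1.
Let dq1 T_00 T_01 T_11 dt1 dt2 := T_00 - 2 * (t1 * T_01 + T01 * dt1)
  + ((t1 * t1 - t2 * t2) * T_11 + T11 * (2 * (t1 * dt1 - t2 * dt2))).
Let dq2 T_01 T_11 dt1 dt2 := 2 * (t1 * t2 * T_11 + T11 * (t1 * dt2 + t2 * dt1))
  - 2 * (t2 * T_01 + T01 * dt2).

(** An abstract square root of [-1]: [ring] then works from the relation [ii] alone. *)
Variable I : R[i].
Hypothesis ii : I * I = -1.
Let tau := t1%:C + I * t2%:C.
Let tau' := t1%:C - I * t2%:C.
Let dt0 := d0t1%:C + I * d0t2%:C.
Let dt1 := d1t1%:C + I * d1t2%:C.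
Let E' := g00%:C - 2 * tau' * g01%:C + tau' * tau' * g11%:C.
Let F := g00%:C - (tau + tau') * g01%:C + tau * tau' * g11%:C.
Let et := h0%:C - tau * h1%:C.
Let et' := h0%:C - tau' * h1%:C.
Let r := - (be%:C * (tau - tau') * (tau - tau') / 2).
Let D := (g00%:C * g11%:C - g01%:C * g01%:C) * ((tau - tau') * (tau - tau')).
Let q' := E' + f%:C * (et' * et').
Let P := F + f%:C * (et * et').
Let kap := eps%:C * (2 * a%:C + b%:C) / (c%:C - eps%:C * a%:C * (nu%:C * nu%:C)).
Let c0 := G0_00%:C - (tau + tau') * G0_01%:C + tau * tau' * G0_11%:C.

(** The coefficient of [q], and in [Qcoef2] that of its conjugate, as [Q_equation] yields them for
    [t = tau] and [t' = conj tau]. *)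
Definition Qcoef1 := 2 * ((G1_00%:C - (tau + tau') * G1_01%:C + tau * tau' * G1_11%:C - (dt0 - tau' * dt1)
    + tau' * c0) / (tau' - tau))
  + nu%:C * r * Qc1 f%:C f'%:C kap et et' q' P (1 - nu%:C * nu%:C) / D.
Definition Qcoef2 := nu%:C * r * Qc2 f%:C f'%:C kap et (1 - nu%:C * nu%:C) / D.

Let rcD (x y : R) : (x + y)%:C = x%:C + y%:C. Proof. exact: rmorphD. Qed.
Let rcN (x : R) : (- x)%:C = - x%:C. Proof. exact: rmorphN. Qed.
Let rcM (x y : R) : (x * y)%:C = x%:C * y%:C. Proof. exact: rmorphM. Qed.
Let rc1 : (1 : R)%:C = 1. Proof. by []. Qed.
Let rc2 : (2 : R)%:C = 2. Proof. exact: rmorph_nat. Qed.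
Let rcE := (rcD, rcN, rcM, rc1, rc2).
Let rc0 (x : R) : (x%:C == 0) = (x == 0). Proof. by rewrite eq_complex /= eqxx andbT. Qed.
Let toC (x y : R) : x = y -> x%:C = y%:C. Proof. by move=> ->. Qed.

(** [Q_equation] over [R[i]], with every hypothesis supplied by real data: real relations are mapped
    into [R[i]], and [q] and its derivatives enter by real and imaginary parts. *)
Lemma Q_equation_real :
  (dq1 T0_00 T0_01 T0_11 d0t1 d0t2)%:C + I * (dq2 T0_01 T0_11 d0t1 d0t2)%:C
  - tau' * ((dq1 T1_00 T1_01 T1_11 d1t1 d1t2)%:C + I * (dq2 T1_01 T1_11 d1t1 d1t2)%:C) =
  Qcoef1 * ((T00 - 2 * (t1 * T01) + (t1 * t1 - t2 * t2) * T11)%:C + I * (2 * (t1 * t2 * T11) - 2 * (t2 * T01))%:C)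
  + Qcoef2 * ((T00 - 2 * (t1 * T01) + (t1 * t1 - t2 * t2) * T11)%:C - I * (2 * (t1 * t2 * T11) - 2 * (t2 * T01))%:C).
Proof.
have I0 : I != 0.
  by apply/eqP => i0; move: ii; rewrite i0 mul0r => /eqP; rewrite eq_sym oppr_eq0 oner_eq0.
have B00C : B00%:C = tau * tau' * be%:C by rewrite B00E !rcE /tau /tau'; ring: ii.
have B01C : B01%:C = (tau + tau') / 2 * be%:C.
  by rewrite B01E !rcE /tau /tau'; field.
have tn : tau - tau' != 0.
  have -> : tau - tau' = 2 * I * t2%:C by rewrite /tau /tau'; ring.
  by rewrite !mulf_neq0 ?pnatr_eq0 // rc0.
have be0' : be%:C != 0 by rewrite rc0.
have sg0' : c%:C - eps%:C * a%:C * (nu%:C * nu%:C) != 0.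
  have -> : c%:C - eps%:C * a%:C * (nu%:C * nu%:C) = sg%:C by rewrite /sg !rcE.
  by rewrite rc0.
have dg0' : g00%:C * g11%:C - g01%:C * g01%:C != 0.
  have -> : g00%:C * g11%:C - g01%:C * g01%:C = dg%:C by rewrite /dg !rcE.
  by rewrite rc0.
have ab0' : a%:C + b%:C != 0 by rewrite -rcD rc0.
have qE : (T00 - 2 * (t1 * T01) + (t1 * t1 - t2 * t2) * T11)%:C + I * (2 * (t1 * t2 * T11) - 2 * (t2 * T01))%:C =
  g00%:C - 2 * tau * g01%:C + tau * tau * g11%:C + f%:C * (et * et).
  by rewrite /T00 /T01 /T11 !rcE /et /tau; ring: ii.
have qE' : (T00 - 2 * (t1 * T01) + (t1 * t1 - t2 * t2) * T11)%:C - I * (2 * (t1 * t2 * T11) - 2 * (t2 * T01))%:C = q'.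
  by rewrite /T00 /T01 /T11 !rcE /q' /E' /et' /tau'; ring: ii.
apply: etrans (esym (congr2 (fun x y => Qcoef1 * x + Qcoef2 * y) qE qE')); rewrite /Qcoef1 /Qcoef2.
have -> : nu%:C * r * Qc2 f%:C f'%:C kap et (1 - nu%:C * nu%:C) / D * q' =
  nu%:C * r * Qc2 f%:C f'%:C kap et (1 - nu%:C * nu%:C) * q' / D by rewrite mulrAC.
have w0 := toC weingarten0; have w1 := toC weingarten1; have cod0 := toC codazzi0; have cod1 := toC codazzi1.
have W' := toC W; have dW0' := toC dW0; have dW1' := toC dW1; have nh := toC norm_h; have od := toC ode.
rewrite /dg /sg /tt !rcE B00C B01C in w0 w1 cod0 cod1 W' dW0' dW1' nh od.
apply: (Q_equation (b0_00 := b0_00%:C) (b0_01 := b0_01%:C) (b0_11 := b0_11%:C)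
  (b1_00 := b1_00%:C) (b1_01 := b1_01%:C) (b1_11 := b1_11%:C)
  be0' tn sg0' dg0' ab0' w0 w1 cod0 cod1 W' dW0' dW1' nh od).
- by rewrite b0_00E b0_01E !rcE /tau /tau' /dt0; ring: ii.
- by rewrite b1_00E b1_01E !rcE /tau /tau' /dt1; ring: ii.
- rewrite /dq1 /dq2 /T0_00 /T0_01 /T0_11 /k_ /T01 /T11 /h00 /h01 !rcE B00C B01C.
  by rewrite /tau /dt0; ring: ii.
rewrite /dq1 /dq2 /T1_00 /T1_01 /T1_11 /k_ /T01 /T11 /h01 /h11 !rcE B01C.
by rewrite /tau /dt1; ring: ii.
Qed.

End RealCoefficients.

Section QSystem.
Variables (R : realType) (eps a b c : R) (f : R -> R) (D : set 'rV[R]_2).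
Local Notation plane := 'rV[R]_2.
Variables P n : nat -> plane -> R.
Hypotheses (eps_pm : eps = 1 \/ eps = -1) (ab0 : a + b != 0).
Hypothesis f_an : forall t, 0 <= t <= 1 -> analytic_at f t.
Hypothesis f_ode : forall t, 0 <= t <= 1 ->
  (c - eps * a * (1 - t)) * (t * f^`()%classic t + 2 * f t) = eps * (2 * a + b) * (1 + t * f t).
Hypothesis pD : patch eps a b c D P n.

Definition tcoef (n : nat -> plane -> R) u := 1 - n 3%N u * n 3%N u.
Definition Tform f (n : nat -> plane -> R) (P : nat -> plane -> R) (i j : 'I_2) u :=
  gI eps P i j u + f (tcoef n u) * (partial i (P 3%N) u * partial j (P 3%N) u).
(* [Z = d_0 - tau d_1] is null for [II], and [q = T(Z, Z)]. *)
Definition tau1 (P n : nat -> plane -> R) u := gII eps P n 0 1 u / gII eps P n 1 1 u.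
Definition tau2 (P n : nat -> plane -> R) u := Num.sqrt (detII eps P n u) / gII eps P n 1 1 u.
Definition Q1 (P n : nat -> plane -> R) u := Tform f n P 0 0 u - 2 * (tau1 P n u * Tform f n P 0 1 u)
  + (tau1 P n u * tau1 P n u - tau2 P n u * tau2 P n u) * Tform f n P 1 1 u.
Definition Q2 (P n : nat -> plane -> R) u := 2 * (tau1 P n u * tau2 P n u * Tform f n P 1 1 u)
  - 2 * (tau2 P n u * Tform f n P 0 1 u).

Let oD : open D := patch_open pD.
Let sP : fsmooth D P := patch_P pD.
Let sn : fsmooth D n := patch_n pD.
Let dI u (Du : D u) : detI eps P u != 0 := lt0r_neq0 (patch_dI pD Du).
Let eps2 : eps * eps = 1. Proof. by case: eps_pm => ->; rewrite ?mulrNN mulr1. Qed.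
Let t1 := tau1 P n.
Let t2 := tau2 P n.
Let q1 := Q1 P n.
Let q2 := Q2 P n.
Let T := Tform f n P.

(** The horizontal part of the normal has nonnegative square: for [eps = -1] it is orthogonal to the
    timelike vector [x], and Lagrange's identity gives the sign. *)
Lemma tcoef_itv u : D u -> 0 <= tcoef n u <= 1.
Proof.
move=> Du; apply/andP; split; last by rewrite /tcoef gerBl -expr2 sqr_ge0.
have := patch_xx pD Du; have := patch_xn pD Du; have := patch_nn pD Du.
rewrite /tcoef /ip /ev /horizontal /= mulr0 addr0 mul0r addr0.
move: (P 0%N u) (P 1%N u) (P 2%N u) (n 0%N u) (n 1%N u) (n 2%N u) (n 3%N u) => x y z u1 u2 u3 nu <-.
rewrite addrK; case: eps_pm => ->.
  by move=> _ _; rewrite mul1r -!expr2 !addr_ge0 ?sqr_ge0.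
rewrite !mulN1r => h1 h2; rewrite subr_ge0 -!expr2.
have zz : z ^+ 2 = 1 + (x ^+ 2 + y ^+ 2) by move: h2; rewrite -!expr2; lra.
have z0 : 0 < z ^+ 2 by rewrite zz ltr_pwDl // addr_ge0 ?sqr_ge0.
rewrite -(ler_pM2l z0).
have -> : z ^+ 2 * u3 ^+ 2 = (x * u1 + y * u2) ^+ 2.
  have -> : x * u1 + y * u2 = z * u3 by move: h1; lra.
  by rewrite exprMn.
have -> : z ^+ 2 * (u1 ^+ 2 + u2 ^+ 2) = (x * u1 + y * u2) ^+ 2 + ((x * u2 - y * u1) ^+ 2 + u1 ^+ 2 + u2 ^+ 2).
  by rewrite zz; ring.
by rewrite lerDl !addr_ge0 ?sqr_ge0.
Qed.

Lemma gII11_gt0 u : D u -> 0 < gII eps P n 1 1 u.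
Proof.
move=> Du; have := patch_dII pD Du; have := patch_II0 pD Du; rewrite /detII => b0 d.
rewrite -(pmulr_rgt0 _ b0); apply: lt_le_trans d _.
by rewrite gerBl -expr2 sqr_ge0.
Qed.

Let B11' u (Du : D u) : gII eps P n 1 1 u != 0 := lt0r_neq0 (gII11_gt0 Du).

Lemma tau2_gt0 u : D u -> 0 < t2 u.
Proof.
move=> Du; apply: divr_gt0; last exact: gII11_gt0.
by rewrite sqrtr_gt0; exact: (patch_dII pD Du).
Qed.

Lemma gII01E u : D u -> gII eps P n 0 1 u = t1 u * gII eps P n 1 1 u.
Proof. by move=> Du; rewrite /t1 /tau1 divfK // B11'. Qed.

Lemma gII00E u : D u -> gII eps P n 0 0 u = (t1 u * t1 u + t2 u * t2 u) * gII eps P n 1 1 u.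
Proof.
move=> Du; have b0 := B11' Du; have d0 := ltW (patch_dII pD Du).
have ss : Num.sqrt (detII eps P n u) * Num.sqrt (detII eps P n u) = detII eps P n u.
  by rewrite -expr2 sqr_sqrtr.
have -> : t1 u * t1 u + t2 u * t2 u = (gII eps P n 0 1 u * gII eps P n 0 1 u
   + Num.sqrt (detII eps P n u) * Num.sqrt (detII eps P n u)) / (gII eps P n 1 1 u * gII eps P n 1 1 u).
  by rewrite /t1 /t2 /tau1 /tau2; field.
by rewrite ss /detII; field.
Qed.

Let sgII i j : smooth D (gII eps P n i j) := smooth_gII eps oD sP sn i j.

Lemma smooth_tau1 : smooth D t1.
Proof. by apply: (smoothM oD) => //; apply: (smoothV oD) => // u; exact: B11'. Qed.

Lemma smooth_tau2 : smooth D t2.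
Proof.
apply: (smoothM oD); last by apply: (smoothV oD) => // u; exact: B11'.
apply: (smooth_sqrt oD) => [u Du|]; first exact: (patch_dII pD Du).
by apply: (smoothB oD); apply: (smoothM oD).
Qed.

Let st : smooth D (tcoef n).
Proof. by apply: (smoothB oD); [exact: smooth_cst|exact: (smoothM oD (sn _) (sn _))]. Qed.

Let f_comp := smooth_comp_analytic oD st (fun u Du => f_an (tcoef_itv Du)).

Let df_comp := smooth_comp_analytic oD st (fun u Du => analytic_derive (f_an (tcoef_itv Du))).

Let sh i : smooth D (partial i (P 3%N)) := smooth_partial i (sP 3%N).

Lemma smooth_Tform i j : smooth D (T i j).
Proof.
apply: (smoothD oD); first exact: (smooth_gI eps oD sP).
exact: (smoothM oD f_comp.1 (smoothM oD (sh i) (sh j))).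
Qed.

Lemma smooth_Q1 : smooth D q1.
Proof.
have sT := smooth_Tform; have s1 := smooth_tau1; have s2 := smooth_tau2.
apply: (smoothD oD); last by apply: (smoothM oD) => //; exact: (smoothB oD (smoothM oD s1 s1) (smoothM oD s2 s2)).
exact: (smoothB oD (sT 0 0) (smoothM oD (smooth_cst D 2) (smoothM oD s1 (sT 0 1)))).
Qed.

Lemma smooth_Q2 : smooth D q2.
Proof.
have sT := smooth_Tform; have s1 := smooth_tau1; have s2 := smooth_tau2.
exact: (smoothB oD (smoothM oD (smooth_cst D 2) (smoothM oD (smoothM oD s1 s2) (sT 1 1)))
  (smoothM oD (smooth_cst D 2) (smoothM oD s2 (sT 0 1)))).
Qed.

Let dd (F : plane -> R) i u : smooth D F -> D u -> is_derive u (delta_mx 0 i) F (partial i F u).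
Proof. by move=> sF Du; apply: derivableP; exact: smooth_derivable sF Du. Qed.

Let pdE (F : plane -> R) i u (d : R) : is_derive u (delta_mx 0 i) F d -> partial i F u = d.
Proof. by case=> _ <-. Qed.

Let dT i j k u : D u -> partial i (T j k) u = gam eps P i j k u + gam eps P i k j u
  + (- (f^`()%classic (tcoef n u)) * (2 * n 3%N u * partial i (n 3%N) u) * (partial j (P 3%N) u * partial k (P 3%N) u)
     + f (tcoef n u) * (partial i (partial j (P 3%N)) u * partial k (P 3%N) u
         + partial i (partial k (P 3%N)) u * partial j (P 3%N) u)).
Proof.
move=> Du.
have dt : partial i (tcoef n) u = - (2 * n 3%N u * partial i (n 3%N) u).
  apply: etrans (pdE (derB (derC 1 u (delta_mx 0 i)) (derM (dd i (sn 3%N) Du) (dd i (sn 3%N) Du)))) _.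
  by move: (partial i (n 3%N) u) => x; ring.
have df : is_derive u (delta_mx 0 i) (fun u => f (tcoef n u)) (partial i (tcoef n) u * f^`()%classic (tcoef n u)).
  by rewrite -f_comp.2 //; apply: dd => //; exact: f_comp.1.
apply: etrans (pdE (derD (dd i (smooth_gI eps oD sP j k) Du)
   (derM df (derM (dd i (sh j) Du) (dd i (sh k) Du))))) _.
rewrite (partial_gI eps sP i j k Du) dt.
move: (partial i (n 3%N) u) (partial i (partial j (P 3%N)) u) (partial i (partial k (P 3%N)) u)
  (partial j (P 3%N) u) (partial k (P 3%N) u) (f^`()%classic (tcoef n u)) (gam eps P i j k u) (gam eps P i k j u) (f (tcoef n u)) => *; ring.
Qed.

Let dQ1 i u : D u -> partial i q1 u = partial i (T 0 0) u
  - 2 * (t1 u * partial i (T 0 1) u + T 0 1 u * partial i t1 u)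
  + ((t1 u * t1 u - t2 u * t2 u) * partial i (T 1 1) u
     + T 1 1 u * (2 * (t1 u * partial i t1 u - t2 u * partial i t2 u))).
Proof.
move=> Du; have d1 := dd i smooth_tau1 Du; have d2 := dd i smooth_tau2 Du.
have sT j k := dd i (smooth_Tform j k) Du.
apply: etrans (pdE (derD (derB (sT 0 0) (derM (derC 2 u (delta_mx 0 i)) (derM d1 (sT 0 1))))
   (derM (derB (derM d1 d1) (derM d2 d2)) (sT 1 1)))) _.
clearbody T t1 t2; move: (partial i (T 0 0) u) (partial i (T 0 1) u) (partial i (T 1 1) u) (partial i t1 u) (partial i t2 u)
  (T 0 1 u) (T 1 1 u) (t1 u) (t2 u) => *; ring.
Qed.

Let dQ2 i u : D u -> partial i q2 u =
  2 * (t1 u * t2 u * partial i (T 1 1) u + T 1 1 u * (t1 u * partial i t2 u + t2 u * partial i t1 u))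
  - 2 * (t2 u * partial i (T 0 1) u + T 0 1 u * partial i t2 u).
Proof.
move=> Du; have d1 := dd i smooth_tau1 Du; have d2 := dd i smooth_tau2 Du.
have sT j k := dd i (smooth_Tform j k) Du.
apply: etrans (pdE (derB (derM (derC 2 u (delta_mx 0 i)) (derM (derM d1 d2) (sT 1 1)))
   (derM (derC 2 u (delta_mx 0 i)) (derM d2 (sT 0 1))))) _.
clearbody T t1 t2; move: (partial i (T 0 1) u) (partial i (T 1 1) u) (partial i t1 u) (partial i t2 u)
  (T 0 1 u) (T 1 1 u) (t1 u) (t2 u) => *; ring.
Qed.

Let dB01 i u : D u -> partial i (gII eps P n 0 1) u =
  t1 u * partial i (gII eps P n 1 1) u + gII eps P n 1 1 u * partial i t1 u.
Proof.
move=> Du; rewrite (partial_ext i oD Du gII01E).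
exact: (pdE (derM (dd i smooth_tau1 Du) (dd i (sgII 1 1) Du))).
Qed.

Let dB00 i u : D u -> partial i (gII eps P n 0 0) u =
  (t1 u * t1 u + t2 u * t2 u) * partial i (gII eps P n 1 1) u
  + gII eps P n 1 1 u * (2 * (t1 u * partial i t1 u + t2 u * partial i t2 u)).
Proof.
move=> Du; rewrite (partial_ext i oD Du gII00E).
have d1 := dd i smooth_tau1 Du; have d2 := dd i smooth_tau2 Du.
apply: etrans (pdE (derM (derD (derM d1 d1) (derM d2 d2)) (dd i (sgII 1 1) Du))) _.
move: (partial i (gII eps P n 1 1) u) (partial i t1 u) (partial i t2 u) (gII eps P n 1 1 u) (t1 u) (t2 u) => *; ring.
Qed.

Let dW i u : D u ->
  (a + b) * (partial i (gII eps P n 0 0) u * gII eps P n 1 1 u + gII eps P n 0 0 u * partial i (gII eps P n 1 1) u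
    - 2 * (gII eps P n 0 1 u * partial i (gII eps P n 0 1) u)) =
  - (2 * eps * a * n 3%N u * partial i (n 3%N) u) * detI eps P u
  + (c - eps * a * (n 3%N u * n 3%N u)) * (2 * (Gam eps P 0 i 0 u + Gam eps P 1 i 1 u) * detI eps P u).
Proof.
move=> Du; have dn := dd i (sn 3%N) Du; have dB j k := dd i (sgII j k) Du.
have dg j k := dd i (smooth_gI eps oD sP j k) Du.
have E1 := pdE (derM (derC (a + b) u (delta_mx 0 i)) (derB (derM (dB 0 0) (dB 1 1)) (derM (dB 0 1) (dB 0 1)))).
have E2 := pdE (derM (derB (derC c u (delta_mx 0 i)) (derM (derC (eps * a) u (delta_mx 0 i)) (derM dn dn)))
  (derB (derM (dg 0 0) (dg 1 1)) (derM (dg 0 1) (dg 0 1)))).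
have E := partial_ext i oD Du (patch_W pD).
rewrite [LHS]E1 [RHS]E2 in E.
move: E; rewrite !(partial_gI eps sP _ _ _ Du) !(gamE dI _ _ _ Du) (gI_sym eps P 1 0).
rewrite /detI.
move: (partial i (n 3%N) u) (partial i (gII eps P n 0 0) u) (partial i (gII eps P n 0 1) u) (partial i (gII eps P n 1 1) u)
  (n 3%N u) (gII eps P n 0 0 u) (gII eps P n 0 1 u) (gII eps P n 1 1 u)
  (Gam eps P 0 i 0 u) (Gam eps P 1 i 0 u) (Gam eps P 0 i 1 u) (Gam eps P 1 i 1 u) (gI eps P 0 0 u) (gI eps P 0 1 u) (gI eps P 1 1 u).
move=> x1 x2 x3 x4 x5 x6 x7 x8 y1 y2 y3 y4 g1 g2 g3 E.
apply: etrans (etrans E _); ring.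
Qed.

Let pB10 i u : D u -> partial i (gII eps P n 1 0) u = partial i (gII eps P n 0 1) u.
Proof. by move=> Du; apply: (partial_ext i oD Du) => v Dv; exact: (gII_sym eps oD n sP 1 0 Dv). Qed.

(** Otherwise the curvature equation would force [det II = 0]. *)
Let sg0 u : D u -> c - eps * a * (n 3%N u * n 3%N u) != 0.
Proof.
move=> Du; have := patch_W pD Du => W; apply/eqP => s0.
move: W; rewrite s0 mul0r => /eqP; rewrite mulf_eq0 (negbTE ab0) /= gt_eqF //.
exact: (patch_dII pD Du).
Qed.

Let I : R[i] := 'i%C.
Let ii : I * I = -1. Proof. by rewrite -expr2 sqr_i. Qed.

Let Ac u : R[i] := Qcoef1 eps a b c (gI eps P 0 0 u) (gI eps P 0 1 u) (gI eps P 1 1 u)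
  (partial 0 (P 3%N) u) (partial 1 (P 3%N) u) (n 3%N u) (t1 u) (t2 u) (gII eps P n 1 1 u)
  (Gam eps P 0 0 0 u) (Gam eps P 0 0 1 u) (Gam eps P 0 1 1 u)
  (Gam eps P 1 0 0 u) (Gam eps P 1 0 1 u) (Gam eps P 1 1 1 u)
  (partial 0 t1 u) (partial 0 t2 u) (partial 1 t1 u) (partial 1 t2 u)
  (f (tcoef n u)) (f^`()%classic (tcoef n u)) I.

Let Bc u : R[i] := Qcoef2 eps a b c (gI eps P 0 0 u) (gI eps P 0 1 u) (gI eps P 1 1 u)
  (partial 0 (P 3%N) u) (partial 1 (P 3%N) u) (n 3%N u) (t1 u) (t2 u) (gII eps P n 1 1 u)
  (f (tcoef n u)) (f^`()%classic (tcoef n u)) I.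

Let Q_complex u : D u ->
  (partial 0 q1 u)%:C + I * (partial 0 q2 u)%:C
  - ((t1 u)%:C - I * (t2 u)%:C) * ((partial 1 q1 u)%:C + I * (partial 1 q2 u)%:C)
  = Ac u * ((q1 u)%:C + I * (q2 u)%:C) + Bc u * ((q1 u)%:C - I * (q2 u)%:C).
Proof.
move=> Du.
have xx := patch_xx pD; have xn := patch_xn pD; have nn := patch_nn pD; have pn := patch_pn pD.
have w0 := weingarten oD eps2 sP sn xx xn nn pn dI 0 Du.
have w1 := weingarten oD eps2 sP sn xx xn nn pn dI 1 Du.
have cod0 := codazzi oD eps2 sP sn xx xn nn pn dI 0 Du.
have cod1 := codazzi oD eps2 sP sn xx xn nn pn dI 1 Du.
have nh := norm_dh oD eps2 sP xx xn nn pn dI Du.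
have hess i j := hessian_height oD eps2 sP xx xn nn pn dI i j Du.
have dW0 := dW 0 Du; have dW1 := dW 1 Du.
have ode : (c - eps * a * (n 3%N u * n 3%N u)) * ((1 - n 3%N u * n 3%N u) * f^`()%classic (tcoef n u) + 2 * f (tcoef n u)) =
   eps * (2 * a + b) * (1 + (1 - n 3%N u * n 3%N u) * f (tcoef n u)).
  by rewrite -(f_ode (tcoef_itv Du)) /tcoef subKr.
have G10 k : Gam eps P k 1 0 u = Gam eps P k 0 1 u by exact: (Gam_sym eps oD sP k 1 0 Du).
have II10 := gII_sym eps oD n sP 1 0 Du.
rewrite (pB10 0 Du) !G10 II10 (gI_sym eps P 1 0) in cod0.
rewrite II10 in cod1; rewrite !G10 in dW1; rewrite II10 in w1.
have t20 : t2 u != 0 by rewrite gt_eqF // tau2_gt0.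
have := Q_equation_real (gII00E Du) (gII01E Du) (dB01 0 Du) (dB01 1 Du) (dB00 0 Du) (dB00 1 Du)
  (B11' Du) t20 (sg0 Du) (dI Du) ab0 w0 w1 cod0 cod1 (patch_W pD Du) dW0 dW1 nh ode ii.
rewrite -/(Ac u) -/(Bc u) => K; apply: etrans (etrans K _); last exact: erefl.
pose hh i j := Gam eps P 0 i j u * partial 0 (P 3%N) u + Gam eps P 1 i j u * partial 1 (P 3%N) u
  + gII eps P n i j u * n 3%N u.
have dT2 i j k : partial i (T j k) u = Gam eps P 0 i j u * gI eps P 0 k u + Gam eps P 1 i j u * gI eps P 1 k u
    + (Gam eps P 0 i k u * gI eps P 0 j u + Gam eps P 1 i k u * gI eps P 1 j u)
    + (- (f^`()%classic (tcoef n u)) * (2 * n 3%N u * partial i (n 3%N) u) * (partial j (P 3%N) u * partial k (P 3%N) u)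
     + f (tcoef n u) * (hh i j * partial k (P 3%N) u + hh i k * partial j (P 3%N) u)).
  by rewrite (dT i j k Du) !(gamE dI _ _ _ Du) !hess.
have gI10 := gI_sym eps P 1 0 u.
have TE j k : T j k u = gI eps P j k u + f (tcoef n u) * (partial j (P 3%N) u * partial k (P 3%N) u) by [].
have dq1 i := dQ1 i Du; have dq2 i := dQ2 i Du.
clearbody q1 q2 T t1 t2.
rewrite (dq1 0) (dq1 1) (dq2 0) (dq2 1) !dT2 !TE /hh !G10 II10 gI10 /=.
move: (t1 u) (t2 u) (partial 0 t1 u) (partial 0 t2 u) (partial 1 t1 u) (partial 1 t2 u).
move: (f (tcoef n u)) (f^`()%classic (tcoef n u)) (partial 0 (n 3%N) u) (partial 1 (n 3%N) u) (n 3%N u).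
move: (gII eps P n 0 0 u) (gII eps P n 0 1 u) (gII eps P n 1 1 u).
move: (gI eps P 0 0 u) (gI eps P 0 1 u) (gI eps P 1 1 u) (partial 0 (P 3%N) u) (partial 1 (P 3%N) u).
move: (Gam eps P 0 0 0 u) (Gam eps P 0 0 1 u) (Gam eps P 0 1 1 u).
move: (Gam eps P 1 0 0 u) (Gam eps P 1 0 1 u) (Gam eps P 1 1 1 u) => *.
by congr (_%:C + I * _%:C - _ * (_%:C + I * _%:C)); ring.
Qed.

Let ccst (x : R[i]) : csmooth D (fun _ => x). Proof. by split; exact: smooth_cst. Qed.

Ltac csm_split := repeat match goal with
  | |- csmooth _ (fun _ => ?x) => exact: (ccst x)
  | |- csmooth _ (fun u => (@?F u)%:C) => apply: (@csmooth_real R D F)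
  | |- csmooth _ (fun u => @?F u + @?G u) => apply: (@csmoothD R D oD F G)
  | |- csmooth _ (fun u => - @?F u) => apply: (@csmoothN R D oD F)
  | |- csmooth _ (fun u => @?F u * @?G u) => apply: (@csmoothM R D oD F G)
  | |- csmooth _ (fun u => (@?F u)^-1) => apply: (@csmoothV R D oD F)
  end.

Let smooth_coefs : csmooth D Ac /\ csmooth D Bc.
Proof.
have sG := smooth_Gam oD sP dI.
have sg_ := smooth_gI eps oD sP.
have s1 := smooth_tau1; have s2 := smooth_tau2.
have tn u : D u -> (t1 u)%:C + I * (t2 u)%:C - ((t1 u)%:C - I * (t2 u)%:C) != 0.
  move=> Du; have t20 : (t2 u)%:C != 0.
    by rewrite eq_complex /= eqxx andbT gt_eqF // tau2_gt0.
  have -> : (t1 u)%:C + I * (t2 u)%:C - ((t1 u)%:C - I * (t2 u)%:C) = 2 * I * (t2 u)%:C by ring.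
  have I0 : I != 0.
    by apply/eqP => i0; move: ii; rewrite i0 mul0r => /eqP; rewrite eq_sym oppr_eq0 oner_eq0.
  by rewrite !mulf_neq0 ?pnatr_eq0.
have tn' u : D u -> (t1 u)%:C - I * (t2 u)%:C - ((t1 u)%:C + I * (t2 u)%:C) != 0.
  by move=> /tn; rewrite -oppr_eq0 opprB.
have sgn u : D u -> c%:C - eps%:C * a%:C * ((n 3%N u)%:C * (n 3%N u)%:C) != 0.
  move=> /sg0; have -> : c%:C - eps%:C * a%:C * ((n 3%N u)%:C * (n 3%N u)%:C) =
    (c - eps * a * (n 3%N u * n 3%N u))%:C by rewrite rmorphB !rmorphM.
  by rewrite eq_complex /= eqxx andbT.
have dgn u : D u -> (gI eps P 0 0 u)%:C * (gI eps P 1 1 u)%:C - (gI eps P 0 1 u)%:C * (gI eps P 0 1 u)%:C != 0.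
  move=> /dI; have -> : (gI eps P 0 0 u)%:C * (gI eps P 1 1 u)%:C - (gI eps P 0 1 u)%:C * (gI eps P 0 1 u)%:C =
    (detI eps P u)%:C by rewrite /detI rmorphB !rmorphM.
  by rewrite eq_complex /= eqxx andbT.
split; rewrite /Ac /Bc /Qcoef1 /Qcoef2 /Qc1 /Qc2; clearbody t1 t2; csm_split.
all: lazymatch goal with
  | |- smooth _ (fun u => Gam _ _ ?k ?i ?j u) => exact: (sG k i j)
  | |- smooth _ (fun u => t1 u) => exact: s1
  | |- smooth _ (fun u => t2 u) => exact: s2
  | |- smooth _ (fun u => partial ?i t1 u) => exact: (smooth_partial i s1)
  | |- smooth _ (fun u => partial ?i t2 u) => exact: (smooth_partial i s2)
  | |- smooth _ (fun u => partial ?i (P _) u) => exact: (sh i)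
  | |- smooth _ (fun u => gI _ _ ?i ?j u) => exact: (sg_ i j)
  | |- smooth _ (fun u => gII _ _ _ ?i ?j u) => exact: (sgII i j)
  | |- smooth _ (fun u => f (tcoef n u)) => exact: f_comp.1
  | |- smooth _ (fun u => f^`()%classic (tcoef n u)) => exact: df_comp.1
  | |- smooth _ _ => exact: (sn 3%N)
  | |- _ => first [exact: tn'|exact: sgn|by move=> u Du; rewrite !mulf_neq0 ?tn ?dgn]
  end.
Qed.

(* In an isothermal chart for [II] this is a Cauchy-Riemann system for [q], up
   to terms of order zero. *)
Lemma Q_system : exists a11 a12 a21 a22 : plane -> R,
  [/\ smooth D a11, smooth D a12, smooth D a21 & smooth D a22] /\
  forall u, D u ->
  partial 0 q1 u - t1 u * partial 1 q1 u - t2 u * partial 1 q2 u = a11 u * q1 u + a12 u * q2 u /\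
  partial 0 q2 u - t1 u * partial 1 q2 u + t2 u * partial 1 q1 u = a21 u * q1 u + a22 u * q2 u.
Proof.
have [[A1 A2] [B1 B2]] := smooth_coefs.
exists (fun u => complex.Re (Ac u) + complex.Re (Bc u)), (fun u => complex.Im (Bc u) - complex.Im (Ac u)),
  (fun u => complex.Im (Ac u) + complex.Im (Bc u)), (fun u => complex.Re (Ac u) - complex.Re (Bc u)).
split; first by split; [exact: smoothD|exact: smoothB|exact: smoothD|exact: smoothB].
move=> u Du; have := Q_complex Du.
case: (Ac u) (Bc u) => [x1 x2] [y1 y2] /=.
move: (partial 0 q1 u) (partial 0 q2 u) (partial 1 q1 u) (partial 1 q2 u) (q1 u) (q2 u) (t1 u) (t2 u).
move=> d1 d2 d3 d4 z1 z2 s1 s2; rewrite /I => -[E1 E2].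
by split; [move: E1|move: E2]; lra.
Qed.

End QSystem.

(** * Continuation of zeros within a patch *)

Section Vanishing.
Variables (R : realType) (D : set 'rV[R]_2) (p : 'rV[R]_2).
Hypothesis Dp : D p.
Implicit Types (F : 'rV[R]_2 -> R) (v w : 'rV[R]_2).

(** Where [F] vanishes identically nearby, so do its partial derivatives, and continuity passes each
    zero to the limit point [p]. *)
Lemma flat_of_vanishing F k : smooth D F ->
  (forall d : R, 0 < d -> exists2 v, `|v - p| < d & \forall w \near v, F w = 0) -> flat_at p k F.
Proof.
have Fp G : smooth D G ->
    (forall d : R, 0 < d -> exists2 v, `|v - p| < d & \forall w \near v, G w = 0) -> G p = 0.
  move=> sG H; apply/eqP; apply: contraT => Gp.
  have G0 : 0 < `|G p| by rewrite normr_gt0.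
  have [d d0 Hd] := (continuousP _ _).1 (smooth_cont sG Dp) _ G0.
  have [v vd Gv] := H d d0; have := Hd v vd.
  by rewrite (nbhs_singleton Gv) sub0r normrN ltxx.
elim: k F => [|k IH] F sF H; first by split; first exact: Fp.
split=> [|i]; first exact: Fp.
apply: IH => [|d d0]; first exact: smooth_partial.
have [v vd Fv] := H d d0; exists v => //.
have [e e0 He] := (near_normP _ _).1 Fv.
apply/near_normP; exists e => // w wv.
have oB : open [set w | `|w - v| < e].
  apply/openP => x /= xv; exists (e - `|x - v|); first by rewrite subr_gt0.
  by move=> y yx; apply: le_lt_trans (ler_distD x _ _) _; lra.
rewrite (partial_ext (F := F) (G := fun _ => 0) i oB wv (fun y yv => He y yv)).
exact: partial_cst.
Qed.

Lemma locally_bounded F : smooth D F -> exists2 d : R, 0 < d &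
  forall u, `|u - p| < d -> `|F u| <= `|F p| + 1.
Proof.
move=> sF; have [d d0 H] := (continuousP _ _).1 (smooth_cont sF Dp) 1 ltr01.
exists d => // u /H /ltW ud.
by rewrite -lerBlDl (le_trans (lerB_dist _ _)).
Qed.

End Vanishing.

Lemma null_form_coefs (R : realFieldType) (x y z s t : R) : t != 0 ->
  x - 2 * (s * y) + (s * s - t * t) * z = 0 -> 2 * (s * t * z) - 2 * (t * y) = 0 ->
  y = s * z /\ x = (s * s + t * t) * z.
Proof.
move=> t0 e1 e2; have yE : y = s * z by apply: (mulfI t0); lra.
by split=> //; move: e1; rewrite yE; lra.
Qed.

(** The chart-free form of [q = 0], as [q] itself depends on the chart through [Z]; [Q_eq0P] relates
    the two. *)
Definition proportional (R : realType) (eps : R) (f : R -> R) (P n : nat -> 'rV[R]_2 -> R)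
  (u : 'rV[R]_2) : Prop :=
  exists m, forall i j, Tform eps f n P i j u = m * gII eps P n i j u.

Section PatchContinuation.
Variables (R : realType) (eps a b c : R) (f : R -> R) (D : set 'rV[R]_2).
Variables P n : nat -> 'rV[R]_2 -> R.
Hypotheses (eps_pm : eps = 1 \/ eps = -1) (ab0 : a + b != 0).
Hypothesis f_an : forall t, 0 <= t <= 1 -> analytic_at f t.
Hypothesis f_ode : forall t, 0 <= t <= 1 ->
  (c - eps * a * (1 - t)) * (t * f^`()%classic t + 2 * f t) = eps * (2 * a + b) * (1 + t * f t).
Hypothesis pD : patch eps a b c D P n.
Let oD : open D := patch_open pD.
Let q1 := Q1 eps f P n.
Let q2 := Q2 eps f P n.
Let t1 := tau1 eps P n.
Let t2 := tau2 eps P n.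

Lemma Tform_sym i j u : Tform eps f n P i j u = Tform eps f n P j i u.
Proof.
by rewrite /Tform (gI_sym eps P i j) [partial i (P 3%N) u * partial j (P 3%N) u]mulrC.
Qed.

(** A real quadratic form that vanishes on the null vector [Z] of [II] also vanishes on its
    conjugate, and these two conditions leave only the multiples of [II]. *)
Lemma Q_eq0P u : D u -> (q1 u = 0 /\ q2 u = 0) <-> proportional eps f P n u.
Proof.
move=> Du; have b00 := gII00E pD Du; have b01 := gII01E pD Du.
have b11 := lt0r_neq0 (gII11_gt0 pD Du); have t20 := lt0r_neq0 (tau2_gt0 pD Du).
rewrite /q1 /q2 /Q1 /Q2; split=> [[e1 e2]|[m H]].
  have [T01 T00] := null_form_coefs t20 e1 e2.
  exists (Tform eps f n P 1 1 u / gII eps P n 1 1 u) => i j.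
  have II10 := gII_sym eps oD n (patch_P pD) 1 0 Du.
  have E (y x s t : R) : x != 0 -> [/\ (s * s + t * t) * y = y / x * ((s * s + t * t) * x),
      s * y = y / x * (s * x) & y = y / x * x].
    by move=> x0; split; field.
  have [E1 E2 E3] := E (Tform eps f n P 1 1 u) _ (tau1 eps P n u) (tau2 eps P n u) b11.
  elim/forall2: i; elim/forall2: j; rewrite ?(Tform_sym 1 0) ?II10 ?T00 ?T01 ?b00 ?b01;
    [exact: E1|exact: E2|exact: E2|exact: E3].
rewrite !H b00 b01; move: (gII _ _ _ _ _ _) (tau1 _ _ _ _) (tau2 _ _ _ _) => x s t.
by split; ring.
Qed.

Lemma flat_continuation p : D p ->
  (forall k, flat_at p k q1 /\ flat_at p k q2) ->
  exists2 d : R, 0 < d & forall u, `|u - p| < d -> D u /\ proportional eps f P n u.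
Proof.
move=> Dp fl.
have [a11 [a12 [a21 [a22 [[s11 s12 s21 s22] H]]]]] := Q_system eps_pm ab0 f_an f_ode pD.
have [d1 d10 H1] := locally_bounded Dp s11; have [d2 d20 H2] := locally_bounded Dp s12.
have [d3 d30 H3] := locally_bounded Dp s21; have [d4 d40 H4] := locally_bounded Dp s22.
have [d5 d50 H5] := (openP D).1 oD p Dp.
pose d := Num.min (Num.min d1 d2) (Num.min (Num.min d3 d4) d5).
pose B := [set u : 'rV[R]_2 | `|u - p| < d].
have oB : open B.
  apply/openP => x /= xp; exists (d - `|x - p|); first by rewrite subr_gt0.
  by move=> y yx; apply: le_lt_trans (ler_distD x _ _) _; lra.
have Bp : B p by rewrite /B /= subrr normr0 !lt_min d10 d20 d30 d40.
have BD : B `<=` D by move=> u; rewrite /B /= !lt_min => /and3P[_ _ ud]; exact: H5.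
(* [unique_continuation] asks for one constant on its domain, so the domain is cut to a ball where
   the four coefficients are bounded. *)
pose M := `|a11 p| + `|a12 p| + `|a21 p| + `|a22 p| + 1.
have M0 : 0 <= M by rewrite /M; do ?apply: addr_ge0.
have sq1 := smooth_Q1 eps_pm f_an pD; have sq2 := smooth_Q2 eps_pm f_an pD.
have bound (x y z w : R) : `|x| <= M -> `|y| <= M -> `|x * z + y * w| <= M * (`|z| + `|w|).
  move=> xM yM; apply: le_trans (ler_normD _ _) _; rewrite mulrDr !normrM.
  by apply: lerD; exact: ler_wpM2r.
have n1 := normr_ge0 (a11 p); have n2 := normr_ge0 (a12 p).
have n3 := normr_ge0 (a21 p); have n4 := normr_ge0 (a22 p).
have [||u|d' d'0 Hd] := @unique_continuation R p B q1 q2 t1 t2 M oB Bp (smooth_sub BD sq1) (smooth_sub BD sq2)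
  (smooth_sub BD (smooth_tau1 pD)) (smooth_sub BD (smooth_tau2 pD)) (tau2_gt0 pD Dp) M0.
- move=> u Bu; have [-> _] := H u (BD u Bu).
  move: Bu; rewrite /B /= !lt_min => /and3P[/andP[u1 u2] /andP[u3 u4] _].
  by apply: bound; [have := H1 u u1|have := H2 u u2]; rewrite /M; lra.
- move=> u Bu; have [_ ->] := H u (BD u Bu).
  move: Bu; rewrite /B /= !lt_min => /and3P[/andP[u1 u2] /andP[u3 u4] _].
  by apply: bound; [have := H3 u u3|have := H4 u u4]; rewrite /M; lra.
- have bO F : smooth D F -> (forall k, flat_at p k F) -> bigO p u F.
    by move=> sF fF; case: (u) => [|k]; [exact: (bigO0 Dp)|exact: (flat_bigO oD Dp)].
  have [B1 [e1 [B10 e10 E1]]] := bO _ sq1 (fun k => (fl k).1).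
  have [B2 [e2 [B20 e20 E2]]] := bO _ sq2 (fun k => (fl k).2).
  exists (B1 + B2), (Num.min e1 e2); rewrite addr_ge0 // lt_min e10 e20; split=> // w.
  rewrite lt_min => /andP[w1 w2]; split.
    by apply: le_trans (E1 w w1) _; rewrite ler_wpM2r ?exprn_ge0 // lerDl.
  by apply: le_trans (E2 w w2) _; rewrite ler_wpM2r ?exprn_ge0 // lerDr.
exists (Num.min d d'); first by rewrite lt_min d'0 andbT !lt_min d10 d20 d30 d40.
move=> u; rewrite lt_min => /andP[ud ud']; have Du := BD u ud; split=> //.
exact/(Q_eq0P Du)/Hd.
Qed.

End PatchContinuation.

Section LocalFields.
Variables (R : realType) (eps : R) (f : R -> R) (E : set 'rV[R]_2) (P n P' n' : nat -> 'rV[R]_2 -> R).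
Hypotheses (oE : open E) (eP : forall u, E u -> ev P u = ev P' u) (en : forall u, E u -> ev n u = ev n' u).

(** A field pulled back by a transition map equals the field of the other chart on the overlap only;
    hence these congruences on an open set. *)
Lemma gI_ext i j u : E u -> gI eps P i j u = gI eps P' i j u.
Proof. by move=> Eu; rewrite /gI (dX_ext oE i Eu eP) (dX_ext oE j Eu eP). Qed.

Lemma gII_ext i j u : E u -> gII eps P n i j u = gII eps P' n' i j u.
Proof.
move=> Eu; rewrite /gII (en Eu).
by rewrite (dX_ext oE i (X := dX j P) (Y := dX j P') Eu (fun v Ev => dX_ext oE j Ev eP)).
Qed.

Lemma Tform_ext i j u : E u -> Tform eps f n P i j u = Tform eps f n' P' i j u.
Proof.
move=> Eu; rewrite /Tform gI_ext // /tcoef.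
have e3 v : E v -> P 3%N v = P' 3%N v by move=> Ev; exact: (congr1 (fun X => X 3%N) (eP Ev)).
rewrite (partial_ext i oE Eu e3) (partial_ext j oE Eu e3).
by have -> : n 3%N u = n' 3%N u by exact: (congr1 (fun X => X 3%N) (en Eu)).
Qed.

Lemma patch_ext a b c : patch eps a b c E P n -> fsmooth E P' -> fsmooth E n' -> patch eps a b c E P' n'.
Proof.
move=> [_ sP sn xx xn nn pn dI B0 dB W] sP' sn'.
have hor u : E u -> ev (horizontal P') u = ev (horizontal P) u.
  move=> Eu; apply/funext => m; rewrite /ev /horizontal; case: (m == 3%N) => //.
  exact: (congr1 (fun X => X m) (esym (eP Eu))).
have dIE u : E u -> detI eps P' u = detI eps P u by move=> Eu; rewrite /detI !gI_ext.
have dIIE u : E u -> detII eps P' n' u = detII eps P n u by move=> Eu; rewrite /detII !gII_ext.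
split=> //.
- by move=> u Eu; rewrite hor // xx.
- by move=> u Eu; rewrite hor // -en // xn.
- by move=> u Eu; rewrite -en // nn.
- by move=> i u Eu; rewrite -(dX_ext oE i Eu eP) -en // pn.
- by move=> u Eu; rewrite dIE // dI.
- by move=> u Eu; rewrite -gII_ext // B0.
- by move=> u Eu; rewrite dIIE // dB.
move=> u Eu; rewrite dIIE // dIE // W //.
by have -> : n 3%N u = n' 3%N u by exact: (congr1 (fun X => X 3%N) (en Eu)).
Qed.

End LocalFields.

Section ProportionalTransport.
Variables (R : realType) (eps : R) (f : R -> R) (D E : set 'rV[R]_2).
Variables (psi : 'rV[R]_2 -> 'rV[R]_2) (P n P' n' : nat -> 'rV[R]_2 -> R).
Hypotheses (oD : open D) (oE : open E) (psiD : forall u, E u -> D (psi u)).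
Hypothesis spsi : forall i, smooth E (fun u => psi u 0 i).
Hypotheses (sP : fsmooth D P) (sn : fsmooth D n).
Hypothesis pn : forall i u, D u -> ip eps (ev (dX i P) u) (ev n u) = 0.
Hypotheses (eP : forall u, E u -> ev (pullf psi P) u = ev P' u).
Hypotheses (en : forall u, E u -> ev (pullf psi n) u = ev n' u).

(* Both forms transform alike, so that being proportional is intrinsic. *)
Lemma proportional_transport u : E u -> proportional eps f P n (psi u) -> proportional eps f P' n' u.
Proof.
move=> Eu [m H]; exists m => i j.
rewrite -(Tform_ext eps f oE eP en i j Eu) -(gII_ext eps oE eP en i j Eu).
rewrite (gII_pullf oD oE psiD spsi sP sn pn i j Eu) /Tform (gI_pullf eps oD psiD spsi sP i j Eu).
have ph k : partial k (pullf psi P 3%N) u = jac psi 0 k u * partial 0 (P 3%N) (psi u)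
    + jac psi 1 k u * partial 1 (P 3%N) (psi u).
  exact: (partial_comp oD psiD spsi k (sP 3%N) Eu).
rewrite (ph i) (ph j).
have h00 := H 0 0; have h01 := H 0 1; have h10 := H 1 0; have h11 := H 1 1.
rewrite /Tform in h00 h01 h10 h11.
have -> : tcoef (pullf psi n) u = tcoef n (psi u) by [].
have A (x y z : R) : x + y = z -> x = z - y by move=> <-; rewrite addrK.
rewrite (A _ _ _ h00) (A _ _ _ h01) (A _ _ _ h10) (A _ _ _ h11).
move: (gII eps P n 0 0 _) (gII eps P n 0 1 _) (gII eps P n 1 0 _) (gII eps P n 1 1 _)
  (partial 0 (P 3%N) _) (partial 1 (P 3%N) _) (f _)
  (jac psi 0 i u) (jac psi 1 i u) (jac psi 0 j u) (jac psi 1 j u) => *; ring.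
Qed.

End ProportionalTransport.

Lemma smooth_coord_comp (R : realType) (D : set 'rV[R]_2) (psi : 'rV[R]_2 -> 'rV[R]_2) i :
  open D -> smooth D psi -> smooth D (fun u => psi u 0 i).
Proof.
move=> oD s k; apply: (Ck_linear (L := fun x : 'rV[R]_2 => x 0 i)) => // [r x|x y|].
- by rewrite mxE.
- by rewrite mxE.
exact: coord_continuous.
Qed.

(** * Charts *)

Section Charts.
Variables (R : realType) (S : topologicalType).
Implicit Types z w : chart R S.

Definition overlap z w : set 'rV[R]_2 := cod w `&` (param w @^-1` dom z).
Definition transition z w (u : 'rV[R]_2) : 'rV[R]_2 := Defs.coord z (param w u).

Lemma overlap_open z w : open (overlap z w).
Proof.
rewrite openE => u [cu du]; apply: filterI; first exact: open_nbhs_nbhs (conj (@cod_open _ _ w) cu).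
exact: param_continuous cu _ (open_nbhs_nbhs (conj (@dom_open _ _ z) du)).
Qed.

Lemma transition_overlap z w u : overlap z w u -> overlap w z (transition z w u).
Proof.
move=> [cu du]; split; first exact: coord_cod.
by rewrite /preimage /= /transition coordK //; exact: param_dom.
Qed.

Lemma transitionK z w u : overlap z w u -> transition w z (transition z w u) = u.
Proof. by move=> [cu du]; rewrite /transition coordK // paramK. Qed.

Lemma smooth_transition_coord z w i : smooth_transition w z ->
  smooth (overlap z w) (fun u => transition z w u 0 i).
Proof. by move=> s; apply: smooth_coord_comp; [exact: overlap_open|exact: s]. Qed.

(** By the chain rule its product with the Jacobian of the inverse transition is 1. *)
Lemma jacobian_neq0 z w u : compatible z w -> overlap z w u -> jacobian (transition z w) u != 0.
Proof.
move=> [szw swz] ou.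
have sp i := smooth_transition_coord i swz; have sc i := smooth_transition_coord i szw.
have pc k i := partial_comp (@overlap_open w z) (@transition_overlap z w) sp i (sc k) ou.
have id k i : partial i (fun v => transition w z (transition z w v) 0 k) u = (k == i)%:R.
  rewrite (partial_ext i (@overlap_open z w) ou (F := _) (G := fun v : 'rV[R]_2 => v 0 k)); last first.
    by move=> v /transitionK ->.
  by case: (is_derive_coord u (delta_mx 0 i) k) => _ E; rewrite [LHS]E mxE eqxx.
have E00 := pc 0 0; have E01 := pc 0 1; have E10 := pc 1 0; have E11 := pc 1 1.
rewrite !id /= in E00 E01 E10 E11; apply/eqP => j0.
have key (x0 x1 y0 y1 a b c d : R) : 1 = a * x0 + c * x1 -> 0 = b * x0 + d * x1 ->
    0 = a * y0 + c * y1 -> 1 = b * y0 + d * y1 -> (a * d - b * c) * (x0 * y1 - x1 * y0) = 1.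
  move=> e1 e2 e3 e4; transitivity ((a * x0 + c * x1) * (b * y0 + d * y1) - (b * x0 + d * x1) * (a * y0 + c * y1)).
    by ring.
  by rewrite -e1 -e2 -e3 -e4 mulr1 mul0r subr0.
have := key _ _ _ _ _ _ _ _ E00 E01 E10 E11.
by rewrite -/(jacobian _ _) j0 mul0r => /eqP; rewrite eq_sym oner_eq0.
Qed.

End Charts.

(** * The global argument *)

Section Surface.
Variables (R : realType) (eps a b c : R) (f : R -> R).
Variables (S : smoothSurface R) (phi N : S -> 'rV[R]_3 * R).
Hypotheses (eps_pm : eps = 1 \/ eps = -1) (ab0 : a + b != 0).
Hypothesis f_an : forall t, 0 <= t <= 1 -> analytic_at f t.
Hypothesis f_ode : forall t, 0 <= t <= 1 ->
  (c - eps * a * (1 - t)) * (t * f^`()%classic t + 2 * f t) = eps * (2 * a + b) * (1 + t * f t).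
Hypotheses (im : immersion eps phi) (un : unit_normal eps phi N).
Hypotheses (pK : positive_Ke eps phi N) (pII : second_form_posdef eps phi N).
Hypothesis WS : W_surface eps a b c phi N.

Local Notation X z := (comp_field (phi \o param z)).
Local Notation Y z := (comp_field (N \o param z)).
Let zpatch z (az : atlas z) : patch eps a b c (cod z) (X z) (Y z) := atlas_patch eps_pm im un pK pII WS az.

Let pull_field (F : S -> 'rV[R]_3 * R) (z w : chart R S) u : overlap z w u ->
  ev (pullf (transition z w) (comp_field (F \o param z))) u = ev (comp_field (F \o param w)) u.
Proof. by move=> [cu du]; rewrite /ev /pullf /comp_field /transition /= coordK. Qed.

(** The hypotheses on the surface concern atlas charts. A conformal chart [w] need not be one of
    them and inherits its patch from the overlap with an atlas chart. *)
Lemma overlap_patch z w : atlas z -> compatible z w ->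
  patch eps a b c (overlap z w) (X w) (Y w).
Proof.
move=> az czw; have pz := zpatch az; have [_ swz] := czw.
have tc u : overlap z w u -> cod z (transition z w u) by move=> [cu du]; exact: coord_cod.
have st i := smooth_transition_coord i swz.
have oo := @overlap_open _ _ z w.
have pp := patch_pullf pz oo tc st (fun u ou => jacobian_neq0 czw ou).
apply: (patch_ext oo (@pull_field phi z w) (@pull_field N z w) pp).
  move=> m; apply: (smooth_ext oo _ (patch_P pp m)) => u ou.
  exact: (congr1 (fun F => F m) (@pull_field phi z w u ou)).
move=> m; apply: (smooth_ext oo _ (patch_n pp m)) => u ou.
exact: (congr1 (fun F => F m) (@pull_field N z w u ou)).
Qed.

Lemma proportional_chart z w u : atlas z -> compatible z w -> overlap z w u ->
  proportional eps f (X z) (Y z) (transition z w u) -> proportional eps f (X w) (Y w) u.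
Proof.
move=> az [_ swz] ou; have pz := zpatch az.
apply: (proportional_transport (patch_open pz) (@overlap_open _ _ z w) _ _ (patch_P pz) (patch_n pz)
  (patch_pn pz) (@pull_field phi z w) (@pull_field N z w) ou).
- by move=> v [cv dv]; exact: coord_cod.
- by move=> i; exact: smooth_transition_coord.
Qed.

(** The converse direction of [proportional_chart]; the patch in [w] now has to come from
    [overlap_patch]. *)
Lemma proportional_atlas z w u : atlas z -> compatible z w -> overlap w z u ->
  proportional eps f (X w) (Y w) (transition w z u) -> proportional eps f (X z) (Y z) u.
Proof.
move=> az czw ou; have pw := overlap_patch az czw; have [szw _] := czw.
apply: (proportional_transport (patch_open pw) (@overlap_open _ _ w z) _ _ (patch_P pw) (patch_n pw)
  (patch_pn pw) (@pull_field phi w z) (@pull_field N w z) ou).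
- by move=> v ov; exact: transition_overlap.
- by move=> i; exact: smooth_transition_coord.
Qed.

Let transition_cont z w u : overlap z w u -> {for u, continuous (@transition R S z w)}.
Proof.
move=> [cu du]; apply: (continuous_comp (f := param w) (g := Defs.coord z)).
  exact: param_continuous.
exact: Defs.coord_continuous.
Qed.

(** One atlas chart is enough in the definition; [locally_proportional_chart] passes to every chart
    compatible with the atlas. *)
Definition locally_proportional : set S := [set p | exists z : chart R S, [/\ atlas z, dom z p &
  exists2 d : R, 0 < d & forall v, `|v - Defs.coord z p| < d -> cod z v -> proportional eps f (X z) (Y z) v]].

Lemma locally_proportional_chart p (w : chart R S) : locally_proportional p ->
  (forall z, atlas z -> compatible z w) -> dom w p ->
  exists2 d : R, 0 < d & forall u, `|u - Defs.coord w p| < d -> proportional eps f (X w) (Y w) u.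
Proof.
move=> [z [az dz [d d0 H]]] cw dw.
have ou : overlap z w (Defs.coord w p) by split; [exact: coord_cod|rewrite /= coordK].
have [d1 d10 H1] := (openP _).1 (@overlap_open _ _ z w) _ ou.
have [d2 d20 H2] := (continuousP _ _).1 (transition_cont ou) _ d0.
exists (Num.min d1 d2); first by rewrite lt_min d10.
move=> u; rewrite lt_min => /andP[ud1 ud2]; have ouu := H1 u ud1.
apply: (proportional_chart az (cw z az) ouu); apply: H; last by case: ouu => cu du; exact: coord_cod.
by have := H2 u ud2; rewrite {2}/transition coordK.
Qed.

Lemma locally_proportional_open : open locally_proportional.
Proof.
rewrite openE => p [z [az dz [d d0 H]]].
have ndom : nbhs p (dom z) by exact: open_nbhs_nbhs (conj (@dom_open _ _ z) dz).
have nball : nbhs p (Defs.coord z @^-1` [set v | `|v - Defs.coord z p| < d]).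
  have nb : \forall v \near Defs.coord z p, `|v - Defs.coord z p| < d by apply/near_normP; exists d.
  exact: (Defs.coord_continuous dz nb).
apply: filterS (filterI ndom nball) => p' [dz' bp']; exists z; split=> //.
exists (d - `|Defs.coord z p' - Defs.coord z p|); first by rewrite subr_gt0.
move=> v vd cv; apply: H => //; apply: le_lt_trans (ler_distD (Defs.coord z p') _ _) _; lra.
Qed.

(** Arbitrarily close to a limit point there are points near which [q] vanishes. Hence [q] is flat
    at the limit point, and [flat_continuation] fills a neighbourhood. *)
Lemma locally_proportional_closed : closed locally_proportional.
Proof.
move=> p clp; have [z az dz] := atlas_cover p; have pz := zpatch az.
have cp := coord_cod dz.
have van (d : R) : 0 < d -> exists2 v, `|v - Defs.coord z p| < d &
    \forall w \near v, Q1 eps f (X z) (Y z) w = 0 /\ Q2 eps f (X z) (Y z) w = 0.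
  move=> d0.
  have ndom : nbhs p (dom z) by exact: open_nbhs_nbhs (conj (@dom_open _ _ z) dz).
  have nball : nbhs p (Defs.coord z @^-1` [set v | `|v - Defs.coord z p| < d]).
    have nb : \forall v \near Defs.coord z p, `|v - Defs.coord z p| < d by apply/near_normP; exists d.
    exact: (Defs.coord_continuous dz nb).
  have [p' [lp' [dz' bp']]] := clp _ (filterI ndom nball).
  exists (Defs.coord z p') => //.
  have [e e0 He] := locally_proportional_chart lp' (fun w aw => atlas_compatible aw az) dz'.
  have [e1 e10 He1] := (openP _).1 (@cod_open _ _ z) _ (coord_cod dz').
  apply/near_normP; exists (Num.min e e1); first by rewrite lt_min e0.
  move=> w; rewrite lt_min => /andP[w1 w2].
  exact/(Q_eq0P f pz (He1 w w2))/He.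
have [k|d d0 H] := flat_continuation eps_pm ab0 f_an f_ode pz cp.
  split; apply: (flat_of_vanishing cp).
  - exact: smooth_Q1 eps_pm f_an pz.
  - by move=> d /van[v vd nv]; exists v => //; apply: filterS nv => w [].
  - exact: smooth_Q2 eps_pm f_an pz.
  - by move=> d /van[v vd nv]; exists v => //; apply: filterS nv => w [].
exists z; split=> //; exists d => // v vd _; by case: (H v vd).
Qed.

Lemma locally_proportional_cases : connected [set: S] ->
  locally_proportional = set0 \/ locally_proportional = setT.
Proof.
move=> cS; have [->|/set0P ne] := eqVneq locally_proportional set0; first by left.
right; apply: cS => //.
  by exists locally_proportional; [exact: locally_proportional_open|rewrite setTI].
by exists locally_proportional; [exact: locally_proportional_closed|rewrite setTI].
Qed.

Section ConformalChart.
(** [f0] is the given function, and [f] an extension of it that is analytic across 0 and 1. *)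
Variables (f0 : R -> R) (w : chart R S) (u0 : 'rV[R]_2).
Hypothesis f0E : forall t, 0 <= t <= 1 -> f t = f0 t.
Hypothesis cw : conformal_parameter eps phi N w.
Hypothesis cu0 : cod w u0.

(** [D] is the part of [w] that meets one atlas chart around the point, since the patch is available
    there. *)
Lemma conformal_patch : exists D : set 'rV[R]_2, [/\ D u0, D `<=` cod w,
  patch eps a b c D (X w) (Y w),
  forall u, D u -> tau1 eps (X w) (Y w) u = 0 /\ tau2 eps (X w) (Y w) u = 1 &
  forall u, D u -> Qcoef eps f0 phi N w u =
    (4^-1 * Q1 eps f (X w) (Y w) u) +i* (4^-1 * Q2 eps f (X w) (Y w) u)].
Proof.
have [z az dz] := atlas_cover (param w u0); have [comp conf] := cw.
have czw : compatible z w by have [] := comp z az.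
have pw := overlap_patch az czw; have oD := patch_open pw; have sX := patch_P pw.
have tauE u : overlap z w u -> tau1 eps (X w) (Y w) u = 0 /\ tau2 eps (X w) (Y w) u = 1.
  move=> ou; have [rho rho0 E] := conf u ou.1.
  have II i j : gII eps (X w) (Y w) i j u = (2 * rho) *+ (i == j).
    by rewrite -(second_formE eps (N \o param w) i j oD sX ou) E !mxE.
  have r0 : 0 < 2 * rho by rewrite mulr_gt0.
  rewrite /tau1 /tau2 /detII !II /= mulr1n mulr0n !mul0r subr0; split=> //.
  by rewrite -expr2 sqrtr_sqr gtr0_norm // divff // gt_eqF.
exists (overlap z w); split=> //; first by move=> u [].
move=> u ou; have [t1E t2E] := tauE u ou.
rewrite /Q1 /Q2 t1E t2E /Qcoef /Ecoef !(first_formE eps _ _ oD sX ou) /Defs.dz.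
have nu : angle eps N (param w u) = Y w 3%N u.
  by rewrite /angle /inner /lform /comp_field /= !mxE !mulr0 !addr0 add0r mulr1.
rewrite nu expr2 -/(tcoef (Y w) u) -(f0E (tcoef_itv eps_pm pw ou)) /Tform.
have -> : height phi \o param w = X w 3%N by [].
move: (gI _ _ 0 0 u) (gI _ _ 0 1 u) (gI _ _ 1 1 u) (partial 0 _ u) (partial 1 _ u) (f _) => x y v h0 h1 F.
by rewrite expr2; apply/eqP; rewrite eq_complex /=; apply/andP; split; apply/eqP; field.
Qed.

Lemma conformal_zero_vanishes : locally_proportional (param w u0) -> Qcoef eps f0 phi N w u0 = 0.
Proof.
move=> lp; have [D [Du0 _ pw _ ->]] := conformal_patch => //.
have [z az|d d0 H] := locally_proportional_chart lp _ (param_dom cu0).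
  by have [] := cw.1 z az.
have [-> ->] : Q1 eps f (X w) (Y w) u0 = 0 /\ Q2 eps f (X w) (Y w) u0 = 0.
  by apply/(Q_eq0P f pw Du0)/H; rewrite paramK // subrr normr0.
by rewrite mulr0.
Qed.

Lemma conformal_zero_index : locally_proportional = set0 -> Qcoef eps f0 phi N w u0 = 0 ->
  isolated_zero (Qcoef eps f0 phi N w) u0 /\
  exists2 j : R, line_field_index (cod w) (Qcoef eps f0 phi N w) u0 j & j < 0.
Proof.
move=> lp0 Q0; have [D [Du0 DW pw tauE QE]] := conformal_patch.
have oD := patch_open pw; have s1 := smooth_Q1 eps_pm f_an pw; have s2 := smooth_Q2 eps_pm f_an pw.
set q1 := Q1 eps f (X w) (Y w) in QE s1; set q2 := Q2 eps f (X w) (Y w) in QE s2.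
have [q10 q20] : q1 u0 = 0 /\ q2 u0 = 0.
  have [E1 E2] : 4^-1 * q1 u0 = 0 /\ 4^-1 * q2 u0 = 0 by move: Q0; rewrite QE // => -[].
  have n4 : (4 : R)^-1 != 0 by rewrite invr_eq0 pnatr_eq0.
  by split; apply: (mulfI n4); rewrite mulr0.
have [a11 [a12 [a21 [a22 [[sa11 sa12 sa21 sa22] H]]]]] := Q_system eps_pm ab0 f_an f_ode pw.
have e1 u : D u -> partial 0 q1 u - partial 1 q2 u = a11 u * q1 u + a12 u * q2 u.
  by move=> Du; have [<- _] := H u Du; have [-> ->] := tauE u Du; rewrite mul0r subr0 mul1r.
have e2 u : D u -> partial 0 q2 u + partial 1 q1 u = a21 u * q1 u + a22 u * q2 u.
  by move=> Du; have [_ <-] := H u Du; have [-> ->] := tauE u Du; rewrite mul0r subr0 mul1r.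
have [fl|[k [c1 [c2 [k0 c0 b1 b2]]]]] := finite_order oD Du0 s1 s2 sa11 sa12 sa21 sa22 e1 e2 q10 q20.
  (* Infinite order is excluded: continuation in [w], carried over to an atlas chart, would make the
     point locally proportional. *)
  have [d d0 Hd] := flat_continuation eps_pm ab0 f_an f_ode pw Du0 fl.
  have [z az dz] := atlas_cover (param w u0).
  have czw : compatible z w by have [] := cw.1 z az.
  suff : locally_proportional (param w u0) by rewrite lp0.
  exists z; split=> //.
  have ou : overlap w z (Defs.coord z (param w u0)).
    by split; [exact: coord_cod|rewrite /= coordK //; exact: param_dom].
  have [d1 d10 H1] := (openP _).1 (@overlap_open _ _ w z) _ ou.
  have [d2 d20 H2] := (continuousP _ _).1 (transition_cont ou) _ d0.
  exists (Num.min d1 d2); first by rewrite lt_min d10.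
  move=> v; rewrite lt_min => /andP[vd1 vd2] _.
  apply: (proportional_atlas az czw (H1 v vd1)).
  have : `|transition w z v - u0| < d.
    by have := H2 v vd2; rewrite {2}/transition coordK // paramK.
  by case/Hd.
pose Q := Qcoef eps f0 phi N w.
have cq1 u : D u -> {for u, continuous (fun v => complex.Re (Q v))}.
  move=> Du; apply: (cont_ext (F := fun v => 4^-1 * q1 v) oD Du).
    by move=> v Dv; rewrite /Q QE.
  by apply: contM; [exact: cont_cst|exact: smooth_cont s1 Du].
have cq2 u : D u -> {for u, continuous (fun v => complex.Im (Q v))}.
  move=> Du; apply: (cont_ext (F := fun v => 4^-1 * q2 v) oD Du).
    by move=> v Dv; rewrite /Q QE.
  by apply: contM; [exact: cont_cst|exact: smooth_cont s2 Du].
have n4 : (4 : R)^-1 != 0 by rewrite invr_eq0 pnatr_eq0.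
have c0' : 4^-1 * c1 != 0 \/ 4^-1 * c2 != 0.
  by case: c0 => c0; [left|right]; rewrite mulf_neq0.
have scale (F G : 'rV[R]_2 -> R) : bigO u0 k.+1 F -> (forall v, D v -> G v = 4^-1 * F v) -> bigO u0 k.+1 G.
  move=> [B [d [B0 d0 HB]]] E; have [d1 d10 H1] := (openP _).1 oD _ Du0.
  exists B, (Num.min d d1); split; [by []|by rewrite lt_min d0|].
  move=> v; rewrite lt_min => /andP[vd vd1]; rewrite (E v (H1 v vd1)) normrM.
  apply: le_trans (HB v vd); rewrite ler_piMl // gtr0_norm ?invr_gt0 //.
  by rewrite invf_le1 // ler1n.
have b1' : bigO u0 k.+1 (fun u => complex.Re (Q u) - (4^-1 * c1 * zre u0 k u - 4^-1 * c2 * zim u0 k u)).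
  by apply: (scale _ _ b1) => v Dv; rewrite /Q QE //=; ring.
have b2' : bigO u0 k.+1 (fun u => complex.Im (Q u) - (4^-1 * c1 * zim u0 k u + 4^-1 * c2 * zre u0 k u)).
  by apply: (scale _ _ b2) => v Dv; rewrite /Q QE //=; ring.
split; first by split=> //; exact: (leading_isolated oD Du0 c0' b1' b2').
have [j [r [r0 rD th]] j0] := leading_index oD Du0 k0 c0' cq1 cq2 b1' b2'.
by exists j => //; exists r; split=> // t s ts; have [/DW ? ?] := rD t s ts.
Qed.

End ConformalChart.

End Surface.

Theorem proposition4p5 (R : realType) (eps a b c : R) (f : R -> R)
  (S : smoothSurface R) (phi N : S -> 'rV[R]_3 * R) :
  eps = 1 \/ eps = -1 ->
  a != 0 -> 0 < b -> a + b != 0 -> 2 * a + b != 0 ->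
  is_f eps a b c f ->
  connected [set: S] ->
  immersion eps phi ->
  unit_normal eps phi N ->
  positive_Ke eps phi N ->
  second_form_posdef eps phi N ->
  W_surface eps a b c phi N ->
  (forall z, conformal_parameter eps phi N z ->
     forall u, cod z u -> Qcoef eps f phi N z u = 0) \/
  (forall z, conformal_parameter eps phi N z ->
     forall u, cod z u -> Qcoef eps f phi N z u = 0 ->
       isolated_zero (Qcoef eps f phi N z) u /\
       exists2 j : R, line_field_index (cod z) (Qcoef eps f phi N z) u j & j < 0).
Proof.
move=> eps_pm a0 _ ab0 _ [A0 f_an f_eq] cS im un pK pII WS.
(* From here on [g] replaces [f]: [1 - nu^2] stays in [[0, 1]], where the two agree, and [g] is
   analytic on both sides of the end points. *)
have [g [gf g_an]] := analytic_extension f_an.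
have g_eq t : 0 < t <= 1 -> 0 < (c - eps * a * (1 - t)) * (c - eps * a) ->
    g t = (- eps * (2 * a + b) * (c - eps * a) * t - (c - eps * a) ^+ 2
           + `|c - eps * a * (1 - t)| `^ ((2 * a + b) / a) * `|c - eps * a| `^ (- (b / a)))
          / (eps * (a + b) * (c - eps * a) * t ^+ 2).
  by move=> t01 st; rewrite gf ?f_eq //; case/andP: t01 => /ltW -> ->.
have ode := f_ode eps_pm a0 ab0 A0 g_an g_eq.
have [lp0|lpT] := locally_proportional_cases eps_pm ab0 g_an ode im un pK pII WS cS.
  right=> z cz u cu; exact: (conformal_zero_index eps_pm ab0 g_an ode im un pK pII WS gf cz cu lp0).
left=> z cz u cu; apply: (conformal_zero_vanishes eps_pm im un pK pII WS gf cz cu).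
by rewrite lpT.
Qed.
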